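(* Assume Hypothesis A (stated in the context) holds. There exists $k\in\mathbb{Z}_+$ such that a $k$-connected $\mathrm{GF}(4)$-representable matroid with at least $2k$ elements is golden-mean if and only if it has no minor isomorphic to any of $F_7$, $F_7^*$, $V_1$, $V_1^*$, $V_2$, $V_3$, $V_3^*$, $P_1$, $P_1^*$, $P_2$, $P_3$, $P_3^*$, the Pappus matroid, or the dual of the Pappus matroid. Moreover, assume Hypothesis B (stated in the context) holds; then there exist $k,n\in\mathbb{Z}_+$ such that a vertically $k$-connected $\mathrm{GF}(4)$-representable matroid with an $M(K_n)$-minor is golden-mean if and only if it has no minor isomorphic to any of $F_7$, $F_7^*$, $V_1$, $V_2$, $V_3$, $P_1$, $P_2$, $P_3$, or the Pappus matroid.
   Context: A matroid is golden-mean if it is representable by a real matrix all of whose nonzero subdeterminants are of the form $\pm\tau^i$ ($i\in\mathbb{Z}$), $\tau=\frac{1+\sqrt5}{2}$. $F_7$ is the Fano plane; the Pappus matroid is the rank-3 matroid of the Pappus configuration (9 points, 9 three-point lines). Let $\alpha\in\mathrm{GF}(4)$ satisfy $\alpha^2=\alpha+1$. $V_1,V_2,V_3,P_1,P_2,P_3$ are the column matroids over $\mathrm{GF}(4)$ of (rows separated by semicolons): $V_1$: $[1,0,0,1,0,1,1,1,1;\ 0,1,0,1,1,\alpha^2,\alpha^2,\alpha,0;\ 0,0,1,0,1,1,\alpha,1,\alpha]$. $V_2$: $[1,0,0,0,1,1,1,0;\ 0,1,0,0,\alpha^2,\alpha,\alpha,1;\ 0,0,1,0,\alpha,\alpha^2,\alpha,1;\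 0,0,0,1,\alpha^2,\alpha^2,\alpha,\alpha]$. $V_3$: $[1,0,0,0,1,0,1,1,1;\ 0,1,0,0,\alpha,1,\alpha^2,\alpha^2,1;\ 0,0,1,0,\alpha,1,\alpha,1,\alpha^2;\ 0,0,0,1,0,1,1,0,0]$. $P_1$: $[0,1,1,1,1,1,0,0,0;\ 0,1,\alpha,0,0,0,1,1,1;\ 1,0,0,1,\alpha,\alpha^2,1,\alpha,\alpha^2]$. $P_2$: $[1,0,0,0,1,0,1,1;\ 0,1,0,0,\alpha,1,1,1;\ 0,0,1,0,1,1,0,1;\ 0,0,0,1,\alpha^2,1,\alpha^2,0]$. $P_3$: $[0,1,1,1,1,1,1,0,0;\ 0,1,\alpha,\alpha^2,0,0,0,1,1;\ 1,0,0,0,1,\alpha,\alpha^2,1,\alpha]$. ''$k$-connected'' is in Tutte's sense. A matroid is vertically $k$-connected if for every $X\subseteq E$ with $r(X)+r(E-X)-r(M)<k$, $X$ or $E-X$ is spanning; $M$ is cyclically $k$-connected if $M^*$ is vertically $k$-connected. Represented matroids: for a field $\mathbb{F}$, an $\mathbb{F}$-represented matroid is a pair $(E,U)$ with $U$ a subspace of $\mathbb{F}^E$; a matrix $A$ whose row space is $U$ represents it, written $M(A)$; its dual is $(E,U^\perp)$; $\widetilde M$ is the underlying abstract matroid; $M|X=(X,U|X)$, $M\backslash X=M|(E-X)$, $M/X=(M^*\backslash X)^*$; simplicity, connectivity and minors come from $\widetilde M$. $\mathbb{F}_p$ is the prime subfield. Frame templates: for $\Gamma\le\mathbb{F}^\times$,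 a $\Gamma$-frame matrix has at most two nonzero entries per column, each nonzero column contains an entry $1$, and a second nonzero entry (if any) equals $-\gamma$, $\gamma\in\Gamma$. A frame template over $\mathbb{F}$ is $\Phi=(\Gamma,C,X,Y_0,Y_1,A_1,\Delta,\Lambda)$ with $\Gamma\le\mathbb{F}^\times$; $C,X,Y_0,Y_1$ pairwise disjoint finite sets; $A_1\in\mathbb{F}^{X\times(C\cup Y_0\cup Y_1)}$; $\Lambda\le\mathbb{F}^X$ and $\Delta\le\mathbb{F}^{C\cup Y_0\cup Y_1}$ additive subgroups closed under scaling by $\Gamma$. $A'\in\mathbb{F}^{B\times E}$ respects $\Phi$ if $X\subseteq B$, $C,Y_0,Y_1\subseteq E$, $A'[X,C\cup Y_0\cup Y_1]=A_1$, and there is $Z\subseteq E-(C\cup Y_0\cup Y_1)$ with $A'[X,Z]=0$, columns of $A'[B-X,Z]$ unit vectors, $A'[B-X,E-(C\cup Y_0\cup Y_1\cup Z)]$ a $\Gamma$-frame matrix, columns of $A'[X,E-(C\cup Y_0\cup Y_1\cup Z)]$ in $\Lambda$, rows of $A'[B-X,C\cup Y_0\cup Y_1]$ in $\Delta$. $A$ conforms to $\Phi$ if for some such $A',Z$: $A[B,E-Z]=A'[B,E-Z]$ and each column $i\in Z$ of $A$ is the sum of columns $i$ and some $j\in Y_1$ of $A'$. An $\mathbb{F}$-represented matroid conforms to $\Phi$ if isomorphic to $M(A)/C\backslash Y_1$ for some conforming $A$; $\mathcal{M}(\Phi)$ is the set of these. Hypothesis A: for every finite field $\mathbb{F}$,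 positive integer $m$, and minor-closed class $\mathcal{M}$ of $\mathbb{F}$-represented matroids, there exist $k\in\mathbb{Z}_+$ and frame templates $\Phi_1,\dots,\Phi_s,\Psi_1,\dots,\Psi_t$ over $\mathbb{F}$ such that $\mathcal{M}\supseteq\mathcal{M}(\Phi_i)$ for all $i$, $\mathcal{M}$ contains the duals of all members of each $\mathcal{M}(\Psi_j)$, and every simple $k$-connected $M\in\mathcal{M}$ with at least $2k$ elements such that $\widetilde M$ has no $\mathrm{PG}(m-1,\mathbb{F}_p)$-minor either lies in some $\mathcal{M}(\Phi_i)$ or has $M^*$ in some $\mathcal{M}(\Psi_j)$. Hypothesis B: same setting; there exist $k,n\in\mathbb{Z}_+$ and frame templates $\Phi_1,\dots,\Phi_s,\Psi_1,\dots,\Psi_t$ with (1) $\mathcal{M}\supseteq\mathcal{M}(\Phi_i)$; (2) $\mathcal{M}$ contains duals of members of each $\mathcal{M}(\Psi_j)$; (3) every simple vertically $k$-connected $M\in\mathcal{M}$ with an $M(K_n)$-minor but no $\mathrm{PG}(m-1,\mathbb{F}_p)$-minor lies in some $\mathcal{M}(\Phi_i)$; (4) for every cosimple cyclically $k$-connected $M\in\mathcal{M}$ with an $M^*(K_n)$-minor but no $\mathrm{PG}(m-1,\mathbb{F}_p)$-minor, $M^*$ lies in some $\mathcal{M}(\Psi_j)$. *)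

(* Defs.v *)
From HB Require Import structures.
From mathcomp Require Import all_boot all_order all_fingroup all_algebra.
From mathcomp Require Import reals.

Set Implicit Arguments.
Unset Strict Implicit.
Unset Printing Implicit Defensive.

Import Order.TTheory GRing.Theory Num.Theory.
Local Open Scope ring_scope.

(** * Matroids *)

(* The ground set is the whole carrier type. *)
Record matroid := Matroid {
  ground :> finType;
  rk : {set ground} -> nat;
  rk_card : forall X, (rk X <= #|X|)%N;
  rk_mono : forall X Y : {set ground}, X \subset Y -> (rk X <= rk Y)%N;
  rk_submod : forall X Y : {set ground},
    (rk (X :|: Y) + rk (X :&: Y) <= rk X + rk Y)%N }.

Section Operations.

Variable M : matroid.
Implicit Types X Y : {set M}.

Definition dual_rk X : nat := (#|X| + rk (~: X) - rk [set: M])%N.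

Lemma rkT_le X : (rk [set: M] <= #|X| + rk (~: X))%N.
Proof.
have := rk_submod X (~: X); rewrite setUCr setICr => h.
apply: leq_trans (leq_addr _ _) (leq_trans h _).
by rewrite leq_add2r rk_card.
Qed.

Lemma dual_rkE X : (dual_rk X + rk [set: M] = #|X| + rk (~: X))%N.
Proof. by rewrite /dual_rk subnK // rkT_le. Qed.

Fact dual_rk_card X : (dual_rk X <= #|X|)%N.
Proof.
by rewrite -(leq_add2r (rk [set: M])) dual_rkE leq_add2l rk_mono ?subsetT.
Qed.

Fact dual_rk_submod X Y :
  (dual_rk (X :|: Y) + dual_rk (X :&: Y) <= dual_rk X + dual_rk Y)%N.
Proof.
rewrite -(leq_add2r (rk [set: M] + rk [set: M])) [leqLHS]addnACA.
rewrite [leqRHS]addnACA !dual_rkE [leqLHS]addnACA [leqRHS]addnACA cardsUI.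
by rewrite leq_add2l setCU setCI addnC rk_submod.
Qed.

Fact dual_rk_mono X Y : X \subset Y -> (dual_rk X <= dual_rk Y)%N.
Proof.
move=> sXY; rewrite -(leq_add2r (rk [set: M])) !dual_rkE.
have -> : ~: X = ~: Y :|: (Y :\: X).
  apply/setP=> e; rewrite !inE; case: (boolP (e \in X)) => [/(subsetP sXY)->|] //.
  by case: (e \in Y).
have h := rk_submod (~: Y) (Y :\: X).
apply: leq_trans (_ : #|X| + (rk (~: Y) + #|Y :\: X|) <= _)%N.
  rewrite leq_add2l; apply: leq_trans (leq_addr _ _) (leq_trans h _).
  by rewrite leq_add2l rk_card.
rewrite (addnC (rk _)) addnA leq_add2r -(cardsID X Y).
by rewrite leq_add2r subset_leq_card // subsetI sXY subxx.
Qed.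

Definition dual : matroid := Matroid dual_rk_card dual_rk_mono dual_rk_submod.

Variable S : {set M}.
Implicit Types A B : {set {e : M | e \in S}}.

Definition restrict_rk A : nat := rk (val @: A).

Fact restrict_rk_card A : (restrict_rk A <= #|A|)%N.
Proof. by rewrite -(card_imset _ val_inj) rk_card. Qed.

Fact restrict_rk_mono A B : A \subset B -> (restrict_rk A <= restrict_rk B)%N.
Proof. by move=> sAB; rewrite rk_mono ?imsetS. Qed.

Fact restrict_rk_submod A B :
  (restrict_rk (A :|: B) + restrict_rk (A :&: B)
     <= restrict_rk A + restrict_rk B)%N.
Proof.
rewrite /restrict_rk imsetU imsetI; first exact: rk_submod.
by move=> ? ? _ _; apply: val_inj.
Qed.

Definition restrict : matroid :=
  Matroid restrict_rk_card restrict_rk_mono restrict_rk_submod.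

End Operations.

Definition delete (M : matroid) (D : {set M}) : matroid := restrict (~: D).

Definition contract (M : matroid) (C : {set M}) : matroid :=
  dual (@delete (dual M) C).

Definition iso (M N : matroid) : Prop :=
  exists2 f : M -> N, bijective f & forall X : {set M}, rk (f @: X) = rk X.

Definition has_minor (M N : matroid) : Prop :=
  exists (C : {set M}) (D : {set contract C}), iso (delete D) N.

Fixpoint excludes (M : matroid) (s : seq matroid) : Prop :=
  if s is N :: s' then ~ has_minor M N /\ excludes M s' else True.

Definition simple (M : matroid) : Prop :=
  forall X : {set M}, (#|X| <= 2)%N -> rk X = #|X|.

Definition cosimple (M : matroid) : Prop := simple (dual M).

(* Tutte connectivity: no j-separation with 0 < j < k. *)
Definition tutte_connected (k : nat) (M : matroid) : Prop :=
  forall (j : nat) (X : {set M}), (0 < j < k)%N ->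
    ~ [/\ (j <= #|X|)%N, (j <= #|~: X|)%N
        & (rk X + rk (~: X) < rk [set: M] + j)%N].

Definition spanning (M : matroid) (X : {set M}) : Prop := rk X = rk [set: M].

Definition vertically_connected (k : nat) (M : matroid) : Prop :=
  forall X : {set M}, (rk X + rk (~: X) < rk [set: M] + k)%N ->
    spanning X \/ spanning (~: X).

Definition cyclically_connected (k : nat) (M : matroid) : Prop :=
  vertically_connected k (dual M).

(** * Represented matroids *)

Record rmatroid (F : fieldType) := RMatroid {
  rground :> finType;
  rspace : {vspace {ffun rground -> F^o}} }.
Arguments RMatroid {F} rground rspace.

Section RepresentedMatroids.

Variable F : fieldType.

Lemma dim_ffun (I : finType) : \dim {: {ffun I -> F^o}} = #|I|.
Proof. by rewrite dimvf; exact: muln1. Qed.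

Section Rows.

Variable E : finType.

Definition res (X : {set E}) (u : {ffun E -> F^o}) :
  {ffun {e : E | e \in X} -> F^o} := [ffun e => u (val e)].

Fact res_is_linear X : linear (res X).
Proof. by move=> a u v; apply/ffunP=> e; rewrite !ffunE. Qed.

HB.instance Definition _ (X : {set E}) :=
  GRing.isLinear.Build F {ffun E -> F^o} {ffun {e : E | e \in X} -> F^o}
    *:%R (res X) (res_is_linear X).

Definition dotp (u v : {ffun E -> F^o}) : F^o := \sum_e u e * v e.

Fact dotp_is_linear u : linear (dotp u).
Proof.
move=> a v w; rewrite /dotp scaler_sumr -big_split; apply: eq_bigr => e _ /=.
by rewrite !ffunE mulrDr mulrCA.
Qed.

HB.instance Definition _ (u : {ffun E -> F^o}) :=
  GRing.isLinear.Build F {ffun E -> F^o} F^o *:%R (dotp u) (dotp_is_linear u).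

Definition perp (U : {vspace {ffun E -> F^o}}) : {vspace {ffun E -> F^o}} :=
  (\bigcap_(i < \dim U) lker (linfun (dotp (vbasis U)`_i)))%VS.

Lemma memv_perp (U : {vspace {ffun E -> F^o}}) (v : {ffun E -> F^o}) :
  reflect (forall u, u \in U -> \sum_e u e * v e = 0) (v \in perp U).
Proof.
apply: (iffP subv_bigcapP) => [h u uU | h i _].
  rewrite (coord_vbasis uU).
  transitivity (\sum_(i < \dim U) coord (vbasis U) i u * dotp (vbasis U)`_i v).
    rewrite /dotp; under [RHS]eq_bigr do rewrite mulr_sumr.
    rewrite exchange_big; apply: eq_bigr => e _ /=.
    by rewrite sum_ffunE mulr_suml; apply: eq_bigr => i _; rewrite ffunE mulrA.
  apply: big1 => i _; have := h i isT.
  by rewrite -memvE memv_ker lfunE /= => /eqP->; rewrite mulr0.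
rewrite -memvE memv_ker lfunE /=; apply/eqP/h/vbasis_mem/mem_nth.
by rewrite size_tuple.
Qed.

Lemma dim_cap_submod (V : vectType F) (K : {set E} -> {vspace V}) :
    (forall X Y, K (X :|: Y) = K X :&: K Y)%VS ->
  forall X Y, (\dim (K X) + \dim (K Y)
                 <= \dim (K (X :|: Y)) + \dim (K (X :&: Y)))%N.
Proof.
move=> KU.
have Kanti (X Y : {set E}) : X \subset Y -> (K Y <= K X)%VS.
  by move/setUidPr=> <-; rewrite KU capvSl.
move=> X Y; rewrite -dimv_sum_cap KU addnC leq_add2l dimvS // subv_add.
by rewrite !Kanti ?subsetIl ?subsetIr.
Qed.

End Rows.

Definition rrestrict (M : rmatroid F) (X : {set M}) : rmatroid F :=
  RMatroid {e : M | e \in X} (linfun (res X) @: rspace M)%VS.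

Definition rdelete (M : rmatroid F) (D : {set M}) : rmatroid F :=
  rrestrict (~: D).

Definition rdual (M : rmatroid F) : rmatroid F := RMatroid M (perp (rspace M)).

Definition rcontract (M : rmatroid F) (C : {set M}) : rmatroid F :=
  rdual (@rdelete (rdual M) C).

(* Projective equivalence: isomorphisms may rescale columns, as the
   normalisation of the columns of a frame matrix requires. *)
Definition riso (M N : rmatroid F) : Prop :=
  exists (f : M -> N) (c : M -> F),
    [/\ bijective f, forall e, c e != 0
      & forall u : {ffun N -> F^o},
          (u \in rspace N) = ([ffun e => c e * u (f e)] \in rspace M)].

Section Underlying.

Variable M : rmatroid F.
Implicit Types X Y : {set M}.

Definition under_rk X : nat := \dim (rspace (rrestrict X)).

Let K X := (rspace M :&: lker (linfun (res X)))%VS.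

Let memK X u :
  reflect (u \in rspace M /\ forall e, e \in X -> u e = 0) (u \in K X).
Proof.
rewrite memv_cap memv_ker lfunE; apply: (iffP andP) => -[-> h]; split=> //.
  by move=> e eX; have /ffunP/(_ (exist _ e eX)) := eqP h; rewrite !ffunE.
by apply/eqP/ffunP=> -[e eX]; rewrite !ffunE h.
Qed.

Let under_rkE X : (\dim (K X) + under_rk X = \dim (rspace M))%N.
Proof. exact: limg_ker_dim. Qed.

Let KU X Y : (K (X :|: Y) = K X :&: K Y)%VS.
Proof.
apply/vspaceP=> u; rewrite memv_cap.
apply/memK/andP => [[uU h]|[/memK[uU hX] /memK[_ hY]]]; split=> //.
- by apply/memK; split=> // e eX; rewrite h // inE eX.
- by apply/memK; split=> // e eY; rewrite h // inE eY orbT.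
- by move=> e; rewrite inE => /orP[/hX|/hY].
Qed.

Fact under_rk_card X : (under_rk X <= #|X|)%N.
Proof.
apply: leq_trans (dimvS (subvf _)) _.
by rewrite dim_ffun card_sig.
Qed.

Fact under_rk_mono X Y : X \subset Y -> (under_rk X <= under_rk Y)%N.
Proof.
move=> /setUidPr sXY; rewrite -(leq_add2l (\dim (K Y))) under_rkE.
by rewrite -(under_rkE X) leq_add2r -sXY KU dimvS // capvSl.
Qed.

Fact under_rk_submod X Y :
  (under_rk (X :|: Y) + under_rk (X :&: Y) <= under_rk X + under_rk Y)%N.
Proof.
have h := dim_cap_submod KU X Y.
rewrite -(leq_add2l (\dim (K X) + \dim (K Y))) [leqRHS]addnACA !under_rkE.
rewrite -[leqRHS](congr2 addn (under_rkE (X :|: Y)) (under_rkE (X :&: Y))).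
by rewrite [leqRHS]addnACA leq_add2r.
Qed.

Definition under : matroid :=
  Matroid under_rk_card under_rk_mono under_rk_submod.

End Underlying.

Definition rmx (B E : finType) (A : B -> E -> F) : rmatroid F :=
  RMatroid E <<codom (fun b : B => [ffun e => A b e] : {ffun E -> F^o})>>%VS.

Definition represents (M : matroid) (B : finType) (A : B -> M -> F) : Prop :=
  forall X : {set M}, @rk (under (rmx A)) X = rk X.

Definition representable (M : matroid) : Prop :=
  exists (r : nat) (A : 'I_r -> M -> F), represents A.

Definition minor_closed (K : rmatroid F -> Prop) : Prop :=
  [/\ forall M N, riso M N -> K M -> K N,
      forall (M : rmatroid F) (D : {set M}), K M -> K (rdelete D)
    & forall (M : rmatroid F) (C : {set M}), K M -> K (rcontract C)].

Definition colmatroid (rows : seq (seq F)) (r n : nat) : matroid :=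
  under (rmx (fun (i : 'I_r) (j : 'I_n) => (nth [::] rows i)`_j)).

End RepresentedMatroids.

(** * Golden-mean matroids *)

Definition tau (R : realType) : R := (1 + Num.sqrt 5%:R) / 2%:R.

Definition golden_mean (R : realType) (M : matroid) : Prop :=
  exists (r : nat) (A : 'I_r -> M -> R),
    represents A /\
    forall (t : nat) (f : 'I_t -> 'I_r) (g : 'I_t -> M),
      injective f -> injective g ->
      let d := \det (\matrix_(i < t, j < t) A (f i) (g j)) in
      d != 0 -> exists i : int, d = tau R ^ i \/ d = - tau R ^ i.

(** * Particular matroids *)

(* PG(m-1, p): points are given by the vectors of 'F_p^m whose first nonzero
   coordinate is 1. *)
Definition PG_point (p m : nat) :=
  {v : 'rV['F_p]_m
     | [exists i : 'I_m, (v 0 i == 1)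
                         && [forall j : 'I_m, (j < i)%N ==> (v 0 j == 0)]]}.

Definition PG (p m : nat) : matroid :=
  under (rmx (fun (i : 'I_m) (v : PG_point p m) => val v 0 i)).

Definition Fano : matroid := PG 2 3.

Section CompleteGraph.

Variable n : nat.

Definition Kn_edge := {e : {set 'I_n} | #|e| == 2}.

Definition adj (X : {set Kn_edge}) : rel 'I_n :=
  [rel i j | [exists e in X, val e == [set i; j]]].

Definition Kn_rk (X : {set Kn_edge}) : nat := (n - n_comp (adj X) 'I_n)%N.

Section Submodular.

Variables (F : fieldType) (pchar2 : 2%N \in [pchar F]).
Implicit Types X Y : {set Kn_edge}.
Local Notation V := {ffun 'I_n -> F^o}.

Let bd (X : {set Kn_edge}) (f : V) : {ffun {e | e \in X} -> F^o} :=
  [ffun e : {e | e \in X} => (\sum_(i in val (val e)) f i : F^o)].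

Let bd_linear X : linear (bd X).
Proof.
move=> a u v; apply/ffunP=> e; rewrite !ffunE scaler_sumr -big_split.
by apply: eq_bigr => i _; rewrite !ffunE.
Qed.

Let lbd X := linfun (HB.pack_for {linear V -> _} (bd X)
  (GRing.isLinear.Build _ _ _ _ (bd X) (bd_linear X))).

Let K X := lker (lbd X).

Let memK X (f : V) :
  reflect (forall e : Kn_edge, e \in X -> \sum_(i in val e) f i = 0)
          (f \in K X).
Proof.
rewrite memv_ker lfunE; apply: (iffP eqP) => [h e eX | h].
  by have /ffunP/(_ (exist _ e eX)) := h; rewrite !ffunE.
by apply/ffunP=> -[e eX]; rewrite !ffunE h.
Qed.

Let KU X Y : (K (X :|: Y) = K X :&: K Y)%VS.
Proof.
apply/vspaceP=> u; rewrite memv_cap.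
apply/memK/andP => [h|[/memK hX /memK hY]]; first split.
- by apply/memK=> e eX; rewrite h // inE eX.
- by apply/memK=> e eY; rewrite h // inE eY orbT.
- by move=> e; rewrite inE => /orP[/hX|/hY].
Qed.

Let adj_sym X : connect_sym (adj X).
Proof.
by apply: sym_connect_sym => i j; apply: eq_existsb => e /=; rewrite setUC.
Qed.

Let memKadj X (f : V) :
  reflect (forall i j, adj X i j -> f i = f j) (f \in K X).
Proof.
apply: (iffP (memK X f)) => h.
  move=> i j /existsP[e /andP[eX /eqP eij]].
  have nij : i != j by have := valP e; rewrite eij cards2; case: (i != j).
  have := h e eX; rewrite eij big_setU1 ?inE //= big_set1 => /eqP.
  by rewrite addr_eq0 => /eqP->; exact: (oppr_pchar2 pchar2).
move=> e eX; have /cards2P[i [j [nij eij]]] := valP e.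
rewrite eij big_setU1 ?inE //= big_set1 (h i j).
  exact: (addrr_pchar2 pchar2).
by apply/existsP; exists e; rewrite eX eij eqxx.
Qed.

Let pull X (f : {ffun {x | roots (adj X) x} -> F^o}) : V :=
  [ffun x : 'I_n => f (exist _ (fingraph.root (adj X) x)
                               (fingraph.roots_root (adj_sym X) x))].

Let pull_linear X : linear (@pull X).
Proof. by move=> a u v; apply/ffunP=> e; rewrite !ffunE. Qed.

Let lpull X := linfun (HB.pack_for {linear _ -> V} (@pull X)
  (GRing.isLinear.Build _ _ _ _ (@pull X) (@pull_linear X))).

Let dimK X : \dim (K X) = n_comp (adj X) 'I_n.
Proof.
have -> : K X = limg (lpull X).
  apply/vspaceP=> f; apply/memKadj/memv_imgP => [h | [g _ ->] i j eij].
    have hc i j : connect (adj X) i j -> f i = f j.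
      move=> /connectP[p + ->]; elim: p i => //= k p IH i /andP[/h-> /IH].
      by [].
    exists [ffun x => f (val x)]; rewrite ?memvf //.
    by apply/ffunP=> x; rewrite lfunE !ffunE /=; apply/hc/connect_root.
  rewrite lfunE !ffunE; congr (g _); apply: val_inj => /=.
  by apply/(fingraph.rootP (adj_sym X))/connect1.
rewrite limg_dim_eq ?dim_ffun ?card_sig.
  by apply: eq_card => x; rewrite !inE andbT.
apply/eqP; rewrite -subv0; apply/subvP=> g /memv_capP[_].
rewrite memv_ker lfunE memv0 => /eqP/ffunP h; apply/eqP/ffunP=> -[x rx].
have := h x; rewrite !ffunE => <-; congr (g _); apply: val_inj => /=.
exact/esym/eqP.
Qed.

Let dimK_le X : (\dim (K X) <= n)%N.
Proof.
by apply: leq_trans (dimvS (subvf _)) _; rewrite dim_ffun card_ord.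
Qed.

Let Kn_rkE X : (\dim (K X) + Kn_rk X = n)%N.
Proof. by rewrite /Kn_rk -dimK subnKC. Qed.

Lemma Kn_rk_card_F X : (Kn_rk X <= #|X|)%N.
Proof.
rewrite -(leq_add2l (\dim (K X))) Kn_rkE.
have := limg_ker_dim (lbd X) fullv; rewrite capfv dim_ffun card_ord => h.
rewrite -[leqLHS]h leq_add2l; apply: leq_trans (dimvS (subvf _)) _.
by rewrite dim_ffun card_sig.
Qed.

Lemma Kn_rk_mono_F X Y : X \subset Y -> (Kn_rk X <= Kn_rk Y)%N.
Proof.
move=> /setUidPr sXY; rewrite -(leq_add2l (\dim (K Y))) Kn_rkE.
by rewrite -[leqRHS](Kn_rkE X) leq_add2r -sXY KU dimvS // capvSl.
Qed.

Lemma Kn_rk_submod_F X Y :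
  (Kn_rk (X :|: Y) + Kn_rk (X :&: Y) <= Kn_rk X + Kn_rk Y)%N.
Proof.
have h := dim_cap_submod KU X Y.
rewrite -(leq_add2l (\dim (K X) + \dim (K Y))) [leqRHS]addnACA !Kn_rkE.
rewrite -[leqRHS](congr2 addn (Kn_rkE (X :|: Y)) (Kn_rkE (X :&: Y))).
by rewrite [leqRHS]addnACA leq_add2r.
Qed.

End Submodular.

Let F2_pchar : 2%N \in [pchar 'F_2] := pchar_Fp (isT : prime 2).

(* The cycle matroid of the complete graph on n vertices. *)
Definition MK : matroid :=
  Matroid (Kn_rk_card_F F2_pchar) (Kn_rk_mono_F F2_pchar)
          (Kn_rk_submod_F F2_pchar).

End CompleteGraph.

Section LocalRank.

Variables (T : finType) (r : {set T} -> nat).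
Implicit Types X Y : {set T}.
Hypothesis r0 : r set0 = 0%N.
Hypothesis r1 : forall X e, (r X <= r (e |: X) <= (r X).+1)%N.
Hypothesis r2 : forall X e f,
  r (e |: X) = r X -> r (f |: X) = r X -> r (e |: (f |: X)) = r X.

Let r_add X (s : seq T) : (r X <= r ([set x in s] :|: X) <= r X + size s)%N.
Proof.
elim: s => [|e s /andP[IH1 IH2]]; first by rewrite set_nil set0U addn0 leqnn.
rewrite set_cons -setUA /= addnS; have /andP[h1 h2] := r1 ([set x in s] :|: X) e.
by rewrite (leq_trans IH1 h1) (leq_trans h2).
Qed.

Let setUD (X Y : {set T}) :
  X \subset Y -> Y = [set x in enum (Y :\: X)] :|: X.
Proof.
move=> sXY; apply/setP=> e; rewrite set_enum !inE.
by case: (boolP (e \in X)) => [/(subsetP sXY)->|_]; rewrite ?orbT ?orbF.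
Qed.

Lemma local_rk_mono (X Y : {set T}) : X \subset Y -> (r X <= r Y)%N.
Proof. by move=> /setUD->; have /andP[] := r_add X (enum (Y :\: X)). Qed.

Lemma local_rk_card (X : {set T}) : (r X <= #|X|)%N.
Proof.
have /andP[_] := r_add set0 (enum X).
by rewrite set_enum setU0 r0 add0n -cardE.
Qed.

Let r_dim1 X e f : (r (e |: (f |: X)) + r X <= r (e |: X) + r (f |: X))%N.
Proof.
have /andP[le1 le2] := r1 X e; have /andP[lf1 lf2] := r1 X f.
have /andP[_ h1] := r1 (f |: X) e; have /andP[_ h2] := r1 (e |: X) f.
rewrite setUCA in h2.
have [eqe|nee] := eqVneq (r (e |: X)) (r X).
  have [eqf|nef] := eqVneq (r (f |: X)) (r X); first by rewrite r2 // eqe eqf.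
  have lt : (r X < r (f |: X))%N by rewrite ltn_neqAle eq_sym nef.
  by rewrite eqe addnC leq_add2l (leq_trans h2) // eqe.
have lt : (r X < r (e |: X))%N by rewrite ltn_neqAle eq_sym nee.
by apply: leq_trans (leq_add h1 (leqnn _)) _; rewrite addSnnS addnC leq_add2r.
Qed.

Let r_dim X e (s : seq T) :
  (r (e |: ([set x in s] :|: X)) + r X
     <= r (e |: X) + r ([set x in s] :|: X))%N.
Proof.
elim: s => [|f s IH]; first by rewrite set_nil set0U.
rewrite set_cons -!setUA; have h := r_dim1 ([set x in s] :|: X) e f.
rewrite -(leq_add2r (r ([set x in s] :|: X))) addnAC.
apply: leq_trans (leq_add h (leqnn _)) _.
by rewrite addnAC [leqRHS]addnAC leq_add2r.
Qed.

Let r_sub (A X : {set T}) (s : seq T) : A \subset X ->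
  (r ([set x in s] :|: X) + r A <= r X + r ([set x in s] :|: A))%N.
Proof.
move=> sAX; elim: s => [|e s IH]; first by rewrite set_nil !set0U.
rewrite set_cons -!setUA.
have := r_dim ([set x in s] :|: A) e (enum (X :\: A)).
rewrite ![[set x in enum _] :|: _]setUCA -setUD // => h.
rewrite -(leq_add2r (r ([set x in s] :|: A))) addnAC.
apply: leq_trans (leq_add h (leqnn _)) _.
by rewrite -addnA addnC [leqRHS]addnAC leq_add2r.
Qed.

Lemma local_rk_submod (X Y : {set T}) :
  (r (X :|: Y) + r (X :&: Y) <= r X + r Y)%N.
Proof.
have := @r_sub (X :&: Y) X (enum (Y :\: (X :&: Y))) (subsetIl _ _).
rewrite -(setUD (subsetIr X Y)) set_enum.
suff -> : Y :\: (X :&: Y) :|: X = X :|: Y by [].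
by apply/setP=> e; rewrite !inE; case: (e \in X); case: (e \in Y).
Qed.

End LocalRank.

Section Pappus.

Implicit Types X Y : {set 'I_9}.

(* Points 0,1,2 and 3,4,5 are on two lines; 6 = 04.13, 7 = 05.23, 8 = 15.24. *)
Definition pappus_lines : seq (seq nat) :=
  [:: [:: 0; 1; 2]; [:: 3; 4; 5]; [:: 6; 7; 8];
      [:: 0; 4; 6]; [:: 1; 3; 6];
      [:: 0; 5; 7]; [:: 2; 3; 7];
      [:: 1; 5; 8]; [:: 2; 4; 8]]%N.

Definition on_line (X : {set 'I_9}) : bool :=
  has (fun L => X \subset [set i | val i \in L]) pappus_lines.

Definition pappus_rk (X : {set 'I_9}) : nat :=
  if (#|X| <= 2)%N then #|X| else if on_line X then 2 else 3.

Let lines_meet (X : {set 'I_9}) (L L' : seq nat) :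
  L \in pappus_lines -> L' \in pappus_lines -> (1 < #|X|)%N ->
  X \subset [set i | val i \in L] -> X \subset [set i | val i \in L'] -> L = L'.
Proof.
move=> hL hL' /card_gt1P[i [j [iX jX nij]]] /subsetP sL /subsetP sL'.
have: all (fun L1 => all (fun L2 : seq nat => (L1 == L2) ||
        all (fun i => all (fun j => (i == j) || (j \notin L2)) L1
                      || (i \notin L2)) L1) pappus_lines) pappus_lines by [].
move=> /allP/(_ L hL)/allP/(_ L' hL')/orP[/eqP // | /allP/(_ (val i))].
have := sL i iX; have := sL j jX; have := sL' i iX; have := sL' j jX.
rewrite !inE => jL' iL' jL iL /(_ iL); rewrite iL' orbF => /allP/(_ _ jL).
by rewrite jL' orbF (inj_eq val_inj) (negbTE nij).
Qed.

Let pappus_rk0 : pappus_rk set0 = 0%N.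
Proof. by rewrite /pappus_rk cards0. Qed.

Let on_lineS (X Y : {set 'I_9}) : X \subset Y -> on_line Y -> on_line X.
Proof.
by move=> sXY /hasP[L hL h]; apply/hasP; exists L => //; apply: subset_trans h.
Qed.

Let pappus_rk1 X e : (pappus_rk X <= pappus_rk (e |: X) <= (pappus_rk X).+1)%N.
Proof.
rewrite /pappus_rk cardsU1; have := @on_lineS X (e |: X) (subsetUr _ _).
case: (boolP (e \in X)) => [eX _|eX hS].
  by rewrite add0n (setUidPr _) ?sub1set // leqnn leqnSn.
rewrite add1n; case: (ltngtP #|X| 2) => [h|h|->].
- by rewrite leqnSn leqnn.
- by move: hS; case: (on_line X); case: (on_line _) => // /(_ isT).
- by case: ifP.
Qed.

Let pappus_rk2 X e f : pappus_rk (e |: X) = pappus_rk X ->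
  pappus_rk (f |: X) = pappus_rk X ->
  pappus_rk (e |: (f |: X)) = pappus_rk X.
Proof.
have [eX|eX] := boolP (e \in X).
  by move=> _ <-; congr pappus_rk; apply/setUidPr; rewrite sub1set inE eX orbT.
have [fX|fX] := boolP (f \in X).
  by have /setUidPr-> : [set f] \subset X by rewrite sub1set.
have [Xs|Xl] := leqP #|X| 1.
  rewrite {1 2}/pappus_rk cardsU1 eX ltnS Xs (leq_trans Xs) // => /esym/eqP.
  by rewrite add1n -[_ == _]/(_ == _) eqn_leq ltnn andbF.
have rk_line (Y : {set 'I_9}) : (2 <= #|Y|)%N ->
    pappus_rk Y = if (#|Y| == 2) || on_line Y then 2%N else 3%N.
  move=> h; rewrite /pappus_rk leq_eqVlt [(_ < 2)%N]ltnNge h orbF.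
  by case: eqP => [->|].
have le2 (Y : {set 'I_9}) g : (2 <= #|Y|)%N -> (2 <= #|g |: Y|)%N.
  by move=> h; apply: leq_trans h (subset_leq_card (subsetUr _ _)).
have c3 g : g \notin X -> (#|g |: X| == 2) = false.
  by move=> gX; rewrite cardsU1 gX; case: #|X| Xl => [|[]].
rewrite (rk_line X) //; case: ifP => [_|nl].
  rewrite !rk_line ?le2 // !c3 //=.
  case: ifP => // /hasP[L hL sL] _; case: ifP => // /hasP[L' hL' sL'] _.
  rewrite orbC; suff -> : on_line (e |: (f |: X)) by [].
  have sX g (L1 : seq nat) : g |: X \subset [set i : 'I_9 | val i \in L1] ->
      X \subset [set i : 'I_9 | val i \in L1].
    by apply: subset_trans; apply: subsetUr.
  have eL := lines_meet hL hL' Xl (sX _ _ sL) (sX _ _ sL').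
  apply/hasP; exists L => //; rewrite setUCA subUset eL sub1set.
  by rewrite -{2}eL sL andbT; apply: (subsetP sL'); rewrite setU11.
move=> _ _; rewrite rk_line ?le2 //.
have gt2 : (2 < #|X|)%N by rewrite ltn_neqAle eq_sym (contraFN _ nl) //= => ->.
have -> : (#|e |: (f |: X)| == 2) = false.
  apply: gtn_eqF; apply: leq_trans gt2 (subset_leq_card _).
  by rewrite setUA subsetUr.
rewrite ifN //=; apply: contraFN nl => h; apply/orP; right.
by apply: on_lineS h; rewrite setUA subsetUr.
Qed.

Definition Pappus : matroid :=
  Matroid (local_rk_card pappus_rk0 pappus_rk1) (local_rk_mono pappus_rk1)
          (local_rk_submod pappus_rk1 pappus_rk2).

End Pappus.

Section Quaternary.

Variables (F : fieldType) (a : F).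

Definition V1 : matroid := colmatroid
  [:: [:: 1; 0; 0; 1; 0; 1;      1;      1; 1];
      [:: 0; 1; 0; 1; 1; a ^+ 2; a ^+ 2; a; 0];
      [:: 0; 0; 1; 0; 1; 1;      a;      1; a]] 3 9.

Definition V2 : matroid := colmatroid
  [:: [:: 1; 0; 0; 0; 1;      1;      1; 0];
      [:: 0; 1; 0; 0; a ^+ 2; a;      a; 1];
      [:: 0; 0; 1; 0; a;      a ^+ 2; a; 1];
      [:: 0; 0; 0; 1; a ^+ 2; a ^+ 2; a; a]] 4 8.

Definition V3 : matroid := colmatroid
  [:: [:: 1; 0; 0; 0; 1; 0; 1;      1;      1];
      [:: 0; 1; 0; 0; a; 1; a ^+ 2; a ^+ 2; 1];
      [:: 0; 0; 1; 0; a; 1; a;      1;      a ^+ 2];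
      [:: 0; 0; 0; 1; 0; 1; 1;      0;      0]] 4 9.

Definition P1 : matroid := colmatroid
  [:: [:: 0; 1; 1; 1; 1; 1;      0; 0; 0];
      [:: 0; 1; a; 0; 0; 0;      1; 1; 1];
      [:: 1; 0; 0; 1; a; a ^+ 2; 1; a; a ^+ 2]] 3 9.

Definition P2 : matroid := colmatroid
  [:: [:: 1; 0; 0; 0; 1;      0; 1;      1];
      [:: 0; 1; 0; 0; a;      1; 1;      1];
      [:: 0; 0; 1; 0; 1;      1; 0;      1];
      [:: 0; 0; 0; 1; a ^+ 2; 1; a ^+ 2; 0]] 4 8.

Definition P3 : matroid := colmatroid
  [:: [:: 0; 1; 1; 1;      1; 1; 1;      0; 0];
      [:: 0; 1; a; a ^+ 2; 0; 0; 0;      1; 1];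
      [:: 1; 0; 0; 0;      1; a; a ^+ 2; 1; a]] 3 9.

End Quaternary.

(** * Frame templates *)

Section Templates.

Variable F : finFieldType.

Definition frame_col (G : {group {unit F}}) (B : finType) (v : B -> F) : Prop :=
  (#|[set b | (v b != 0)%R]| <= 2)%N /\
  ((exists b, v b != 0) ->
   exists2 b0, v b0 = 1 &
     forall b, b != b0 -> v b != 0 -> exists2 g, g \in G & v b = - val g).

(* Pairwise disjointness of C, X, Y0, Y1 is built in: they are separate types,
   and C u Y0 u Y1 is the sum type. *)
Record frame_template := FrameTemplate {
  Gam : {group {unit F}};
  tC : finType;
  tX : finType;
  tY0 : finType;
  tY1 : finType;
  A1 : tX -> tC + tY0 + tY1 -> F;
  Del : {set {ffun tC + tY0 + tY1 -> F}};
  Lam : {set {ffun tX -> F}};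
  Del_zmod : zmod_closed Del;
  Lam_zmod : zmod_closed Lam;
  Del_scale : forall g v, g \in Gam -> v \in Del ->
    [ffun y => val g * v y] \in Del;
  Lam_scale : forall g v, g \in Gam -> v \in Lam ->
    [ffun x => val g * v x] \in Lam }.

Section Conform.

Variable Phi : frame_template.

Definition tCY := (tC Phi + tY0 Phi + tY1 Phi)%type.

(* Rows B = X + B' and columns E = (C u Y0 u Y1) + E'.  Since conforming
   matroids are taken up to isomorphism, this loses no generality over
   X, C, Y0, Y1 being subsets of B and E. *)
Section Matrices.

Variables B' E' : finType.
Let B := (tX Phi + B')%type.
Let E := (tCY + E')%type.

Definition respects (A' : B -> E -> F) (Z : {set E'}) : Prop :=
  [/\ forall x y, A' (inl x) (inl y) = A1 x y,
      forall x e, e \in Z -> A' (inl x) (inr e) = 0,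
      forall e, e \in Z ->
        exists b0 : B', forall b, A' (inr b) (inr e) = (b == b0)%:R
    & [/\ forall e, e \notin Z ->
            frame_col (Gam Phi) (fun b : B' => A' (inr b) (inr e)),
          forall e, e \notin Z ->
            [ffun x => A' (inl x) (inr e)] \in Lam Phi
        & forall b : B', [ffun y => A' (inr b) (inl y)] \in Del Phi]].

Definition conforming (A : B -> E -> F) : Prop :=
  exists (A' : B -> E -> F) (Z : {set E'}),
    [/\ respects A' Z,
        forall b y, A b (inl y) = A' b (inl y),
        forall b e, e \notin Z -> A b (inr e) = A' b (inr e)
      & forall e, e \in Z -> exists j : tY1 Phi,
          forall b, A b (inr e) = A' b (inr e) + A' b (inl (inr j))].

Definition C_elts : {set E} := [set inl (inl (inl c)) | c : tC Phi].
Definition Y1_elts : {set E} := [set inl (inr y) | y : tY1 Phi].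

Definition template_minor (A : B -> E -> F) : rmatroid F :=
  let N := @rcontract F (rmx A) C_elts in
  @rdelete F N [set e : N | val e \in Y1_elts].

End Matrices.

Definition conforms (M : rmatroid F) : Prop :=
  exists (B' E' : finType) (A : (tX Phi + B') -> (tCY + E') -> F),
    conforming A /\ riso M (template_minor A).

End Conform.

End Templates.

(** * The two structural hypotheses *)

Definition HypothesisA : Prop :=
  forall (F : finFieldType) (p : nat), p \in [pchar F] ->
  forall m : nat, (0 < m)%N ->
  forall K : rmatroid F -> Prop, minor_closed K ->
  exists (k s t : nat)
         (Phi : 'I_s -> frame_template F) (Psi : 'I_t -> frame_template F),
    [/\ (0 < k)%N,
        forall i M, conforms (Phi i) M -> K M,
        forall j M, conforms (Psi j) M -> K (rdual M)
      & forall M, K M -> simple (under M) -> tutte_connected k (under M) ->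
          (2 * k <= #|M|)%N -> ~ has_minor (under M) (PG p m) ->
          (exists i, conforms (Phi i) M) \/
          (exists j, conforms (Psi j) (rdual M))].

Definition HypothesisB : Prop :=
  forall (F : finFieldType) (p : nat), p \in [pchar F] ->
  forall m : nat, (0 < m)%N ->
  forall K : rmatroid F -> Prop, minor_closed K ->
  exists (k n s t : nat)
         (Phi : 'I_s -> frame_template F) (Psi : 'I_t -> frame_template F),
    [/\ (0 < k)%N /\ (0 < n)%N,
        forall i M, conforms (Phi i) M -> K M,
        forall j M, conforms (Psi j) M -> K (rdual M),
        forall M, K M -> simple (under M) -> vertically_connected k (under M) ->
          has_minor (under M) (MK n) -> ~ has_minor (under M) (PG p m) ->
          exists i, conforms (Phi i) M
      & forall M, K M -> cosimple (under M) ->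
          cyclically_connected k (under M) ->
          has_minor (under M) (dual (MK n)) -> ~ has_minor (under M) (PG p m) ->
          exists j, conforms (Psi j) (rdual M)].

(* Main.v *)
(** A frame template over GF(4) all of whose members avoid the Fano plane and [P1] has trivial
    group, and its subspaces [Lam] and [Del] can be absorbed into the template.  For a member in which
    no set of at most [#|Y0|] elements contains a nonzero vector of the row space, what is left is a
    matroid represented by zero-sum vectors [w s] on a vertex set, while the template also contains
    every complete graph enlarged by the images of these vectors under identification of vertices.
    Avoiding [V1], [P1], [P3], Fano and Pappus therefore restricts the shapes of the vectors [w s], and a
    finite tree search over these shapes shows that all of them lift to one of finitely many families of
    vectors over [Z[tau]], on which every subdeterminant is [0] or a unit [+- tau ^ i].  Connectivity
    gives the condition on small sets, duality handles the templates [Psi], and in the vertically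
    connected case one first simplifies the matroid.  Conversely the excluded matroids are not golden-mean
    because golden-mean matroids are closed under minors and duality and reducing [tau] to [3] represents
    them over GF(5), where the excluded matroids are not representable. *)

From HB Require Import structures.
Require Import Defs.
From Stdlib Require Classical_Prop Classical_Pred_Type FunctionalExtensionality String Ascii.
From mathcomp Require Import all_boot all_order all_fingroup all_algebra.
From mathcomp Require Import finfield reals.
From mathcomp Require Import zify ring.

Set Implicit Arguments.
Unset Strict Implicit.
Unset Printing Implicit Defensive.

Import Order.TTheory GRing.Theory Num.Theory.
Local Open Scope ring_scope.

(** * Minors and duality *)

(** The difficulty is unboundedness: a template has members with any number of vertices and of
    vectors [w s]. Two facts make the problem finite. Excluding the Fano plane leaves, besides zero
    vectors and edges, only vectors with entries 1, a, a^2 or 1, 1, a, a up to scaling, so a new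
    vector has finitely many positions relative to the vertices already named. And a family is given
    by a rule: a core of at most five vertices, finitely many vectors on it, and finitely many ways
    to link an outside vertex to it. Pivoting at an outside vertex stays inside the family, so one
    finite table of subdeterminants on the core settles matrices of every size. The ring Z[tau]
    enters through its quotients: GF(4) is its reduction modulo 2, and modulo the square root of 5
    it becomes GF(5) with [tau] equal to 3. A quantity that is 0 or [+- tau ^ i] vanishes exactly
    when its reduction does, because units stay units; so ranks survive both reductions. Of the long
    tables only Boolean checks enter the proof. *)

Lemma val_imset_setT (M : finType) (S : {set M}) :
  val @: [set: {e : M | e \in S}] = S.
Proof.
apply/setP=> e; apply/imsetP/idP => [[x _ ->]|eS]; first exact: valP x.
by exists (exist _ e eS).
Qed.

Lemma val_imsetC (M : finType) (S : {set M}) (Y : {set {e : M | e \in S}}) :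
  val @: (~: Y) = S :\: val @: Y.
Proof.
apply/setP=> e; rewrite inE; apply/imsetP/andP => [[x xY ->]|[eY eS]].
  by split; [rewrite mem_imset ?inE // in xY *; exact: val_inj | exact: valP x].
exists (exist _ e eS) => //; rewrite inE; apply: contra eY => h.
by apply/imsetP; exists (exist _ e eS).
Qed.

(** Here and in the other [_arith] lemmas the rank identities are abstracted to plain natural
    numbers, so that [lia] never meets the set and matroid terms. *)
Lemma contract_arith (ry rc ru cy cC dC dD rT cD : nat) :
  (ry + dC = cy + dD -> dC + rT = cC + rc -> dD + rT = cD + ru ->
  cD = cC - cy -> cy <= cC -> ry + rc = ru)%N.
Proof. lia. Qed.

(** Contraction is defined as the dual of a deletion in the dual; unfolding both dual ranks recovers
    the usual rank of a contraction, in additive form. *)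
Lemma rk_contract (M : matroid) (C : {set M}) (Y : {set contract C}) :
  (rk Y + rk C = rk (val @: (Y : {set {e : M | e \in ~: C}}) :|: C))%N.
Proof.
have hE := @dual_rkE (@delete (dual M) C) Y.
have e1 (Z : {set @delete (dual M) C}) : rk Z = dual_rk (val @: (Z : {set {e : M | e \in ~: C}})) by [].
rewrite !e1 val_imset_setT val_imsetC in hE.
have h1 := dual_rkE (~: C : {set M}).
have h2 := dual_rkE (~: C :\: val @: (Y : {set {e : M | e \in ~: C}}) : {set M}).
have -> : rk Y = dual_rk (Y : {set @delete (dual M) C}) by [].
have sY : val @: (Y : {set {e : M | e \in ~: C}}) \subset ~: C.
  by apply/subsetP=> _ /imsetP[x _ ->]; exact: valP x.
have c2 := cardsD (~: C) (val @: (Y : {set {e : M | e \in ~: C}})).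
rewrite (setIidPr sY) card_imset in c2; last exact: val_inj.
have c3 := subset_leq_card sY; rewrite card_imset in c3; last exact: val_inj.
rewrite setCK in h1; rewrite setCD setCK setUC in h2.
exact: (contract_arith hE h1 h2 c2 c3).
Qed.

(** Embedding form of minors: elements outside both the image of [g] and [C] are the deleted ones.
    It avoids the nested subset types of [contract] and [delete], and composing minors becomes
    composing maps. *)
Definition minor_map (M N : matroid) (g : N -> M) (C : {set M}) : Prop :=
  [/\ injective g, forall e, g e \notin C
    & forall X : {set N}, (rk (g @: X :|: C) = rk X + rk C)%N].

Lemma has_minorP (M N : matroid) :
  has_minor M N <-> exists (g : N -> M) (C : {set M}), minor_map g C.
Proof.
split=> [[C [D [f [f' fK f'K] rf]]]|[g [C [g_inj gC rg]]]].
  exists (fun e => val (val (f' e))), C; split.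
  - by move=> x y /val_inj/val_inj; exact: (can_inj f'K).
  - by move=> e; have := valP (val (f' e)); rewrite inE.
  move=> X; have fX : f @: (f' @: X) = X.
    by rewrite -imset_comp -[RHS]imset_id; apply: eq_imset => x /=.
  rewrite -{2}fX rf.
  have -> : rk (f' @: X) = rk (val @: (f' @: X : {set {e | e \in ~: D}})) by [].
  rewrite rk_contract; congr (rk (_ :|: _)).
  by rewrite -!imset_comp; apply: eq_imset.
have gC' e : g e \in ~: C by rewrite inE.
pose h e : {x | x \in ~: C} := exist _ (g e) (gC' e).
have h_inj : injective h by move=> x y [/g_inj].
pose D := ~: (h @: [set: N]) : {set contract C}.
have eD : ~: D = h @: [set: N] by rewrite setCK.
have hD e : h e \in ~: D by rewrite eD imset_f.
pose k e : {x | x \in ~: D} := exist _ (h e) (hD e).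
have k_bij : bijective k.
  apply: inj_card_bij; first by move=> x y [/g_inj].
  rewrite card_sig; apply: eq_leq; rewrite -[RHS]cardsT -(card_imset _ h_inj).
  by rewrite -eD; apply: eq_card => x.
have [f kK fK] := k_bij; exists C, D, f; first by exists k.
move=> X; apply/(@addIn (rk C)); rewrite -rg.
have -> : rk X = rk (val @: (X : {set {e | e \in ~: D}})) by [].
rewrite rk_contract; congr (rk (_ :|: _)).
rewrite -!imset_comp; apply: eq_imset => x /=.
by rewrite -{2}(fK x).
Qed.

Lemma iso_sym (M N : matroid) : iso M N -> iso N M.
Proof.
case=> f [g fK gK] rf; exists g; first by exists f.
move=> X; rewrite -rf -imset_comp -[in RHS](imset_id X).
by congr rk; apply: eq_imset => x /=.
Qed.

Lemma dualK_arith (cX dT rT dC cC rX cT r2 : nat) :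
  (r2 + dT = cX + dC -> dC + rT = cC + rX -> dT + rT = cT + 0 ->
  cX + cC = cT -> r2 = rX)%N.
Proof. lia. Qed.

Lemma iso_dualK (M : matroid) : iso (dual (dual M)) M.
Proof.
exists id; first by exists id.
move=> X; rewrite imset_id.
have h1 := @dual_rkE (dual M) X; have h2 := dual_rkE (~: X : {set M}).
have h3 := dual_rkE [set: M].
have r0 : rk (set0 : {set M}) = 0%N by apply/eqP; rewrite -leqn0 -(cards0 M) rk_card.
rewrite setCK in h2; rewrite setCT r0 in h3.
have c := cardsC X.
have -> : rk (X : {set dual (dual M)}) = dual_rk (X : {set dual M}) by [].
have e1 (Y : {set dual M}) : rk Y = dual_rk (Y : {set M}) by [].
rewrite !e1 in h1; rewrite cardsT in h3.
exact: (esym (dualK_arith h1 h2 h3 c)).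
Qed.

Lemma iso_has_minor (M N : matroid) : iso M N -> has_minor M N.
Proof.
move=> /iso_sym[f fb rf]; apply/has_minorP; exists f, set0; split.
- exact: bij_inj.
- by move=> e; rewrite inE.
by move=> X; rewrite setU0 rf; have := rk_card (set0 : {set M}); rewrite cards0 leqn0 => /eqP->; rewrite addn0.
Qed.

Lemma has_minor_trans (M N P : matroid) :
  has_minor M N -> has_minor N P -> has_minor M P.
Proof.
move=> /has_minorP[g [C [gi gC rg]]] /has_minorP[h [D [hi hD rh]]].
apply/has_minorP; exists (g \o h), (g @: D :|: C); split.
- exact: inj_comp.
- by move=> e; rewrite inE negb_or gC andbT; apply: contraNN (hD e) => /imsetP[y yD /gi->].
move=> X; rewrite imset_comp setUA -imsetU !rg rh.
by rewrite addnA.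
Qed.

Lemma has_minor_isol (M M' N : matroid) : iso M M' -> has_minor M' N -> has_minor M N.
Proof. by move=> /iso_has_minor; exact: has_minor_trans. Qed.

Lemma has_minor_isor (M N N' : matroid) : iso N N' -> has_minor M N -> has_minor M N'.
Proof. by move=> /iso_has_minor h h'; exact: has_minor_trans h' h. Qed.

Lemma minor_dual_arith (d1 rT cX cD dX rN rX d3 c : nat) :
  (d1 + rT = cX + cD + (rX + c) -> dX + rN = cX + rX -> d3 + rT = cD + (rN + c) ->
  d1 = dX + d3)%N.
Proof. lia. Qed.

(** Dualising swaps the two kinds of removed elements: the same embedding works, with the deleted
    elements [D] now contracted. *)
Lemma has_minor_dual (M N : matroid) : has_minor M N -> has_minor (dual M) (dual N).
Proof.
move=> /has_minorP[g [C [gi gC rg]]]; apply/has_minorP.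
pose D := ~: (g @: [set: N] :|: C).
exists g, D; split=> //.
  by move=> e; rewrite !inE negbK imset_f.
move=> X.
have h1 := dual_rkE (g @: X :|: D); have h2 := @dual_rkE N X.
have h3 := dual_rkE D.
have d1 : #|g @: X :|: D| = (#|X| + #|D|)%N.
  rewrite cardsU card_imset // (_ : _ :&: _ = set0) ?cards0 ?subn0 //.
  apply/setP=> e; rewrite !inE; apply/negP=> /andP[/imsetP[x _ ->]].
  by rewrite imset_f.
have eC : ~: (g @: X :|: D) = g @: (~: X) :|: C.
  apply/setP=> e; rewrite setCU setCK !inE.
  apply/andP/orP => [[eX /orP[/imsetP[x _ ex]|]]|[/imsetP[x xX ->]|eC]].
  - left; apply/imsetP; exists x => //; rewrite inE; apply: contraNN eX => xX.
    by rewrite ex; apply: imset_f.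
  - by right.
  - rewrite inE in xX; split; last by rewrite imset_f.
    by apply: contraNN xX => /imsetP[y yX /gi->].
  - split; last by rewrite eC orbT.
    by apply/imsetP=> -[x _ ex]; have := gC x; rewrite -ex eC.
have r1 := rg (~: X); have r2 := rg [set: N].
rewrite d1 eC r1 in h1; rewrite setCK r2 in h3.
have -> : rk (g @: X :|: D : {set dual M}) = dual_rk (g @: X :|: D : {set M}) by [].
have -> : rk (D : {set dual M}) = dual_rk (D : {set M}) by [].
have -> : rk (X : {set dual N}) = @dual_rk N X by [].
exact: (minor_dual_arith h1 h2 h3).
Qed.

Lemma has_minor_rk (M N : matroid) : has_minor M N -> (rk [set: N] <= rk [set: M])%N.
Proof.
move=> /has_minorP[g [C [gi gC rg]]].
have := rg [set: N] => h; rewrite -(leq_add2r (rk C)) -h.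
by apply: leq_trans (rk_mono (subsetT _)) (leq_addr _ _).
Qed.

Lemma excludesP (M : matroid) (s : seq matroid) :
  excludes M s <-> (forall N, List.In N s -> ~ has_minor M N).
Proof.
elim: s => [|N s IH] /=; first by split.
split=> [[h /IH hs] P [<-|/hs]|h] //.
by split; [apply: h; left | apply/IH => P Ps; apply: h; right].
Qed.

(** * Represented matroids *)

Lemma minor_arith (k a b d x y w n m : nat) :
  (k + a = b -> k + n = d -> a + x = n -> d + w = m -> b + y = m -> y = x + w)%N.
Proof. lia. Qed.

Lemma rdual_arith (d rT cX rC vX p dp u cE cC pc : nat) :
  (d + rT = cX + rC -> vX + p = dp -> dp + u = cE -> pc + rC = cC ->
  pc = vX -> rT = u -> cX + cC = cE -> d = p)%N.
Proof. lia. Qed.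

Section Represented.

Variable F : fieldType.

Lemma mem_rmx (B E : finType) (A : B -> E -> F) (u : {ffun E -> F^o}) :
  reflect (exists p : B -> F, forall e, u e = \sum_b p b * A b e)
          (u \in rspace (rmx A)).
Proof.
pose r b : {ffun E -> F^o} := [ffun e => A b e].
have rb b : r b \in rspace (rmx A) by apply: memv_span; apply/codomP; exists b.
apply: (iffP idP) => [|[p up]]; last first.
  have -> : u = \sum_b p b *: r b.
    by apply/ffunP=> e; rewrite sum_ffunE up; apply: eq_bigr => b _; rewrite !ffunE.
  by apply: memv_suml => b _; apply: memvZ.
rewrite /rmx /= => uE; have := @coord_span _ _ _ (codom_tuple r) u uE.
move=> /ffunP {}uE; exists (fun b => coord (codom_tuple r) (enum_rank b) u) => e.
rewrite (reindex (@enum_val _ (mem B))) /=; last exact/onW_bij/enum_val_bij.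
have := uE e; rewrite sum_ffunE => ->; apply: eq_bigr => i _.
by rewrite ffunE nth_codom ffunE enum_valK.
Qed.

Lemma mem_rrestrict (M : rmatroid F) (X : {set M})
    (v : {ffun {e : M | e \in X} -> F^o}) :
  reflect (exists2 u, u \in rspace M & forall e, v e = u (val e))
          (v \in rspace (rrestrict X)).
Proof.
apply: (iffP memv_imgP) => [[u uM ->]|[u uM uv]]; exists u => //.
  by move=> e; rewrite lfunE /= ffunE.
by apply/ffunP=> e; rewrite uv lfunE /= ffunE.
Qed.

(* Fredholm alternative. *)
Lemma dual_solvable (I E : finType) (a : I -> E -> F) (w : E -> F) :
  (forall v : E -> F, (forall i, \sum_e a i e * v e = 0) ->
     \sum_e w e * v e = 0) ->
  exists c : I -> F, forall e, w e = \sum_i c i * a i e.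
Proof.
move=> h; pose B := \matrix_(i < #|I|, j < #|E|) a (enum_val i) (enum_val j).
pose wr := \row_(j < #|E|) w (enum_val j).
have sum_enum (G : E -> F) : \sum_e G e = \sum_(j < #|E|) G (enum_val j).
  rewrite (reindex (@enum_val _ (mem E))) /=; last exact/onW_bij/enum_val_bij.
  by [].
have /submxP[c cE] : (wr <= B)%MS.
  rewrite submxE; apply/eqP/rowP=> k; rewrite !mxE.
  have := h (fun e => cokermx B (enum_rank e) k); rewrite sum_enum.
  under eq_bigr do rewrite enum_valK.
  move=> h'; rewrite -[RHS]h' => [|i].
    by apply: eq_bigr => j _; rewrite !mxE.
  rewrite sum_enum; under eq_bigr do rewrite enum_valK.
  have /matrixP/(_ (enum_rank i) k) := mulmx_coker B; rewrite !mxE => hB; rewrite -[RHS]hB.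
  by apply: eq_bigr => j _; rewrite [B _ _]mxE enum_rankK.
exists (fun i => c 0 (enum_rank i)) => e.
have /rowP/(_ (enum_rank e)) := cE; rewrite !mxE enum_rankK => ->.
rewrite [RHS](reindex (@enum_val _ (mem I))) /=; last exact/onW_bij/enum_val_bij.
by apply: eq_bigr => j _; rewrite [B _ _]mxE enum_valK enum_rankK.
Qed.

Section Perp.

Variable E : finType.
Implicit Types U : {vspace {ffun E -> F^o}}.

Lemma perpK U : perp (perp U) = U.
Proof.
apply/vspaceP=> w; apply/idP/idP => [/memv_perp h|wU]; last first.
  apply/memv_perp=> v /memv_perp/(_ w wU) hv; rewrite -[RHS]hv.
  by apply: eq_bigr => e _; rewrite mulrC.
have [v hv|c wE] := @dual_solvable 'I_(\dim U) E (fun i => (vbasis U)`_i) w.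
  rewrite -[RHS](h [ffun e => v e]); first by apply: eq_bigr => e _; rewrite ffunE mulrC.
  apply/memv_perp=> u uU; rewrite (coord_vbasis uU).
  under eq_bigr do rewrite sum_ffunE mulr_suml.
  rewrite exchange_big /= big1 // => i _.
  transitivity (coord (vbasis U) i u * \sum_e (vbasis U)`_i e * v e).
    by rewrite mulr_sumr; apply: eq_bigr => e _; rewrite !ffunE mulrA.
  by rewrite hv mulr0.
have -> : w = \sum_i c i *: (vbasis U)`_i.
  by apply/ffunP=> e; rewrite sum_ffunE wE; apply: eq_bigr => i _; rewrite ffunE.
apply: memv_suml => i _; apply/memvZ/vbasis_mem/mem_nth.
by rewrite size_tuple.
Qed.

Lemma perp0 : perp (0%VS : {vspace {ffun E -> F^o}}) = fullv.
Proof.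
apply/vspaceP=> v; rewrite memvf; apply/memv_perp=> u; rewrite memv0 => /eqP->.
by apply: big1 => e _; rewrite ffunE mul0r.
Qed.

End Perp.

Section PerpDim.

Variable E : finType.
Variable U : {vspace {ffun E -> F^o}}.

Let k := \dim U.
Let T (v : {ffun E -> F^o}) : {ffun 'I_k -> F^o} :=
  [ffun i : 'I_k => dotp (vbasis U)`_i v].

Let T_linear : linear T.
Proof. by move=> a v w; apply/ffunP=> i; rewrite !ffunE linearP. Qed.

HB.instance Definition _ := GRing.isLinear.Build _ _ _ _ T T_linear.

(** Rank-nullity for the map [T] of scalar products with a basis of [U]. Its kernel is [perp U], and
    it is onto because a vector orthogonal to the image is a linear relation among the basis
    vectors. *)
Lemma dim_perp : (\dim (perp U) + \dim U = #|E|)%N.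
Proof.
have := limg_ker_dim (linfun T) fullv; rewrite capfv dim_ffun => <-.
congr (_ + _)%N.
  congr (\dim _); apply/vspaceP=> v; rewrite memv_ker lfunE /=.
  apply/idP/eqP => [/memv_perp h|h].
    by apply/ffunP=> i; rewrite !ffunE; apply/h/vbasis_mem/mem_nth; rewrite size_tuple.
  apply/memv_perp=> u uU; rewrite (coord_vbasis uU) -[LHS]/(dotp _ v).
  have dotC (x y : {ffun E -> F^o}) : dotp x y = dotp y x.
    by apply: eq_bigr => e _; rewrite mulrC.
  rewrite dotC linear_sum big1 // => i _; rewrite linearZ /= dotC.
  by have /ffunP/(_ i) := h; rewrite !ffunE => ->; rewrite scaler0.
rewrite -(perpK (limg _)).
suff -> : perp (limg (linfun T)) = 0%VS by rewrite perp0 dim_ffun card_ord.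
apply/eqP; rewrite -subv0; apply/subvP=> c /memv_perp hc; rewrite memv0.
have s0 : \sum_(i < k) c i *: (vbasis U)`_i = 0.
  apply/ffunP=> e; rewrite sum_ffunE ffunE.
  rewrite -[RHS](hc (T [ffun x => (x == e)%:R])); last first.
    by rewrite -[T _]lfunE memv_img ?memvf.
  apply: eq_bigr => i _; rewrite !ffunE mulrC; congr (_ * _).
  rewrite /dotp (bigD1 e) //= ffunE eqxx mulr1 big1 ?addr0 // => x /negPf xe.
  by rewrite ffunE xe mulr0.
have /freeP/(_ c s0) h := basis_free (vbasisP U).
by apply/eqP/ffunP=> i; rewrite ffunE.
Qed.

End PerpDim.

Section Minors.

Implicit Types M N : rmatroid F.

(** Contraction on row spaces: keep the vectors vanishing on [C] and forget these coordinates. One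
    direction extends [v] by zero and tests it against the orthogonal space, using [perpK]. *)
Lemma mem_rcontract M (C : {set M}) (v : {ffun {e : M | e \in ~: C} -> F^o}) :
  reflect (exists u, [/\ u \in rspace M, forall e, e \in C -> u e = 0
                        & forall e, v e = u (val e)])
          (v \in rspace (rcontract C)).
Proof.
have sumC (G : M -> F) : (forall e, e \in C -> G e = 0) ->
    \sum_e G e = \sum_(e : {e : M | e \in ~: C}) G (val e).
  move=> G0; rewrite (bigID (mem (~: C))) /= [X in _ + X]big1 ?addr0; last first.
    by move=> e; rewrite inE negbK => /G0.
  rewrite (reindex_omap (val : {e : M | e \in ~: C} -> M) insub) => [|e eC]; last by rewrite insubT.
  by apply: eq_bigl => e; rewrite valK eqxx andbT; exact: valP e.
apply: (iffP (@memv_perp _ _ _ v)) => [h|[u [uM u0 uv]] w wD].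
  pose u : {ffun M -> F^o} := [ffun e => if insub e is Some e' then v e' else 0].
  have uC e : e \in C -> u e = 0 by move=> eC; rewrite ffunE insubF // inE eC.
  have uv e : v e = u (val e) by rewrite ffunE valK.
  exists u; split=> //; rewrite -(perpK (rspace M)); apply/memv_perp=> w wM.
  rewrite (@sumC (fun e => w e * u e)) => [|e /uC->]; last by rewrite mulr0.
  rewrite -[RHS](h (res (~: C) w)).
    by apply: eq_bigr => e _; rewrite [res _ _ _]ffunE uv.
  by apply/(@mem_rrestrict (rdual M)); exists w => // e; rewrite ffunE.
have [x /memv_perp xM wx] := @mem_rrestrict (rdual M) (~: C) w wD.
rewrite -[RHS](xM u uM) (@sumC (fun e => u e * x e)) => [|e /u0->]; last by rewrite mul0r.
by apply: eq_bigr => e _; rewrite wx uv mulrC.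
Qed.

Definition vanish M (X : {set M}) : {vspace {ffun M -> F^o}} :=
  (rspace M :&: lker (linfun (res X)))%VS.

Lemma mem_vanish M (X : {set M}) u :
  reflect (u \in rspace M /\ forall e, e \in X -> u e = 0) (u \in vanish X).
Proof.
rewrite memv_cap memv_ker lfunE; apply: (iffP andP) => -[-> h]; split=> //.
  by move=> e eX; have /ffunP/(_ (exist _ e eX)) := eqP h; rewrite !ffunE.
by apply/eqP/ffunP=> -[e eX]; rewrite !ffunE h.
Qed.

Lemma dim_vanish M (X : {set M}) :
  (\dim (vanish X) + @rk (under M) X = \dim (rspace M))%N.
Proof. exact: limg_ker_dim. Qed.

Definition rescale (E E' : finType) (g : E' -> E) (c : E' -> F)
    (u : {ffun E -> F^o}) : {ffun E' -> F^o} := [ffun e => c e * u (g e)].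

Fact rescale_linear (E E' : finType) (g : E' -> E) (c : E' -> F) :
  linear (rescale g c).
Proof.
move=> a u v; apply/ffunP=> e; rewrite !ffunE /= mulrDr; congr (_ + _).
exact: mulrCA.
Qed.

HB.instance Definition _ (E E' : finType) (g : E' -> E) (c : E' -> F) :=
  GRing.isLinear.Build _ _ _ _ (rescale g c) (rescale_linear g c).

(** Represented form of [minor_map], with a nonzero scale [c] on each kept column; minors of
    template matroids are exhibited in this form. *)
Definition rminor_map M N (g : N -> M) (c : N -> F) (C : {set M}) : Prop :=
  [/\ injective g, forall e, g e \notin C, forall e, c e != 0
    & forall v : {ffun N -> F^o}, v \in rspace N <->
        exists u, [/\ u \in rspace M, forall x, x \in C -> u x = 0
                    & forall e, v e = c e * u (g e)]].

(** The rescaled restriction [L] maps the vectors vanishing on [C] onto [rspace N], and those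
    vanishing also on [g @: X] onto the vectors of [N] vanishing on [X], with the same kernel.
    Rank-nullity compares the dimensions. *)
Lemma rminor_has_minor M N (g : N -> M) (c : N -> F) (C : {set M}) :
  rminor_map g c C -> has_minor (under M) (under N).
Proof.
case=> gi gC c0 gN; apply/has_minorP; exists g, C; split=> // X.
pose L := linfun (rescale g c).
have LE u e : L u e = c e * u (g e) by rewrite lfunE /= ffunE.
have imC : (L @: vanish C)%VS = rspace N.
  apply/vspaceP=> v; apply/memv_imgP/idP => [[u /mem_vanish[uM uC] ->]|/gN[u [uM uC uv]]].
    by apply/gN; exists u; split=> // e; rewrite LE.
  by exists u; [apply/mem_vanish | apply/ffunP=> e; rewrite LE uv].
have imX : (L @: vanish (g @: X :|: C))%VS = vanish X.
  apply/vspaceP=> v; apply/memv_imgP/mem_vanish => [[u /mem_vanish[uM u0] ->]|].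
    split; last by move=> e eX; rewrite LE u0 ?mulr0 // inE imset_f.
    by apply/gN; exists u; split=> // x xC; rewrite u0 // inE xC orbT.
  move=> [/gN[u [uM uC uv]] v0]; exists u; last by apply/ffunP=> e; rewrite LE uv.
  apply/mem_vanish; split=> // x; rewrite inE => /orP[/imsetP[e eX ->]|/uC//].
  by have /eqP := v0 e eX; rewrite uv mulf_eq0 (negPf (c0 e)) => /eqP.
have ker : (vanish (g @: X :|: C) :&: lker L = vanish C :&: lker L)%VS.
  apply/vspaceP=> u; rewrite [LHS]memv_cap [RHS]memv_cap; case: (boolP (u \in lker L)) => [|_]; last by rewrite !andbF.
  rewrite memv_ker !andbT => /eqP/ffunP Lu.
  apply/idP/idP => /mem_vanish[uM u0]; apply/mem_vanish; split=> // x.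
    by move=> xC; rewrite u0 // inE xC orbT.
  rewrite inE => /orP[/imsetP[e eX ->]|/u0//].
  by have /eqP := Lu e; rewrite LE ffunE mulf_eq0 (negPf (c0 e)) => /eqP.
have := dim_vanish (g @: X :|: C); have := dim_vanish C.
have := dim_vanish X.
have := limg_ker_dim L (vanish C); have := limg_ker_dim L (vanish (g @: X :|: C)).
rewrite imC imX ker.
exact: minor_arith.
Qed.

Lemma riso_has_minor M N : riso M N -> has_minor (under M) (under N).
Proof.
case=> f [c [[g fK gK] c0 fN]].
apply: (@rminor_has_minor _ _ g (fun e => (c (g e))^-1) set0); split.
- exact: can_inj gK.
- by move=> e; rewrite inE.
- by move=> e; rewrite invr_eq0.
move=> v; rewrite fN; split=> [h|[u [uM _ uv]]].
  exists [ffun e => c e * v (f e)]; split=> // [x|e]; first by rewrite inE.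
  by rewrite ffunE gK mulKf.
suff -> : [ffun e => c e * v (f e)] = u by [].
by apply/ffunP=> e; rewrite ffunE uv fK mulVKf.
Qed.

Lemma rdelete_has_minor M (D : {set M}) : has_minor (under M) (under (rdelete D)).
Proof.
apply: (@rminor_has_minor _ (rdelete D) val (fun=> 1) set0); split.
- exact: val_inj.
- by move=> e; rewrite inE.
- by move=> e; exact: oner_neq0.
move=> v; split=> [/mem_rrestrict[u uM uv]|[u [uM _ uv]]].
  by exists u; split=> // [x|e]; rewrite ?inE // mul1r uv.
by apply/mem_rrestrict; exists u => // e; rewrite uv mul1r.
Qed.

Lemma rcontract_has_minor M (C : {set M}) :
  has_minor (under M) (under (rcontract C)).
Proof.
apply: (@rminor_has_minor M (rcontract C)
  (fun e : {e : M | e \in ~: C} => val e) (fun=> 1) C); split.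
- exact: val_inj.
- by move=> e; have := valP (e : {e : M | e \in ~: C}); rewrite inE.
- by move=> e; exact: oner_neq0.
move=> v; split=> [/mem_rcontract[u [uM uC uv]]|[u [uM uC uv]]].
  by exists u; split=> // e; rewrite mul1r uv.
by apply/mem_rcontract; exists u; split=> // e; rewrite uv mul1r.
Qed.

(** This is the kind of class to which the structural hypotheses are applied. *)
Lemma excludes_minor_closed (s : seq matroid) :
  minor_closed (fun M : rmatroid F => excludes (under M) s).
Proof.
have h M N : has_minor (under M) (under N) ->
    excludes (under M) s -> excludes (under N) s.
  move=> MN /excludesP sM; apply/excludesP=> P Ps NP.
  exact: sM Ps (has_minor_trans MN NP).
split=> M N; [move=> /riso_has_minor|apply: h|apply: h]; first exact: h.
  exact: rdelete_has_minor.
exact: rcontract_has_minor.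
Qed.

(** The vectors of [perp (rspace M)] vanishing on [X] are, read on the complement of [X], the
    orthogonal space of the restriction of [M] to that complement; [dim_perp] turns this into the
    dual rank formula. *)
Lemma rk_rdual M (X : {set M}) : @rk (under (rdual M)) X = @dual_rk (under M) X.
Proof.
have h1 := @dual_rkE (under M) X.
have h2 := @dim_vanish (rdual M) X.
have h3 := dim_perp (rspace M).
have h4 := dim_perp (rspace (@rrestrict _ M (~: X))).
have h5 : \dim (perp (rspace (@rrestrict _ M (~: X)))) = \dim (@vanish (rdual M) X).
  pose L := linfun (res (~: X) : {ffun M -> F^o} -> _).
  have := limg_ker_dim L (@vanish (rdual M) X).
  rewrite (_ : (_ :&: _)%VS = 0%VS) ?dimv0.
    move=> <-; rewrite add0n; congr (\dim _); apply/vspaceP=> v.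
    apply/memv_perp/memv_imgP => [h|[u /(@mem_vanish (rdual M) X)[uM uX] ->] w /mem_rrestrict[x xM wx]].
      have /(@mem_rcontract (rdual M)) : v \in rspace (@rcontract F (rdual M) X).
        apply/(@memv_perp F).
        move=> w /(@mem_rrestrict (rdual (rdual M)))[x xM wx]; apply: h; apply/mem_rrestrict.
        by exists x => //; rewrite -(perpK (rspace M)).
      move=> [u [uM uX uv]]; exists u; first by apply/(@mem_vanish (rdual M) X).
      by apply/ffunP=> e; rewrite lfunE /= ffunE uv.
    have := memv_perp _ _ uM _ xM; rewrite (bigID (mem X)) /= big1 ?add0r; last first.
      by move=> e /uX->; rewrite mulr0.
    move=> hs; rewrite -[RHS]hs [RHS](reindex_omap (val : {e : M | e \in ~: X} -> M) insub) /=.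
      apply: eq_big => e; first by rewrite valK eqxx andbT; have := valP e; rewrite inE => ->.
      by move=> _; rewrite wx lfunE /= ffunE.
    by move=> e eX; rewrite insubT ?inE.
  apply/eqP; rewrite -subv0; apply/subvP=> u /memv_capP[/(@mem_vanish (rdual M) X)[_ uX]].
  rewrite memv_ker lfunE memv0 => /eqP/ffunP h0; apply/eqP/ffunP=> e; rewrite ffunE.
  have [/uX//|eX] := boolP (e \in X).
  by have := h0 (exist _ e (introT setCP (negP eX))); rewrite !ffunE.
have h6 : @rk (under M) [set: M] = \dim (rspace M).
  have := dim_vanish [set: M]; rewrite (_ : vanish _ = 0%VS) ?dimv0 ?add0n //.
  apply/eqP; rewrite -subv0; apply/subvP=> u /mem_vanish[_ u0]; rewrite memv0.
  by apply/eqP/ffunP=> e; rewrite ffunE u0 ?inE.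
have c := cardsC X.
rewrite card_sig in h4.
have {}h4 : (\dim (perp (rspace (@rrestrict _ M (~: X)))) + @rk (under M) (~: X) = #|~: X|)%N.
  by apply: etrans h4 _; apply: eq_card.
exact: (esym (rdual_arith h1 h2 h3 h4 h5 h6 c)).
Qed.

Lemma under_rdual M : iso (under (rdual M)) (dual (under M)).
Proof. by exists id => [|X]; [exists id | rewrite imset_id; exact/esym/rk_rdual]. Qed.

End Minors.
End Represented.

(** * Golden-mean matrices *)

(** Rows and columns are selected by arbitrary maps: a repetition gives determinant 0 and a
    reordering only a sign, so injectivity rarely has to be carried along. *)
Definition subdet (K : comNzRingType) (B E : finType) (A : B -> E -> K) t
    (f : 'I_t -> B) (g : 'I_t -> E) : K :=
  \det (\matrix_(i < t, j < t) A (f i) (g j)).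

Lemma eq_subdet (K : comNzRingType) (B E B' E' : finType) (A : B -> E -> K)
    (A' : B' -> E' -> K) t (f : 'I_t -> B) (g : 'I_t -> E) (f' : 'I_t -> B')
    (g' : 'I_t -> E') :
  (forall i j, A (f i) (g j) = A' (f' i) (g' j)) -> subdet A f g = subdet A' f' g'.
Proof. by move=> h; congr (\det _); apply/matrixP=> i j; rewrite !mxE. Qed.

Lemma subdet_tr (K : comNzRingType) (B E : finType) (A : B -> E -> K) t
    (f : 'I_t -> B) (g : 'I_t -> E) :
  subdet (fun e b => A b e) g f = subdet A f g.
Proof. by rewrite /subdet -det_tr; congr (\det _); apply/matrixP=> i j; rewrite !mxE. Qed.

Lemma subdet_inj (K : comNzRingType) (B E : finType) (A : B -> E -> K) t
    (f : 'I_t -> B) (g : 'I_t -> E) :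
  subdet A f g != 0 -> injective f.
Proof.
move=> d i j fij; apply: contraNeq d => nij; apply/eqP.
by apply: (@determinant_alternate _ _ _ i j) => // k; rewrite !mxE fij.
Qed.

Lemma subdet_injr (K : comNzRingType) (B E : finType) (A : B -> E -> K) t
    (f : 'I_t -> B) (g : 'I_t -> E) :
  subdet A f g != 0 -> injective g.
Proof. by rewrite -subdet_tr; exact: subdet_inj. Qed.

(** * Rank as the largest size of a nonzero subdeterminant *)

Section Rank.

Variable K : fieldType.

Lemma rank_minorP m n (M : 'M[K]_(m, n)) t :
  (t <= \rank M)%N <->
  exists (f : 'I_t -> 'I_m) (g : 'I_t -> 'I_n), \det (mxsub f g M) != 0.
Proof.
split=> [le_t|[f [g d]]]; last first.
  have -> : t = \rank (mxsub f g M).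
    by apply/esym/eqP; rewrite -[_ == _]/(row_free _) row_free_unit unitmxE unitfE.
  have -> : mxsub f g M = rowsub f (colsub g M) by apply/matrixP=> i j; rewrite !mxE.
  apply: leq_trans (mxrankS (rowsub_sub _ _)) _.
  have -> : colsub g M = (rowsub g M^T)^T by apply/matrixP=> i j; rewrite !mxE.
  by rewrite mxrank_tr -(mxrank_tr M) mxrankS // rowsub_sub.
pose f k := maxrankfun M (widen_ord le_t k).
have rowf_free : row_free (rowsub f M).
  have -> : rowsub f M = rowsub (widen_ord le_t) (rowsub (maxrankfun M) M).
    by apply/matrixP=> i j; rewrite !mxE.
  rewrite -row_leq_rank rowsubE mxrankMfree ?maxrowsub_free //.
  rewrite row_leq_rank; apply/row_freeP; exists (\matrix_(i, j) (i == widen_ord le_t j)%:R).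
  apply/matrixP=> i j; rewrite !mxE (bigD1 (widen_ord le_t i)) //= big1 => [|k /negPf nk].
    by rewrite !mxE eqxx addr0 mul1r -val_eqE.
  by rewrite !mxE eq_sym nk mul0r.
pose N := (rowsub f M)^T.
have rN : \rank N = t by rewrite mxrank_tr; apply/eqP.
pose g k := maxrankfun N (cast_ord (esym rN) k).
exists f, g; rewrite -unitfE -unitmxE -unitmx_tr -row_free_unit.
have -> : (mxsub f g M)^T = rowsub g N by apply/matrixP=> i j; rewrite !mxE.
rewrite -row_leq_rank -{1}rN -(eq_maxrowsub N); apply: mxrankS.
apply/row_subP=> k; have -> : row k (rowsub (maxrankfun N) N) = row (cast_ord rN k) (rowsub g N).
  by apply/rowP=> j; rewrite !mxE /g cast_ordK.
exact: row_sub.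
Qed.

(** Columns outside [X] are zeroed rather than removed, which keeps the matrix size independent of
    [X]. *)
Definition colmx (B E : finType) (A : B -> E -> K) (X : {set E}) : 'M[K]_(#|B|, #|E|) :=
  \matrix_(i, j) (if enum_val j \in X then A (enum_val i) (enum_val j) else 0).

Lemma rk_rmx (B E : finType) (A : B -> E -> K) (X : {set E}) :
  @rk (under (rmx A)) X = \rank (colmx A X).
Proof.
pose M := colmx A X; pose m := maxrankfun M.
pose w k : {ffun {e : E | e \in X} -> K^o} := [ffun e => A (enum_val (m k)) (val e)].
pose s := [tuple w k | k < \rank M].
have sE (k : 'I_(\rank M)) : s`_k = w k by rewrite -tnth_nth tnth_mktuple.
have free_s : free s.
  apply/freeP=> c c0 k.
  have /row_free_inj/(_ (\row_j c j) 0) := maxrowsub_free M.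
  rewrite mul0mx => h; have /rowP/(_ k) : (\row_j c j) = 0; last by rewrite !mxE.
  apply: h; apply/rowP=> j; rewrite !mxE.
  under eq_bigr do rewrite !mxE.
  have [jX|_] := boolP (enum_val j \in X); last by apply: big1 => i _; rewrite mulr0.
  have /ffunP/(_ (exist (fun e => e \in X) _ jX)) := c0; rewrite sum_ffunE ffunE => h0; rewrite -[RHS]h0.
  by apply: eq_bigr => i _; rewrite sE !ffunE.
have -> : @rk (under (rmx A)) X = \dim <<s>>; last by move/eqP: free_s => ->; rewrite size_tuple.
congr (\dim _); apply/vspaceP=> v; apply/idP/idP; last first.
  move: v; apply/subvP; apply/span_subvP=> v /tnthP[k ->]; rewrite tnth_mktuple.
  apply/mem_rrestrict; exists [ffun e => A (enum_val (m k)) e]; last by move=> e; rewrite !ffunE.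
  apply/mem_rmx; exists (fun b => (b == enum_val (m k))%:R) => e.
  by rewrite ffunE (bigD1 (enum_val (m k))) //= eqxx mul1r big1 ?addr0 // => b /negPf->; rewrite mul0r.
move=> /mem_rrestrict[u /mem_rmx[p up] vu].
have /submxP[c cE] : ((\row_i p (enum_val i)) *m M <= rowsub m M)%MS.
  by rewrite eq_maxrowsub submxMl.
have -> : v = \sum_k c 0 k *: s`_k.
  apply/ffunP=> e; rewrite sum_ffunE vu up.
  have /rowP/(_ (enum_rank (val e))) := cE; rewrite !mxE.
  under eq_bigr do rewrite !mxE enum_rankK (valP e).
  under [X in _ = X -> _]eq_bigr do rewrite !mxE enum_rankK (valP e).
  rewrite (reindex (@enum_val _ (mem B))) /=; last exact/onW_bij/enum_val_bij.
  by move=> ->; apply: eq_bigr => k _; rewrite sE !ffunE.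
apply: memv_suml => k _; apply/memvZ/memv_span; rewrite sE.
by apply/tnthP; exists k; rewrite tnth_mktuple.
Qed.

Lemma rk_subdetP (B E : finType) (A : B -> E -> K) (X : {set E}) t :
  (t <= @rk (under (rmx A)) X)%N <->
  exists (f : 'I_t -> B) (g : 'I_t -> E), (forall j, g j \in X) /\ subdet A f g != 0.
Proof.
rewrite rk_rmx; split=> [/rank_minorP[f [g d]]|[f [g [gX d]]]].
  have gX j : enum_val (g j) \in X.
    apply: contraNT d => jX; rewrite (expand_det_col _ j) big1 // => i _.
    by rewrite !mxE (negPf jX) mul0r.
  exists (enum_val \o f), (enum_val \o g); split=> //.
  by congr (\det _ != 0): d; apply/matrixP=> i j; rewrite !mxE gX.
apply/rank_minorP; exists (enum_rank \o f), (enum_rank \o g).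
by congr (\det _ != 0): d; apply/matrixP=> i j; rewrite !mxE /= !enum_rankK gX.
Qed.

End Rank.

(** The two matrices may live over different fields; this is how ranks travel between the reals,
    GF(4) and GF(5). *)
Lemma rk_rmx_eq (K K' : fieldType) (B B' E E' : finType) (A : B -> E -> K)
    (A' : B' -> E' -> K') (X : {set E}) (X' : {set E'}) :
  (forall t, (exists (f : 'I_t -> B) (g : 'I_t -> E),
                (forall j, g j \in X) /\ subdet A f g != 0) <->
             (exists (f : 'I_t -> B') (g : 'I_t -> E'),
                (forall j, g j \in X') /\ subdet A' f g != 0)) ->
  @rk (under (rmx A)) X = @rk (under (rmx A')) X'.
Proof.
move=> h; apply/eqP; rewrite eqn_leq; apply/andP; split.
  by apply/rk_subdetP/h/rk_subdetP.
by apply/rk_subdetP/h/rk_subdetP.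
Qed.

Lemma rk_rmx_comp (K : fieldType) (B E E' : finType) (A : B -> E -> K) (g : E' -> E)
    (X : {set E'}) :
  @rk (under (rmx (fun b e => A b (g e)))) X = @rk (under (rmx A)) (g @: X).
Proof.
apply: rk_rmx_eq => t; split=> -[f [h [hX d]]].
  by exists f, (g \o h); split=> // j; apply: imset_f.
have /fin_all_exists2[k kX kh] : forall j, exists2 e, e \in X & h j = g e.
  by move=> j; apply/imsetP.
by exists f, k; split=> //; congr (_ != 0): d; apply: eq_subdet => i j; rewrite kh.
Qed.

Definition ocons (T : Type) t (x : T) (f : 'I_t -> T) (i : 'I_(1 + t)) : T :=
  if split i is inr j then f j else x.

(** * Pivoting and its effect on subdeterminants *)

Section Pivot.

Variables (K : fieldType) (B E : finType) (A : B -> E -> K) (b0 : B) (e0 : E).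
Hypothesis a0 : A b0 e0 != 0.

(** Schur complement of the entry at ([b0], [e0]), kept on all rows and columns: its row [b0] and
    column [e0] are zero. *)
Definition schur b e := A b e - A b e0 * A b0 e / A b0 e0.

Lemma subdet_schur t (f : 'I_t -> B) (g : 'I_t -> E) :
  subdet schur f g = subdet A (ocons b0 f) (ocons e0 g) / A b0 e0.
Proof.
pose M := \matrix_(i < 1 + t, j < 1 + t) A (ocons b0 f i) (ocons e0 g j).
pose D := \matrix_(i < t, j < t) schur (f i) (g j).
have -> : subdet A (ocons b0 f) (ocons e0 g) = A b0 e0 * \det D; last by rewrite mulrC mulKf.
have ME : M = block_mx 1%:M 0 (\col_i (A (f i) e0 / A b0 e0)) 1%:M *m
              block_mx (A b0 e0)%:M (\row_j A b0 (g j)) 0 D.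
  rewrite mulmx_block !mul0mx !mul1mx !addr0 -[M]submxK.
  congr block_mx; apply/matrixP=> i j; rewrite !mxE /ocons ?big_ord1 ?mxE.
  - by rewrite !(unsplitK (inl _)) (ord1 i) (ord1 j) eqxx.
  - by rewrite (unsplitK (inl _)) (unsplitK (inr _)).
  - by rewrite (unsplitK (inl _)) (unsplitK (inr _)) (ord1 j) eqxx divfK ?addr0.
  - by rewrite !(unsplitK (inr _)) /schur mulrAC addrC subrK.
by rewrite /subdet -/M ME det_mulmx det_lblock det_ublock !det1 mul1r det_scalar1 mul1r.
Qed.

Definition fullpivot b e := if b == b0 then A b0 e / A b0 e0 else schur b e.

(** Once row [b0] is among the selected rows, the Gauss-Jordan step is left multiplication by an
    elementary matrix [T] of determinant [1 / A b0 e0]. *)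
Lemma subdet_fullpivot_row t (f : 'I_t -> B) (g : 'I_t -> E) i0 : f i0 = b0 -> injective f ->
  subdet fullpivot f g = subdet A f g / A b0 e0.
Proof.
move=> fi0 fi; pose T := \matrix_(i < t, j < t)
  (if i == i0 then (j == i0)%:R / A b0 e0
   else (i == j)%:R - A (f i) e0 / A b0 e0 * (j == i0)%:R).
have -> : subdet fullpivot f g = \det T * subdet A f g.
  rewrite -det_mulmx; congr (\det _); apply/matrixP=> i j; rewrite !mxE /fullpivot.
  have fE : (f i == b0) = (i == i0) by rewrite -fi0 (inj_eq fi).
  rewrite fE; have [->|ni] := eqVneq i i0.
    rewrite (bigD1 i0) //= big1 => [|k /negPf nk]; rewrite !mxE eqxx ?eqxx ?nk ?mul0r //.
    by rewrite fi0 addr0 mul1r mulrC.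
  rewrite (bigD1 i) //= (bigD1 i0) 1?eq_sym //= big1 ?addr0 => [|k /andP[/negPf nk /negPf nk0]].
    rewrite !mxE (negPf ni) !eqxx fi0 /schur !(mulr0, mulr1, subr0, mul1r).
    by rewrite sub0r mulNr; congr (_ - _); rewrite mulrAC.
  by rewrite !mxE (negPf ni) eq_sym nk nk0 mulr0 subr0 mul0r.
rewrite mulrC; congr (_ * _); rewrite (expand_det_row _ i0) (bigD1 i0) //= big1 ?addr0.
  rewrite !mxE !eqxx mul1r /cofactor -signr_odd oddD addbb expr0 mul1r.
  rewrite (_ : row' _ _ = 1%:M) ?det1 ?mulr1 //; apply/matrixP=> i j; rewrite !mxE.
  have nl (k : 'I_t.-1) : (lift i0 k == i0) = false by apply/negbTE; rewrite eq_sym neq_lift.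
  by rewrite !nl mulr0 subr0 (inj_eq lift_inj).
by move=> j /negPf nj; rewrite !mxE eqxx nj !mul0r.
Qed.

Lemma subdet_fullpivot t (f : 'I_t -> B) (g : 'I_t -> E) : (forall i, f i != b0) ->
  subdet fullpivot f g = subdet schur f g.
Proof. by move=> fn; apply: eq_subdet => i j; rewrite /fullpivot (negPf (fn i)). Qed.

(** Pivoting in column [e0] and losing the pivot row is contraction of [e0]. *)
Lemma mem_rmx_schur (u : {ffun E -> K^o}) :
  (u \in rspace (rmx schur)) = (u \in @vanish K (rmx A) [set e0]).
Proof.
have sE (p : B -> K) e : \sum_b p b * schur b e
    = \sum_b p b * A b e - (\sum_b p b * A b e0) * A b0 e / A b0 e0.
  rewrite -mulrA mulr_suml -sumrB; apply: eq_bigr => b _.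
  by rewrite mulrBr !mulrA.
apply/mem_rmx/(@mem_vanish K (rmx A)) => [[p up]|[/mem_rmx[p up] u0]].
  split; last by move=> e /set1P->; rewrite up sE mulfK // subrr.
  apply/mem_rmx; exists (fun b => p b - (b == b0)%:R * (\sum_b p b * A b e0) / A b0 e0) => e.
  rewrite up sE (eq_bigr _ (fun b _ => mulrBl _ _ _)) sumrB; congr (_ - _).
  rewrite [RHS](bigD1 b0) //= eqxx mul1r [X in _ + X]big1 ?addr0; last by move=> b /negPf->; rewrite !mul0r.
  by rewrite mulrAC.
exists p => e; rewrite sE -up -(up e0).
have -> : u e0 = 0 by apply: u0; rewrite inE.
by rewrite (_ : (0 : K^o) = 0 :> K) // !mul0r subr0.
Qed.

End Pivot.

Lemma minor_rep_arith (a x b c y m r : nat) :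
  (a + x = b -> b + c = m -> a + y = m -> y = r + c -> x = r)%N.
Proof. lia. Qed.

Section Golden.

Variable R : realType.
Local Notation tau := (tau R).

Lemma sqr_tau : tau ^+ 2 = tau + 1.
Proof.
rewrite /Defs.tau; have h : Num.sqrt (5%:R : R) ^+ 2 = 5%:R by rewrite sqr_sqrtr ?ler0n.
by rewrite exprMn sqrrD h; field.
Qed.

Lemma tau_neq0 : tau != 0.
Proof. by apply/eqP=> h; have := sqr_tau; rewrite h expr0n add0r => /eqP; rewrite eq_sym oner_eq0. Qed.

(** Zero is included so that the property is closed under products and can be asked of every
    subdeterminant. *)
Definition pz (x : R) : Prop := x = 0 \/ exists i : int, x = tau ^ i \/ x = - tau ^ i.

Lemma pz0 : pz 0. Proof. by left. Qed.
Lemma pz1 : pz 1. Proof. by right; exists 0; left; rewrite expr0z. Qed.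
Lemma pzN x : pz x -> pz (- x).
Proof.
case=> [->|[i [->|->]]]; first by rewrite oppr0; left.
  by right; exists i; right.
by right; exists i; left; rewrite opprK.
Qed.
Lemma pzM x y : pz x -> pz y -> pz (x * y).
Proof.
case=> [->|[i hi]]; first by rewrite mul0r; left.
case=> [->|[j hj]]; first by rewrite mulr0; left.
right; exists (i + j); rewrite expfzDr ?tau_neq0 //.
by case: hi => ->; case: hj => ->; rewrite ?(mulrN, mulNr, opprK); [left|right|right|left].
Qed.
Lemma pzV x : pz x -> pz x^-1.
Proof.
case=> [->|[i hi]]; first by rewrite invr0; left.
right; exists (- i); rewrite -invr_expz.
by case: hi => ->; rewrite ?invrN; [left|right].
Qed.

Definition gm (B E : finType) (A : B -> E -> R) : Prop :=
  forall t (f : 'I_t -> B) (g : 'I_t -> E), pz (subdet A f g).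

Lemma gm_sub (B E B' E' : finType) (A : B -> E -> R) (h : B' -> B) (k : E' -> E) :
  gm A -> gm (fun b e => A (h b) (k e)).
Proof. by move=> hA t f g; exact: (hA t (h \o f) (k \o g)). Qed.

Lemma eq_gm (B E : finType) (A A' : B -> E -> R) : (forall b e, A b e = A' b e) -> gm A -> gm A'.
Proof. by move=> h hA t f g; rewrite -(@eq_subdet _ _ _ _ _ A A' _ f g f g). Qed.

Lemma gm_tr (B E : finType) (A : B -> E -> R) : gm A -> gm (fun e b => A b e).
Proof. by move=> hA t f g; rewrite subdet_tr. Qed.

Lemma gm_scale (B E : finType) (A : B -> E -> R) (c : E -> R) :
  (forall e, pz (c e)) -> gm A -> gm (fun b e => c e * A b e).
Proof.
move=> pc hA t f g.
have -> : subdet (fun b e => c e * A b e) f g = subdet A f g * \prod_j c (g j).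
  rewrite /subdet -[X in _ = _ * X](_ : \det (diag_mx (\row_j c (g j))) = _).
    rewrite -det_mulmx; congr (\det _); apply/matrixP=> i j.
    by rewrite mul_mx_diag !mxE mulrC.
  by rewrite det_diag; apply: eq_bigr => j _; rewrite mxE.
apply: pzM => //; elim/big_ind: _ => //; [exact: pz1|exact: pzM].
Qed.

Lemma gm_scale_row (B E : finType) (A : B -> E -> R) (c : B -> R) :
  (forall b, pz (c b)) -> gm A -> gm (fun b e => c b * A b e).
Proof. by move=> pc /gm_tr/(gm_scale pc)/gm_tr. Qed.

Lemma gm_schur (B E : finType) (A : B -> E -> R) b0 e0 : A b0 e0 != 0 ->
  gm A -> gm (schur A b0 e0).
Proof.
move=> a0 hA t f g; rewrite subdet_schur //; apply: pzM => //; apply: pzV.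
have := hA 1%N (fun=> b0) (fun=> e0); rewrite /subdet det_mx11 mxE; exact.
Qed.

Lemma gm_fullpivot (B E : finType) (A : B -> E -> R) b0 e0 : A b0 e0 != 0 ->
  gm A -> gm (fullpivot A b0 e0).
Proof.
move=> a0 hA t f g.
have pa : pz (A b0 e0)^-1.
  by apply: pzV; have := hA 1%N (fun=> b0) (fun=> e0); rewrite /subdet det_mx11 mxE; exact.
have [fi|nfi] := boolP (injectiveb f); last first.
  left; apply/eqP; apply: contraNT nfi => d; apply/injectiveP; exact: subdet_inj d.
have [/existsP[i0 /eqP h]|/existsPn h] := boolP [exists i, f i == b0].
  by rewrite (@subdet_fullpivot_row _ _ _ A b0 e0 _ f g i0 h (injectiveP _ fi)); apply: pzM.
by rewrite subdet_fullpivot //; exact: gm_schur.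
Qed.

(** A selected unit column is either zero on the selected rows, or expansion along it leaves, up to
    sign, a subdeterminant with one row and one column less. *)
Lemma gm_unit (B E : finType) (A : B -> E -> R) : gm A ->
  gm (fun b (x : E + B) => match x with inl e => A b e | inr b' => (b == b')%:R end).
Proof.
move=> hA; elim=> [|t IH] f g; first by rewrite /subdet det_mx00; exact: pz1.
have [/existsP[j0 h]|/existsPn h] := boolP [exists j, if g j is inr _ then true else false].
  case gj: (g j0) h => [//|b'] _.
  set Au := (X in subdet X f g); have [d0|d] := eqVneq (subdet Au f g) 0; first by left.
  have fi := subdet_inj d.
  rewrite {d}/subdet (expand_det_col _ j0) /Au {Au}.
  have [/existsP[i0 /eqP fi0]|/existsPn nf] := boolP [exists i, f i == b']; last first.
    by rewrite big1 => [|i _]; [left | rewrite mxE gj (negPf (nf i)) mul0r].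
  rewrite (bigD1 i0) //= big1 ?addr0 => [|i ni]; last first.
    by rewrite mxE gj -fi0 (inj_eq fi) (negPf ni) mul0r.
  rewrite mxE gj fi0 eqxx mul1r /cofactor.
  have := IH (f \o lift i0) (g \o lift j0).
  rewrite (_ : subdet _ _ _ = \det (row' i0 (col' j0 (\matrix_(i, j) 
      match g j with inl e => A (f i) e | inr b' => (f i == b')%:R end)))); last first.
    by congr (\det _); apply/matrixP=> i j; rewrite !mxE.
  by rewrite -signr_odd; case: (odd _) => h; rewrite ?expr0 ?expr1 ?mul1r ?mulN1r //; exact: pzN.
have /fin_all_exists[g' gE] : forall j, exists e, g j = inl e.
  by move=> j; have := h j; case: (g j) => // e _; exists e.
by rewrite (@eq_subdet _ _ _ _ _ _ A _ f g f g') // => i j; rewrite gE.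
Qed.

Lemma golden_meanP (M : matroid) :
  golden_mean R M <-> exists (B : finType) (A : B -> M -> R), represents A /\ gm A.
Proof.
split=> [[r [A [rA hA]]]|[B [A [rA hA]]]].
  exists 'I_r, A; split=> // t f g.
  have [->|d] := eqVneq (subdet A f g) 0; first exact: pz0.
  have [i hi] := hA t f g (subdet_inj d) (subdet_injr d) d.
  by right; exists i.
exists #|B|, (fun i e => A (enum_val i) e); split.
  move=> X; rewrite -rA; apply: rk_rmx_eq => t; split=> -[f [g [gX d]]].
    by exists (enum_val \o f), g.
  exists (enum_rank \o f), g; split=> //; congr (_ != 0): d.
  by apply: eq_subdet => i j /=; rewrite enum_rankK.
move=> t f g fi gi d d0; have := hA t (enum_val \o f) g.
have -> : subdet A (enum_val \o f) g = d by [].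
by case=> [h|//]; rewrite h eqxx in d0.
Qed.

(** One pivot for each element of [C]; an element whose column is zero is a loop and imposes no
    condition on the row space. *)
Lemma gm_contract (B E : finType) (A : B -> E -> R) (C : {set E}) : gm A ->
  exists2 A' : B -> E -> R, gm A' & rspace (rmx A') = @vanish R (rmx A) C.
Proof.
move=> hA; have [n] := ubnP #|C|; elim: n => // n IH in A hA C *.
rewrite ltnS => leC; have [->|/set0Pn[e0 e0C]] := eqVneq C set0.
  exists A => //; apply/vspaceP=> u; apply/idP/(@mem_vanish R (rmx A)) => [|[]//].
  by split=> // e; rewrite inE.
have [A1 hA1 A1E] : exists2 A1 : B -> E -> R, gm A1 & rspace (rmx A1) = @vanish R (rmx A) [set e0].
  have [/existsP[b0 a0]|/existsPn a0] := boolP [exists b, A b e0 != 0].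
    exists (schur A b0 e0); first exact: gm_schur.
    by apply/vspaceP=> u; rewrite mem_rmx_schur.
  exists A => //; apply/vspaceP=> u; apply/idP/(@mem_vanish R (rmx A)) => [uA|[]//].
  split=> // e /set1P->; have /mem_rmx[p ->] := uA.
  by apply: big1 => b _; have := a0 b; rewrite negbK => /eqP->; rewrite mulr0.
have [|A' hA' A'E] := IH A1 hA1 (C :\ e0); first by move: leC; rewrite (cardsD1 e0) e0C.
exists A' => //; rewrite A'E; apply/vspaceP=> u.
apply/(@mem_vanish R (rmx A1))/(@mem_vanish R (rmx A)).
  rewrite A1E => -[/(@mem_vanish R (rmx A))[uA u0] uC]; split=> // e eC.
  by have [->|ne] := eqVneq e e0; [rewrite u0 ?inE | rewrite uC // !inE ne].
move=> [uA uC]; rewrite A1E; split.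
  by apply/(@mem_vanish R (rmx A)); split=> // e /set1P->; exact: uC.
by move=> e; rewrite inE => /andP[_]; exact: uC.
Qed.

Lemma golden_mean_minor (M N : matroid) :
  golden_mean R M -> has_minor M N -> golden_mean R N.
Proof.
move=> /golden_meanP[B [A [rA hA]]] /has_minorP[g [C [gi gC rg]]].
have [A' hA' A'E] := gm_contract C hA.
apply/golden_meanP; exists B, (fun b e => A' b (g e)); split; last exact: (@gm_sub _ _ _ _ A' id g).
move=> X; rewrite rk_rmx_comp.
have h1 := @dim_vanish R (rmx A') (g @: X); have h2 := @dim_vanish R (rmx A) C.
have h3 := @dim_vanish R (rmx A) (g @: X :|: C).
have e : @vanish R (rmx A') (g @: X) = @vanish R (rmx A) (g @: X :|: C).
  apply/vspaceP=> u; apply/(@mem_vanish R (rmx A'))/(@mem_vanish R (rmx A)).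
    rewrite A'E => -[/(@mem_vanish R (rmx A))[uA uC] uX]; split=> // e.
    by rewrite inE => /orP[/uX|/uC].
  move=> [uA u0]; rewrite A'E; split=> [|e eX]; last by rewrite u0 // inE eX.
  by apply/(@mem_vanish R (rmx A)); split=> // e eC; rewrite u0 // inE eC orbT.
rewrite e A'E in h1; move: (rg X); rewrite -!(rA _).
exact: (minor_rep_arith h1 h2 h3).
Qed.

Lemma golden_mean_iso (M N : matroid) : iso M N -> golden_mean R M -> golden_mean R N.
Proof. by move=> /iso_has_minor h g; exact: golden_mean_minor g h. Qed.

(** Gauss-Jordan elimination by [fullpivot], which preserves [gm]. The set [S] collects the pivot
    rows and [p] their columns; [e1] is only a default value. *)
Lemma gm_standard (B E : finType) (A : B -> E -> R) (e1 : E) : gm A ->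
  exists (A' : B -> E -> R) (S : {set B}) (p : B -> E),
    [/\ gm A', forall u, (u \in rspace (rmx A')) = (u \in rspace (rmx A)),
        forall b s, s \in S -> A' b (p s) = (b == s)%:R
      & forall b e, b \notin S -> A' b e = 0].
Proof.
move=> hA.
suff h n (A1 : B -> E -> R) (S : {set B}) (p : B -> E) : (#|~: S| <= n)%N -> gm A1 ->
    (forall u, (u \in rspace (rmx A1)) = (u \in rspace (rmx A))) ->
    (forall b s, s \in S -> A1 b (p s) = (b == s)%:R) ->
  exists (A' : B -> E -> R) (S : {set B}) (p : B -> E),
    [/\ gm A', forall u, (u \in rspace (rmx A')) = (u \in rspace (rmx A)),
        forall b s, s \in S -> A' b (p s) = (b == s)%:R
      & forall b e, b \notin S -> A' b e = 0].
  by apply: (h _ A set0 (fun=> e1) (leqnn _)) => // b s; rewrite inE.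
elim: n => [|n IH] in A1 S p *; move=> leS hA1 A1E pS.
  by exists A1, S, p; split=> // b e; move: leS; rewrite leqn0 cards_eq0 => /eqP/setP/(_ b); rewrite !inE => ->.
have [/existsP[b0 /andP[b0S /existsP[e0 a0]]]|/existsPn nz] :=
    boolP [exists b, (b \notin S) && [exists e, A1 b e != 0]]; last first.
  exists A1, S, p; split=> // b e bS; have := nz b; rewrite bS => /existsPn/(_ e).
  by rewrite negbK => /eqP.
have a0n : A1 b0 e0 != 0 := a0.
apply: (IH (fullpivot A1 b0 e0) (b0 |: S) (fun s => if s == b0 then e0 else p s)).
- have : (#|~: (b0 |: S)| < #|~: S|)%N; last by move=> /leq_trans/(_ leS).
  apply: proper_card; apply/properP; split; first by rewrite setCS subsetUr.
  by exists b0; rewrite !inE ?eqxx.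
- exact: gm_fullpivot.
- move=> u; rewrite -A1E; apply/mem_rmx/mem_rmx => -[q uq].
    exists (fun b => (b != b0)%:R * q b + (b == b0)%:R * (q b0 - \sum_(b | b != b0) q b * A1 b e0) / A1 b0 e0) => e.
    rewrite uq (bigD1 b0) //= [RHS](bigD1 b0) //= /fullpivot eqxx mul0r add0r mul1r.
    rewrite (eq_bigr (fun b => q b * A1 b e - q b * A1 b e0 * (A1 b0 e / A1 b0 e0))) => [|b /negPf nb]; last first.
      by rewrite nb /schur mulrBr !mulrA.
    rewrite sumrB -mulr_suml [X in _ = _ + X](eq_bigr (fun b => q b * A1 b e)) => [|b nb]; last first.
      by rewrite nb (negPf nb) mul0r mul0r addr0 mul1r.
    by field.
  exists (fun b => if b == b0 then \sum_b q b * A1 b e0 else q b) => e.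
  rewrite uq [RHS](bigD1 b0) //= /fullpivot eqxx.
  rewrite [X in _ = _ + X](eq_bigr (fun b => q b * A1 b e - q b * A1 b e0 * (A1 b0 e / A1 b0 e0))) => [|b /negPf nb]; last first.
    by rewrite nb /schur mulrBr !mulrA.
  rewrite sumrB -mulr_suml (bigD1 b0) //= [X in _ = X * _ + _](bigD1 b0) //=.
  by field.
- move=> b s; rewrite !inE; have [->|ns] /= := eqVneq s b0.
    move=> _; rewrite /fullpivot /schur; case: eqVneq => _; first by rewrite divff.
    by rewrite mulfK // subrr.
  move=> sS; rewrite /fullpivot /schur !pS // (eq_sym b0) (negPf ns).
  by case: eqVneq => [->|_]; rewrite ?mulr0 ?mul0r ?subr0 // eq_sym (negPf ns).
Qed.

Lemma golden_mean_dual (M : matroid) : golden_mean R M -> golden_mean R (dual M).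
Proof.
move=> /golden_meanP[B [A [rA hA]]]; apply/golden_meanP.
have dualE (B' : finType) (D : B' -> M -> R) :
    rspace (rmx D) = perp (rspace (rmx A)) -> represents (M := dual M) D.
  move=> DE X.
  have -> : @rk (under (rmx D)) X = @rk (under (rdual (rmx A))) X.
    by rewrite -[LHS]/(\dim (linfun (res X) @: rspace (rmx D))) DE.
  rewrite rk_rdual; have h := @dual_rkE (under (rmx A)) X; have h' := @dual_rkE M X.
  by rewrite !rA -h' in h; exact: addIn h.
have [M0|/card_gt0P[e1 _]] := posnP #|M|.
  exists void, (fun v _ => match v : void return R with end); split.
    move=> X; have X0 : #|X| = 0%N by apply/eqP; rewrite -leqn0 -M0 max_card.
    have := rk_card X; have := @rk_card (under (rmx (fun (v : void) (_ : dual M) => match v return R with end))) X.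
    by rewrite X0 !leqn0 => /eqP-> /eqP->.
  by case=> [|t] f g; [rewrite /subdet det_mx00; exact: pz1 | case: (f ord0)].
have [A' [S [p [hA' A'E pS A'0]]]] := gm_standard e1 hA.
pose q y := [pick s in S | p s == y].
have pinj s s' : s \in S -> s' \in S -> p s = p s' -> s = s'.
  move=> sS s'S pp; have := pS s s sS; rewrite eqxx pp pS // => /eqP.
  by case: (s =P s') => //= _; rewrite eq_sym oner_eq0.
have qP s : s \in S -> q (p s) = Some s.
  move=> sS; rewrite /q; case: pickP => [s' /andP[s'S /eqP/pinj->]//|/(_ s)].
  by rewrite sS eqxx.
have qS y s : q y = Some s -> s \in S /\ y = p s.
  by rewrite /q; case: pickP => // s' /andP[s'S /eqP<-] [<-].
(* The classical dual of the standard form: identity on the non-pivot columns, minus the transpose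
   of [A'] on the pivot columns. Rows are indexed by all of [M]; those at pivot elements come out
   zero. *)
pose D (x y : M) : R := (x == y)%:R - (if q y is Some s then A' s x else 0).
exists M, D; split; last first.
  have h1 : gm (fun x s => (q x == None)%:R * (-1 * A' s x)).
    apply: gm_scale_row; first by move=> x; case: (_ == _); [exact: pz1|exact: pz0].
    by apply: gm_scale; [move=> _; apply/pzN/pz1 | apply: gm_tr].
  have := @gm_sub _ _ M M _ id (fun y => if q y is Some s then inl s else inr y) (gm_unit h1).
  apply: eq_gm => x y; rewrite /D; case qy: (q y) => [s|]; last by rewrite subr0.
  have [sS ->] := qS _ _ qy; case qx: (q x) => [s'|] /=.
    have [s'S ->] := qS _ _ qx; rewrite mul0r pS //.
    suff -> : (p s' == p s) = (s == s') by rewrite subrr.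
    by apply/eqP/eqP => [/pinj->|->].
  rewrite mul1r mulN1r; case: eqVneq => [xs|]; last by rewrite sub0r.
  by rewrite xs qP in qx.
apply: dualE; rewrite -(_ : rspace (rmx A') = rspace (rmx A)); last exact/vspaceP.
have sumq (v : M -> R) (x : M) : \sum_y D x y * v y = v x - \sum_(s in S) A' s x * v (p s).
  rewrite /D; under eq_bigr do rewrite mulrBl; rewrite sumrB; congr (_ - _).
    rewrite (bigD1 x) //= eqxx mul1r big1 ?addr0 // => y ny.
    by rewrite eq_sym (negPf ny) mul0r.
  pose H y := (if q y is Some s then A' s x else 0) * v y.
  rewrite [RHS](eq_bigr (H \o p)) => [|s sS]; last by rewrite /H /= qP.
  have -> : \sum_(s in S) (H \o p) s = \sum_(y in p @: S) H y.
    by rewrite big_imset // => s s' sS s'S; exact: pinj.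
  rewrite [RHS]big_mkcond; apply: eq_bigr => y _; rewrite -/(H y).
  case: ifP => // /negP yS; rewrite /H; case qy: (q y) => [s|]; last by rewrite mul0r.
  by have [sS ys] := qS _ _ qy; case: yS; rewrite ys imset_f.
have A'sum (r : B -> R) e : \sum_b r b * A' b e = \sum_(s in S) r s * A' s e.
  by rewrite [RHS]big_mkcond; apply: eq_bigr => b _; case: ifP => // /negbT /A'0->; rewrite mulr0.
apply/vspaceP=> w; apply/mem_rmx/memv_perp => [[r wr] u /(@mem_rmx R B M A')[c uc]|h].
  under eq_bigr do rewrite wr mulr_sumr; rewrite exchange_big big1 //= => x _.
  transitivity (r x * \sum_y D x y * u y).
    rewrite mulr_sumr; apply: eq_bigr => y _; rewrite mulrCA; congr (_ * _).
    exact: mulrC.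
  rewrite sumq (_ : u x = \sum_(s in S) A' s x * u (p s)) ?subrr ?mulr0 // uc A'sum.
  apply: eq_bigr => s sS; rewrite uc A'sum mulrC (bigD1 s) //= pS // eqxx mulr1 big1 ?addr0 //.
  by move=> s' /andP[s'S ns]; rewrite pS // (negPf ns) mulr0.
exists w => y; rewrite /D; under eq_bigr do rewrite mulrBr; rewrite sumrB.
rewrite (bigD1 y) //= eqxx mulr1 [X in _ + X - _]big1 ?addr0 => [|x nx]; last first.
  by rewrite (negPf nx) mulr0.
case qy: (q y) => [s|]; last by rewrite big1 ?subr0 // => x _; rewrite mulr0.
rewrite -[LHS]subr0; congr (_ - _); rewrite -[LHS](h [ffun x => A' s x]).
  by apply: eq_bigr => x _; rewrite ffunE mulrC.
apply/(@mem_rmx R B M A'); exists (fun b => (b == s)%:R) => x; rewrite ffunE (bigD1 s) //= eqxx mul1r.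
by rewrite big1 ?addr0 // => b /negPf->; rewrite mul0r.
Qed.

End Golden.

(** * Reduction from Z[tau] to other fields *)

Section Evaluation.

(** Integer polynomials stand for elements of Z[tau]: the same polynomial can be evaluated at [tau]
    and at a root of x^2 = x + 1 in any other field. *)
Definition pev (K : comNzRingType) (a : K) (p : {poly int}) : K := (map_poly intr p).[a].

Lemma pev_is_zmod (K : comNzRingType) (a : K) : zmod_morphism (pev a).
Proof. by move=> p q; rewrite /pev rmorphB /= hornerD hornerN. Qed.

Lemma pev_is_monoid (K : comNzRingType) (a : K) : monoid_morphism (pev a).
Proof. by split=> [|p q]; rewrite /pev ?rmorph1 ?hornerC // rmorphM hornerM. Qed.

HB.instance Definition _ (K : comNzRingType) (a : K) :=
  GRing.isZmodMorphism.Build {poly int} K (pev a) (pev_is_zmod a).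
HB.instance Definition _ (K : comNzRingType) (a : K) :=
  GRing.isMonoidMorphism.Build {poly int} K (pev a) (pev_is_monoid a).

Lemma pevX (K : comNzRingType) (a : K) : pev a 'X = a.
Proof. by rewrite /pev map_polyX hornerX. Qed.

Lemma pevC (K : comNzRingType) (a : K) (c : int) : pev a c%:P = c%:~R.
Proof. by rewrite /pev map_polyC hornerC. Qed.

Lemma pevD (K : comNzRingType) (a : K) p q : pev a (p + q) = pev a p + pev a q.
Proof. exact: raddfD. Qed.
Lemma pevB (K : comNzRingType) (a : K) p q : pev a (p - q) = pev a p - pev a q.
Proof. exact: raddfB. Qed.
Lemma pevM (K : comNzRingType) (a : K) p q : pev a (p * q) = pev a p * pev a q.
Proof. exact: rmorphM. Qed.
Lemma pevXn (K : comNzRingType) (a : K) n : pev a 'X^n = a ^+ n.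
Proof. by rewrite -{2}(pevX a); exact: rmorphXn. Qed.

(** The remainder modulo X^2 - X - 1; the point is that [u] and [v] do not depend on the ring. *)
Lemma pev_linear (p : {poly int}) : exists u v : int,
  forall (K : comNzRingType) (a : K), a ^+ 2 = a + 1 -> pev a p = u%:~R + v%:~R * a.
Proof.
elim/poly_ind: p => [|p c [u [v h]]].
  by exists 0, 0 => K a _; rewrite raddf0 mul0r addr0.
exists (v + c), (u + v) => K a ha; rewrite pevD pevM pevX pevC h //.
by rewrite mulrDl -mulrA -expr2 ha !intrD; ring.
Qed.

(** Otherwise the exponent of 5 is even on the left and odd on the right. *)
Lemma sqr5_eq0 (x y : int) : x ^+ 2 = 5 * y ^+ 2 -> y = 0.
Proof.
move=> h; apply/eqP; apply: contraTT isT => y0.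
have h' : (`|x| ^ 2 = 5 * `|y| ^ 2)%N by have := congr1 absz h; rewrite abszM !abszX.
have yp : (0 < `|y|)%N by rewrite absz_gt0.
have xp : (0 < `|x|)%N.
  by rewrite lt0n; apply/eqP=> x0; move: h'; rewrite x0 => /esym/eqP; rewrite muln_eq0 expn_eq0 /= eqn0Ngt yp.
have := congr1 (odd \o logn 5) h'; rewrite /= lognX lognM ?expn_gt0 ?yp // lognX.
by rewrite (@pfactorK 5 1) // oddD !oddM.
Qed.

Variable R : realType.
Local Notation tau := (tau R).

(** Multiplying by the conjugate gives the norm equation u^2 + u v - v^2 = 0, and completing the
    square gives (2 u + v)^2 = 5 v^2. *)
Lemma tau_free (u v : int) : u%:~R + v%:~R * tau = 0 -> u = 0 /\ v = 0.
Proof.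
move=> h; have t2 := sqr_tau R.
have e : (u ^+ 2 + u * v - v ^+ 2)%:~R = 0 :> R.
  transitivity ((u%:~R + v%:~R * tau) * (u%:~R + v%:~R * (1 - tau)) : R); last by rewrite h mul0r.
  rewrite intrB intrD !intrM.
  transitivity (u%:~R * u%:~R + u%:~R * v%:~R + v%:~R * v%:~R * (tau - tau ^+ 2) : R); last by ring.
  by rewrite t2; ring.
have e0 : u ^+ 2 + u * v - v ^+ 2 = 0 by apply/eqP; rewrite -(intr_eq0 R) e.
have v0 : v = 0 by apply: (@sqr5_eq0 (2 * u + v)); lia.
by split=> //; move: h; rewrite v0 mul0r addr0 => /eqP; rewrite intr_eq0 => /eqP.
Qed.

Section Transfer.

Variables (K : fieldType) (a : K).
Hypothesis ha : a ^+ 2 = a + 1.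

Lemma golden_root_neq0 : a != 0.
Proof. by apply/eqP=> h; move: ha; rewrite h expr0n add0r => /eqP; rewrite eq_sym oner_eq0. Qed.

Lemma pev_tau0 (p : {poly int}) : pev tau p = 0 -> pev a p = 0.
Proof.
have [u [v h]] := pev_linear p; rewrite !h ?sqr_tau // => /tau_free[-> ->].
by rewrite mul0r addr0.
Qed.

(** Integer polynomial relations at [tau] persist at [a] ([pev_tau0]), so a value [+- tau ^ i]
    becomes [+- a ^ i], which is nonzero. For negative [i] the relation is first multiplied by a
    power of the indeterminate. *)
Lemma pev_pz (p : {poly int}) : pz (pev tau p) -> (pev tau p == 0) = (pev a p == 0).
Proof.
move=> [h|[i hi]]; first by rewrite h pev_tau0 ?eqxx.
have t0 := tau_neq0 R; have a0 := golden_root_neq0.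
have -> : (pev tau p == 0) = false.
  by apply/negbTE; case: hi => ->; rewrite ?oppr_eq0 expfz_neq0.
apply/esym/negbTE.
have [s [s2 hs]] : exists s : int, s ^+ 2 = 1 /\ pev tau p = s%:~R * tau ^ i.
  by case: hi => ->; [exists 1; rewrite mul1r | exists (-1); rewrite mulN1r].
have sK : (s%:~R : K) != 0.
  apply/eqP=> s0; have := congr1 (fun z : int => z%:~R : K) s2.
  by rewrite rmorphXn /= s0 expr0n => /eqP; rewrite eq_sym oner_eq0.
case: i hs {hi} => n hs.
  have : pev tau (p - s%:P * 'X^n) = 0 by rewrite pevB pevM pevXn pevC hs subrr.
  move/pev_tau0; rewrite pevB pevM pevXn pevC => /eqP; rewrite subr_eq0 => /eqP->.
  by rewrite mulf_neq0 ?expf_neq0.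
have : pev tau (p * 'X^(n.+1) - s%:P) = 0.
  rewrite pevB pevM pevXn pevC hs NegzE -exprnN divfK ?expf_neq0 //.
  by rewrite subrr.
move/pev_tau0; rewrite pevB pevM pevXn pevC => /eqP; rewrite subr_eq0 => /eqP h.
by apply: contraNneq sK => p0; rewrite -h p0 mul0r.
Qed.

Lemma pev_subdet (L : comNzRingType) (b : L) (B E : finType) (P : B -> E -> {poly int}) t
    (f : 'I_t -> B) (g : 'I_t -> E) :
  subdet (fun x e => pev b (P x e)) f g = pev b (subdet P f g).
Proof. by rewrite /subdet -det_map_mx; congr (\det _); apply/matrixP=> i j; rewrite !mxE. Qed.

Lemma gm_transfer (B E : finType) (P : B -> E -> {poly int}) (X : {set E}) :
  gm (fun b e => pev tau (P b e)) ->
  @rk (under (rmx (fun b e => pev tau (P b e)))) X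
    = @rk (under (rmx (fun b e => pev a (P b e)))) X.
Proof.
move=> hP; apply: rk_rmx_eq => t.
by split=> -[f [g [gX d]]]; exists f, g; split=> //; move: d;
  rewrite !pev_subdet pev_pz // -pev_subdet.
Qed.

(** The entries are lifted to integer polynomials, negative powers through the inverse [tau - 1] of
    [tau]; then [gm_transfer] applies. *)
Lemma golden_mean_transfer (M : matroid) : golden_mean R M ->
  exists (B : finType) (A : B -> M -> K), represents A.
Proof.
move=> /golden_meanP[B [A [rA hA]]].
have /fin_all_exists[P PE] : forall x : B * M, exists p : {poly int}, pev tau p = A x.1 x.2.
  move=> [b e] /=; have := hA 1%N (fun=> b) (fun=> e); rewrite /subdet det_mx11 mxE.
  case=> [->|[i hi]]; first by exists 0; rewrite raddf0.
  have [p pE] : exists p : {poly int}, pev tau p = tau ^ i.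
    case: i {hi} => n; first by exists 'X^n; rewrite pevXn.
    exists (('X - 1) ^+ n.+1); rewrite rmorphXn /= pevB pevX rmorph1 NegzE -exprnN -exprVn.
    congr (_ ^+ _); apply: (mulfI (tau_neq0 R)); rewrite mulfV ?tau_neq0 // mulrBr mulr1 -expr2.
    by rewrite sqr_tau addrC addKr.
  by case: hi => ->; [exists p | exists (- p); rewrite -[- p]sub0r pevB pE raddf0 sub0r].
have hP : gm (fun b e => pev tau (P (b, e))).
  by apply: eq_gm hA => b e; rewrite PE.
exists B, (fun b e => pev a (P (b, e))) => X; rewrite -(gm_transfer _ hP) -rA.
by apply: rk_rmx_eq => t; split=> -[f [g [gX d]]]; exists f, g; split=> //;
  congr (_ != 0): d; apply: eq_subdet => i j; rewrite PE.
Qed.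

End Transfer.
End Evaluation.

(** * The excluded matroids are not golden-mean *)

Section ListDet.

Variables (T : Type) (zero one : T) (add mul : T -> T -> T) (opp : T -> T).

(** Laplace expansion along the first row over bare operations, so that determinants over any
    concrete encoding of a field can be computed. *)
Fixpoint ldet (n : nat) (M : nat -> nat -> T) : T :=
  if n is n'.+1 then
    foldr add zero [seq (let d := mul (M 0%N j) (ldet n' (fun i k => M i.+1 (bump j k))) in
                         if odd j then opp d else d) | j <- iota 0 n]
  else one.

End ListDet.

Lemma ldetE (K : comNzRingType) n (M : nat -> nat -> K) :
  ldet 0 1 +%R *%R -%R n M = \det (\matrix_(i < n, j < n) M i j).
Proof.
elim: n M => [|n IH] M; first by rewrite det_mx00.
pose G j := let d := M 0%N j * ldet 0 1 +%R *%R -%R n (fun i k => M i.+1 (bump j k)) in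
  if odd j then - d else d.
have -> : ldet 0 1 +%R *%R -%R n.+1 M = foldr +%R 0 [seq G j | j <- iota 0 n.+1] by [].
rewrite foldrE big_map -[iota 0 n.+1]/(index_iota 0 n.+1) big_mkord.
rewrite (expand_det_row _ ord0); apply: eq_bigr => j _; rewrite mxE /cofactor /G IH add0n.
rewrite -signr_odd (_ : row' ord0 (col' j _) = \matrix_(i < n, k < n) M i.+1 (bump j k) :> 'M_n).
  by case: (odd j); rewrite ?expr1 ?expr0 ?mul1r // mulN1r mulrN.
by apply/matrixP=> i k; rewrite !mxE.
Qed.

Lemma ldet_morph (T T' : Type) z o (ad mu : T -> T -> T) op z' o' (ad' mu' : T' -> T' -> T') op'
    (h : T -> T') : h z = z' -> h o = o' -> (forall x y, h (ad x y) = ad' (h x) (h y)) ->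
  (forall x y, h (mu x y) = mu' (h x) (h y)) -> (forall x, h (op x) = op' (h x)) ->
  forall n M, h (ldet z o ad mu op n M) = ldet z' o' ad' mu' op' n (fun i j => h (M i j)).
Proof.
move=> hz ho ha hm hop; elim=> [|n IH] M //=.
rewrite ha; congr (ad' _ _); first by rewrite hm IH.
elim: (iota 1 n) => //= j s IHs; rewrite ha IHs; congr (ad' _ _).
by case: ifP => _; rewrite ?hop hm IH.
Qed.

(** * Independent sets, bases and coordinates *)

Section Independence.

Lemma rk_closure (M : matroid) (Y X : {set M}) :
  (forall e, e \in X -> rk (e |: Y) = rk Y) -> rk (X :|: Y) = rk Y.
Proof.
have [n] := ubnP #|X|; elim: n X => // n IH X; rewrite ltnS => leX h.
have [->|/set0Pn[e eX]] := eqVneq X set0; first by rewrite set0U.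
have IHe := IH (X :\ e).
have hX : rk (X :\ e :|: Y) = rk Y.
  apply: IHe; first by move: leX; rewrite (cardsD1 e X) eX.
  by move=> x; rewrite inE => /andP[_ /h].
have := rk_submod (X :\ e :|: Y) (e |: Y); rewrite hX h //.
have -> : (X :\ e :|: Y) :|: (e |: Y) = X :|: Y.
  apply/setP=> x; rewrite !inE; have [->|_] /= := eqVneq x e; first by rewrite eX orbT.
  by case: (x \in X); case: (x \in Y).
have le1 : (rk Y <= rk ((X :\ e :|: Y) :&: (e |: Y)))%N.
  by apply: rk_mono; rewrite subsetI !subsetUr.
have le2 : (rk Y <= rk (X :|: Y))%N by apply: rk_mono; rewrite subsetUr.
by move=> hs; apply/eqP; rewrite eqn_leq le2 andbT -(leq_add2r (rk Y)) (leq_trans _ hs) // leq_add2l.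
Qed.

Lemma indep_subset (M : matroid) (X : {set M}) t : (t <= rk X)%N ->
  exists2 Y : {set M}, Y \subset X & #|Y| = t /\ rk Y = t.
Proof.
elim: t => [|t IH] le_t.
  exists set0; first exact: sub0set.
  by split; [rewrite cards0 | apply/eqP; rewrite -leqn0 -(cards0 M) rk_card].
have [Y sYX [cY rY]] := IH (ltnW le_t).
have [/existsP[e /andP[eX ne]]|/existsPn h] := boolP [exists e, (e \in X) && (rk (e |: Y) != rk Y)].
  exists (e |: Y); first by rewrite subUset sub1set eX.
  have eY : e \notin Y.
    by apply: contraNN ne => eY; rewrite (setUidPr _) // sub1set.
  have c : #|e |: Y| = t.+1 by rewrite cardsU1 eY cY.
  split=> //; apply/eqP; rewrite eqn_leq -{1}c rk_card /= -rY ltn_neqAle eq_sym ne.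
  by rewrite rk_mono // subsetUr.
have := rk_closure (Y := Y) (X := X); rewrite (setUidPl sYX) => r.
move: le_t; rewrite r ?rY ?ltnn // => e eX; have := h e; rewrite eX negbK => /eqP he.
by rewrite he.
Qed.

Lemma rk_indep_sub (M : matroid) (Y X : {set M}) : Y \subset X -> rk X = #|X| -> rk Y = #|Y|.
Proof.
move=> sYX rX; apply/eqP; rewrite eqn_leq rk_card /=.
have := rk_submod Y (X :\: Y); rewrite (_ : Y :|: _ = X) ?rX => [h|]; last first.
  by apply/setP=> x; rewrite !inE; case: (boolP (x \in Y)) => [/(subsetP sYX)->|].
have c := cardsID Y X; rewrite (setIidPr sYX) in c.
have h2 := rk_card (X :\: Y); have h3 := leq_trans (leq_addr _ _) h.
by rewrite -(leq_add2r #|X :\: Y|) c (leq_trans h3) // leq_add2l.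
Qed.

(** A rank is the size of a largest independent subset, so only independence of sets of at most [d]
    elements has to be compared. *)
Lemma rk_eq_indep (M N : matroid) (f : M -> N) d : injective f ->
  (rk [set: M] <= d)%N -> (rk [set: N] <= d)%N ->
  (forall Y : {set M}, (#|Y| <= d)%N -> (rk Y == #|Y|) = (rk (f @: Y) == #|Y|)) ->
  forall X : {set M}, rk (f @: X) = rk X.
Proof.
move=> fi rM rN h X; apply/eqP; rewrite eqn_leq; apply/andP; split.
  have [Y sY [cY rY]] := indep_subset (leqnn (rk (f @: X))).
  have [Z YE] : exists Z : {set M}, Y = f @: Z.
    exists [set x | f x \in Y]; apply/setP=> y; apply/idP/imsetP => [yY|[x]]; last by rewrite inE => xY ->.
    by have /imsetP[x _ yx] := subsetP sY y yY; exists x; rewrite // inE -yx.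
  have cZ : #|Z| = rk (f @: X) by rewrite -cY YE card_imset.
  have := h Z; rewrite cZ -YE rY eqxx => /(_ (leq_trans (rk_mono (subsetT _)) rN))/eqP<-.
  by apply: rk_mono; apply/subsetP=> x xZ; rewrite -(mem_imset _ _ fi) (subsetP sY) // YE imset_f.
have [Y sY [cY rY]] := indep_subset (leqnn (rk X)).
have := h Y; rewrite cY rY eqxx => /(_ (leq_trans (rk_mono (subsetT _)) rM))/esym/eqP<-.
by apply/rk_mono/imsetS.
Qed.

Variables (K : fieldType) (E : finType) (r : nat) (A : 'I_r -> E -> K).

(** A nonzero subdeterminant of size [r] uses every row and every column of the set once, so it
    differs from this one by permutations. *)
Lemma rk_basisP (g : 'I_r -> E) : injective g ->
  (subdet A id g != 0) = (@rk (under (rmx A)) (g @: [set: 'I_r]) == r).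
Proof.
move=> gi; apply/idP/eqP => [d|rX].
  apply/eqP; rewrite eqn_leq; apply/andP; split.
    by apply: leq_trans (rk_card _) _; rewrite card_imset // cardsT card_ord.
  by apply/rk_subdetP; exists id, g; split=> // j; rewrite imset_f.
have /rk_subdetP[f [g' [g'X d]]] : (r <= @rk (under (rmx A)) (g @: [set: 'I_r]))%N by rewrite rX.
have /fin_all_exists[h hE] : forall j, exists k, g' j = g k.
  by move=> j; have /imsetP[k _ ->] := g'X j; exists k.
have hi : injective h by move=> x y hxy; apply: (subdet_injr d); rewrite !hE hxy.
have fi := subdet_inj d.
apply: contraNneq d => d0.
have -> : subdet A f g' = \det (row_perm (perm fi) (col_perm (perm hi) (\matrix_(i, j) A i (g j)))).
  by congr (\det _); apply/matrixP=> i j; rewrite !mxE !permE hE.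
by rewrite row_permE col_permE !det_mulmx -/(subdet A id g) d0 mul0r mulr0.
Qed.

End Independence.

(** Coordinates in the basis [b]: the row space restricted to a basis is the full space, so the unit
    vectors lift, and the lifts span the row space. *)
Lemma rep_coords (K : fieldType) (N : matroid) (B : finType) (A : B -> N -> K) r
    (b : 'I_r -> N) : represents A -> injective b -> rk (b @: [set: 'I_r]) = r ->
  rk [set: N] = r ->
  exists C : 'I_r -> N -> K, (forall i j, C i (b j) = (i == j)%:R) /\ represents C.
Proof.
move=> rA bi rb rN; set T := b @: [set: 'I_r] in rb.
have cT : #|T| = r by rewrite card_imset // cardsT card_ord.
have full : rspace (@rrestrict K (rmx A) T) = fullv.
  apply/eqP; rewrite eqEdim subvf /= dim_ffun card_sig.
  have -> : \dim (rspace (@rrestrict K (rmx A) T)) = r by have := rA T; rewrite rb.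
  by rewrite -[leqRHS]cT; apply: eq_leq; apply: eq_card.
have bT j : b j \in T by rewrite imset_f.
have /fin_all_exists2[u uA ub] : forall i : 'I_r, exists2 u : {ffun N -> K^o},
    u \in rspace (rmx A) & forall j, u (b j) = (i == j)%:R.
  move=> i; have /mem_rrestrict[u uA uE] :
      [ffun e : {e | e \in T} => (val e == b i)%:R] \in rspace (@rrestrict K (rmx A) T).
    by rewrite full memvf.
  exists u => // j; have := uE (exist _ (b j) (bT j)); rewrite ffunE /= => <-.
  by rewrite (inj_eq bi) eq_sym.
pose Cu (i : 'I_r) (e : N) : K := u i e.
exists Cu; split=> // X; rewrite -rA.
have v0 : @vanish K (rmx A) [set: N] = 0%VS.
  apply/eqP; rewrite -subv0; apply/subvP=> x /(@mem_vanish K (rmx A))[_ x0].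
  by rewrite memv0; apply/eqP/ffunP=> e; rewrite x0 ?inE // ffunE.
have vT : @vanish K (rmx A) T = 0%VS.
  apply/eqP; rewrite -dimv_eq0; have := @dim_vanish K (rmx A) T.
  have := @dim_vanish K (rmx A) [set: N]; rewrite !rA rb rN => <-.
  by rewrite v0 dimv0 => /addIn->.
suff e : rspace (rmx Cu) = rspace (rmx A).
  by rewrite -[LHS]/(\dim (linfun (res X) @: rspace (rmx Cu))) e.
apply/vspaceP=> v; apply/mem_rmx/idP => [[p vp]|vA].
  have -> : v = \sum_i p i *: u i.
    by apply/ffunP=> e; rewrite sum_ffunE vp; apply: eq_bigr => i _; rewrite ffunE.
  by apply: memv_suml => i _; apply: memvZ.
exists (fun i => v (b i)) => e.
have : v - \sum_i v (b i) *: u i \in @vanish K (rmx A) T.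
  apply/(@mem_vanish K (rmx A)); split.
    by apply: memvB => //; apply: memv_suml => i _; apply: memvZ.
  move=> _ /imsetP[j _ ->]; rewrite !ffunE sum_ffunE (bigD1 j) //= ffunE ub eqxx.
  rewrite big1 ?addr0 => [|i ni]; last by rewrite ffunE ub (negPf ni) scaler0.
  by rewrite [_ *: _]mulr1 subrr.
rewrite vT memv0 subr_eq0 => /eqP/ffunP/(_ e) ->; rewrite sum_ffunE.
by apply: eq_bigr => i _; rewrite ffunE.
Qed.

(** Computable GF(4): the pair (x, y) stands for x + y a with a^2 = a + 1, so [b4] is a^2. *)
Definition g4 : Type := (bool * bool)%type.
Definition o4 : g4 := (false, false).
Definition i4 : g4 := (true, false).
Definition a4 : g4 := (false, true).
Definition b4 : g4 := (true, true).
Definition add4 (x y : g4) : g4 := (x.1 (+) y.1, x.2 (+) y.2).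
Definition mul4 (x y : g4) : g4 :=
  ((x.1 && y.1) (+) (x.2 && y.2), (x.1 && y.2) (+) (x.2 && y.1) (+) (x.2 && y.2)).
Definition det4 := ldet o4 i4 add4 mul4 id.
Definition ent4 (R : seq (seq g4)) i j := nth o4 (nth [::] R i) j.

Section Quaternary.

Variables (F : fieldType) (a : F).

Definition phi (x : g4) : F :=
  if x.2 then (if x.1 then a ^+ 2 else a) else (if x.1 then 1 else 0).

Definition cmat (R : seq (seq g4)) r n := colmatroid (map (map phi) R) r n.

Lemma phi_ent R i j : (nth [::] (map (map phi) R) i)`_j = phi (ent4 R i j).
Proof.
rewrite /ent4; have [iR|iR] := ltnP i (size R).
  rewrite (nth_map [::]) //; have [jR|jR] := ltnP j (size (nth [::] R i)).
    by rewrite (nth_map o4).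
  by rewrite [LHS]nth_default ?size_map // [nth o4 _ _]nth_default.
have -> : nth [::] R i = [::] by rewrite nth_default.
have -> : nth [::] (map (map phi) R) i = [::] by rewrite nth_default ?size_map.
by rewrite !nth_nil.
Qed.

Hypothesis ch : 2%N \in [pchar F].
Hypothesis ha : a ^+ 2 = a + 1.

Lemma phi_add x y : phi (add4 x y) = phi x + phi y.
Proof.
have e2 (z : F) : z + z = 0 by exact: addrr_pchar2.
case: x => -[] []; case: y => -[] []; rewrite /phi /= ?ha ?add0r ?addr0 ?e2 //.
- by rewrite -addrA e2 addr0.
- by rewrite addrAC e2 add0r.
- by rewrite addrCA e2 addr0.
- by rewrite addrC.
- by rewrite addrA e2 add0r.
Qed.

Lemma phi_mul x y : phi (mul4 x y) = phi x * phi y.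
Proof.
have e2 (z : F) : z + z = 0 by exact: addrr_pchar2.
have a3 : a * (a + 1) = 1 by rewrite mulrDr mulr1 -expr2 ha addrAC e2 add0r.
case: x => -[] []; case: y => -[] []; rewrite /phi /= ?mul0r ?mulr0 ?mul1r ?mulr1 //.
- by rewrite ha mulrDl mul1r a3 addrCA e2 addr0.
- by rewrite ha mulrC a3.
- by rewrite ha a3.
Qed.

Lemma phi_eq0 x : (phi x == 0) = (x == o4).
Proof.
have a0 := golden_root_neq0 ha.
by case: x => -[] []; rewrite /phi /= ?expf_eq0 ?(negPf a0) ?oner_eq0 ?eqxx.
Qed.

Lemma phi_det4 r M : phi (det4 r M) = \det (\matrix_(i < r, j < r) phi (M i j)).
Proof.
rewrite -(ldetE r (fun i j => phi (M i j))); apply: ldet_morph => //; [exact: phi_add | exact: phi_mul |].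
by move=> x; rewrite oppr_pchar2.
Qed.

Definition tl r n (T : 'I_r -> 'I_n) : seq nat := [seq val (T j) | j <- enum 'I_r].

Lemma nth_tl r n (T : 'I_r -> 'I_n) (j : 'I_r) : nth 0%N (tl T) j = T j.
Proof. by rewrite (nth_map j) ?size_enum_ord // nth_ord_enum. Qed.

Definition indc (R : seq (seq g4)) r (s : seq nat) : bool :=
  det4 r (fun i j => ent4 R i (nth 0%N s j)) != o4.

Lemma cmat_basis R r n (T : 'I_r -> 'I_n) : injective T ->
  (@rk (cmat R r n) (T @: [set: 'I_r]) == r) = indc R r (tl T).
Proof.
move=> Ti; rewrite -rk_basisP // /indc -phi_eq0 phi_det4; congr (\det _ != 0).
by apply/matrixP=> i j; rewrite !mxE nth_tl phi_ent.
Qed.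

Lemma cmat_rkT R r n : (@rk (cmat R r n) [set: 'I_n] <= r)%N.
Proof.
rewrite -[leqRHS]card_ord; have := leqnn (@rk (cmat R r n) [set: 'I_n]).
by move=> /rk_subdetP[f [g [_ d]]]; rewrite -[leqLHS]card_ord; apply: leq_card (subdet_inj d).
Qed.

End Quaternary.

(* [all], [has] and [&&] evaluate all their arguments under call by value;
   these variants stop early. *)
Fixpoint lall (T : Type) (p : T -> bool) (s : seq T) : bool :=
  if s is x :: s' then (if p x then lall p s' else false) else true.
Fixpoint lhas (T : Type) (p : T -> bool) (s : seq T) : bool :=
  if s is x :: s' then (if p x then true else lhas p s') else false.

Lemma lallE (T : Type) (p : T -> bool) s : lall p s = all p s.
Proof. by elim: s => //= x s ->; case: (p x). Qed.
Lemma lhasE (T : Type) (p : T -> bool) s : lhas p s = has p s.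
Proof. by elim: s => //= x s ->; case: (p x). Qed.

(** * Exhaustive search for a representation over GF(5) *)

Section Search5.

Definition add5 x y := ((x + y) %% 5)%N.
Definition mul5 x y := ((x * y) %% 5)%N.
Definition opp5 x := ((4 * x) %% 5)%N.
Definition det5 r (vs : seq (seq nat)) :=
  ldet 0%N 1%N add5 mul5 opp5 r (fun i j => nth 0%N (nth [::] vs j) i).

Fixpoint subs k (s : seq nat) : seq (seq nat) :=
  match k, s with
  | 0, _ => [:: [::]]
  | k'.+1, x :: s' => map (cons x) (subs k' s') ++ subs k s'
  | _, [::] => [::]
  end%N.

Fixpoint vecs5 r : seq (seq nat) :=
  if r is r'.+1 then flatten [seq map (cons x) (vecs5 r') | x <- iota 0 5] else [:: [::]].

Lemma vecs5S r : vecs5 r.+1 = flatten [seq map (cons x) (vecs5 r) | x <- iota 0 5].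
Proof. by []. Qed.

Lemma F5_val (x : 'F_5) : (val x)%:R = x.
Proof. exact: natr_Zp. Qed.

Lemma F5_div0 (y l : 'F_5) : l != 0 -> (val (y / l) != 0%N) = (y != 0).
Proof. by move=> l0; rewrite -[0%N]/(val (0 : 'F_5)) val_eqE mulf_eq0 invr_eq0 (negPf l0) orbF. Qed.

(** One representative of each projective point, namely the one with first nonzero entry 1, and also
    the zero vector, which passes thanks to the default 1 of [nth]. *)
Definition cands5 r := [seq v <- vecs5 r | nth 1%N [seq y <- v | y != 0%N] 0 == 1%N].

Variables (r : nat) (ind : seq nat -> bool) (bas : seq nat) (u0 : nat).

Definition okstep (l : seq (seq nat)) (tbl : seq (seq nat * bool)) (v : seq nat) : bool :=
  lall (fun p => (det5 r (rcons [seq nth [::] l i | i <- p.1] v) %% 5 != 0)%N == p.2) tbl.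

(** Backtracking over the elements in order. Elements of [bas] receive unit vectors and [u0] a 0-1
    vector, the latter by row scaling. A new column is tested together with all sets of [r - 1]
    earlier ones. *)
Fixpoint srch k (l : seq (seq nat)) : bool :=
  if k is k'.+1 then
    let tbl := [seq (s, ind (rcons s (size l))) | s <- subs r.-1 (iota 0 (size l))] in
    lhas (fun v => if okstep l tbl v then srch k' (rcons l v) else false)
      (if size l \in bas then [:: mkseq (fun i => (i == index (size l) bas)%N : nat) r]
       else if size l == u0 then [seq v <- cands5 r | all (fun y => y < 2)%N v]
       else cands5 r)
  else true.

Lemma subs_subseq k s t : t \in subs k s -> subseq t s /\ size t = k.
Proof.
elim: s k t => [|x s IH] [|k] t //=; rewrite ?inE; try by move=> /eqP->.
rewrite mem_cat => /orP[/mapP[u /IH[su <-] ->]|/IH[su <-]].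
  by rewrite /= eqxx.
by split=> //; apply: subseq_trans su (subseq_cons _ _).
Qed.

Lemma mem_vecs5 v : all (fun y => y < 5)%N v -> v \in vecs5 (size v).
Proof.
elim: v => [|x v IH] //; rewrite [all _ _]/= => /andP[x5 /IH vv].
rewrite [size _]/= vecs5S; apply/flattenP; exists (map (cons x) (vecs5 (size v))).
  by apply/mapP; exists x => //; rewrite mem_iota.
exact: map_f.
Qed.

Variable n : nat.
Variable C : 'I_r -> 'I_n -> 'F_5.
Hypothesis r_gt0 : (0 < r)%N.
Hypothesis n_gt0 : (0 < n)%N.
Hypothesis hC : forall T : 'I_r -> 'I_n, injective T -> (subdet C id T != 0) = ind (tl T).
Variable b : 'I_r -> 'I_n.
Hypothesis b_inj : injective b.
Hypothesis bas_b : bas = tl b.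
Variable mu : 'I_r -> 'F_5.
Hypothesis mu0 : forall i, mu i != 0.
Hypothesis Cb : forall i j, C i (b j) = (i == j)%:R * mu i.
Hypothesis Cu : forall i e, val e = u0 -> C i e = 0 \/ C i e = 1.

Let oe (e : nat) : 'I_n := insubd (Ordinal n_gt0) e.
Let oeE e : (e < n)%N -> oe e = e :> nat. Proof. by move=> h; rewrite val_insubd h. Qed.

Let lam (e : nat) : 'F_5 := nth 1 [seq y <- [seq C i (oe e) | i <- enum 'I_r] | y != 0] 0.
Let av (e : nat) : seq nat := [seq val (C i (oe e) / lam e) | i <- enum 'I_r].

Let lam0 e : lam e != 0.
Proof.
rewrite /lam; set s := [seq y <- _ | y != 0].
have : all (fun y => y != 0) s by apply: filter_all.
by case: s => [|y s] //= /andP[].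
Qed.

Let avE e (i : 'I_r) : C i (oe e) = lam e * (nth 0%N (av e) i)%:R.
Proof. by rewrite (nth_map i) ?size_enum_ord // nth_ord_enum F5_val mulrC divfK. Qed.

Let av_cand e : av e \in cands5 r.
Proof.
rewrite mem_filter; apply/andP; split; last first.
  have -> : r = size (av e) by rewrite size_map size_enum_ord.
  by apply: mem_vecs5; apply/allP=> y /mapP[i _ ->]; exact: (ltn_ord (_ : 'F_5)).
rewrite /av (map_comp (fun y => val (y / lam e)) (fun i => C i (oe e))) filter_map.
rewrite (eq_filter (a2 := fun y => y != 0)); last first.
  by move=> y; exact: F5_div0.
have : lam e = nth 1 [seq y <- [seq C i (oe e) | i <- enum 'I_r] | y != 0] 0 by [].
case: [seq y <- _ | y != 0] => [|y s]; first by [].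
move=> yE; have {}yE : lam e = y := yE.
by rewrite -[nth _ _ _]/(val (y / lam e)) -yE divff.
Qed.

Let det5E (s : seq nat) (T : 'I_r -> 'I_n) : tl T = s -> 
  (det5 r (map av s) %% 5 != 0)%N = (subdet C id T != 0).
Proof.
move=> sT; have p5 : 5%N \in [pchar 'F_5] by exact: pchar_Fp.
have f5 m : (m %% 5)%:R = m%:R :> 'F_5 by exact: Fp_nat_mod.
have -> : (det5 r (map av s) %% 5 != 0)%N = ((det5 r (map av s))%:R != 0 :> 'F_5).
  by rewrite -(dvdn_pcharf p5) /dvdn.
have sz : size s = r by rewrite -sT size_map size_enum_ord.
rewrite /det5 (@ldet_morph _ _ _ _ _ _ _ 0 1 +%R *%R -%R (fun m => m%:R : 'F_5)) //; first last.
- move=> x; rewrite f5; apply/eqP; rewrite -addr_eq0 -natrD -(dvdn_pcharf p5).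
  by rewrite addnC -mulSn dvdn_mulr.
- by move=> x y; rewrite f5 natrM.
- by move=> x y; rewrite f5 natrD.
rewrite ldetE.
have -> : subdet C id T = \prod_j lam (T j) * \det (\matrix_(i < r, j < r) (nth 0%N (nth [::] (map av s) j) i)%:R).
  rewrite mulrC -[X in _ = _ * X](_ : \det (diag_mx (\row_j lam (T j))) = _); last first.
    by rewrite det_diag; apply: eq_bigr => j _; rewrite mxE.
  rewrite -det_mulmx; congr (\det _); apply/matrixP=> i j.
  rewrite mul_mx_diag !mxE (nth_map 0%N) ?sz // -sT nth_tl mulrC -avE.
  by congr (C _ _); apply: ord_inj; rewrite oeE.
by rewrite mulf_eq0 negb_or; case: (boolP (\prod_j _ == 0)) => // /prodf_eq0[j _]; rewrite (negPf (lam0 _)).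
Qed.

(** A genuine representation, with each column divided by its first nonzero entry [lam], is a branch
    that the search accepts; so a failing search refutes representability. *)
Lemma srch_sound k : (k <= n)%N -> srch k (map av (iota 0 (n - k))).
Proof.
elim: k => // k IH ltk; set e := (n - k.+1)%N.
have eS : (n - k)%N = e.+1 by rewrite /e -subSS subSn.
have en : (e < n)%N by rewrite /e; lia.
have sl : size [seq av i | i <- iota 0 e] = e by rewrite size_map size_iota.
rewrite [srch _ _]/= lhasE sl; apply/hasP; exists (av e).
  case: ifP => [|_]; last first.
    case: ifP => [/eqP eu|_]; last exact: av_cand.
    rewrite mem_filter av_cand andbT; apply/allP=> y /mapP[i _ ->].
    have Ce j : C j (oe e) = 0 \/ C j (oe e) = 1 by apply: Cu; rewrite -eu; exact: oeE.
    have l1 : lam e = 1.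
      rewrite /lam; set s := [seq y <- _ | y != 0].
      have : {subset s <= [:: 1]}.
        move=> z; rewrite mem_filter => /andP[z0 /mapP[j _ zj]]; move: z0; rewrite zj inE.
        by case: (Ce j) => ->.
      by case: s => [|z s] //= /(_ z); rewrite inE eqxx => /(_ isT); rewrite inE => /eqP.
    by rewrite l1 divr1; case: (Ce i) => ->.
  rewrite bas_b => ein; rewrite inE; apply/eqP.
  have [j jE] : exists j, b j = oe e.
    by have /mapP[j _ ej] := ein; exists j; apply: ord_inj; rewrite oeE.
  have ij : index e (tl b) = j.
    have {1}-> : e = val (b j) by rewrite jE; apply/esym/oeE.
    rewrite /tl -[RHS](index_enum_ord j) -(index_map (f := fun x => val (b x))) //.
    by move=> x y /val_inj/b_inj.
  have lamE : lam e = mu j.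
    rewrite /lam -jE; set s := [seq y <- _ | y != 0].
    have s1 : {subset s <= [:: mu j]}.
      move=> y; rewrite mem_filter => /andP[y0 /mapP[i _ yi]]; move: y0; rewrite yi Cb inE.
      by case: (eqVneq i j) => [->|_]; rewrite ?mul1r ?mul0r ?eqxx.
    have : mu j \in s.
      rewrite mem_filter mu0; apply/mapP; exists j; rewrite ?mem_enum // Cb eqxx mul1r //.
    by case: s s1 => [|y s] //= /(_ y); rewrite inE eqxx => /(_ isT); rewrite inE => /eqP.
  have sz1 : size (av e) = r by rewrite /av size_map size_enum_ord.
  apply: (@eq_from_nth _ 0%N); first by rewrite size_mkseq sz1.
  rewrite sz1 => i ir; rewrite /av lamE; rewrite nth_mkseq // (nth_map (Ordinal ir)) ?size_enum_ord //.
  rewrite (nth_ord_enum (Ordinal ir) (Ordinal ir)) -jE Cb ij.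
  case: (eqVneq (Ordinal ir) j) => [ij'|nij]; last first.
    rewrite (_ : (i == j) = false) ?mul0r //.
    by apply/negP=> /eqP h; case/eqP: nij; apply: val_inj.
  rewrite -ij' mulfK; last exact: mu0.
  by rewrite /= eqxx.
rewrite -(map_rcons av); set tbl := [seq (s, ind (rcons s e)) | s <- _]; have -> : okstep [seq av i | i <- iota 0 e] tbl (av e); last first.
  by have := IH (ltnW ltk); rewrite eS -addn1 iotaD add0n cats1.
rewrite /okstep lallE /tbl all_map; apply/allP=> s /subs_subseq[ss sz] /=.
have sn : all (fun i => i < e)%N s.
  by apply/allP=> i /(mem_subseq ss); rewrite mem_iota.
have us : uniq (rcons s e).
  rewrite rcons_uniq (subseq_uniq ss) ?iota_uniq // andbT.
  by apply/negP=> /(allP sn); rewrite ltnn.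
have szr : size (rcons s e) = r by rewrite size_rcons sz prednK.
pose T (j : 'I_r) := oe (nth 0%N (rcons s e) j).
have Tv j : T j = nth 0%N (rcons s e) j :> nat.
  apply: oeE; have : nth 0%N (rcons s e) j \in rcons s e by rewrite mem_nth ?szr.
  by rewrite mem_rcons inE => /orP[/eqP->//|/(allP sn)/ltn_trans]; apply.
have tlT : tl T = rcons s e.
  have szT : size (tl T) = r by rewrite /tl size_map size_enum_ord.
  apply: (@eq_from_nth _ 0%N); rewrite szT ?szr // => i ir.
  by rewrite (nth_tl T (Ordinal ir)) Tv.
have Ti : injective T.
  by move=> x y /(congr1 val) /= /eqP; rewrite !Tv nth_uniq ?szr // => /eqP/val_inj.
apply/eqP; rewrite -tlT -hC // -(det5E tlT) map_rcons; congr (det5 _ (rcons _ _) %% 5 != 0)%N.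
apply/eq_in_map => i /(allP sn) ie; rewrite (nth_map 0%N) ?size_iota // nth_iota //.
Qed.

End Search5.

(** In GF(5) the element 3 is a root of x^2 = x + 1. After [rep_coords] the basis carries the
    identity; dividing row [i] by the entry [nu i] of column [u0] makes that column 0-1, and the
    basis columns become multiples of unit vectors, which is why [srch_sound] allows the factors
    [mu]. *)
Lemma not_golden5 (R : realType) (N : matroid) r n (f : N -> 'I_n) (ind : seq nat -> bool)
    (b : 'I_r -> 'I_n) (u0 : nat) : (0 < r)%N -> (0 < n)%N -> bijective f ->
  (forall T : 'I_r -> 'I_n, injective T ->
     (rk (f @^-1: (T @: [set: 'I_r])) == r) = ind (tl T)) ->
  (rk [set: N] <= r)%N -> injective b -> ind (tl b) ->
  ~~ srch r ind (tl b) u0 n [::] -> ~ golden_mean R N.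
Proof.
move=> r0 n0 [g fK gK] hind rN bi indb ns gN.
have ha : (3 : 'F_5) ^+ 2 = 3 + 1 by apply/eqP.
have [B [A rA]] := golden_mean_transfer ha gN.
have pre (X : {set 'I_n}) : f @^-1: X = g @: X.
  apply/setP=> x; rewrite inE; apply/idP/imsetP => [h|[y yX ->]]; last by rewrite gK.
  by exists (f x).
have rb : rk ((g \o b) @: [set: 'I_r]) = r by apply/eqP; rewrite imset_comp -pre hind.
have [|||C [Cb rC]] := @rep_coords _ N B A r (g \o b) rA.
- by apply: inj_comp => //; exact: can_inj gK.
- exact: rb.
- by apply/eqP; rewrite eqn_leq rN -{1}rb rk_mono ?subsetT.
move/negP: ns; apply.
pose nu i := let c := C i (g (insubd (Ordinal n0) u0)) in if c == 0 then 1 else c.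
have nu0 i : nu i != 0 by rewrite /nu /=; case: ifPn => // _; exact: oner_neq0.
have := @srch_sound r ind (tl b) u0 n (fun i e => C i (g e) / nu i) r0 n0 _ b bi erefl (fun i => (nu i)^-1).
move=> /(_ _ _ _ _ n (leqnn n)); rewrite subnn; apply.
- move=> T Ti; rewrite -hind // pre -imset_comp -rC -rk_basisP; last first.
    by apply: inj_comp Ti; exact: can_inj gK.
  have -> : subdet (fun i e => C i (g e) / nu i) id T = (\prod_i (nu i)^-1) * subdet C id (g \o T).
    rewrite /subdet -[X in _ = X * _](_ : \det (diag_mx (\row_i (nu i)^-1)) = _); last first.
      by rewrite det_diag; apply: eq_bigr => j _; rewrite mxE.
    by rewrite -det_mulmx; congr (\det _); apply/matrixP=> i j; rewrite mul_diag_mx !mxE mulrC.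
  rewrite mulf_eq0 negb_or; case: (boolP (\prod_i _ == 0)) => // /prodf_eq0[j _].
  by rewrite invr_eq0 (negPf (nu0 j)).
- by move=> i; rewrite invr_eq0.
- by move=> i j /=; rewrite (Cb i j).
move=> i e eu; have -> : e = insubd (Ordinal n0) u0.
  by apply: val_inj; rewrite val_insubd -eu ltn_ord.
by rewrite /nu; case: eqVneq => [->|h]; [left; rewrite mul0r | right; rewrite divff].
Qed.

Definition V1c : seq (seq g4) :=
  [:: [:: i4; o4; o4; i4; o4; i4; i4; i4; i4];
      [:: o4; i4; o4; i4; i4; b4; b4; a4; o4];
      [:: o4; o4; i4; o4; i4; i4; a4; i4; a4]].
Definition V2c : seq (seq g4) :=
  [:: [:: i4; o4; o4; o4; i4; i4; i4; o4];
      [:: o4; i4; o4; o4; b4; a4; a4; i4];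
      [:: o4; o4; i4; o4; a4; b4; a4; i4];
      [:: o4; o4; o4; i4; b4; b4; a4; a4]].
Definition V3c : seq (seq g4) :=
  [:: [:: i4; o4; o4; o4; i4; o4; i4; i4; i4];
      [:: o4; i4; o4; o4; a4; i4; b4; b4; i4];
      [:: o4; o4; i4; o4; a4; i4; a4; i4; b4];
      [:: o4; o4; o4; i4; o4; i4; i4; o4; o4]].
Definition P1c : seq (seq g4) :=
  [:: [:: o4; i4; i4; i4; i4; i4; o4; o4; o4];
      [:: o4; i4; a4; o4; o4; o4; i4; i4; i4];
      [:: i4; o4; o4; i4; a4; b4; i4; a4; b4]].
Definition P2c : seq (seq g4) :=
  [:: [:: i4; o4; o4; o4; i4; o4; i4; i4];
      [:: o4; i4; o4; o4; a4; i4; i4; i4];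
      [:: o4; o4; i4; o4; i4; i4; o4; i4];
      [:: o4; o4; o4; i4; b4; i4; b4; o4]].
Definition P3c : seq (seq g4) :=
  [:: [:: o4; i4; i4; i4; i4; i4; i4; o4; o4];
      [:: o4; i4; a4; b4; o4; o4; o4; i4; i4];
      [:: i4; o4; o4; o4; i4; a4; b4; i4; a4]].
Definition F7c : seq (seq g4) :=
  [:: [:: i4; o4; o4; i4; i4; o4; i4];
      [:: o4; i4; o4; i4; o4; i4; i4];
      [:: o4; o4; i4; o4; i4; i4; i4]].
(** Coordinates over GF(4) for the Pappus matroid in the numbering of [pappus_lines]; [pap_tables]
    verifies them. *)
Definition Papc : seq (seq g4) :=
  [:: [:: o4; o4; o4; i4; i4; i4; i4; i4; i4];
      [:: o4; i4; i4; o4; i4; b4; i4; b4; a4];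
      [:: i4; o4; i4; o4; a4; i4; o4; b4; i4]].

Section NotGolden.

Variables (F : fieldType) (a : F).
Hypothesis ch : 2%N \in [pchar F].
Hypothesis ha : a ^+ 2 = a + 1.
Variable R : realType.

Lemma tl_widen r n (le_rn : (r <= n)%N) : tl (widen_ord le_rn) = iota 0 r.
Proof. by rewrite /tl -val_enum_ord; apply: eq_map. Qed.

Lemma cmat_not_golden M r n u0 : (0 < r)%N -> (r <= n)%N -> indc M r (iota 0 r) ->
  ~~ srch r (indc M r) (iota 0 r) u0 n [::] -> ~ golden_mean R (cmat a M r n).
Proof.
move=> r0 rn hi hs; rewrite -(tl_widen rn) in hi hs.
apply: (@not_golden5 R (cmat a M r n) r n id (indc M r) (widen_ord rn) u0) => //.
- exact: leq_trans r0 rn.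
- by exists id.
- by move=> T Ti; rewrite -(cmat_basis ch ha) //; congr (rk _ == _); apply/setP=> x; rewrite inE.
- exact: cmat_rkT.
- by move=> x y /(congr1 val) /= /val_inj.
Qed.

(** Here and below the last argument of [cmat_not_golden] is an element without zero coordinate in
    the basis of the first [r] elements, so row scaling fixes it completely and the search stays
    small. *)
Lemma V1_not_golden : ~ golden_mean R (V1 a).
Proof. apply: (@cmat_not_golden V1c 3 9 5); [by []|by []| |]; by vm_compute. Qed.
Lemma V2_not_golden : ~ golden_mean R (V2 a).
Proof. apply: (@cmat_not_golden V2c 4 8 4); [by []|by []| |]; by vm_compute. Qed.
Lemma V3_not_golden : ~ golden_mean R (V3 a).
Proof. apply: (@cmat_not_golden V3c 4 9 6); [by []|by []| |]; by vm_compute. Qed.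
Lemma P1_not_golden : ~ golden_mean R (P1 a).
Proof. apply: (@cmat_not_golden P1c 3 9 3); [by []|by []| |]; by vm_compute. Qed.
Lemma P2_not_golden : ~ golden_mean R (P2 a).
Proof. apply: (@cmat_not_golden P2c 4 8 4); [by []|by []| |]; by vm_compute. Qed.
Lemma P3_not_golden : ~ golden_mean R (P3 a).
Proof. apply: (@cmat_not_golden P3c 3 9 4); [by []|by []| |]; by vm_compute. Qed.

Let psi (x : 'F_2) : F := (val x)%:R.

Let psi_zmod : zmod_morphism psi.
Proof.
have e2 : 1 - 1 = 0 :> F by rewrite subrr.
have n1 : 0 - 1 = 1 :> F by rewrite sub0r oppr_pchar2.
by case=> [[|[|x]] hx] [[|[|y]] hy] //; rewrite /psi /= ?subr0 ?e2 ?n1.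
Qed.

Let psi_monoid : monoid_morphism psi.
Proof.
split=> //; case=> [[|[|x]] hx] [[|[|y]] hy] //; rewrite /psi /= ?mul0r ?mulr0 ?mul1r //.
Qed.

HB.instance Definition _ := GRing.isZmodMorphism.Build _ _ psi psi_zmod.
HB.instance Definition _ := GRing.isMonoidMorphism.Build _ _ psi psi_monoid.

Let vF (j : 'I_7) : 'rV['F_2]_3 := \row_i ((ent4 F7c i j).1 : nat)%:R.

Let vF_point (j : 'I_7) : [exists i : 'I_3, (vF j 0 i == 1) && [forall k : 'I_3, (k < i)%N ==> (vF j 0 k == 0)]].
Proof.
pose l : nat := nth 0%N [:: 0; 1; 2; 0; 0; 1; 0]%N j.
have l3 : (l < 3)%N by rewrite /l; case: j {l} => -[|[|[|[|[|[|[|]]]]]]].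
apply/existsP; exists (Ordinal l3); apply/andP; split.
  by rewrite mxE /=; move: l3; rewrite /l; case: j {l} => -[|[|[|[|[|[|[|]]]]]]].
apply/forallP=> k; apply/implyP; rewrite mxE /= /l; case: k => -[|[|[|]]] //= hk;
  by case: j {l l3} => -[|[|[|[|[|[|[|]]]]]]].
Qed.

(** Both matrices have the same 0-1 entries, transported by the embedding [psi] of the prime field;
    the seven columns are all nonzero vectors of length 3. *)
Lemma Fano_iso : iso (cmat a F7c 3 7) Fano.
Proof.
pose f (j : 'I_7) : PG_point 2 3 := exist _ (vF j) (vF_point j).
have two (x : 'F_2) : x = 0 \/ x = 1.
  by case: x => -[|[|x]] hx //; [left|right]; apply: val_inj.
have fi : injective f.
  move=> j k [/rowP h]; apply: val_inj.
  have := h 0; have := h 1; have := h (Ordinal (isT : 2 < 3)%N); rewrite !mxE.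
  by move: j k {h} => [[|[|[|[|[|[|[|j]]]]]]] hj] [[|[|[|[|[|[|[|k]]]]]]] hk].
exists f.
  have fs (p : PG_point 2 3) : exists j, f j = p.
    have h j : (forall i, vF j 0 i = val p 0 i) -> exists j, f j = p.
      by move=> e; exists j; apply: val_inj; apply/rowP.
    have ex : exists j : 'I_7, forall i, vF j 0 i = val p 0 i; last by have [j /h] := ex.
    have := two (val p 0 0); have := two (val p 0 1); have := two (val p 0 (Ordinal (isT : 2 < 3)%N)).
    have pick j (hj : (j < 7)%N) : val p 0 0 = (ent4 F7c 0 j).1%:R -> val p 0 1 = (ent4 F7c 1 j).1%:R ->
        val p 0 (Ordinal (isT : 2 < 3)%N) = (ent4 F7c 2 j).1%:R ->
        exists j : 'I_7, forall i, vF j 0 i = val p 0 i.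
      move=> h0 h1 h2; exists (Ordinal hj) => i; rewrite mxE.
      by case: i => -[|[|[|]]] //= hi; rewrite -?h0 -?h1 -?h2; congr (val p 0 _); apply: val_inj.
    have := valP p => /existsP[i0 /andP[/eqP p1 _]].
    case=> h2 [] h1 [] h0.
    - exfalso; have : val p 0 i0 = 0; last by rewrite p1 => /eqP; rewrite oner_eq0.
      case: i0 {p1} => -[|[|[|]]] //= hi.
      + by apply: etrans h0; congr (_ _ _); apply: val_inj.
      + by apply: etrans h1; congr (_ _ _); apply: val_inj.
      by apply: etrans h2; congr (_ _ _); apply: val_inj.
    - exact: (pick 0%N).
    - exact: (pick 1%N).
    - exact: (pick 3%N).
    - exact: (pick 2%N).
    - exact: (pick 4%N).
    - exact: (pick 5%N).
    - exact: (pick 6%N).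
  apply: inj_card_bij => //.
  have /fin_all_exists[g gE] := fs; apply: leq_card (_ : injective g).
  by move=> x y h; rewrite -(gE x) h gE.
move=> X; rewrite -rk_rmx_comp; apply/esym; apply: rk_rmx_eq => t.
have e u v : subdet (fun (i : 'I_3) (j : 'I_7) => (nth [::] (map (map (phi a)) F7c) i)`_j) u v
    = psi (subdet (fun (i : 'I_3) (j : 'I_7) => val (f j) 0 i) u v) :> F.
  move: t u v => t u v; rewrite /subdet -det_map_mx; congr (\det _); apply/matrixP=> i j.
  rewrite !mxE phi_ent; move: (u i) (v j) => {}i {}j.
  rewrite -[X in _ = X]/(val (((ent4 F7c i j).1 : nat)%:R : 'F_2))%:R.
  have -> : val (((ent4 F7c i j).1 : nat)%:R : 'F_2) = (ent4 F7c i j).1 by case: (ent4 F7c i j).1.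
  have : (ent4 F7c i j).2 = false by move: i j => [[|[|[|i]]] hi] [[|[|[|[|[|[|[|j]]]]]]] hj].
  by rewrite /phi => ->; case: (ent4 F7c i j).1.
by split=> -[u [v [vX d]]]; exists u, v; split=> //; move: d; rewrite e fmorph_eq0.
Qed.

Lemma Fano_not_golden : ~ golden_mean R Fano.
Proof.
move=> /(golden_mean_iso (iso_sym Fano_iso)).
apply: (@cmat_not_golden F7c 3 7 6); [by []|by []| |]; by vm_compute.
Qed.

Definition pap_ind (s : seq nat) : bool :=
  ~~ has (fun L => all (fun i => i \in L) s) pappus_lines.

Lemma pap_indE (T : 'I_3 -> 'I_9) : injective T ->
  (pappus_rk (T @: [set: 'I_3]) == 3) = pap_ind (tl T).
Proof.
move=> Ti; rewrite /pappus_rk card_imset // cardsT card_ord /= /pap_ind /on_line.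
have -> : has (fun L => T @: [set: 'I_3] \subset [set i | val i \in L]) pappus_lines
    = has (fun L => all (fun i => i \in L) (tl T)) pappus_lines.
  apply: eq_has => L; apply/subsetP/allP => h.
    by move=> _ /mapP[j _ ->]; have := h (T j); rewrite inE; apply; rewrite imset_f.
  by move=> _ /imsetP[j _ ->]; rewrite inE; apply: h; apply: map_f; rewrite mem_enum.
by case: (has _ _).
Qed.

(** Comparing triples settles sets of size 3. The second table extends every pair to an independent
    triple, which makes smaller sets independent by [rk_indep_sub]. *)
Lemma pap_tables : all (fun i => all (fun j => all (fun k =>
    uniq [:: i; j; k] ==> (indc Papc 3 [:: i; j; k] == pap_ind [:: i; j; k])) (iota 0 9))
  (iota 0 9)) (iota 0 9) /\
  all (fun i => all (fun j => (i == j) || has (fun k =>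
    uniq [:: i; j; k] && indc Papc 3 [:: i; j; k]) (iota 0 9)) (iota 0 9)) (iota 0 9).
Proof. by split; vm_compute. Qed.

Lemma tl3 n (T : 'I_3 -> 'I_n) :
  tl T = [:: val (T 0); val (T 1); val (T (Ordinal (isT : 2 < 3)%N))].
Proof.
rewrite /tl; have -> : enum 'I_3 = [:: 0; 1; Ordinal (isT : 2 < 3)%N].
  by apply: (inj_map val_inj); rewrite val_enum_ord.
by [].
Qed.

Lemma pap_ind_indc (T : 'I_3 -> 'I_9) : injective T -> indc Papc 3 (tl T) = pap_ind (tl T).
Proof.
move=> Ti; have [h _] := pap_tables; rewrite tl3.
have m9 (x : 'I_9) : val x \in iota 0 9 by rewrite mem_iota; exact: ltn_ord.
have /allP/(_ _ (m9 (T 1)))/allP/(_ _ (m9 (T (Ordinal (isT : 2 < 3)%N))))/implyP h3 := allP h _ (m9 (T 0)).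
suff /h3/eqP : uniq [:: val (T 0); val (T 1); val (T (Ordinal (isT : 2 < 3)%N))] by [].
by rewrite /= !inE !(inj_eq val_inj) !(inj_eq Ti).
Qed.

Lemma Pappus_iso : iso (cmat a Papc 3 9) Pappus.
Proof.
exists id; first by exists id.
apply: (@rk_eq_indep (cmat a Papc 3 9) Pappus id 3) => //.
- exact: cmat_rkT.
- by rewrite -[rk _]/(pappus_rk _) /pappus_rk; case: ifP => [/leq_trans->|_] //; case: ifP.
move=> Y; rewrite imset_id -[in RHS]/(pappus_rk Y) leq_eqVlt => /orP[/eqP c3|c2].
  pose T (j : 'I_3) := enum_val (cast_ord (esym c3) j).
  have Ti : injective T by move=> x y /enum_val_inj/cast_ord_inj.
  have YT : (Y : {set 'I_9}) = T @: [set: 'I_3].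
    apply/eqP; rewrite eq_sym eqEcard card_imset // cardsT card_ord [X in (X <= _)%N]c3 leqnn andbT.
    by apply/subsetP=> _ /imsetP[j _ ->]; exact: enum_valP.
  by rewrite c3 YT (cmat_basis ch ha) // pap_indE // pap_ind_indc.
rewrite ltnS in c2; have -> : @rk Pappus Y = #|Y| by rewrite -[rk _]/(pappus_rk _) /pappus_rk c2.
rewrite eqxx; apply/eqP.
have [i [j [nij sY]]] : exists i j : 'I_9, i != j /\ (Y : {set 'I_9}) \subset [set i; j].
  have [c|c|c] := ltngtP #|Y| 1.
  - have /eqP : #|Y| == 0%N by rewrite -leqn0.
    by move/cards0_eq->; exists 0, 1; rewrite sub0set.
  - have /cards2P[i [j [nij ->]]] : #|Y| == 2 by rewrite eqn_leq c2.
    by exists i, j.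
  have /cards1P[i ->] : #|Y| == 1%N by apply/eqP.
  exists i, (if (i : 'I_9) == 0 then 1 else 0); split.
    by case: (eqVneq (i : 'I_9) 0) => [->|].
  by rewrite sub1set !inE eqxx.
have [_ h] := pap_tables.
have m9 (x : 'I_9) : val x \in iota 0 9 by rewrite mem_iota; exact: ltn_ord.
have /allP/(_ _ (m9 j)) := allP h _ (m9 i); rewrite (inj_eq val_inj) (negPf nij) => /hasP[k].
rewrite mem_iota => /= k9 /andP[u ik].
pose T (x : 'I_3) : 'I_9 := nth i [:: i; j; Ordinal k9] x.
have tT : tl T = [:: val i; val j; k] by rewrite tl3.
have Ti : injective T.
  move=> x y /eqP; rewrite nth_uniq ?ltn_ord //; exact: (fun h => val_inj (eqP h)).
apply: (@rk_indep_sub (cmat a Papc 3 9) Y (T @: [set: 'I_3])).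
  apply: subset_trans sY _; apply/subsetP=> x; rewrite !inE => /orP[]/eqP->; apply/imsetP.
    by exists 0.
  by exists 1.
by rewrite card_imset // cardsT card_ord; apply/eqP; rewrite (cmat_basis ch ha) // tT.
Qed.

(** The points 0, 1, 2 being collinear, the basis is 0, 1, 3; the point 4 is on no line through two
    of these. *)
Lemma Pappus_not_golden : ~ golden_mean R Pappus.
Proof.
pose b (j : 'I_3) : 'I_9 := inord (nth 0 [:: 0; 1; 3] j)%N.
have tb : tl b = [:: 0; 1; 3]%N by rewrite tl3 /= !inordK.
apply: (@not_golden5 R Pappus 3 9 id pap_ind b 4); [by []|by []|by exists id| | | | |].
- move=> T Ti; rewrite -pap_indE // -[rk _]/(pappus_rk _); congr (pappus_rk _ == _).
  by apply/setP=> x; rewrite inE.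
- by rewrite -[rk _]/(pappus_rk _) /pappus_rk; case: ifP => [/leq_trans->|_] //; case: ifP.
- move=> x y h; have /eqP : nth 0%N (tl b) x = nth 0%N (tl b) y by rewrite !nth_tl h.
  by rewrite tb nth_uniq // => /eqP/val_inj.
- by rewrite tb.
- by rewrite tb; vm_compute.
Qed.

End NotGolden.

(** * Frame templates *)

Lemma riso_refl (F : fieldType) (M : rmatroid F) : riso M M.
Proof.
exists id, (fun=> 1); split; [by exists id | by move=> e; exact: oner_neq0 |].
move=> u; rewrite (_ : [ffun e => 1 * u e] = u) //.
by apply/ffunP=> e; rewrite ffunE mul1r.
Qed.

Lemma riso_has_minor_sym (F : fieldType) (M N : rmatroid F) :
  riso M N -> has_minor (under N) (under M).
Proof.
case=> f [c [[g fK gK] c0 fN]].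
apply: (@rminor_has_minor _ _ _ f c set0); split=> //.
- exact: can_inj fK.
- by move=> e; rewrite inE.
move=> v; split=> [h|[u [uN _ uv]]].
  pose u : {ffun N -> F^o} := [ffun x => (c (g x))^-1 * v (g x)].
  have uv e : v e = c e * u (f e) by rewrite ffunE fK mulVKf.
  exists u; split=> // [|x]; last by rewrite inE.
  by rewrite fN (_ : [ffun e => c e * u (f e)] = v) //; apply/ffunP=> e; rewrite [LHS]ffunE.
rewrite fN in uN.
by rewrite (_ : v = [ffun e => c e * u (f e)]) //; apply/ffunP=> e; rewrite [RHS]ffunE.
Qed.

Section ContractDelete.

Variables (F : fieldType) (M : rmatroid F) (C Y : {set M}).

Definition cdel : rmatroid F := @rdelete F (rcontract C) [set e : rcontract C | val e \in Y].

Definition cdel_val (e : cdel) : M := val (val e).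

Lemma cdel_val_inj : injective cdel_val.
Proof. by move=> x y /val_inj/val_inj. Qed.

Lemma cdel_valP e : (cdel_val e \notin C) && (cdel_val e \notin Y).
Proof.
rewrite /cdel_val; case: e => -[e h1] h2 /=.
by have := h2; have := h1; rewrite !inE => -> /= ->.
Qed.

Lemma cdel_emb e : e \notin C -> e \notin Y -> exists x : cdel, cdel_val x = e.
Proof.
move=> eC eY; have h1 : e \in ~: C by rewrite inE.
have h2 : (exist _ e h1 : rcontract C) \in ~: [set e : rcontract C | val e \in Y].
  by rewrite !inE.
by exists (exist (fun x : rcontract C => x \in ~: _) (exist _ e h1) h2).
Qed.

Lemma mem_cdel (u : {ffun cdel -> F^o}) :
  u \in rspace cdel <-> exists w, [/\ w \in rspace M, forall e, e \in C -> w e = 0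
    & forall e, u e = w (cdel_val e)].
Proof.
split.
  move=> /(@mem_rrestrict F (rcontract C) _ u)[v].
  move=> /(@mem_rcontract F M C v)[w [wA w0 wv]] vu.
  by exists w; split=> // e; rewrite vu wv.
move=> [w [wM w0 uw]]; apply/(@mem_rrestrict F (rcontract C) _ u).
exists [ffun e : rcontract C => w (val e)]; last by move=> e; rewrite ffunE uw.
by apply/(@mem_rcontract F M C); exists w; split=> // e; rewrite ffunE.
Qed.

(** Describes minors of [M / C \ Y] inside [M] itself, with [K] the elements contracted in addition
    to [C]. *)
Lemma cdel_has_minor (N : rmatroid F) (g : N -> M) (c : N -> F) (K : {set M}) :
  injective g -> (forall n, [/\ g n \notin C, g n \notin Y & g n \notin K]) ->
  (forall x, x \in K -> x \notin C /\ x \notin Y) -> (forall n, c n != 0) ->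
  (forall v : {ffun N -> F^o}, v \in rspace N <->
     exists w, [/\ w \in rspace M, forall e, e \in C -> w e = 0,
        forall e, e \in K -> w e = 0 & forall n, v n = c n * w (g n)]) ->
  has_minor (under cdel) (under N).
Proof.
move=> gi gk Kk c0 h.
have /fin_all_exists[f fE] : forall n, exists x, cdel_val x = g n.
  by move=> n; have [] := gk n => ? ? _; exact: cdel_emb.
apply: (@rminor_has_minor _ cdel N f c [set x | cdel_val x \in K]); split=> //.
- by move=> x y e; apply: gi; rewrite -!fE e.
- by move=> e; rewrite inE fE; have [] := gk e.
move=> v; split=> [/h[w [wM wC wK hv]]|[u [/mem_cdel[w [wM wC wu]] u0 uv]]].
  exists [ffun x => w (cdel_val x)]; split.
  - by apply/mem_cdel; exists w; split=> // e; rewrite ffunE.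
  - by move=> x; rewrite inE ffunE; exact: wK.
  by move=> e; rewrite ffunE fE.
apply/h; exists w; split=> // [x xK|n]; last by rewrite uv wu fE.
have [xC xY] := Kk x xK; have [x' x'E] := cdel_emb xC xY.
by have := u0 x'; rewrite inE wu x'E; apply.
Qed.

End ContractDelete.

Section FrameColumns.

Variables (F : finFieldType) (G : {group {unit F}}) (B : finType).
Hypothesis ch : 2%N \in [pchar F].

Lemma frame_col01 (v : B -> F) : (forall b, v b = 0 \/ v b = 1) ->
  (#|[set b | (v b != 0)%R]| <= 2)%N -> frame_col G v.
Proof.
move=> v01 c; split=> // -[b vb]; exists b; first by case: (v01 b) vb => ->; rewrite ?eqxx.
move=> b' _ vb'; exists 1%g; first exact: group1.
by case: (v01 b') vb' => ->; rewrite ?eqxx // oppr_pchar2.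
Qed.

(** In characteristic 2 this is the column of a graph edge; for [i = j] it is zero, a loop. *)
Definition edgec (i j b : B) : F := (b == i)%:R + (b == j)%:R.

Lemma frame_edgec i j : frame_col G (edgec i j).
Proof.
have e2 : 1 + 1 = 0 :> F by exact: addrr_pchar2.
apply: frame_col01 => [b|].
  by rewrite /edgec; case: (b == i); case: (b == j); rewrite ?e2 ?addr0 ?add0r; [left|right|right|left].
apply: leq_trans (subset_leq_card (_ : _ \subset [set i; j])) _; last by rewrite cards2; case: (_ != _).
apply/subsetP=> b; rewrite !inE /edgec; case: (b == i); case: (b == j) => //.
by rewrite addr0 eqxx.
Qed.

Lemma frame_unit (i : B) : frame_col G (fun b => (b == i)%:R).
Proof.
apply: frame_col01 => [b|]; first by case: (b == i); [right|left].
apply: leq_trans (subset_leq_card (_ : _ \subset [set i])) _; last by rewrite cards1.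
by apply/subsetP=> b; rewrite !inE; case: (b == i); rewrite ?eqxx.
Qed.

Lemma sum_unitc (be : B -> F) i : \sum_b be b * (b == i)%:R = be i.
Proof.
by rewrite (bigD1 i) //= eqxx mulr1 big1 ?addr0 // => b /negPf->; rewrite mulr0.
Qed.

Lemma sum_edgec (be : B -> F) i j : \sum_b be b * edgec i j b = be i + be j.
Proof.
rewrite -[in RHS](sum_unitc be i) -[in RHS](sum_unitc be j) -big_split.
by apply: eq_bigr => b _; rewrite /edgec mulrDr.
Qed.

(** The value [None] stands for a missing entry; it becomes the additional vertex [None] in
    [template_frame]. *)
Lemma frame_trivial (v : B -> F) : (forall g, g \in G -> val g = 1) -> frame_col G v ->
  exists p q : option B, forall b, v b = (Some b == p)%:R + (Some b == q)%:R.
Proof.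
move=> G1 [c h].
have [[b vb]|v0] := altP (@existsP _ (fun b => v b != 0)); last first.
  exists None, None => b; rewrite addr0; apply/eqP; move: v0; rewrite negb_exists => /forallP/(_ b).
  by rewrite negbK.
have {h} [|b0 v1 h] := h; first by exists b.
have v1' b' : b' != b0 -> v b' != 0 -> v b' = 1.
  by move=> nb /(h _ nb)[g /G1 g1 ->]; rewrite g1 oppr_pchar2.
have b0s : b0 \in [set b | v b != 0] by rewrite inE v1 oner_neq0.
have [[b1 /andP[n1 v1b]]|v0] := altP (@existsP _ (fun b => (b != b0) && (v b != 0))).
  exists (Some b0), (Some b1) => x; rewrite !(inj_eq Some_inj).
  have [->|nx] := eqVneq x b0; first by rewrite eq_sym (negPf n1) addr0.
  have [->|nx1] := eqVneq x b1; first by rewrite add0r v1'.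
  rewrite addr0; apply/eqP; apply: contraLR c => vx; rewrite -ltnNge.
  apply: leq_trans (_ : #|[set b0; b1; x]| <= _)%N.
    by rewrite [_ :|: _]setUC cardsU1 cards2 !inE (eq_sym b0) n1 (negPf nx) (negPf nx1).
  by apply: subset_leq_card; apply/subsetP=> y; rewrite !inE => /orP[/orP[]|]/eqP-> //; rewrite v1 oner_neq0.
exists (Some b0), None => x; rewrite addr0 (inj_eq Some_inj).
have [->|nx] := eqVneq x b0; first by rewrite v1.
apply/eqP; move: v0; rewrite negb_exists => /forallP/(_ x).
by rewrite nx /= negbK.
Qed.

End FrameColumns.

(** * Conforming matrices in explicit form *)

Section Template.

Variable F : finFieldType.
Variable Phi : frame_template F.

Section Build.

Variables (B' E' : finType) (fr : E' -> B' -> F) (la : E' -> {ffun tX Phi -> F}).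
Variables (zz : E' -> option (tY1 Phi)) (de : B' -> {ffun tCY Phi -> F}).

(** Normal form of a conforming matrix: [la] and [fr] are the upper and lower blocks of the free
    columns, [de] gives the rows in Delta, and [zz e = Some j] means that [e] is in Z and has column
    [j] of Y1 added. *)
Definition tmat (b : tX Phi + B') (e : tCY Phi + E') : F :=
  match b, e with
  | inl x, inl y => A1 x y
  | inr b, inl y => de b y
  | inl x, inr e => la e x + (if zz e is Some j then A1 x (inr j) else 0)
  | inr b, inr e => fr e b + (if zz e is Some j then de b (inr j) else 0)
  end.

Definition tmat_wf : Prop :=
  [/\ forall b, de b \in Del Phi,
      forall e j, zz e = Some j ->
        la e = 0 /\ exists b0, forall b, fr e b = (b == b0)%:R
    & forall e, zz e = None -> la e \in Lam Phi /\ frame_col (Gam Phi) (fr e)].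

Lemma tmat_conforming : tmat_wf -> conforming tmat.
Proof.
case=> hde hS hN.
pose A' (b : tX Phi + B') (e : tCY Phi + E') : F :=
  match b, e with
  | inl x, inl y => A1 x y
  | inr b, inl y => de b y
  | inl x, inr e => la e x
  | inr b, inr e => fr e b
  end.
exists A', [set e | zz e != None]; split.
- split=> //.
  + move=> x e; rewrite inE /=; case ze: (zz e) => [j|] // _.
    by have [-> _] := hS e j ze; rewrite ffunE.
  + move=> e; rewrite inE /=; case ze: (zz e) => [j|] // _.
    by have [_] := hS e j ze.
  split=> [e|e|b].
  + by rewrite inE negbK => /eqP/hN[].
  + rewrite inE negbK => /eqP/hN[h _].
    by rewrite (_ : [ffun x => A' (inl x) (inr e)] = la e) //; apply/ffunP=> x; rewrite ffunE.
  by rewrite (_ : [ffun y => A' (inr b) (inl y)] = de b) //; apply/ffunP=> x; rewrite ffunE.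
- by case.
- by move=> b e; rewrite inE negbK => /eqP ze; case: b => b /=; rewrite ze addr0.
move=> e; rewrite inE; case ze: (zz e) => [j|] // _; exists j.
by case=> b /=; rewrite ze.
Qed.

(** From here on a vector of the row space is handled as a pair of coefficient functions, [xi] on
    the rows of X and [be] on the frame rows; [tval] and [cval] are its values on the columns. *)
Definition tval (xi : tX Phi -> F) (be : B' -> F) (y : tCY Phi) : F :=
  \sum_x xi x * A1 x y + \sum_b be b * de b y.

Definition cval xi be (e : tCY Phi + E') : F :=
  match e with
  | inl y => tval xi be y
  | inr e => \sum_x xi x * la e x + \sum_b be b * fr e b
             + (if zz e is Some j then tval xi be (inr j) else 0)
  end.

Lemma cvalE (p : tX Phi + B' -> F) e :
  \sum_b p b * tmat b e = cval (fun x => p (inl x)) (fun b => p (inr b)) e.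
Proof.
rewrite big_sumType /=; case: e => [y|e] //=.
case: (zz e) => [j|]; last first.
  by rewrite addr0; congr (_ + _); apply: eq_bigr => b _; rewrite addr0.
rewrite /tval addrACA -!big_split /=; congr (_ + _); apply: eq_bigr => b _;
  by rewrite mulrDr.
Qed.

Definition keep (e : tCY Phi + E') : bool :=
  match e with inl (inl (inr _)) => true | inr _ => true | _ => false end.

Lemma keepE e : keep e = (e \notin C_elts Phi E') && (e \notin Y1_elts Phi E').
Proof.
case: e => [[[c|y]|y]|e] /=.
- by rewrite imset_f.
- by apply/esym/andP; split; apply/negP=> /imsetP[].
- by rewrite [_ \in Y1_elts _ _]imset_f // andbF.
by apply/esym/andP; split; apply/negP=> /imsetP[].
Qed.

Lemma rmx_tmat_cval (w : {ffun tCY Phi + E' -> F^o}) :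
  w \in rspace (rmx tmat) <-> exists xi be, forall e, w e = cval xi be e.
Proof.
split=> [/mem_rmx[p pw]|[xi [be h]]].
  by exists (fun x => p (inl x)), (fun b => p (inr b)) => e; rewrite pw cvalE.
apply/mem_rmx; exists (fun b => match b with inl x => xi x | inr b => be b end) => e.
by rewrite cvalE h.
Qed.

Lemma mem_tminor (u : {ffun cdel (C_elts Phi E' : {set rmx tmat}) (Y1_elts Phi E') -> F^o}) :
  u \in rspace (template_minor tmat) <->
  exists xi be, (forall c, tval xi be (inl (inl c)) = 0) /\
    forall e, u e = cval xi be (cdel_val e).
Proof.
split=> [/mem_cdel[w [/rmx_tmat_cval[xi [be wE]] w0 uw]]|[xi [be [h0 hu]]]].
  exists xi, be; split=> [c|e]; last by rewrite uw wE.
  by have := w0 (inl (inl (inl c))); rewrite wE; apply; exact: imset_f.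
apply/mem_cdel; exists [ffun e => cval xi be e]; split=> [|e|e]; last by rewrite ffunE.
  by apply/rmx_tmat_cval; exists xi, be => e; rewrite ffunE.
by move=> /imsetP[c _ ->]; rewrite ffunE /= h0.
Qed.

Lemma tminor_has_minor (M : rmatroid F) (g : M -> tCY Phi + E') (c : M -> F)
    (K : {set tCY Phi + E'}) :
  injective g -> (forall n, keep (g n)) -> (forall n, g n \notin K) ->
  (forall x, x \in K -> keep x) -> (forall n, c n != 0) ->
  (forall v : {ffun M -> F^o}, v \in rspace M <->
     exists xi be, [/\ forall c, tval xi be (inl (inl c)) = 0,
        forall x, x \in K -> cval xi be x = 0 &
        forall n, v n = c n * cval xi be (g n)]) ->
  has_minor (under (template_minor tmat)) (under M).
Proof.
move=> gi gk gK Kk c0 h.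
apply: (@cdel_has_minor F (rmx tmat) (C_elts Phi E') (Y1_elts Phi E') M g c K) => //.
- by move=> n; have := gk n; rewrite keepE => /andP[].
- by move=> x /Kk; rewrite keepE => /andP[].
move=> v; split=> [/h[xi [be [hC hK hv]]]|[w [/rmx_tmat_cval[xi [be wE]] wC wK hv]]].
  exists [ffun e => cval xi be e]; split=> [|e|e|n].
  - by apply/rmx_tmat_cval; exists xi, be => e; rewrite ffunE.
  - by move=> /imsetP[x _ ->]; rewrite ffunE /= hC.
  - by rewrite ffunE; exact: hK.
  by rewrite ffunE.
apply/h; exists xi, be; split=> [x|x xK|n]; last by rewrite hv wE.
  by have := wC (inl (inl (inl x))); rewrite wE; apply; exact: imset_f.
by have := wK x xK; rewrite wE.
Qed.

(** Only the pairs ([xi], [be]) killing C and [K] matter: the first condition says that their values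
    on the kept columns lie in the target row space, the second that they exhaust it. *)
Lemma tminor_rmx (B M : finType) (A : B -> M -> F) (g : M -> tCY Phi + E') (c : M -> F)
    (K : {set tCY Phi + E'}) :
  injective g -> (forall n, keep (g n)) -> (forall n, g n \notin K) ->
  (forall x, x \in K -> keep x) -> (forall n, c n != 0) ->
  (forall xi be, (forall c, tval xi be (inl (inl c)) = 0) ->
     (forall x, x \in K -> cval xi be x = 0) ->
     exists ga, forall n, c n * cval xi be (g n) = \sum_b ga b * A b n) ->
  (forall ga, exists xi be, [/\ forall c, tval xi be (inl (inl c)) = 0,
     forall x, x \in K -> cval xi be x = 0 &
     forall n, c n * cval xi be (g n) = \sum_b ga b * A b n]) ->
  has_minor (under (template_minor tmat)) (under (rmx A)).
Proof.
move=> gi gk gK Kk c0 h1 h2; apply: (@tminor_has_minor (rmx A) g c K) => // v.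
split=> [/mem_rmx[ga gv]|[xi [be [hC hK hv]]]].
  have [xi [be [hC hK e]]] := h2 ga; exists xi, be; split=> // n.
  by rewrite gv e.
by apply/mem_rmx; have [ga e] := h1 _ _ hC hK; exists ga => n; rewrite hv e.
Qed.

End Build.

Lemma conformingP (B' E' : finType) (A : tX Phi + B' -> tCY Phi + E' -> F) :
  conforming A -> exists fr la zz de, tmat_wf fr la zz de /\
    forall b e, A b e = tmat fr la zz de b e.
Proof.
case=> A' [Z [[h1 h2 h3 [h4 h5 h6]] eY eN eZ]].
have /fin_all_exists[zz zzP] : forall e, exists o : option (tY1 Phi),
    if e \in Z then exists2 j, o = Some j &
      forall b, A b (inr e) = A' b (inr e) + A' b (inl (inr j)) else o = None.
  move=> e; case: (boolP (e \in Z)) => [/eZ[j hj]|_]; last by exists None.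
  by exists (Some j), j.
exists (fun e b => A' (inr b) (inr e)), (fun e => [ffun x => A' (inl x) (inr e)]), zz,
  (fun b => [ffun y => A' (inr b) (inl y)]); split.
  split=> // [e j ze|e ze].
    have eZ' : e \in Z by have := zzP e; case: ifP => // _; rewrite ze.
    split; last exact: h3.
    by apply/ffunP=> x; rewrite !ffunE h2.
  have eZ' : e \notin Z.
    by apply/negP=> eZ'; have := zzP e; rewrite eZ' ze => -[].
  by split; [exact: h5 | exact: h4].
move=> [x|b] [y|e] /=; rewrite ?ffunE.
- by rewrite eY h1.
- have := zzP e; case: ifP => [eZ' [j -> ->]|eZ' ->]; first by rewrite h1.
  by rewrite addr0 eN ?eZ'.
- by rewrite eY.
have := zzP e; case: ifP => [eZ' [j -> ->]|eZ' ->]; first by rewrite ffunE.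
by rewrite addr0 eN ?eZ'.
Qed.

End Template.

(** * Restrictions on a template whose members avoid the Fano plane and [P1] *)

Section TemplateAnalysis.

Variables (F : finFieldType) (a : F).
Hypothesis ch : 2%N \in [pchar F].
Hypothesis ha : a ^+ 2 = a + 1.
Hypothesis hF : forall x : F, exists y, x = phi a y.
Variable Phi : frame_template F.

Hypothesis exF7 : forall (B' E' : finType) (A : tX Phi + B' -> tCY Phi + E' -> F),
  conforming A -> ~ has_minor (under (template_minor A)) (cmat a F7c 3 7).
Hypothesis exP1 : forall (B' E' : finType) (A : tX Phi + B' -> tCY Phi + E' -> F),
  conforming A -> ~ has_minor (under (template_minor A)) (cmat a P1c 3 9).

Let e2 (z : F) : z + z = 0. Proof. exact: addrr_pchar2. Qed.

Let De0 : (0 : {ffun tCY Phi -> F}) \in Del Phi. Proof. by have [] := Del_zmod Phi. Qed.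
Let La0 : (0 : {ffun tX Phi -> F}) \in Lam Phi. Proof. by have [] := Lam_zmod Phi. Qed.

(** The multiplicative group of GF(4) has prime order 3, so a nontrivial [Gam] is the whole group.
    Each column of the matrix of [P1] has at most two nonzero entries, one of them 1, so this matrix
    would itself be the frame part of a conforming matrix. *)
Lemma Gam_trivial g : g \in Gam Phi -> val g = 1.
Proof.
move=> gG; apply/eqP/negP=> /negP g1.
have gall (x : F) : x != 0 -> exists2 h, h \in Gam Phi & x = val h.
  have [y gy] := hF (val g); have [z ->] := hF x; rewrite (phi_eq0 ha) => z0.
  have /orP[/orP[]|] : [|| z == i4, z == y | z == mul4 y y] || false.
    have : phi a y != 0 by rewrite -gy; have := valP g; rewrite unitfE.
    rewrite (phi_eq0 ha); move: g1; rewrite gy.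
    by case: (y) => -[] []; case: (z) z0 => -[] [] //=; rewrite /phi /= eqxx.
  - by move=> /eqP->; exists 1%g; rewrite ?group1.
  - case/orP=> /eqP->; first by exists g.
    by exists (g * g)%g; rewrite ?groupM //= gy (phi_mul ch ha).
  by [].
pose fr (e : 'I_9) (b : 'I_3) : F := phi a (ent4 P1c b e).
apply: (@exP1 'I_3 'I_9 (@tmat F Phi 'I_3 'I_9 fr (fun=> 0) (fun=> None) (fun=> 0))).
  apply: tmat_conforming; split=> // e _; split=> //.
  have [b0 [b1 [nb b01 v0]]] : exists b0 b1, [/\ b0 != b1, fr e b0 = 1
      & forall b, b != b0 -> b != b1 -> fr e b = 0].
    have o2 : (2 < 3)%N by [].
    rewrite /fr; case: e => -[|[|[|[|[|[|[|[|[|]]]]]]]]] //= he;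
    [exists (Ordinal o2), 0 | exists 0, 1 | exists 0, 1 | exists 0, (Ordinal o2) | exists 0, (Ordinal o2)
    | exists 0, (Ordinal o2) | exists 1, (Ordinal o2) | exists 1, (Ordinal o2) | exists 1, (Ordinal o2)];
    by split=> // -[[|[|[|]]] hb].
  split; last first.
    move=> _; exists b0 => // b nb0 vb; have [h hG hb] := gall _ vb.
    by exists h; rewrite // oppr_pchar2.
  apply: leq_trans (_ : #|[set b0; b1]| <= _)%N; last by rewrite cards2; case: (_ != _).
  apply: subset_leq_card; apply/subsetP=> b; rewrite !inE; apply: contraR.
  by rewrite negb_or => /andP[h0 h1]; rewrite v0.
apply: (@tminor_rmx _ _ _ _ _ _ _ _ 'I_3 'I_9 _ (fun e => inr e) (fun=> 1) set0) => //.
- by move=> x y [].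
- by move=> n; rewrite inE.
- by move=> x; rewrite inE.
- by move=> n; exact: oner_neq0.
- move=> xi be _ _; exists be => n; rewrite mul1r /= addr0 big1 ?add0r => [|x _].
    by apply: eq_bigr => b _; rewrite /fr -phi_ent.
  by rewrite ffunE mulr0.
move=> ga; exists (fun=> 0), ga; split.
- by move=> c; rewrite /tval !big1 ?addr0 // => x _; rewrite ?mul0r // ffunE mulr0.
- by move=> x; rewrite inE.
move=> n; rewrite mul1r /= addr0 big1 ?add0r => [|x _].
  by apply: eq_bigr => b _; rewrite /fr -phi_ent.
by rewrite mul0r.
Qed.

Section Universal.

Variables (de : {ffun tCY Phi -> F}) (la : {ffun tX Phi -> F}).
Hypotheses (deD : de \in Del Phi) (laL : la \in Lam Phi).

(** A gadget with five frame rows, where row 0 carries the zero row of Delta and rows 1 to 4 carry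
    [de]. It has all edges, with and without [la] above them, a unit column at row 0 and, attached
    to row 0, a copy of every column of Y1, because the originals are deleted in a template
    matroid. *)
Let E' := (('I_5 * 'I_5 * bool) + option (tY1 Phi))%type.
Let z5 : 'I_5 := ord0.
Let ufr (e : E') : 'I_5 -> F :=
  match e with inl (p, q, _) => edgec F p q | inr _ => fun b => (b == z5)%:R end.
Let ula (e : E') : {ffun tX Phi -> F} :=
  match e with inl (_, true) => la | _ => 0 end.
Let uzz (e : E') : option (tY1 Phi) := match e with inr o => o | _ => None end.
Let ude (b : 'I_5) : {ffun tCY Phi -> F} := if b == z5 then 0 else de.

Lemma umat_conforming : conforming (tmat ufr ula uzz ude).
Proof.
apply: tmat_conforming; split.
- by move=> b; rewrite /ude; case: ifP.
- by move=> [[[p q] []]|[y|]] j //= _; split=> //; exists z5.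
move=> [[[p q] []]|[y|]] //= _; split=> //; by [exact: frame_edgec | exact: frame_unit].
Qed.

Definition u0 : tCY Phi + E' := inr (inr None).
Definition ue (p q : nat) (l : bool) : tCY Phi + E' := inr (inl (inord p, inord q, l)).
(** Contracting [u0] forces the value 0 on row 0; the copies of the columns of Y1 then take the
    values of the originals ([uval_kap]). *)
Definition kap (y : tCY Phi) : tCY Phi + E' :=
  match y with inr y1 => inr (inr (Some y1)) | _ => inl y end.

Local Notation uval := (cval ufr ula uzz ude).
Local Notation utv := (tval ude).
Let sm (be : 'I_5 -> F) := be (inord 1) + be (inord 2) + be (inord 3) + be (inord 4).

Lemma uval_tv xi be y : utv xi be y = \sum_x xi x * A1 x y + sm be * de y.
Proof.
rewrite /tval; congr (_ + _); rewrite /sm !big_ord_recl big_ord0 /ude /= ffunE mulr0 add0r addr0.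
have i1 : inord 1 = lift ord0 ord0 :> 'I_5 by apply: val_inj; rewrite /= inordK.
have i2 : inord 2 = lift ord0 (lift ord0 ord0) :> 'I_5 by apply: val_inj; rewrite /= inordK.
have i3 : inord 3 = lift ord0 (lift ord0 (lift ord0 ord0)) :> 'I_5 by apply: val_inj; rewrite /= inordK.
have i4' : inord 4 = lift ord0 (lift ord0 (lift ord0 (lift ord0 ord0))) :> 'I_5 by apply: val_inj; rewrite /= inordK.
by rewrite i1 i2 i3 i4' !mulrDl !addrA.
Qed.

Lemma uval_0 xi be : uval xi be u0 = be z5.
Proof. by rewrite /= sum_unitc big1 ?add0r ?addr0 // => x _; rewrite ffunE mulr0. Qed.

Lemma uval_e xi be p q l : uval xi be (ue p q l) =
  be (inord p) + be (inord q) + (if l then \sum_x xi x * la x else 0).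
Proof.
rewrite /= sum_edgec addr0 addrC; case: l => //=.
by rewrite big1 // => x _; rewrite ffunE mulr0.
Qed.

Lemma uval_kap xi be y : be z5 = 0 -> uval xi be (kap y) = utv xi be y.
Proof.
move=> b0; case: y => [y|y1] //=; rewrite sum_unitc b0 addr0 big1 ?add0r // => x _.
by rewrite ffunE mulr0.
Qed.

Definition six (j : nat) : nat * nat :=
  nth (0, 0)%N [:: (0, 1); (0, 2); (0, 3); (1, 2); (1, 3); (2, 3)]%N j.

(** With value 0 on row 0 and g1, g2, g3 on rows 1 to 3, the six edges read g1, g2, g3 and their
    pairwise sums. A seventh element reading g1 + g2 + g3 completes the Fano plane, provided that
    g1, g2, g3 stay free after contracting [K]. *)
Lemma universal_fano (K : {set tCY Phi + E'}) (x7 : tCY Phi + E') (c : F) :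
  c != 0 -> u0 \in K -> x7 \notin K -> keep x7 -> (forall x, x \in K -> keep x) ->
  (forall j, (j < 6)%N -> ue (six j).1 (six j).2 false != x7 /\
                          ue (six j).1 (six j).2 false \notin K) ->
  (forall xi be, (forall c, utv xi be (inl (inl c)) = 0) ->
     (forall x, x \in K -> uval xi be x = 0) ->
     c * uval xi be x7 = be (inord 1) + be (inord 2) + be (inord 3)) ->
  (forall g1 g2 g3, exists xi be, [/\ forall c, utv xi be (inl (inl c)) = 0,
     forall x, x \in K -> uval xi be x = 0,
     be (inord 1) = g1, be (inord 2) = g2 & be (inord 3) = g3]) -> False.
Proof.
move=> c0 u0K x7K k7 Kk h6 h1 h2.
apply: (exF7 umat_conforming).
pose g (j : 'I_7) := if (j < 6)%N then ue (six j).1 (six j).2 false else x7.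
pose cc (j : 'I_7) : F := if (j < 6)%N then 1 else c.
have val_g xi be (gm : 'I_3 -> F) : be z5 = 0 -> c * uval xi be x7 = gm 0 + gm 1 + gm (Ordinal (isT : 2 < 3)%N) ->
    be (inord 1) = gm 0 -> be (inord 2) = gm 1 -> be (inord 3) = gm (Ordinal (isT : 2 < 3)%N) ->
    forall j, cc j * uval xi be (g j) = \sum_i gm i * (nth [::] [seq map (phi a) i | i <- F7c] i)`_j.
  move=> b0 h b1 b2 b3 j; rewrite /cc /g.
  have bb0 : be (inord 0) = 0 by rewrite -b0; congr be; apply: val_inj; rewrite /= inordK.
  have S3 (G : 'I_3 -> F) : \sum_i G i = G 0 + G 1 + G (Ordinal (isT : 2 < 3)%N).
    rewrite !big_ord_recl big_ord0 addr0 addrA; congr (_ + G _ + G _); exact: val_inj.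
  rewrite S3; case: ifP => j6; rewrite ?uval_e ?addr0 ?mul1r.
    case: j j6 => -[|[|[|[|[|[|[|]]]]]]] //= hj _;
      by rewrite ?bb0 ?b1 ?b2 ?b3 /phi /= ?mulr1 ?mulr0 ?addr0 ?add0r.
  by rewrite h; case: j j6 => -[|[|[|[|[|[|[|]]]]]]] //= hj _; rewrite /phi /= !mulr1.
apply: (@tminor_rmx _ _ _ _ _ _ _ _ 'I_3 'I_7 _ g cc K) => //.
- have ueI p q p' q' : (p < 5)%N -> (q < 5)%N -> (p' < 5)%N -> (q' < 5)%N ->
      ue p q false = ue p' q' false -> (p, q) = (p', q').
    move=> hp hq hp' hq' [/(congr1 val) /= e1 /(congr1 val) /= e2'].
    by move: e1 e2'; rewrite !inordK // => -> ->.
  have s5 j : ((six j).1 < 5)%N && ((six j).2 < 5)%N.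
    by case: j => [|[|[|[|[|[|j]]]]]] //; rewrite /six nth_default.
  have lt6 (j : 'I_7) : ~~ (j < 6)%N -> j = 6%N :> nat by have := ltn_ord j; lia.
  move=> j k; rewrite /g; case: ifP => j6; case: ifP => k6.
  + have /andP[? ?] := s5 j; have /andP[? ?] := s5 k.
    move=> /ueI h; apply: val_inj.
    have : six j = six k by rewrite [six j]surjective_pairing [six k]surjective_pairing; apply: h.
    have : all (fun x => all (fun y => (six x == six y) ==> (x == y)) (iota 0 6)) (iota 0 6) by [].
    move=> /allP/(_ (val j)); rewrite mem_iota => /(_ j6)/allP/(_ (val k)); rewrite mem_iota => /(_ k6).
    by move=> /implyP hs /eqP/hs/eqP.
  + by move=> e; have [/eqP] := h6 _ j6.
  + by move=> /esym/eqP e; have [/negP] := h6 _ k6.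
  by move=> _; apply: val_inj; rewrite /= (lt6 j) ?j6 // (lt6 k) ?k6.
- by move=> j; rewrite /g; case: ifP.
- by move=> j; rewrite /g; case: ifP => // j6; have [] := h6 _ j6.
- by move=> j; rewrite /cc; case: ifP => // _; exact: oner_neq0.
- move=> xi be hC hK; exists (fun i : 'I_3 => be (inord i.+1)) => j.
  apply: val_g => //; first by rewrite -(uval_0 xi) hK.
  by rewrite h1 //.
move=> gm; have [xi [be [hC hK b1 b2 b3]]] := h2 (gm 0) (gm 1) (gm (Ordinal (isT : 2 < 3)%N)).
exists xi, be; split=> //; apply: val_g => //; first by rewrite -(uval_0 xi) hK.
by rewrite h1 // b1 b2 b3.
Qed.

End Universal.

Let ieq5 (p q : nat) : (p < 5)%N -> (q < 5)%N -> (inord p == inord q :> 'I_5) = (p == q).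
Proof. by move=> hp hq; rewrite -val_eqE /= !inordK. Qed.

Let ue_eq (p q p' q' : nat) l l' : (p < 5)%N -> (q < 5)%N -> (p' < 5)%N -> (q' < 5)%N ->
  (ue p q l == ue p' q' l') = [&& p == p', q == q' & l == l'].
Proof.
move=> hp hq hp' hq'; rewrite -[LHS]/((inord p, inord q, l) == (inord p', inord q', l') :> 'I_5 * 'I_5 * bool).
by rewrite !xpair_eqE !ieq5 // andbA.
Qed.

(* The functional values [be] on the five frame rows, [be 0] and [be 4] prescribed. *)
Let be5 (g1 g2 g3 g4 : F) (i : 'I_5) : F := nth 0 [:: 0; g1; g2; g3; g4] i.
Let be5E g1 g2 g3 g4 : [/\ be5 g1 g2 g3 g4 ord0 = 0, be5 g1 g2 g3 g4 (inord 1) = g1,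
  be5 g1 g2 g3 g4 (inord 2) = g2, be5 g1 g2 g3 g4 (inord 3) = g3 & be5 g1 g2 g3 g4 (inord 4) = g4].
Proof. by rewrite /be5 !inordK. Qed.
Let be5_0 g1 g2 g3 g4 : be5 g1 g2 g3 g4 (inord 0) = 0.
Proof. by rewrite /be5 inordK. Qed.

(** The functionals on the rows of X that survive the contraction of C. *)
Definition inH (xi : tX Phi -> F) : Prop := forall c, \sum_x xi x * A1 x (inl (inl c)) = 0.

(** Otherwise contract the edge 03 lifted by [la]: this makes the value on [la] equal to g3, and the
    edge 12 lifted by [la] reads g1 + g2 + g3. Multiples of [xi] realise every g3. *)
Lemma Lam_kill xi la : la \in Lam Phi -> inH xi -> \sum_x xi x * la x = 0.
Proof.
move=> laL hxi; apply/eqP/negP=> /negP l0.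
set r := \sum_x xi x * la x in l0.
apply: (@universal_fano 0 la De0 laL [set u0; ue 0 4 false; ue 0 3 true] (ue 1 2 true) 1).
- exact: oner_neq0.
- by rewrite !inE eqxx.
- by rewrite !inE !ue_eq //.
- by [].
- by move=> x; rewrite !inE => /orP[/orP[]|] /eqP->.
- by case=> [|[|[|[|[|[|]]]]]] // _; rewrite !inE !ue_eq.
- move=> xi' be hC hK; have := hK (ue 0 3 true); have := hK u0; have := hK (ue 0 4 false).
  rewrite !inE !eqxx ?orbT => _ /(_ isT) + /(_ isT).
  rewrite uval_0 !uval_e mul1r => b0.
  have -> : be (inord 0) = 0 by rewrite -b0; congr be; apply: val_inj; rewrite /= inordK.
  by rewrite add0r => /eqP; rewrite addr_eq0 oppr_pchar2 // => /eqP->.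
move=> g1 g2 g3; exists (fun x => g3 / r * xi x), (be5 g1 g2 g3 0).
have [b0 b1 b2 b3 b4] := be5E g1 g2 g3 0.
have sc (h : tX Phi -> F) : \sum_x g3 / r * xi x * h x = g3 / r * \sum_x xi x * h x.
  by rewrite mulr_sumr; apply: eq_bigr => x _; rewrite mulrA.
split=> // [c|x].
  by rewrite uval_tv ffunE mulr0 addr0 sc hxi mulr0.
rewrite !inE => /orP[/orP[]|] /eqP->.
- by rewrite uval_0.
- by rewrite uval_e be5_0 b4 !addr0.
by rewrite uval_e be5_0 b3 add0r sc divfK.
Qed.

Definition isC (y : tCY Phi) : bool := if y is inl (inl _) then true else false.

(** Take a relation among the columns of [A1] that [de] violates, with least support outside C. It
    ties the sum of the values on rows 1 to 4 to a single column, which supplies the seventh point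
    of a Fano plane. *)
Lemma Del_kill de (n : tCY Phi -> F) : de \in Del Phi ->
  (forall x, \sum_y A1 x y * n y = 0) -> \sum_y de y * n y = 0.
Proof.
move=> deD An; apply/eqP/negP=> /negP dn.
pose P (n : {ffun tCY Phi -> F}) := [forall x, \sum_y A1 x y * n y == 0] && (\sum_y de y * n y != 0).
pose mu (n : {ffun tCY Phi -> F}) := #|[set y | n y != 0 & ~~ isC y]|.
have [n0 Pn0] : exists n0, P n0.
  exists [ffun y => n y]; apply/andP; split; last by under eq_bigr do rewrite ffunE.
  by apply/forallP=> x; under eq_bigr do rewrite ffunE; apply/eqP.
have [m /andP[/forallP Am dm] mmin] := @arg_minnP _ n0 P mu Pn0.
have {}Am x : \sum_y A1 x y * m y = 0 by exact/eqP.
set d := \sum_y de y * m y in dm.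
have mtv xi be : \sum_y m y * tval (fun b : 'I_5 => if b == ord0 then 0 else de) xi be y
    = (be (inord 1) + be (inord 2) + be (inord 3) + be (inord 4)) * d.
  under eq_bigr do rewrite (uval_tv de) mulrDr.
  rewrite big_split /= [X in X + _](_ : _ = 0) ?add0r.
    by rewrite /d mulr_sumr; apply: eq_bigr => y _; rewrite mulrCA [m y * _]mulrC.
  under eq_bigr do rewrite mulr_sumr; rewrite exchange_big /= big1 // => x _.
  rewrite -[RHS](mulr0 (xi x)) -[in RHS](Am x) mulr_sumr.
  by apply: eq_bigr => y _; rewrite mulrCA [m y * _]mulrC.
(* If the violated relation lives on C, contracting C forces g1 + g2 + g3 + g4 = 0, so the edge 04
   reads g1 + g2 + g3. *)
have [m0|m0] := posnP (mu m).
  have mC y : ~~ isC y -> m y = 0.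
    move=> ny; apply/eqP/negPn/negP=> my; have : y \in [set y | m y != 0 & ~~ isC y] by rewrite inE my.
    by rewrite (cards0_eq m0) inE.
  apply: (@universal_fano de 0 deD La0 [set u0] (ue 0 4 false) 1).
  - exact: oner_neq0.
  - by rewrite inE.
  - by rewrite inE.
  - by [].
  - by move=> x; rewrite !inE => /eqP->.
  - by case=> [|[|[|[|[|[|]]]]]] // _; rewrite !inE !ue_eq.
  - move=> xi be hC /(_ u0); rewrite inE eqxx => /(_ isT); rewrite uval_0 uval_e mul1r addr0 => b0.
    have -> : be (inord 0) = 0 by rewrite -b0; congr be; apply: val_inj; rewrite /= inordK.
    have := mtv xi be; rewrite big1 => [/esym/eqP|y _]; last first.
      by case: (boolP (isC y)) => [|/mC->]; [case: y => [[c|]|] // _; rewrite hC mulr0 | rewrite mul0r].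
    by rewrite mulf_eq0 (negPf dm) orbF addr_eq0 oppr_pchar2 // => /eqP->; rewrite add0r.
  move=> g1 g2 g3; exists (fun=> 0), (be5 g1 g2 g3 (g1 + g2 + g3)).
  have [b0 b1 b2 b3 b4] := be5E g1 g2 g3 (g1 + g2 + g3).
  split=> // [c|x]; last by rewrite inE => /eqP->; rewrite uval_0.
  by rewrite uval_tv b1 b2 b3 b4 e2 mul0r addr0 big1 // => x _; rewrite mul0r.
(* Otherwise the support outside C except one element [y] is contracted, and the edge 04 as well so
   that g4 = 0; then [y] reads a multiple of g1 + g2 + g3. *)
have /card_gt0P[y] := m0; rewrite inE => /andP[my yC].
pose S := [set z | m z != 0 & ~~ isC z] :\ y.
pose K : {set _} := u0 |: (ue 0 4 false |: [set kap z | z in S]).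
have kapI : injective kap by move=> [u|u] [v|v] // [->].
have kap_ue z p q l : kap z != ue p q l by case: z.
have kap_u0 z : kap z != u0 by case: z.
have kapk z : ~~ isC z -> keep (kap z) by case: z => [[]|].
apply: (@universal_fano de 0 deD La0 K (kap y) (m y / d)).
- by rewrite mulf_neq0 ?invr_eq0.
- by rewrite !inE eqxx.
- rewrite !inE (negPf (kap_u0 _)) (negPf (kap_ue _ _ _ _)) /=; apply/negP=> /imsetP[z zS /kapI yz].
  by move: zS; rewrite -yz !inE eqxx.
- exact: kapk.
- move=> x; rewrite !inE => /orP[/eqP->|/orP[/eqP->|/imsetP[z zS ->]]] //; apply: kapk.
  by move: zS; rewrite !inE => /and3P[].
- move=> j j6; split; first by rewrite eq_sym kap_ue.
  rewrite !inE; have -> : [set kap z | z in S] =i [set x in [set kap z | z in S]] by move=> x; rewrite inE.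
  rewrite inE; apply/norP; split; first by [].
  apply/norP; split; first by case: j j6 => [|[|[|[|[|[|]]]]]] // _; rewrite ue_eq.
  by apply/negP=> /imsetP[z _ /esym/eqP]; rewrite (negPf (kap_ue _ _ _ _)).
- move=> xi be hC hK; have b0 : be ord0 = 0.
    by rewrite -(uval_0 de 0 xi) hK // !inE eqxx.
  have b4 : be (inord 4) = 0.
    have := hK (ue 0 4 false); rewrite !inE eqxx orbT => /(_ isT); rewrite uval_e addr0.
    have -> : be (inord 0) = 0 by rewrite -b0; congr be; apply: val_inj; rewrite /= inordK.
    by rewrite add0r.
  have := mtv xi be; rewrite b4 addr0 uval_kap // (bigD1 y) //= big1 ?addr0 => [h|z zy].
    by rewrite mulrAC h mulfK.
  have [->|mz] := eqVneq (m z) 0; first by rewrite mul0r.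
  case: (boolP (isC z)) => [|zC]; first by case: z {zy mz} => [[c|]|] // _; rewrite hC mulr0.
  rewrite -(uval_kap de 0 xi z b0) hK ?mulr0 // !inE; apply/orP; right; apply/orP; right.
  by apply: imset_f; rewrite !inE zy mz.
(* The values g1, g2, g3 extend to a functional killing C and the contracted columns: by
   [dual_solvable] an obstruction would be a violated relation whose support avoids [y], against
   minimality. *)
move=> g1 g2 g3; pose D z := isC z || (z \in S); pose s := g1 + g2 + g3.
have [] := @dual_solvable F (tX Phi) (tCY Phi) (fun x z => if D z then A1 x z else 0)
  (fun z => if D z then - (s * de z) else 0).
  move=> v hv; pose v' : {ffun tCY Phi -> F} := [ffun z => if D z then v z else 0].
  have dv (h : tCY Phi -> F) : \sum_z (if D z then h z else 0) * v z = \sum_z h z * v' z.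
    by apply: eq_bigr => z _; rewrite ffunE; case: ifP; rewrite ?mul0r ?mulr0.
  rewrite dv; apply/eqP/negPn/negP=> nz.
  have /mmin : P v'.
    apply/andP; split; first by apply/forallP=> x; rewrite -dv hv.
    apply: contraNneq nz => h0; apply/eqP; transitivity (- s * \sum_z de z * v' z); last by rewrite h0 mulr0.
    by rewrite mulr_sumr; apply: eq_bigr => z _; rewrite -mulNr mulrA.
  apply/negP; rewrite -ltnNge; apply: proper_card; apply/properP; split.
    apply/subsetP=> z; rewrite !inE ffunE /D !inE => /andP[+ zC].
    by rewrite (negPf zC) /=; case: ifP => [/and3P[_ -> _] //|]; rewrite eqxx.
  exists y; first by rewrite inE my.
  by rewrite !inE ffunE /D !inE eqxx (negPf yC) /= eqxx.
move=> xi hxi; exists xi, (be5 g1 g2 g3 0).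
have [b0 b1 b2 b3 b4] := be5E g1 g2 g3 0.
have tv0 z : D z -> tval (fun b : 'I_5 => if b == ord0 then 0 else de) xi (be5 g1 g2 g3 0) z = 0.
  move=> Dz; have := hxi z; rewrite Dz uval_tv b1 b2 b3 b4 addr0 -/s => h.
  by rewrite -h addNr.
split=> // [c|x]; first by apply: tv0.
rewrite !inE => /orP[/eqP->|/orP[/eqP->|/imsetP[z zS ->]]].
- by rewrite uval_0.
- by rewrite uval_e be5_0 b4 !addr0.
by rewrite uval_kap // tv0 // /D zS orbT.
Qed.

Lemma Del_rows de : de \in Del Phi -> exists xi : tX Phi -> F, forall y, de y = \sum_x xi x * A1 x y.
Proof. by move=> deD; apply: dual_solvable => v; exact: Del_kill. Qed.

(** Otherwise the seventh point is the loop 00 lifted by [la]. If [xi'] with its frame part kills C,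
    then [xi'] plus (g1 + g2 + g3) times [xi] is in [inH], and [Lam_kill] gives the value of [xi']
    on [la]. *)
Lemma Del_Lam de la xi : de \in Del Phi -> la \in Lam Phi ->
  (forall y, de y = \sum_x xi x * A1 x y) -> \sum_x xi x * la x = 0.
Proof.
move=> deD laL hxi; apply/eqP/negP=> /negP l0.
set r := \sum_x xi x * la x in l0.
have lin (s t : F) (u : tX Phi -> F) (h : tX Phi -> F) : \sum_x (u x + s * xi x) * h x
    = \sum_x u x * h x + s * \sum_x xi x * h x.
  by rewrite mulr_sumr -big_split; apply: eq_bigr => x _; rewrite mulrDl mulrA.
apply: (@universal_fano de la deD laL [set u0; ue 0 4 false] (ue 0 0 true) r^-1).
- by rewrite invr_eq0.
- by rewrite !inE eqxx.
- by rewrite !inE !ue_eq.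
- by [].
- by move=> x; rewrite !inE => /orP[] /eqP->.
- by case=> [|[|[|[|[|[|]]]]]] // _; rewrite !inE !ue_eq.
- move=> xi' be hC hK; have := hK (ue 0 4 false); have := hK u0.
  rewrite !inE !eqxx ?orbT => /(_ isT) + /(_ isT); rewrite uval_0 !uval_e addr0 => b0.
  have -> : be (inord 0) = 0 by rewrite -b0; congr be; apply: val_inj; rewrite /= inordK.
  rewrite add0r => b4; rewrite addr0 add0r; set s := be (inord 1) + _ + _.
  have hH : inH (fun x => xi' x + s * xi x).
    by move=> c; rewrite lin // -hxi; have := hC c; rewrite uval_tv b4 addr0.
  have := Lam_kill laL hH; rewrite lin // -/r => /eqP; rewrite addr_eq0 oppr_pchar2 // => /eqP->.
  by rewrite mulrC mulfK.
move=> g1 g2 g3; exists (fun x => - (g1 + g2 + g3) * xi x), (be5 g1 g2 g3 0).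
have [b0 b1 b2 b3 b4] := be5E g1 g2 g3 0.
split=> // [c|x].
  rewrite uval_tv b1 b2 b3 b4 addr0 hxi mulr_sumr -big_split big1 // => x _.
  by rewrite -mulrA mulNr; exact: addNr.
by rewrite !inE => /orP[] /eqP->; rewrite ?uval_0 // uval_e be5_0 b4 !addr0.
Qed.

Definition hh (xi : tX Phi -> F) (y : tCY Phi) : F := \sum_x xi x * A1 x y.

Section Structure.

Variables (B' E' : finType) (fr : E' -> B' -> F) (la : E' -> {ffun tX Phi -> F}).
Variables (zz : E' -> option (tY1 Phi)) (de : B' -> {ffun tCY Phi -> F}).
Hypothesis wf : tmat_wf fr la zz de.

Definition pval xi (be : B' -> F) (e : tCY Phi + E') : F :=
  match e with
  | inl y => hh xi y
  | inr e => \sum_b be b * fr e b + (if zz e is Some j then hh xi (inr j) else 0)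
  end.

(* Adding to the functional on the rows of [X] the combination of the rows of [Delta] makes the
   two row blocks independent. *)
Lemma cval_pval : exists eta : B' -> tX Phi -> F, forall xi be,
  let xi' := fun x => xi x + \sum_b be b * eta b x in
  (forall y, tval de xi be y = hh xi' y) /\
  (inH xi' -> forall e, cval fr la zz de xi be e = pval xi' be e).
Proof.
case: wf => hde hS hN.
have /fin_all_exists[eta etaE] : forall b, exists eta : tX Phi -> F, forall y, de b y = \sum_x eta x * A1 x y.
  by move=> b; exact: Del_rows.
exists eta => xi be xi'.
have tv (h : tX Phi -> F) : \sum_x xi' x * h x = \sum_x xi x * h x + \sum_b be b * \sum_x eta b x * h x.
  under eq_bigr do rewrite /xi' mulrDl mulr_suml; rewrite big_split /=; congr (_ + _).
  rewrite exchange_big /=; apply: eq_bigr => b _; rewrite mulr_sumr.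
  by apply: eq_bigr => x _; rewrite mulrA.
have tvE y : tval de xi be y = hh xi' y.
  by rewrite /tval /hh tv; congr (_ + _); apply: eq_bigr => b _; rewrite etaE.
split=> // hH [y|e] /=; first exact: tvE.
have l0 : \sum_x xi x * la e x = 0.
  case ze: (zz e) => [j|]; first by have [-> _] := hS e j ze; rewrite big1 // => x _; rewrite ffunE mulr0.
  have [laL _] := hN e ze; have := Lam_kill laL hH; rewrite tv [X in _ + X]big1 ?addr0 // => b _.
  by rewrite (Del_Lam (hde b) laL (etaE b)) mulr0.
by rewrite l0 add0r; case: (zz e) => [j|] //; rewrite tvE.
Qed.

Lemma pval_cval : 
  (forall xi be, (forall c, tval de xi be (inl (inl c)) = 0) ->
    exists2 xi', inH xi' & forall e, cval fr la zz de xi be e = pval xi' be e) /\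
  (forall xi be, inH xi -> exists xi', (forall c, tval de xi' be (inl (inl c)) = 0) /\
    forall e, cval fr la zz de xi' be e = pval xi be e).
Proof.
have [eta etaE] := cval_pval; split=> xi be h.
  have [e1 e3] := etaE xi be; exists (fun x => xi x + \sum_b be b * eta b x).
    by move=> c; rewrite -[LHS]/(hh _ _) -e1 h.
  by apply: e3 => c; rewrite -[LHS]/(hh _ _) -e1 h.
pose xi' x := xi x - \sum_b be b * eta b x; have [e1 e3] := etaE xi' be.
have ext x : xi' x + \sum_b be b * eta b x = xi x by rewrite subrK.
have hE y : hh (fun x => xi' x + \sum_b be b * eta b x) y = hh xi y.
  by apply: eq_bigr => x _; rewrite ext.
exists xi'; split=> [c|e]; first by rewrite e1 hE; exact: h.
rewrite e3 => [|c]; last by rewrite -[LHS]/(hh _ _) hE; exact: h.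
case: e => [y|e] /=; first exact: hE.
by case: (zz e) => [j|] //; rewrite hE.
Qed.

Lemma mem_tminor_pval (u : {ffun cdel (C_elts Phi E' : {set rmx (tmat fr la zz de)}) (Y1_elts Phi E') -> F^o}) :
  u \in rspace (template_minor (tmat fr la zz de)) <->
  exists xi be, inH xi /\ forall e, u e = pval xi be (cdel_val e).
Proof.
have [h1 h2] := pval_cval; split=> [/mem_tminor[xi [be [hC hu]]]|[xi [be [hH hu]]]].
  by have [xi' hH e] := h1 xi be hC; exists xi', be; split=> // x; rewrite hu e.
apply/mem_tminor; have [xi' [hC e]] := h2 xi be hH; exists xi', be; split=> // x.
by rewrite hu e.
Qed.

Lemma tminor_pval (B M : finType) (A : B -> M -> F) (g : M -> tCY Phi + E')
    (K : {set tCY Phi + E'}) :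
  injective g -> (forall n, keep (g n)) -> (forall n, g n \notin K) ->
  (forall x, x \in K -> keep x) ->
  (forall xi be, inH xi -> (forall x, x \in K -> pval xi be x = 0) ->
     exists ga, forall n, pval xi be (g n) = \sum_b ga b * A b n) ->
  (forall ga, exists xi be, [/\ inH xi,
     forall x, x \in K -> pval xi be x = 0 &
     forall n, pval xi be (g n) = \sum_b ga b * A b n]) ->
  has_minor (under (template_minor (tmat fr la zz de))) (under (rmx A)).
Proof.
move=> gi gk gK Kk h1 h2; have [p1 p2] := pval_cval.
apply: (@tminor_rmx _ _ _ _ _ _ _ _ B M A g (fun=> 1) K) => //.
- by move=> n; exact: oner_neq0.
- move=> xi be hC hK; have [xi' hH e] := p1 xi be hC.
  have [|ga hga] := h1 xi' be hH; first by move=> x xK; rewrite -e hK.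
  by exists ga => n; rewrite mul1r e hga.
move=> ga; have [xi [be [hH hK hv]]] := h2 ga; have [xi' [hC e]] := p2 xi be hH.
by exists xi', be; split=> // [x xK|n]; [rewrite e hK | rewrite mul1r e hv].
Qed.

End Structure.

Lemma hhD s t xi xi' y : hh (fun x => s * xi x + t * xi' x) y = s * hh xi y + t * hh xi' y.
Proof.
by rewrite /hh !mulr_sumr -big_split; apply: eq_bigr => x _; rewrite mulrDl !mulrA.
Qed.

Lemma hh_sum (I : finType) (c : I -> F) (xi : I -> tX Phi -> F) y :
  hh (fun x => \sum_i c i * xi i x) y = \sum_i c i * hh (xi i) y.
Proof.
rewrite /hh; under eq_bigr do rewrite mulr_suml; rewrite exchange_big /=.
by apply: eq_bigr => i _; rewrite mulr_sumr; apply: eq_bigr => x _; rewrite mulrA.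
Qed.

Lemma inHE xi : inH xi <-> forall c, hh xi (inl (inl c)) = 0.
Proof. by []. Qed.

(* A basis [J] of the restrictions to [H] of the columns of [Y1], with its dual basis [eta]. *)
Lemma Y1_basis : exists (J : {set tY1 Phi}) (eta : tY1 Phi -> tX Phi -> F),
  [/\ forall j, inH (eta j),
      forall j j', j \in J -> j' \in J -> hh (eta j) (inr j') = (j == j')%:R &
      forall xi, inH xi -> (forall j, j \in J -> hh xi (inr j) = 0) -> forall y, hh xi (inr y) = 0].
Proof.
pose P (J : {set tY1 Phi}) := [forall c : {ffun tY1 Phi -> F}, [exists xi : {ffun tX Phi -> F},
  [forall c, hh xi (inl (inl c)) == 0] && [forall j, (j \in J) ==> (hh xi (inr j) == c j)]]].
have PE J : P J -> forall c : tY1 Phi -> F, exists xi : tX Phi -> F, inH xi /\ forall j, j \in J -> hh xi (inr j) = c j.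
  move=> /forallP h c; have /existsP[xi /andP[/forallP h1 /forallP h2]] := h [ffun j => c j].
  exists xi; split=> [d|j jJ]; first by apply/eqP; exact: h1.
  by have /implyP/(_ jJ)/eqP := h2 j; rewrite ffunE.
have P0 : P set0.
  apply/forallP=> c; apply/existsP; exists 0; apply/andP; split; apply/forallP=> x.
    by rewrite /hh big1 // => y _; rewrite ffunE mul0r.
  by rewrite inE.
have [J PJ mJ] : exists2 J, P J & forall J', P J' -> (#|J'| <= #|J|)%N.
  by have [J PJ mJ] := @arg_maxnP _ set0 P (fun J : {set tY1 Phi} => #|J|) P0; exists J.
have /fin_all_exists[eta etaE] : forall i, exists xi, inH xi /\ forall j, j \in J -> hh xi (inr j) = (i == j)%:R.
  by move=> i; exact: (PE J PJ (fun j => (i == j)%:R)).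
exists J, eta; split=> [j|j j' _|xi hxi hJ y]; first by have [] := etaE j.
  by have [_] := etaE j; apply.
apply/eqP/negPn/negP=> y0.
have yJ : y \notin J by apply: contra y0 => /hJ->.
suff /mJ : P (y |: J) by rewrite cardsU1 yJ ltnn.
apply/forallP=> c; have [xi0 [h0 e0]] := PE J PJ c.
pose t := (c y - hh xi0 (inr y)) / hh xi (inr y).
apply/existsP; exists [ffun x => 1 * xi0 x + t * xi x].
have E z : hh [ffun x => 1 * xi0 x + t * xi x] z = hh xi0 z + t * hh xi z.
  by rewrite -[hh xi0 z]mul1r -hhD; apply: eq_bigr => x _; rewrite ffunE.
apply/andP; split; apply/forallP=> z.
  by rewrite E ((inHE _).1 h0) ((inHE _).1 hxi) mulr0 addr0.
apply/implyP; rewrite !inE E => /orP[/eqP->|zJ]; first by rewrite /t divfK // addrC subrK.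
by rewrite hJ // mulr0 addr0 e0.
Qed.

End TemplateAnalysis.

Definition merge (F : finFieldType) (V S : finType) (w : S -> V -> F) m (pi : V -> 'I_m)
    (s : S) (i : 'I_m) : F := \sum_(v | pi v == i) w s v.

(* The complete graph on [m] vertices extended by the vectors [w s] after identification of the
   vertices along [pi]. *)
Definition KW (F : finFieldType) (V S : finType) (w : S -> V -> F) m (pi : V -> 'I_m) : rmatroid F :=
  rmx (fun (i : 'I_m) (e : 'I_m * 'I_m + S) =>
    match e with inl (p, q) => edgec F p q i | inr s => merge w pi s i end).

Lemma sum_merge (F : finFieldType) (V S : finType) (w : S -> V -> F) m (pi : V -> 'I_m) s (be : 'I_m -> F) :
  \sum_i be i * merge w pi s i = \sum_v be (pi v) * w s v.
Proof.
rewrite [RHS](partition_big pi predT) //=; apply: eq_bigr => i _.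
by rewrite mulr_sumr; apply: eq_bigr => v /eqP->.
Qed.

Lemma sum_option (F : nmodType) (T : finType) (G : option T -> F) :
  \sum_v G v = G None + \sum_t G (Some t).
Proof.
rewrite (bigD1 None) //=; congr (_ + _).
rewrite (reindex_omap Some id) /=; last by case.
by apply: eq_bigl => t; rewrite eqxx.
Qed.

(** * Template matroids as zero-sum vectors on a vertex set *)

Section TemplateFrame.

Variables (F : finFieldType) (a : F).
Hypothesis ch : 2%N \in [pchar F].
Hypothesis ha : a ^+ 2 = a + 1.
Hypothesis hF : forall x : F, exists y, x = phi a y.
Variable Phi : frame_template F.

Hypothesis exF7 : forall (B' E' : finType) (A : tX Phi + B' -> tCY Phi + E' -> F),
  conforming A -> ~ has_minor (under (template_minor A)) (cmat a F7c 3 7).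
Hypothesis exP1 : forall (B' E' : finType) (A : tX Phi + B' -> tCY Phi + E' -> F),
  conforming A -> ~ has_minor (under (template_minor A)) (cmat a P1c 3 9).

Let e2 (z : F) : z + z = 0. Proof. exact: addrr_pchar2. Qed.
Let opp2 (z : F) : - z = z. Proof. exact: oppr_pchar2. Qed.

Variables (B' E' : finType) (fr : E' -> B' -> F) (la : E' -> {ffun tX Phi -> F}).
Variables (zz : E' -> option (tY1 Phi)) (de : B' -> {ffun tCY Phi -> F}).
Hypothesis wf : tmat_wf fr la zz de.
(** Dually, on [inH] each column of Y0 is a combination of columns of Y1. In [template_golden] this
    comes from the absence of nonzero vectors with small support. *)
Hypothesis nd : forall xi, @inH F Phi xi -> (forall y, hh xi (inr y) = 0) ->
  forall y, hh xi (inl (inr y)) = 0.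

(** The vertices are the frame rows, one vertex for each element of Y1, and [None]. A column of Y1
    in the basis [J] is read as the edge from its vertex to [None]; any other column of Y0 or Y1 is
    a combination [co] of these edges, balanced at [None] to have sum 0. Constants may be added to a
    vertex functional, so its value at [None] can be normalised to 0. *)
Lemma template_frame : exists (V S : finType) (w : S -> V -> F),
  [/\ forall s, \sum_v w s v = 0,
      forall m (pi : V -> 'I_m),
        exists (B2 E2 : finType) (A2 : tX Phi + B2 -> tCY Phi + E2 -> F),
          conforming A2 /\ has_minor (under (template_minor A2)) (under (KW w pi)) &
      has_minor (under (rmx (fun v s => w s v))) (under (template_minor (tmat fr la zz de)))].
Proof.
have [J [eta [etaH etaJ Jmax]]] := @Y1_basis F Phi.
pose co (z : tCY Phi) (j : tY1 Phi) : F := if j \in J then hh (eta j) z else 0.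
have Jsol (c : tY1 Phi -> F) : exists xi, @inH F Phi xi /\ forall j, j \in J -> hh xi (inr j) = c j.
  exists (fun x => \sum_j (if j \in J then c j else 0) * eta j x); split=> [d|j jJ].
    by rewrite -[LHS]/(hh _ _) hh_sum big1 // => j _; rewrite [hh _ _]etaH mulr0.
  rewrite hh_sum (bigD1 j) //= jJ etaJ // eqxx mulr1 big1 ?addr0 // => i ij.
  by case: ifP => [iJ|]; rewrite ?mul0r // etaJ // (negPf ij) mulr0.
(* Subtracting the expansion in the dual basis leaves a functional killing [J], hence Y1 by [Jmax],
   hence Y0 by [nd]. *)
have hhE xi z : @inH F Phi xi -> ~~ isC z -> hh xi z = \sum_j co z j * hh xi (inr j).
  move=> hxi zC.
  pose xi' x := 1 * xi x + (-1) * \sum_j (if j \in J then hh xi (inr j) else 0) * eta j x.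
  have E y : hh xi' y = hh xi y - \sum_j (if j \in J then hh xi (inr j) else 0) * hh (eta j) y.
    by rewrite /xi' hhD mul1r mulN1r hh_sum.
  have hxi' : inH xi'.
    move=> d; rewrite -[LHS]/(hh _ _) E [hh xi _]hxi sub0r big1 ?oppr0 // => j _.
    by rewrite [hh (eta j) _]etaH mulr0.
  have J0 j : j \in J -> hh xi' (inr j) = 0.
    move=> jJ; rewrite E (bigD1 j) //= jJ etaJ // eqxx mulr1 big1 ?addr0 ?subrr // => i ij.
    by case: ifP => [iJ|]; rewrite ?mul0r // etaJ // (negPf ij) mulr0.
  have Y0 := Jmax xi' hxi' J0.
  have z0 : hh xi' z = 0 by case: (z) zC => [[|y]|y] //= _; apply: nd.
  apply/eqP; rewrite -subr_eq0 -[X in _ == X]z0 E; apply/eqP; congr (_ - _).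
  by apply: eq_bigr => j _; rewrite /co; case: ifP => _; rewrite ?mul0r // mulrC.
have /fin_all_exists[pq pqE] : forall e, exists pq : option B' * option B',
    (forall b, fr e b = (Some b == pq.1)%:R + (Some b == pq.2)%:R) /\
    (zz e != None -> pq.2 = None).
  move=> e; have [_ hS hN] := wf; case ze: (zz e) => [j|].
    have [_ [b0 hb]] := hS e j ze; exists (Some b0, None); split=> // b.
    by rewrite hb addr0.
  have [_ fe] := hN e ze.
  by have [p [q h]] := frame_trivial ch (Gam_trivial ch ha hF exP1) fe; exists (p, q).
pose V := option (tY1 Phi + B')%type; pose S := (tY0 Phi + E')%type.
pose vm (o : option B') : V := omap inr o.
pose cv (z : tCY Phi) (v : V) : F :=
  match v with Some (inl j) => co z j | Some (inr _) => 0 | None => - \sum_j co z j end.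
pose w (s : S) (v : V) : F := match s with
  | inl y => cv (inl (inr y)) v
  | inr e => ((v == vm (pq e).1)%:R + (v == vm (pq e).2)%:R)
             + (if zz e is Some j then cv (inr j) v else 0) end.
have sum_cv (th : V -> F) z : \sum_v th v * cv z v = \sum_j co z j * (th (Some (inl j)) - th None).
  rewrite sum_option big_sumType /= [X in _ + (_ + X)]big1 ?addr0 => [|b _]; last by rewrite mulr0.
  rewrite mulrN mulr_sumr -sumrN -big_split; apply: eq_bigr => j _.
  by rewrite mulrBr [co z j * th None]mulrC [co z j * _]mulrC; exact: addrC.
have cvE xi th z : @inH F Phi xi -> ~~ isC z ->
    (forall j, j \in J -> th (Some (inl j)) - th None = hh xi (inr j)) ->
    \sum_v th v * cv z v = hh xi z.
  move=> hxi zC hth; rewrite sum_cv hhE //; apply: eq_bigr => j _.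
  by rewrite /co; case: ifP => [/hth->|]; rewrite ?mul0r.
have E0 xi th y : @inH F Phi xi ->
    (forall j, j \in J -> th (Some (inl j)) - th None = hh xi (inr j)) ->
    \sum_v th v * w (inl y) v = hh xi (inl (inr y)).
  by move=> hxi hth; rewrite /w (cvE xi).
have E1 xi th e : @inH F Phi xi ->
    (forall j, j \in J -> th (Some (inl j)) - th None = hh xi (inr j)) ->
    \sum_v th v * w (inr e) v = th (vm (pq e).1) + th (vm (pq e).2)
       + (if zz e is Some j then hh xi (inr j) else 0).
  move=> hxi hth; rewrite /w; under eq_bigr do rewrite mulrDr; rewrite big_split /=; congr (_ + _).
    exact: (@sum_edgec F V th).
  case: (zz e) => [j|]; last by rewrite big1 // => v _; rewrite mulr0.
  by rewrite (cvE xi).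
have fpq (be : B' -> F) (th : V -> F) e : (forall b, th (Some (inr b)) - th None = be b) ->
    \sum_b be b * fr e b = th (vm (pq e).1) + th (vm (pq e).2).
  move=> hth; have [h _] := pqE e; under eq_bigr do rewrite h mulrDr; rewrite big_split /=.
  have S1 (o : option B') : \sum_b be b * (Some b == o)%:R = th (vm o) - th None.
    case: o => [b0|] /=; last by rewrite subrr big1 // => b _; rewrite mulr0.
    by rewrite hth -[RHS](sum_unitc be b0).
  by rewrite !S1 addrACA -opprD e2 oppr0 addr0.
have H0 : @inH F Phi (fun=> 0) by move=> c; rewrite big1 // => x _; rewrite mul0r.
have hh0 y : hh (fun=> 0) y = 0 :> F by rewrite /hh big1 // => x _; rewrite mul0r.
exists V, S, w; split.
- move=> s; have -> : \sum_v w s v = \sum_v 1 * w s v by apply: eq_bigr => v _; rewrite mul1r.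
  have h1 j : j \in J -> (1 : F) - 1 = hh (fun=> 0) (inr j) by rewrite hh0 subrr.
  case: s => [y|e]; first by rewrite (E0 (fun=> 0) (fun=> 1)) // hh0.
  rewrite (E1 (fun=> 0) (fun=> 1)) // e2 add0r.
  by case: (zz e) => [j|] //; rewrite hh0.
(* The new member has [m] frame rows and all edges on them. Contracting the unit column at [pi None]
   and, for [j] in [J], the Z-column made of the unit vector at the image of the vertex of [j] and
   column [j] of Y1 identifies that column with an edge; [xi] is then determined on Y0 and Y1 by the
   frame values. *)
- move=> m pi.
  pose E2 := (('I_m * 'I_m + E') + option (tY1 Phi))%type.
  pose fr2 (e : E2) : 'I_m -> F := match e with
    | inl (inl (p, q)) => edgec F p q
    | inl (inr e) => if zz e is Some _ then fun b => (b == pi (vm (pq e).1))%:R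
                     else edgec F (pi (vm (pq e).1)) (pi (vm (pq e).2))
    | inr None => fun b => (b == pi None)%:R
    | inr (Some j) => fun b => (b == pi (Some (inl j)))%:R end.
  pose zz2 (e : E2) := match e with inl (inl _) => None | inl (inr e) => zz e | inr o => o end.
  pose la2 (e : E2) : {ffun tX Phi -> F} := 0.
  pose de2 (b : 'I_m) : {ffun tCY Phi -> F} := 0.
  have De0 : (0 : {ffun tCY Phi -> F}) \in Del Phi by have [] := Del_zmod Phi.
  have La0 : (0 : {ffun tX Phi -> F}) \in Lam Phi by have [] := Lam_zmod Phi.
  have wf2 : tmat_wf fr2 la2 zz2 de2.
    split=> //.
      move=> [[[p q]|e]|[j'|]] j //= h; split=> //; last by exists (pi (Some (inl j'))).
      by rewrite h; exists (pi (vm (pq e).1)).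
    move=> [[[p q]|e]|[j'|]] //= h; split=> //; [exact: frame_edgec | | exact: frame_unit].
    by rewrite h; exact: frame_edgec.
  exists 'I_m, E2, (tmat fr2 la2 zz2 de2); split; first exact: tmat_conforming.
  pose g (x : 'I_m * 'I_m + S) : tCY Phi + E2 := match x with
    | inl pq => inr (inl (inl pq)) | inr (inl y) => inl (inl (inr y))
    | inr (inr e) => inr (inl (inr e)) end.
  pose K : {set tCY Phi + E2} := inr (inr None) |: [set inr (inr (Some j)) | j in J].
  apply: (tminor_pval ch exF7 wf2 (g := g) (K := K)).
  + by move=> [x|[y|e]] [x'|[y'|e']] //= [->].
  + by move=> [x|[y|e]].
  + by move=> [x|[y|e]]; rewrite !inE /=; apply/negP=> /imsetP[].
  + by move=> x; rewrite !inE => /orP[/eqP->|/imsetP[j _ ->]].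
  + move=> xi be hxi hK; exists be.
    have b0 : be (pi None) = 0.
      by have := hK (inr (inr None)); rewrite !inE eqxx => /(_ isT) /=; rewrite sum_unitc addr0.
    have bj j : j \in J -> be (pi (Some (inl j))) - be (pi None) = hh xi (inr j).
      move=> jJ; have := hK (inr (inr (Some j))); rewrite inE imset_f // orbT => /(_ isT) /=.
      by rewrite sum_unitc b0 subr0 => /eqP; rewrite addr_eq0 opp2 => /eqP.
    move=> [[p q]|[y|e]] //=; first by rewrite addr0.
      by rewrite (sum_merge w) (E0 xi (fun v => be (pi v))).
    rewrite (sum_merge w) (E1 xi (fun v => be (pi v))) //; congr (_ + _).
    have [_ h] := pqE e; case: (zz e) h => [j|] h; last by rewrite sum_edgec.
    by rewrite sum_unitc h // b0 addr0.
  move=> ga; have [xi [hxi hJ]] := Jsol (fun j => ga (pi (Some (inl j))) - ga (pi None)).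
  exists xi, (fun i => ga i - ga (pi None)).
  have hJ' j : j \in J -> ga (pi (Some (inl j))) - ga (pi None) = hh xi (inr j) by move=> /hJ->.
  split=> // [x|[[p q]|[y|e]]] /=.
  + rewrite !inE => /orP[/eqP->|/imsetP[j jJ ->]] /=; rewrite sum_unitc; first by rewrite subrr addr0.
    by rewrite hJ // e2.
  + by rewrite !sum_edgec addr0 addrACA -opprD e2 oppr0 addr0.
  + by rewrite (sum_merge w) (E0 xi (fun v => ga (pi v))).
  rewrite (sum_merge w) (E1 xi (fun v => ga (pi v))) //; congr (_ + _).
  have [_ h] := pqE e; case: (zz e) h => [j|] h.
    by rewrite sum_unitc h //= opp2.
  by rewrite sum_edgec addrACA -opprD e2 oppr0 addr0.
pose emb (s : S) : tCY Phi + E' := match s with inl y => inl (inl (inr y)) | inr e => inr e end.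
have pE xi be th s : @inH F Phi xi ->
    (forall j, j \in J -> th (Some (inl j)) - th None = hh xi (inr j)) ->
    (forall b, th (Some (inr b)) - th None = be b) ->
    \sum_v th v * w s v = pval fr zz xi be (emb s).
  by move=> hxi h1 h2'; case: s => [y|e]; [rewrite (E0 xi) | rewrite (E1 xi) //= (fpq be th)].
pose T := cdel (C_elts Phi E' : {set rmx (tmat fr la zz de)}) (Y1_elts Phi E').
have /fin_all_exists[g gE] : forall e : T, exists s, emb s = cdel_val e.
  move=> e; have := cdel_valP e; rewrite -keepE.
  by case: (cdel_val e) => [[[c|y]|y]|x] //= _; [exists (inl y) | exists (inr x)].
apply: (@rminor_has_minor F (rmx (fun v s => w s v)) T g (fun=> 1) set0); split.
- by move=> x y e; apply: cdel_val_inj; rewrite -!gE e.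
- by move=> e; rewrite inE.
- by move=> e; exact: oner_neq0.
move=> v; split=> [/(mem_tminor_pval ch exF7 wf)[xi [be [hxi hv]]]|[u [/mem_rmx[th uE] _ hv]]].
  pose th (x : V) : F := match x with Some (inl j) => hh xi (inr j) | Some (inr b) => be b | None => 0 end.
  exists [ffun s => \sum_v th v * w s v]; split=> [|x|e]; rewrite ?inE //.
    by apply/mem_rmx; exists th => s; rewrite ffunE.
  by rewrite mul1r hv ffunE -gE (pE xi be) // => [j _|b]; rewrite subr0.
apply/(mem_tminor_pval ch exF7 wf).
have [xi [hxi hJ]] := Jsol (fun j => th (Some (inl j)) - th None).
exists xi, (fun b => th (Some (inr b)) - th None); split=> // e.
by rewrite hv mul1r uE -gE -(pE _ _ th) // => j /hJ->.
Qed.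

End TemplateFrame.

(** * Families of golden-mean vectors *)

Lemma mem_subs s l : subseq s l -> s \in subs (size s) l.
Proof.
elim: l s => [|x l IH] [|y s] //=; case: eqP => [->|_] h; rewrite mem_cat.
  by apply/orP; left; apply: map_f; exact: IH.
by rewrite (IH (y :: s) h) orbT.
Qed.

(** A selection of rows or columns is a permutation of an increasing one, so finite determinant
    checks may run over [subs] only. *)
Lemma sort_ord_inj n t (f : 'I_t -> 'I_n) : injective f ->
  exists (f' : 'I_t -> 'I_n) (p : 'S_t), (forall i, f i = f' (p i)) /\ tl f' \in subs t (iota 0 n).
Proof.
move=> fi; pose A := f @: [set: 'I_t].
have cA : #|A| = t by rewrite card_imset // cardsT card_ord.
pose f' (i : 'I_t) : 'I_n := enum_val (cast_ord (esym cA) i).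
have fA i : f i \in A by apply: imset_f.
pose q i := cast_ord cA (enum_rank_in (fA i) (f i)).
have qE i : f' (q i) = f i.
  by rewrite /f' /q cast_ordK enum_rankK_in.
have qi : injective q by move=> x y e; apply: fi; rewrite -!qE e.
exists f', (perm qi); split=> [i|]; first by rewrite permE qE.
have tlE : tl f' = map val (enum A).
  have sz : size (tl f') = t by rewrite /tl size_map size_enum_ord.
  apply: (@eq_from_nth _ 0%N); first by rewrite sz size_map -cardE cA.
  rewrite sz => i it; rewrite (nth_tl f' (Ordinal it)) (nth_map (f (Ordinal it))) -?cardE ?cA //.
  by rewrite /f' (enum_val_nth (f (Ordinal it))).
have szt : size (tl f') = t by rewrite /tl size_map size_enum_ord.
have ss : subseq (tl f') (iota 0 n).
  rewrite tlE -val_enum_ord; apply: map_subseq.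
  rewrite (_ : enum A = filter (mem A) (enum 'I_n)); first exact: filter_subseq.
  by rewrite !enumT.
by have := mem_subs ss; rewrite szt.
Qed.

Lemma subdet_perm (K : comNzRingType) (B E : finType) (A : B -> E -> K) t (f : 'I_t -> B)
    (g : 'I_t -> E) (p q : 'S_t) :
  subdet A (f \o p) (g \o q) = (-1) ^+ p * (-1) ^+ q * subdet A f g.
Proof.
have rowp (f1 : 'I_t -> B) (g1 : 'I_t -> E) (p1 : 'S_t) :
    subdet A (f1 \o p1) g1 = (-1) ^+ p1 * subdet A f1 g1.
  rewrite /subdet -det_perm -det_mulmx -row_permE; congr (\det _).
  by apply/matrixP=> i j; rewrite !mxE.
rewrite rowp -mulrA; congr (_ * _); rewrite -[subdet A f (g \o q)]subdet_tr -[subdet A f g]subdet_tr.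
rewrite /subdet -det_perm -det_mulmx -row_permE; congr (\det _).
by apply/matrixP=> i j; rewrite !mxE.
Qed.

Lemma subdet_expand (K : fieldType) (B E : finType) (A : B -> E -> K) t (f : 'I_t.+1 -> B)
    (g : 'I_t.+1 -> E) i0 j0 : injective f -> A (f i0) (g j0) != 0 ->
  subdet A f g = A (f i0) (g j0) * ((-1) ^+ (i0 + j0)
    * subdet (schur A (f i0) (g j0)) (f \o lift i0) (g \o lift j0)).
Proof.
move=> fi a0; have := @subdet_fullpivot_row _ _ _ A (f i0) (g j0) _ f g i0 (erefl _) fi.
move=> /(congr1 (fun x => x * A (f i0) (g j0))); rewrite divfK // => <-; rewrite mulrC; congr (_ * _).
have sc0 b : schur A (f i0) (g j0) b (g j0) = 0 by rewrite /schur mulfK // subrr.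
rewrite /subdet (expand_det_col _ j0) (bigD1 i0) //= big1 ?addr0 => [|i ni]; last first.
  by rewrite mxE /fullpivot (inj_eq fi) (negPf ni) sc0 mul0r.
rewrite mxE /fullpivot eqxx divff // mul1r /cofactor; congr (_ * \det _).
apply/matrixP=> i j; rewrite !mxE /fullpivot /= (inj_eq fi).
by rewrite eq_sym (negPf (neq_lift _ _)).
Qed.

(** Computable Z[tau]: the pair (x, y) stands for x + y tau, [zmul] uses tau^2 = tau + 1, and [zred]
    is reduction modulo 2. *)
Definition z2 : Type := (int * int)%type.
Definition zadd (x y : z2) : z2 := (x.1 + y.1, x.2 + y.2).
Definition zopp (x : z2) : z2 := (- x.1, - x.2).
Definition zmul (x y : z2) : z2 :=
  (x.1 * y.1 + x.2 * y.2, x.1 * y.2 + x.2 * y.1 + x.2 * y.2).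
Definition zev (K : comNzRingType) (x : K) (p : z2) : K := p.1%:~R + p.2%:~R * x.
Definition zred (p : z2) : g4 := (odd `|p.1|%N, odd `|p.2|%N).
Definition zpol (p : z2) : {poly int} := p.1%:P + p.2%:P * 'X.

Section Zev.
Variables (K : comNzRingType) (x : K).

Lemma zevD p q : zev x (zadd p q) = zev x p + zev x q.
Proof. by rewrite /zev /= !rmorphD mulrDl addrACA. Qed.
Lemma zevN p : zev x (zopp p) = - zev x p.
Proof. by rewrite /zev /= !rmorphN mulNr opprD. Qed.
Lemma zev0 : zev x (0, 0) = 0. Proof. by rewrite /zev mul0r addr0. Qed.
Lemma zev1 : zev x (1, 0) = 1. Proof. by rewrite /zev mul0r addr0. Qed.
Lemma zevM p q : x ^+ 2 = x + 1 -> zev x (zmul p q) = zev x p * zev x q.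
Proof.
move=> hx; rewrite /zev /= !rmorphD !rmorphM /= mulrDr !mulrDl.
have -> : p.2%:~R * x * (q.2%:~R * x) = p.2%:~R * q.2%:~R * x ^+ 2 by rewrite expr2 mulrACA.
by rewrite hx; ring.
Qed.
Lemma pev_zpol p : pev x (zpol p) = zev x p.
Proof. by rewrite /zpol pevD pevM !pevC pevX. Qed.
Lemma zev_red p : 2%N \in [pchar K] -> zev x p = (odd `|p.1|%N)%:R + (odd `|p.2|%N)%:R * x.
Proof.
move=> ch; have h (i : int) : i%:~R = (odd `|i|%N)%:R :> K.
  have hn (n : nat) : n%:R = (odd n)%:R :> K.
    by rewrite -[in LHS](odd_double_half n) natrD -mul2n natrM (pcharf0 ch) mul0r addr0.
  case: i => n; first exact: (hn n).
  by rewrite NegzE rmorphN /= (oppr_pchar2 ch); exact: (hn n.+1).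
by rewrite /zev !h.
Qed.
End Zev.

(** The pairs (0, 1) and (-1, 1) are tau and its inverse; exponents up to 6 cover every unit needed
    in [family_table]. *)
Definition zunits : seq z2 :=
  let ps := [seq iter n (zmul (0, 1)) (1, 0) | n <- iota 0 7]
         ++ [seq iter n (zmul (-1, 1)) (1, 0) | n <- iota 0 7] in
  ps ++ map zopp ps.

Definition zvec0 d : seq z2 := nseq d (0, 0).
Definition zsub (x y : seq z2) : seq z2 := [seq zadd p.1 (zopp p.2) | p <- zip x y].
(** How an outside vertex can be joined to the core: by an edge to [c0] (the zero vector), by an
    edge to core vertex [k], or by a vector of [S]. The coordinate of [c0] is omitted throughout,
    since sums are 0. *)
Definition zlinks d (S : seq (seq z2)) : seq (seq z2) :=
  zvec0 d :: [seq mkseq (fun i => if i == k then (-1, 0) else (0, 0)) d | k <- iota 0 d] ++ S.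

Definition zdet := ldet ((0, 0) : z2) ((1, 0) : z2) zadd zmul zopp.

(** Two links at the same outside vertex leave, after a pivot there, the difference of their core
    parts; it must again be a unit multiple of a core vector. Given this closure, determinants need
    testing on core columns only. *)
Definition fam_ok d (Y S : seq (seq z2)) : bool :=
  let Y0 := zvec0 d :: Y in let L := zlinks d S in
  if all (fun y => size y == d) (Y0 ++ L) then
    if lall (fun s => lall (fun s' => lhas (fun y => lhas (fun u => zsub s s' == map (zmul u) y) zunits) Y0) L) L
    then lall (fun t => lall (fun rs => lall (fun cs =>
       zdet t (fun i j => nth (0, 0) (nth [::] Y0 (nth 0%N cs j)) (nth 0%N rs i)) \in ((0, 0) : z2) :: zunits)
       (subs t (iota 0 (size Y0)))) (subs t (iota 0 d))) (iota 0 d.+1)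
    else false
  else false.

(** * A family closed under pivoting outside its core *)

Section Family.

Variables (R : realType) (d : nat) (Y S : seq (seq z2)).
Hypothesis ok : fam_ok d Y S.
Local Notation tau := (tau R).
Let Y0 := zvec0 d :: Y.
Let L := zlinks d S.
Let ev := zev tau.

Let size_ok y : y \in Y0 ++ L -> size y = d.
Proof. by move: ok; rewrite /fam_ok; case: ifP => // /allP h _ /h/eqP. Qed.

Let diff_ok s s' : s \in L -> s' \in L ->
  exists u y, [/\ u \in zunits, y \in Y0 & zsub s s' = map (zmul u) y].
Proof.
move: ok; rewrite /fam_ok; case: ifP => // _; case: ifP => // + _; rewrite lallE => /allP h sL s'L.
have := h s sL; rewrite lallE => /allP/(_ s' s'L); rewrite lhasE => /hasP[y yY].
by rewrite lhasE => /hasP[u uU /eqP e]; exists u, y.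
Qed.

Let evM p q : ev (zmul p q) = ev p * ev q. Proof. exact: zevM (sqr_tau R). Qed.

Let pz_units u : u \in zunits -> pz (ev u).
Proof.
have pt : pz (ev (0, 1)) by rewrite /ev /zev add0r mul1r; right; exists 1; left; rewrite expr1z.
have pti : pz (ev (-1, 1)).
  have -> : ev (-1, 1) = tau^-1.
    apply: (mulfI (tau_neq0 R)); rewrite mulfV ?tau_neq0 // /ev /zev mul1r rmorphN /= mulrDr -expr2.
    by rewrite sqr_tau mulr1z mulrN mulr1 addrC addrAC subrr add0r.
  by apply: pzV; right; exists 1; left; rewrite expr1z.
have it p n : pz (ev p) -> pz (ev (iter n (zmul p) (1, 0))).
  by move=> pp; elim: n => [|n IH] /=; [rewrite /ev zev1; exact: pz1 | rewrite evM; exact: pzM].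
have h v : v \in [seq iter n (zmul (0, 1)) (1, 0) | n <- iota 0 7]
         ++ [seq iter n (zmul (-1, 1)) (1, 0) | n <- iota 0 7] -> pz (ev v).
  by rewrite mem_cat => /orP[]/mapP[n _ ->]; apply: it.
rewrite /zunits mem_cat => /orP[/h//|/mapP[v /h hv ->]].
by rewrite /ev zevN; exact: pzN.
Qed.

Lemma table_gm : gm (fun (r : 'I_d) (c : 'I_(size Y0)) => ev (nth (0, 0) (nth [::] Y0 c) r)).
Proof.
set M := fun r c => _; move=> t f g.
have [->|nz] := eqVneq (subdet M f g) 0; first exact: pz0.
have [f' [p [fE fs]]] := sort_ord_inj (subdet_inj nz).
have [g' [q [gE gs]]] := sort_ord_inj (subdet_injr nz).
have -> : subdet M f g = subdet M (f' \o p) (g' \o q) by apply: eq_subdet => i j; rewrite /= -fE -gE.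
rewrite subdet_perm.
have ps (b1 : bool) (x : R) : pz x -> pz ((-1) ^+ b1 * x).
  by case: b1 => h; rewrite ?expr1 ?mulN1r ?expr0 ?mul1r //; exact: pzN.
rewrite -mulrA; refine (ps _ _ (ps _ _ _)).
have td : t \in iota 0 d.+1.
  by rewrite mem_iota /= ltnS; have := leq_card f (subdet_inj nz); rewrite !card_ord.
move: ok; rewrite /fam_ok; case: ifP => // _; case: ifP => // _.
rewrite lallE => /allP/(_ t td); rewrite lallE => /allP/(_ _ fs); rewrite lallE => /allP/(_ _ gs).
set D := zdet _ _ => DU.
have -> : subdet M f' g' = ev D.
  rewrite /D /zdet /ev (@ldet_morph _ _ _ _ _ _ _ 0 1 +%R *%R -%R (zev tau)) ?zev0 ?zev1 //; first last.
  - by move=> x; exact: zevN.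
  - by move=> x y; exact: zevD.
  rewrite ldetE /subdet; congr (\det _); apply/matrixP=> i j; rewrite !mxE !nth_tl //.
by move: DU; rewrite inE => /orP[/eqP->|/pz_units//]; rewrite /ev zev0; exact: pz0.
Qed.

Variables (V : finType) (c0 : V) (core : seq V).
Hypotheses (core_uniq : uniq (c0 :: core)) (core_size : size core = d).

Let cvec (y : seq z2) (v : V) : R := ev (nth (0, 0) y (index v core)).
Let nc (v : V) := v \notin c0 :: core.
Let del (i v : V) : R := (v == i)%:R.

(** Edges meeting the core need no constructor: they are links through [zlinks], or multiples of
    core vectors as differences of two links. *)
Inductive fam_col (x : V -> R) : Prop :=
| FamCore c y of pz c & y \in Y0 & forall v, x v = c * cvec y v
| FamLink c i s of pz c & nc i & s \in L & forall v, x v = c * (del i v + cvec s v)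
| FamEdge c i j of pz c & nc i & nc j & i != j & forall v, x v = c * (del i v - del j v).

Let cvec_out y v : y \in Y0 ++ L -> v \notin core -> cvec y v = 0.
Proof.
by move=> /size_ok sy vc; rewrite /cvec nth_default ?sy -?core_size ?memNindex // /ev zev0.
Qed.

Let cvec_sub s s' v : s \in L -> s' \in L -> cvec (zsub s s') v = cvec s v - cvec s' v.
Proof.
move=> sL s'L; have ss : size s = d by rewrite size_ok // mem_cat sL orbT.
have ss' : size s' = d by rewrite size_ok // mem_cat s'L orbT.
have sz : size (zip s s') = d by rewrite size_zip ss ss' minnn.
rewrite /cvec /ev; have [lt|ge] := ltnP (index v core) d.
  by rewrite (nth_map ((0, 0), (0, 0))) ?sz // nth_zip ?ss ?ss' //= zevD zevN.
by rewrite !nth_default ?size_map ?sz ?ss ?ss' // zev0 subrr.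
Qed.

Let cvec_diff s s' : s \in L -> s' \in L -> exists c y, [/\ pz c, y \in Y0 &
  forall v, cvec s v - cvec s' v = c * cvec y v].
Proof.
move=> sL s'L; have [u [y [uU yY e]]] := diff_ok sL s'L; exists (ev u), y; split=> //; first exact: pz_units.
move=> v; rewrite -cvec_sub // e /cvec; have [lt|ge] := ltnP (index v core) (size y).
  by rewrite (nth_map (0, 0)) // evM.
by rewrite !nth_default ?size_map // /ev zev0 mulr0.
Qed.

Let L0 : zvec0 d \in L. Proof. by rewrite inE eqxx. Qed.
Let cvec0 v : cvec (zvec0 d) v = 0.
Proof. by rewrite /cvec nth_nseq; case: ifP; rewrite /ev zev0. Qed.
Let YL y : y \in Y0 -> y \in Y0 ++ L. Proof. by rewrite mem_cat => ->. Qed.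
Let LL y : y \in L -> y \in Y0 ++ L. Proof. by rewrite mem_cat => ->; rewrite orbT. Qed.
Let nc_core v : nc v -> v \notin core. Proof. by rewrite /nc inE negb_or => /andP[]. Qed.

(* A column meeting the non-core row [i], scaled to have entry 1 there, minus [e_i]. *)
Let rest (i : V) (r : V -> R) : Prop :=
  (exists2 s, s \in L & r =1 cvec s) \/ (exists j, [/\ nc j, j != i & forall v, r v = - del j v]).

Let fam_col_at i x : nc i -> fam_col x -> x i != 0 ->
  exists c r, [/\ pz c, rest i r & forall v, x v = c * (del i v + r v)].
Proof.
move=> ni [c y pc yY xE|c j s pc nj sL xE|c j k pc nj nk jk xE] xi.
- by move: xi; rewrite xE (cvec_out (YL yY) (nc_core ni)) mulr0 eqxx.
- exists c, (cvec s); split=> //; first by left; exists s.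
  move: xi; rewrite xE (cvec_out (LL sL) (nc_core ni)) addr0 /del; case: (eqVneq i j) => [ij _ v|_]; first by rewrite xE ij.
  by rewrite mulr0 eqxx.
move: xi; rewrite xE /del; have [ij|nij] := eqVneq i j.
  move=> _; exists c, (fun v => - del k v); split=> //; last by move=> v; rewrite xE ij.
  by right; exists k; split=> //; rewrite ij eq_sym.
have [ik|nik] := eqVneq i k; last by rewrite subrr mulr0 eqxx.
move=> _; exists (- c), (fun v => - del j v); split=> //; first exact: pzN.
  by right; exists j; split=> //; rewrite eq_sym.
by move=> v; rewrite xE ik mulNr -mulrN opprB.
Qed.

Let fam_col_rest i c r r' : rest i r -> rest i r' -> pz c -> fam_col (fun v => c * (r v - r' v)).
Proof.
move=> [[s sL rE]|[j [nj ji rE]]] [[s' s'L rE']|[k [nk ki rE']]] pc.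
- have [c' [y [pc' yY e]]] := cvec_diff sL s'L.
  by apply: (@FamCore _ (c * c') y) => // [|v]; [exact: pzM | rewrite rE rE' e mulrA].
- by apply: (@FamLink _ c k s) => // v; rewrite rE rE' opprK addrC.
- apply: (@FamLink _ (- c) j s') => // [|v]; first exact: pzN.
  by rewrite rE rE' -opprD mulrN mulNr.
have [jk'|njk] := eqVneq j k.
  apply: (@FamCore _ 0 (zvec0 d)); rewrite ?inE ?eqxx //; first exact: pz0.
  by move=> v; rewrite rE rE' jk' subrr mulr0 mul0r.
by apply: (@FamEdge _ c k j) => // [|v]; rewrite 1?eq_sym // rE rE' opprK addrC.
Qed.

(** Induction on the size. A selected row outside the core is removed by a pivot, and the new
    columns are again of the family ([fam_col_rest]). When all selected rows are in the core,
    outside edges vanish and links reduce to multiples of core columns, so [table_gm] applies. *)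
Lemma fam_gm (E : finType) (A : V -> E -> R) : (forall e, fam_col (A^~ e)) -> gm A.
Proof.
move=> hA t; elim: t A hA => [|t IH] A hA f g.
  by rewrite /subdet det_mx00; exact: pz1.
have [dz|nz] := eqVneq (subdet A f g) 0; first by rewrite dz; exact: pz0.
have fi := subdet_inj nz.
have [[i0 ni0]|allc] := altP (@existsP _ (fun i => nc (f i))).
  have [j0 a0] : exists j, A (f i0) (g j) != 0.
    apply/existsP; apply: contraNT nz; rewrite negb_exists => /forallP h.
    rewrite /subdet (expand_det_row _ i0) big1 // => j _; rewrite mxE.
    by have := h j; rewrite negbK => /eqP->; rewrite mul0r.
  rewrite (subdet_expand fi a0).
  have [c [r [pc hr xE]]] := fam_col_at ni0 (hA (g j0)) a0.
  have ri r1 : rest (f i0) r1 -> r1 (f i0) = 0.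
    move=> [[s sL ->]|[j [nj ji ->]]]; first exact: cvec_out (LL sL) (nc_core ni0).
    by rewrite /del eq_sym (negPf ji) oppr0.
  have xi : A (f i0) (g j0) = c by rewrite xE /del eqxx ri // addr0 mulr1.
  have c0' : c != 0 by rewrite -xi.
  rewrite xi; apply: pzM => //; rewrite -signr_odd.
  have ps (b1 : bool) (x : R) : pz x -> pz ((-1) ^+ b1 * x).
    by case: b1 => h; rewrite ?expr1 ?mulN1r ?expr0 ?mul1r //; exact: pzN.
  apply/ps/IH => e.
  have [v0|nv] := eqVneq (A (f i0) e) 0.
    have E1 v : schur A (f i0) (g j0) v e = A v e by rewrite /schur v0 mulr0 mul0r subr0.
    case: (hA e) => [c' y p1 p2 h|c' i s p1 p2 p3 h|c' i j p1 p2 p3 p4 h].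
    - by apply: (FamCore p1 p2) => v; rewrite E1 h.
    - by apply: (FamLink p1 p2 p3) => v; rewrite E1 h.
    by apply: (FamEdge p1 p2 p3 p4) => v; rewrite E1 h.
  have [c' [r' [pc' hr' xE']]] := fam_col_at ni0 (hA e) nv.
  have E1 v : schur A (f i0) (g j0) v e = c' * (r' v - r v).
    rewrite /schur xi xE xE' [A (f i0) e]xE' /del eqxx (ri r' hr') addr0 mulr1.
    by rewrite mulrAC [c * _]mulrC mulfK // [_ * c']mulrC -mulrBr opprD addrACA subrr add0r.
  case: (fam_col_rest hr' hr pc') => [c1 y p1 p2 h|c1 i s p1 p2 p3 h|c1 i j p1 p2 p3 p4 h].
  - by apply: (FamCore p1 p2) => v; rewrite E1 h.
  - by apply: (FamLink p1 p2 p3) => v; rewrite E1 h.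
  by apply: (FamEdge p1 p2 p3 p4) => v; rewrite E1 h.
have fc i : f i \in c0 :: core.
  by move: allc; rewrite negb_exists => /forallP/(_ i); rewrite negbK.
have colE e : exists (c : R) (k : 'I_(size Y0)), pz c /\
    forall v, v \in c0 :: core -> A v e = c * cvec (nth [::] Y0 k) v.
  have idx y : y \in Y0 -> exists k : 'I_(size Y0), nth [::] Y0 k = y.
    by move=> yY; rewrite -index_mem in yY; exists (Ordinal yY); rewrite nth_index -?index_mem.
  case: (hA e) => [c y pc yY h|c i s pc ni sL h|c i j pc ni nj ij h].
  - by have [k kE] := idx y yY; exists c, k; rewrite kE.
  - have [c' [y [pc' yY e']]] := cvec_diff sL L0; have [k kE] := idx y yY.
    exists (c * c'), k; rewrite kE; split=> [|v vc]; first exact: pzM.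
    rewrite h -mulrA -e' cvec0 subr0 /del; case: eqVneq => [vi|_]; last by rewrite add0r.
    by move: ni; rewrite /nc -vi vc.
  have [k kE] := idx (zvec0 d) (mem_head _ _); exists 0, k; split=> [|v vc]; first exact: pz0.
  rewrite mul0r h /del; case: eqVneq => [vi|_]; first by move: ni; rewrite /nc -vi vc.
  by case: eqVneq => [vj|_]; [move: nj; rewrite /nc -vj vc | rewrite subrr mulr0].
have /fin_all_exists[cc /fin_all_exists[kk ckE]] := colE.
have fcore i : f i \in core.
  have := fc i; rewrite inE => /orP[/eqP fi0|//]; exfalso; move/negP: nz; apply.
  rewrite /subdet (expand_det_row _ i) big1 // => j _; rewrite mxE.
  have [_ ->] := ckE (g j); last exact: fc.
  rewrite fi0 cvec_out ?mulr0 ?mul0r //; last by have := core_uniq => /= /andP[].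
  by apply: YL; apply: mem_nth.
have rlt i : (index (f i) core < d)%N by rewrite -core_size index_mem.
pose r i : 'I_d := Ordinal (rlt i).
rewrite (@eq_subdet _ _ _ 'I_t.+1 'I_t.+1 A
  (fun i j => cc (g j) * ev (nth (0, 0) (nth [::] Y0 (kk (g j))) (r i))) _ f g id id); last first.
  by move=> i j; have [_ ->] := ckE (g j).
apply: (@gm_scale R 'I_t.+1 'I_t.+1 _ (fun j => cc (g j))); first by move=> j; have [] := ckE (g j).
exact: (gm_sub r (fun j => kk (g j)) table_gm).
Qed.

Variables (F : finFieldType) (b : F) (I : finType) (w : I -> V -> F).
Hypotheses (ch : 2%N \in [pchar F]) (hb : b ^+ 2 = b + 1).
Hypothesis sum0 : forall s, \sum_v w s v = 0.

(** Here the coordinate at [c0] is unconstrained in the last two cases because it is determined by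
    the sum 0. *)
Definition fam_vec (s : I) : Prop := exists2 k : F, k != 0 &
  [\/ forall v, w s v = 0,
      exists p q, forall v, w s v = k * ((v == p)%:R + (v == q)%:R),
      exists2 y, y \in Y & forall v, v != c0 -> w s v = k * zev b (nth (0, 0) y (index v core)) |
      exists i l, [/\ i \notin c0 :: core, l \in S & forall v, v != c0 ->
        w s v = k * ((v == i)%:R + zev b (nth (0, 0) l (index v core)))]].

(** Each [w s] is lifted to a family column [P s] over Z[tau]. The lifted real matrix is
    golden-mean, [gm_transfer] makes its reduction represent the same matroid, and the reduction
    agrees with [w] up to column scaling and row [c0]. *)
Lemma family_golden : (forall s, fam_vec s) -> golden_mean R (under (rmx (fun v s => w s v))).
Proof.
move=> hw.
have zdel (K : comNzRingType) (x : K) (i v : V) : zev x (if v == i then (1, 0) else (0, 0)) = (v == i)%:R.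
  by case: eqP; rewrite ?zev1 ?zev0.
have /fin_all_exists[P PE] : forall s, exists P : V -> z2,
    fam_col (fun v => ev (P v)) /\ exists2 k : F, k != 0 & forall v, v != c0 -> w s v = k * zev b (P v).
  move=> s; have [k k0 [h|[p [q h]]|[y yY h]|[i [l [ni lS h]]]]] := hw s.
  - exists (fun=> (0, 0)); split.
      by apply: (@FamCore _ 0 (zvec0 d)) => [||v]; rewrite ?mem_head ?mul0r /ev ?zev0 //; exact: pz0.
    by exists 1; [exact: oner_neq0 | move=> v _; rewrite h zev0 mulr0].
  - have [pq|npq] := eqVneq p q.
      exists (fun=> (0, 0)); split.
        by apply: (@FamCore _ 0 (zvec0 d)) => [||v]; rewrite ?mem_head ?mul0r /ev ?zev0 //; exact: pz0.
      by exists 1; [exact: oner_neq0 | move=> v _; rewrite h pq zev0 addrr_pchar2 // !mulr0].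
    pose e (i v : V) : z2 := if v == i then (1, 0) else (0, 0).
    exists (fun v => if v == c0 then (0, 0) else zadd (e p v) (zopp (e q v))); split; last first.
      by exists k => // v vc; rewrite h (negPf vc) zevD zevN !zdel (oppr_pchar2 ch).
    have ev_e i v : ev (e i v) = del i v by exact: zdel.
    have cl i : i \in c0 :: core -> exists2 s, s \in L & forall v, v != c0 -> - del i v = cvec s v.
      rewrite inE => /orP[/eqP->|ic]; first by exists (zvec0 d) => // v vc; rewrite /del (negPf vc) cvec0 oppr0.
      exists (mkseq (fun j => if j == index i core then (-1, 0) else (0, 0)) d).
        rewrite inE mem_cat; apply/orP; right; apply/orP; left; apply/mapP; exists (index i core) => //.
        by rewrite mem_iota /= add0n -core_size index_mem.
      move=> v vc; rewrite /cvec; have [vcore|vcore] := boolP (v \in core); last first.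
        rewrite nth_default ?size_mkseq -?core_size ?memNindex // /ev zev0 /del.
        by case: eqVneq => [vi|_]; [move: vcore; rewrite vi ic | rewrite oppr0].
      rewrite nth_mkseq -?core_size ?index_mem // /del.
      have -> : (index v core == index i core) = (v == i).
        by apply/eqP/eqP => [e'|->//]; rewrite -(nth_index v vcore) e' nth_index.
      by case: eqP; rewrite /ev /zev /= ?mul0r ?addr0 ?oppr0 // rmorphN.
    have c0E i : (i \in c0 :: core) = false -> del i c0 = 0.
      by rewrite inE /del; case: eqP => [->|]; rewrite ?eqxx // eq_sym; case: eqP.
    have x0 (l : seq z2) : l \in L -> cvec l c0 = 0.
      by move=> sL; apply: cvec_out; [exact: LL | have := core_uniq => /= /andP[]].
    have [pc|npc] := boolP (p \in c0 :: core); have [qc|nqc] := boolP (q \in c0 :: core).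
    + have [s1 s1L e1] := cl p pc; have [s2 s2L e2'] := cl q qc.
      have [c [y [pcc yY e3]]] := cvec_diff s2L s1L.
      apply: (@FamCore _ c y) => // v; rewrite -e3; case: ifPn => vc.
        by rewrite (eqP vc) !x0 // subrr /ev zev0.
      by rewrite /ev zevD zevN -/ev !ev_e -(e1 _ vc) -(e2' _ vc) opprK addrC.
    + have [s1 s1L e1] := cl p pc.
      apply: (@FamLink _ (-1) q s1) => // [|v]; first by apply: pzN; exact: pz1.
      case: ifPn => vc; last by rewrite /ev zevD zevN -/ev !ev_e -(e1 _ vc) mulN1r opprB.
      by rewrite (eqP vc) x0 // c0E ?(negPf nqc) // addr0 mulr0 /ev zev0.
    + have [s1 s1L e1] := cl q qc.
      apply: (@FamLink _ 1 p s1) => // [|v]; first exact: pz1.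
      case: ifPn => vc; last by rewrite /ev zevD zevN -/ev !ev_e -(e1 _ vc) mul1r.
      by rewrite (eqP vc) x0 // c0E ?(negPf npc) // addr0 mulr0 /ev zev0.
    apply: (@FamEdge _ 1 p q) => // [|v]; first exact: pz1.
    case: ifPn => vc; last by rewrite /ev zevD zevN -/ev !ev_e mul1r.
    by rewrite (eqP vc) !c0E ?(negPf npc) ?(negPf nqc) // subrr mulr0 /ev zev0.
  - exists (fun v => nth (0, 0) y (index v core)); split; last by exists k.
    apply: (@FamCore _ 1 y) => [||v]; rewrite ?mul1r //; first exact: pz1.
    by rewrite inE yY orbT.
  exists (fun v => zadd (if v == i then (1, 0) else (0, 0)) (nth (0, 0) l (index v core))); split; last first.
    by exists k => // v vc; rewrite h // zevD zdel.
  apply: (@FamLink _ 1 i l) => // [||v]; first exact: pz1.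
    by rewrite inE mem_cat lS !orbT.
  by rewrite mul1r /ev zevD zdel.
have hgm : gm (fun v s => pev tau (zpol (P s v))).
  apply: (@eq_gm R V I (fun v s => ev (P s v))); first by move=> v s; rewrite pev_zpol.
  by apply: fam_gm => s; have [] := PE s.
have gP : golden_mean R (under (rmx (fun v s => pev b (zpol (P s v))))).
  apply/golden_meanP; exists V, (fun v s => pev tau (zpol (P s v))); split=> // X.
  exact: gm_transfer.
have /fin_all_exists2[k k0 kE] : forall s, exists2 k : F, k != 0 & forall v, v != c0 -> w s v = k * zev b (P s v).
  by move=> s; have [] := PE s.
have P00 s : ev (P s c0) = 0.
  have c0n : c0 \notin core by have := core_uniq => /= /andP[].
  have dn i : nc i -> del i c0 = 0 by rewrite /nc inE negb_or /del => /andP[/negPf + _]; rewrite eq_sym => ->.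
  have [[c y _ yY ->|c i l _ ni lL ->|c i j _ ni nj _ ->] _] := PE s.
  - by rewrite cvec_out ?mulr0 //; exact: YL.
  - by rewrite cvec_out ?dn ?addr0 ?mulr0 //; exact: LL.
  by rewrite !dn // subrr mulr0.
have Pb0 s : zev b (P s c0) = 0.
  by rewrite -pev_zpol; apply: (pev_tau0 hb); rewrite pev_zpol; exact: P00.
apply: (golden_mean_minor gP).
apply: (@rminor_has_minor F (rmx (fun v s => pev b (zpol (P s v)))) (rmx (fun v s => w s v)) id k set0).
split=> // [e|v]; first by rewrite inE.
(* Subtracting the constant [p c0] from a functional does not change its value on a zero-sum vector;
   this eliminates row [c0]. *)
have wE (p : V -> F) s : \sum_x p x * w s x = k s * \sum_x (p x - p c0) * pev b (zpol (P s x)).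
  transitivity (\sum_x (p x - p c0) * w s x).
    rewrite -[LHS]subr0 -[X in _ - X](mulr0 (p c0)) -[X in _ - p c0 * X](sum0 s) mulr_sumr -sumrB.
    by apply: eq_bigr => x _; rewrite mulrBl.
  rewrite mulr_sumr; apply: eq_bigr => x _; rewrite pev_zpol.
  have [->|xc] := eqVneq x c0; first by rewrite subrr !mul0r mulr0.
  by rewrite kE // mulrCA.
split=> [/mem_rmx[p pE]|[u [/mem_rmx[p uE] _ vE]]].
  exists [ffun s => \sum_x (p x - p c0) * pev b (zpol (P s x))]; split=> [|x|s]; rewrite ?inE //.
    by apply/mem_rmx; exists (fun x => p x - p c0) => s; rewrite ffunE.
  by rewrite pE ffunE wE.
apply/mem_rmx; exists (fun x => if x == c0 then 0 else p x) => s.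
rewrite vE uE wE eqxx; congr (_ * _); apply: eq_bigr => x _; rewrite subr0.
by case: eqP => [->|] //; rewrite pev_zpol Pb0 !mulr0.
Qed.

End Family.

(** * Classification of zero-sum vectors *)

(** The Frobenius automorphism; it lets a family be used with a^2 in the place of a. *)
Definition conj4 (x : g4) : g4 := (x.1 (+) x.2, x.2).
Definition units4 : seq g4 := [:: i4; a4; b4].
Definition dot4 m (x y : seq g4) : g4 :=
  foldr add4 o4 [seq mul4 (nth o4 x i) (nth o4 y i) | i <- iota 0 m].

(* A certificate that the graphic matroid of K_(m+1) extended by the vectors [W] has one of the
   five rank-3 matroids as a minor: the references [C] are contracted, the references [G], scaled
   by [S], are kept, and [th] are three functionals killing [C].  A reference (p, q) is an edge if
   p <= m and the vector number q of [W] otherwise.  [d] and [g] decompose the identity along the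
   constant functional, [th], and functionals dual to [C]. *)
Record mcert := MCert {
  mc_m : nat; mc_W : seq (seq g4); mc_C : seq (nat * nat); mc_G : seq (nat * nat);
  mc_S : seq g4; mc_T : nat; mc_th : seq (seq g4); mc_d : seq (seq g4); mc_g : seq (seq g4) }.

Definition targets : seq (seq (seq g4) * nat) :=
  [:: (F7c, 7); (P1c, 9); (P3c, 9); (V1c, 9); (Papc, 9)]%N.

Definition ones4 m : seq g4 := nseq m i4.

Section CertDef.
Variable c : mcert.
Let m := (mc_m c).+1.

Definition evec (r : nat * nat) : seq g4 :=
  if (r.1 < m)%N then [seq if (i == r.1) (+) (i == r.2) then i4 else o4 | i <- iota 0 m]
  else nth [::] (mc_W c) r.2.

Definition valid_ref (r : nat * nat) : bool :=
  if (r.1 < m)%N then (r.2 < m)%N else (r.1 == m) && (r.2 < size (mc_W c))%N.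

Definition mc_ok : bool :=
  let T := nth (F7c, 7%N) targets (mc_T c) in
  [&& all valid_ref (mc_C c ++ mc_G c), uniq (mc_C c ++ mc_G c),
      size (mc_G c) == T.2, size (mc_S c) == T.2, all (fun s => s != o4) (mc_S c),
      all (fun i => all (fun j => (i == j) || all (fun s =>
         map (mul4 s) (nth [::] (mc_W c) i) != nth [::] (mc_W c) j) units4) (iota 0 (size (mc_W c))))
         (iota 0 (size (mc_W c))),
      all (fun v => size v == m) (mc_W c),
      all (fun r => all (fun t => dot4 m (nth [::] (mc_th c) t) (evec r) == o4) (iota 0 3)) (mc_C c),
      all (fun j => (dot4 m (ones4 m) (evec (nth (0, 0)%N (mc_G c) j)) == o4) &&
        all (fun t => ent4 T.1 t j == mul4 (nth o4 (mc_S c) j)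
          (dot4 m (nth [::] (mc_th c) t) (evec (nth (0, 0)%N (mc_G c) j)))) (iota 0 3)) (iota 0 T.2)
    & all (fun v => all (fun v' => (if v == v' then i4 else o4) ==
        add4 (nth o4 (nth [::] (mc_d c) 0) v')
        (add4 (foldr add4 o4 [seq mul4 (nth o4 (nth [::] (mc_d c) t.+1) v') (nth o4 (nth [::] (mc_th c) t) v)
           | t <- iota 0 3])
        (foldr add4 o4 [seq mul4 (nth o4 (evec (nth (0, 0)%N (mc_C c) k)) v') (nth o4 (nth [::] (mc_g c) k) v)
           | k <- iota 0 (size (mc_C c))]))) (iota 0 m)) (iota 0 m)].
End CertDef.

(** The number of a certificate, the vertex to which each label is sent, and for each vector of the
    certificate the pattern and the scalar producing it. *)
Definition witness : Type := (nat * seq nat * seq (nat * g4))%type.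

Definition mrg m (mu : seq nat) (t : seq g4) : seq g4 :=
  [seq foldr add4 o4 [seq nth o4 t i | i <- iota 0 (size mu) & nth 0%N mu i == q] | q <- iota 0 m].

Definition mcert0 : mcert := MCert 0 [::] [::] [::] [::] 0 [::] [::] [::].

Definition okbad (certs : seq mcert) L (ps : seq (seq g4)) (wt : witness) : bool :=
  let: (eid, mu, rows) := wt in
  let c := nth mcert0 certs eid in
  [&& (eid < size certs)%N, size mu == L, all (fun q => q <= mc_m c)%N mu, (0 < size rows)%N,
      size rows == size (mc_W c)
    & all (fun i => let rc := nth (0%N, o4) rows i in
        [&& (rc.1 < size ps)%N, rc.2 != o4, (size (nth [::] ps rc.1) <= L)%N
          & map (mul4 rc.2) (mrg (mc_m c).+1 mu (nth [::] ps rc.1)) == nth [::] (mc_W c) i])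
        (iota 0 (size rows))].

(** Vectors with given numbers of entries 1, a, a^2 on [m] named vertices; entries not placed there
    go to fresh vertices in a fixed order, since fresh vertices are interchangeable. *)
Fixpoint gen (m n1 n2 n3 : nat) : seq (seq g4) :=
  if m is m'.+1 then
    map (cons o4) (gen m' n1 n2 n3)
    ++ (if n1 is k.+1 then map (cons i4) (gen m' k n2 n3) else [::])
    ++ (if n2 is k.+1 then map (cons a4) (gen m' n1 k n3) else [::])
    ++ (if n3 is k.+1 then map (cons b4) (gen m' n1 n2 k) else [::])
  else [:: nseq n1 i4 ++ nseq n2 a4 ++ nseq n3 b4].

Definition firstnz (u : seq g4) : g4 := nth o4 [seq x <- u | x != o4] 0.

(** Scaling permutes 1, a, a^2, so the first shape is normalised by its first nonzero entry. Two
    pairs of distinct nonzero values can be scaled to 1, 1, a, a in exactly one way. *)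
Definition types m : seq (seq g4) :=
  [seq u <- gen m 1 1 1 | firstnz u == i4] ++ gen m 2 2 0.

Definition family : Type := (nat * seq (seq g4) * seq (seq g4))%type.

(** The list [emb] places the core, [c0] first. An index of at least [m] in [emb] denotes a spare
    vertex where all vectors vanish, whereas such an index in [u] denotes a fresh vertex. One
    nonzero entry off the core makes the vector a candidate link. *)
Definition infam (f : family) (cj : bool) (emb : seq nat) m (u : seq g4) : bool :=
  lhas (fun c => let x := [seq (let z := mul4 c y in if cj then conj4 z else z) | y <- u] in
    let tail := [seq if (e < m)%N then nth o4 x e else o4 | e <- behead emb] in
    let rest := [seq j <- iota 0 (size u) | (nth o4 x j != o4) && ((m <= j)%N || (j \notin emb))] in
    if rest is j :: r then
      if nilp r then if nth o4 x j == i4 then tail \in f.2 else false else false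
    else tail \in f.1.2) units4.

(** The patterns [nd_p] are known to occur on [nd_m] named vertices; the family [nd_f], conjugated
    if [nd_c], is placed at [nd_e]. A vector leaving it is sent by [nd_k] to a child with a
    renaming, or by [nd_x] to an explicit witness of a forbidden minor. *)
Record node := Node {
  nd_m : nat; nd_p : seq (seq g4); nd_f : nat; nd_c : bool; nd_e : seq nat;
  nd_k : seq (seq g4 * (nat * seq nat)); nd_x : seq (seq g4 * witness) }.

Definition node0 : node := Node 0 [::] 0 false [::] [::] [::].

(* The child node at index [kd.2.1], its labels read through [kd.2.2], uses only vectors of [ps]. *)
Definition kidok (nodes : seq node) i (ps : seq (seq g4)) L (kd : nat * seq nat) : bool :=
  let ch := nth node0 nodes kd.1 in let rho := kd.2 in
  [&& (kd.1 < i)%N, size rho == nd_m ch, uniq rho, all (fun e => e < L)%N rho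
    & all (fun t => has (fun q => has (fun c =>
        all (fun k => mul4 c (nth o4 q (nth 0%N rho k)) == nth o4 t k) (iota 0 (size rho))
        && all (fun j => (j \in rho) || (nth o4 q j == o4)) (iota 0 L)) units4) ps) (nd_p ch)].

(** Tries and sorting only speed up the lookup: whatever [tryrows] retrieves is verified by [okbad],
    so no correctness statement about them is required. *)
Inductive trie (T : Type) := TLeaf | TNode of option T & trie T & trie T.
Arguments TLeaf {T}.

Fixpoint tfind (T : Type) (k : seq bool) (t : trie T) : option T :=
  match t with
  | TLeaf => None
  | TNode o l r => if k is b :: k' then tfind k' (if b then r else l) else o
  end.

Fixpoint tadd (T : Type) (v : T) (k : seq bool) (t : trie T) : trie T :=
  match k with
  | [::] => match t with TLeaf => TNode (Some v) TLeaf TLeaf | TNode _ l r => TNode (Some v) l r end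
  | b :: k' => match t with
    | TLeaf => if b then TNode None TLeaf (tadd v k' TLeaf) else TNode None (tadd v k' TLeaf) TLeaf
    | TNode o l r => if b then TNode o l (tadd v k' r) else TNode o (tadd v k' l) r
    end
  end.

Fixpoint lebits (s t : seq bool) : bool :=
  match s, t with
  | x :: s', y :: t' =>
    if x then if y then lebits s' t' else false else if y then true else lebits s' t'
  | _, _ => true
  end.

Fixpoint insc (x : seq bool * nat) (s : seq (seq bool * nat)) : seq (seq bool * nat) :=
  if s is y :: s' then if lebits x.1 y.1 then x :: s else y :: insc x s' else [:: x].

(* The nonzero columns of the rows [rs], in increasing order, with their indices. *)
Definition sortcols (rs : seq (seq g4)) L : seq (seq bool * nat) :=
  foldr (fun j s =>
    let c := foldr (fun r acc => let x := nth o4 r j in [:: x.1, x.2 & acc]) [::] rs in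
    if lhas id c then insc (c, j) s else s) [::] (iota 0 L).

Definition btable : Type := seq (seq nat * (seq nat * nat * seq (nat * g4))).
Definition bentry : Type := (seq nat * nat * seq (nat * g4))%type.

(* A tabulated pattern lists the base 4 codes of its columns; it is stored under all rescalings and
   permutations of its rows. *)
Definition expand (tab : btable) : trie bentry :=
  foldr (fun e t =>
    let row r := [seq nth o4 [:: o4; i4; a4; b4] ((k %/ 4 ^ r) %% 4) | k <- e.1] in
    (* Columns of a two-row pattern have codes below 16. *)
    let three := has (fun k => 15 < k)%N e.1 in
    foldr (fun pi t => foldr (fun cs t =>
        let rs := [seq map (mul4 (nth o4 cs q)) (row (nth 0%N pi q)) | q <- iota 0 3] in
        let cl := sortcols rs (size e.1) in
        tadd ([seq nth 0%N e.2.1.1 x.2 | x <- cl], e.2.1.2,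
              (* The square of a unit [c] of GF(4) is its inverse, which undoes the rescaling of the
                 row. *)
              [seq (let q := index rc.1 pi in let c := nth o4 cs q in (q, mul4 rc.2 (mul4 c c)))
                 | rc <- e.2.2])
          (flatten (map fst cl)) t)
      t [seq c1 :: cs | c1 <- units4,
             cs <- [seq [:: c2; c3] | c2 <- units4, c3 <- if three then units4 else [:: i4]]])
      t (if three then [:: [:: 0; 1; 2]; [:: 0; 2; 1]; [:: 1; 0; 2]; [:: 1; 2; 0]; [:: 2; 0; 1]; [:: 2; 1; 0]]
         else [:: [:: 0; 1; 2]; [:: 1; 0; 2]])%N) TLeaf tab.

Section Search.
Variables (certs : seq mcert) (tab : trie bentry) (ps : seq (seq g4)) (L : nat).

Definition tryrows (ids : seq nat) : bool :=
  let cl := sortcols [seq nth [::] ps i | i <- ids] L in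
  if tfind (flatten (map fst cl)) tab is Some v then
    let lab := map snd cl in
    okbad certs L ps (v.1.2, [seq nth 0%N v.1.1 (index j lab) | j <- iota 0 L],
      [seq (nth 0%N ids rc.1, rc.2) | rc <- v.2])
  else false.

(** The new vector has index [n] in [ps]; index [n.+1] is past the end, so the third row is zero, as
    in the stored keys of two-row patterns. *)
Definition srch2 n : bool := lhas (fun i => tryrows [:: i; n; n.+1]) (iota 0 n).

Definition srch3 n : bool :=
  lhas (fun i => lhas (fun j => tryrows [:: i; j; n]) (iota 0 i)) (iota 0 n).
End Search.

(** The bounds 7 and [m + 5] fit the twelve spare vertices of [node_sound]: at most seven vertices
    are named, and five spare ones remain for the core. *)
Definition check_node (fams : seq family) certs tab (nodes : seq node) i : bool :=
  let nd := nth node0 nodes i in let m := nd_m nd in let p := nd_p nd in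
  let f := nth (0%N, [::], [::]) fams (nd_f nd) in
  if [&& all (fun t => size t <= m)%N p, uniq (nd_e nd), size (nd_e nd) == f.1.1.+1,
         all (fun e => e < m + 5)%N (nd_e nd) & (nd_f nd < size fams)%N && (m <= 7)%N] then
    lall (fun u => let ps := rcons p u in let L := size u in
      if infam f (nd_c nd) (nd_e nd) m u then true
      else if lhas (fun kd => if kd.1 == u then kidok nodes i ps L kd.2 else false) (nd_k nd) then true
      else if lhas (fun e => if e.1 == u then okbad certs L ps e.2 else false) (nd_x nd) then true
      else if srch2 certs tab ps L (size p) then true
      else srch3 certs tab ps L (size p)) (types m)
  else false.

Section Classification.

Variables (F : finFieldType) (a : F).
Hypothesis ch : 2%N \in [pchar F].
Hypothesis ha : a ^+ 2 = a + 1.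
Hypothesis hF : forall x : F, exists y, x = phi a y.

Let phiD := phi_add ch ha.
Let phiM := phi_mul ch ha.
Local Notation ph := (phi a).
Let ph0 : ph o4 = 0. Proof. by []. Qed.

Lemma phi_foldr (s : seq g4) : ph (foldr add4 o4 s) = \sum_(x <- s) ph x.
Proof. by elim: s => [|x s IH] /=; rewrite ?big_nil // big_cons phiD IH. Qed.

Lemma phi_dot m x y : ph (dot4 m x y) = \sum_(i < m) ph (nth o4 x i) * ph (nth o4 y i).
Proof.
rewrite phi_foldr big_map -{1}[m]subn0 -/(index_iota 0 m) big_mkord.
by apply: eq_bigr => i _; rewrite phiM.
Qed.

(** * Soundness of a minor certificate *)

Section Cert.

Variable c : mcert.
Hypothesis ok : mc_ok c.
Let m := (mc_m c).+1.
Let T := nth (F7c, 7%N) targets (mc_T c).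

Variables (V I : finType) (w : I -> V -> F) (pi : V -> 'I_m) (sf : nat -> I) (kf : nat -> F).
Hypothesis kf0 : forall i, (i < size (mc_W c))%N -> kf i != 0.
Hypothesis sfE : forall i, (i < size (mc_W c))%N ->
  forall q : 'I_m, merge w pi (sf i) q = kf i * ph (nth o4 (nth [::] (mc_W c) i) q).

(** By the decomposition of the identity a vertex functional killing the contracted elements is a
    combination of the constant one and the three [th]. The constant one is 0 on the kept elements,
    which have sum 0, so exactly the row space of the target remains. *)
Lemma cert_minor : has_minor (under (KW w pi)) (cmat a T.1 3 T.2).
Proof.
case/and5P: ok => /allP valC uq /eqP szG /eqP szS /and5P[/allP S0 /allP Wnp /allP Wsz /allP thC].
case/andP=> /allP GT /allP idt.
pose elt (r : nat * nat) : 'I_m * 'I_m + I :=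
  if (r.1 < m)%N then inl (inord r.1, inord r.2) else inr (sf r.2).
pose kr (r : nat * nat) : F := if (r.1 < m)%N then 1 else kf r.2.
pose col (q : 'I_m) (e : 'I_m * 'I_m + I) : F :=
  match e with inl (p, p') => edgec F p p' q | inr s => merge w pi s q end.
have kr0 r : valid_ref c r -> kr r != 0.
  rewrite /valid_ref /kr; case: ifP => _ h; first exact: oner_neq0.
  by case/andP: h => _; exact: kf0.
have colE r (q : 'I_m) : valid_ref c r -> col q (elt r) = kr r * ph (nth o4 (evec c r) q).
  rewrite /valid_ref /elt /kr /evec -/m; case: ifP => r1 h; last by case/andP: h => _ h; rewrite /col sfE.
  rewrite [LHS]/= mul1r (nth_map 0%N) ?size_iota ?ltn_ord // nth_iota ?ltn_ord // add0n /edgec.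
  have e x : (x < m)%N -> (q == inord x) = (val q == x) by move=> xm; rewrite -val_eqE /= inordK.
  rewrite !e //; case: (_ == r.1); case: (_ == r.2) => /=; rewrite ?addr0 ?add0r //.
  exact: addrr_pchar2.
(* Distinct references name distinct elements because no two vectors of the certificate are
   proportional. *)
have elt_inj : {in [pred r | valid_ref c r] &, injective elt}.
  move=> [x y] [x' y']; rewrite !inE /valid_ref /elt /=.
  case: ifP => hx hy; case: ifP => hx' hy' //.
    move=> [/(congr1 val) /= e1 /(congr1 val) /= e2]; move: e1 e2; rewrite !inordK // => -> -> //.
  move=> [es]; case/andP: hy => /eqP-> yW; case/andP: hy' => /eqP-> yW'; congr (_, _).
  apply/eqP; apply: contraT => ny.
  have iW z : (z < size (mc_W c))%N -> z \in iota 0 (size (mc_W c)) by rewrite mem_iota.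
  have /allP/(_ _ (iW _ yW')) := Wnp _ (iW _ yW); rewrite (negPf ny) /= => /andP[n1 /andP[n2 /andP[n3 _]]].
  have inj4 x1 x2 : ph x1 = ph x2 -> x1 = x2.
    move=> e; apply/eqP; have : ph (add4 x1 x2) == 0 by rewrite phiD e addrr_pchar2.
    by rewrite (phi_eq0 ha); case: x1 {e} => -[] []; case: x2 => -[] [].
  have [k kE] := hF (kf y / kf y').
  have k0 : k != o4 by rewrite -(phi_eq0 ha) -kE mulf_neq0 ?invr_eq0 ?kf0.
  have e : map (mul4 k) (nth [::] (mc_W c) y) = nth [::] (mc_W c) y'.
    have s1 : size (nth [::] (mc_W c) y) = m by apply/eqP/Wsz/mem_nth.
    have s2 : size (nth [::] (mc_W c) y') = m by apply/eqP/Wsz/mem_nth.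
    apply: (@eq_from_nth _ o4); first by rewrite size_map s1 s2.
    rewrite size_map s1 => i im; rewrite (nth_map o4) ?s1 //; apply: inj4; rewrite phiM -kE.
    have := sfE yW (Ordinal im); rewrite es (sfE yW') /= => h.
    by apply: (mulfI (kf0 yW')); rewrite h mulrA [kf y' * _]mulrC divfK ?kf0.
  by move: k0 n1 n2 n3; rewrite -e; case: (k) => -[] [] //=; rewrite ?eqxx.
pose G j := nth (0, 0)%N (mc_G c) j.
have Gmem (j : 'I_T.2) : G j \in mc_G c by rewrite mem_nth ?szG.
have Gval (j : 'I_T.2) : valid_ref c (G j) by apply: valC; rewrite mem_cat Gmem orbT.
have Cval r : r \in mc_C c -> valid_ref c r by move=> rC; apply: valC; rewrite mem_cat rC.
have [uC [dCG uG]] : uniq (mc_C c) /\ ~~ has (mem (mc_C c)) (mc_G c) /\ uniq (mc_G c).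
  by move: uq; rewrite cat_uniq => /and3P[].
have evE (th : 'I_m -> F) r : valid_ref c r ->
    \sum_q th q * col q (elt r) = kr r * \sum_q th q * ph (nth o4 (evec c r) q).
  by move=> vr; rewrite mulr_sumr; apply: eq_bigr => q _; rewrite colE // mulrCA.
have thdot (ga : 'I_3 -> F) (x : seq g4) :
    \sum_(q < m) (\sum_(t < 3) ga t * ph (nth o4 (nth [::] (mc_th c) t) q)) * ph (nth o4 x q)
    = \sum_(t < 3) ga t * ph (dot4 m (nth [::] (mc_th c) t) x).
  under eq_bigr do rewrite mulr_suml; rewrite exchange_big /=; apply: eq_bigr => t _.
  by rewrite phi_dot mulr_sumr; apply: eq_bigr => q _; rewrite mulrA.
have i3 (t : 'I_3) : val t \in iota 0 3 by rewrite mem_iota; exact: ltn_ord.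
have GTj (j : 'I_T.2) : dot4 m (ones4 m) (evec c (G j)) = o4 /\ forall t : 'I_3,
    ent4 T.1 t j = mul4 (nth o4 (mc_S c) j) (dot4 m (nth [::] (mc_th c) t) (evec c (G j))).
  have jT : val j \in iota 0 T.2 by rewrite mem_iota; exact: ltn_ord.
  by have /andP[/eqP h1 /allP h2] := GT _ jT; split=> // t; apply/eqP/(h2 (val t) (i3 t)).
apply: (@rminor_has_minor F (KW w pi) (rmx (fun (i : 'I_3) (j : 'I_T.2) => (nth [::] (map (map ph) T.1) i)`_j))
  (fun j : 'I_T.2 => elt (G j)) (fun j => ph (nth o4 (mc_S c) j) / kr (G j))
  [set e | e \in map elt (mc_C c)]); split.
- move=> j k /elt_inj; rewrite !inE => /(_ (Gval j) (Gval k)) /eqP.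
  by rewrite nth_uniq ?szG // => /eqP/val_inj.
- move=> j; rewrite inE; apply/negP=> /mapP[r rC /elt_inj]; rewrite !inE => /(_ (Gval j) (Cval _ rC)) e.
  by case/hasP: dCG; exists (G j) => //=; rewrite e.
- move=> j; rewrite mulf_neq0 ?invr_eq0 ?kr0 ?Gval // (phi_eq0 ha).
  by apply: S0; rewrite mem_nth // szS.
move=> v; split=> [/mem_rmx[ga vE]|[u [/mem_rmx[th uE] u0 vE]]].
  pose th (q : 'I_m) := \sum_(t < 3) ga t * ph (nth o4 (nth [::] (mc_th c) t) q).
  exists [ffun e => \sum_q th q * col q e]; split=> [|e|j].
  - by apply/mem_rmx; exists th => e; rewrite ffunE.
  - rewrite inE ffunE => /mapP[r rC ->]; rewrite evE ?Cval // thdot big1 ?mulr0 // => t _.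
    by have /allP/(_ _ (i3 t))/eqP-> := thC r rC; rewrite ph0 mulr0.
  rewrite ffunE evE ?Gval // thdot mulrA divfK ?kr0 ?Gval // vE mulr_sumr; apply: eq_bigr => t _.
  by rewrite phi_ent; have [_ ->] := GTj j; rewrite phiM mulrCA.
have uE' e : u e = \sum_q th q * col q e by exact: uE.
pose D k := \sum_(q < m) th q * ph (nth o4 (nth [::] (mc_d c) k) q).
have thE (q : 'I_m) : th q = D 0%N + \sum_(t < 3) D t.+1 * ph (nth o4 (nth [::] (mc_th c) t) q).
  have qm (x : 'I_m) : val x \in iota 0 m by rewrite mem_iota; exact: ltn_ord.
  transitivity (\sum_(q' < m) th q' * ph (if val q == val q' then i4 else o4)).
    rewrite (bigD1 q) //= eqxx mulr1 big1 ?addr0 // => q' nq; rewrite ifN ?mulr0 //.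
    by rewrite eq_sym.
  have E (q' : 'I_m) := eqP (allP (idt _ (qm q)) _ (qm q')).
  under eq_bigr do rewrite E !phiD !phi_foldr !big_map !mulrDr.
  rewrite !big_split /=; congr (_ + _); rewrite [X in _ + X](_ : _ = 0) ?addr0.
    have hD k y : \sum_(i < m) th i * ph (mul4 (nth o4 (nth [::] (mc_d c) k) i) y) = D k * ph y.
      by rewrite /D mulr_suml; apply: eq_bigr => i _; rewrite phiM mulrA.
    rewrite !hD [X in _ + (_ + (_ + X))]big1 ?addr0 => [|i _]; last by rewrite ph0 mulr0.
    by rewrite !big_ord_recl big_ord0 addr0.
  under eq_bigr do rewrite mulr_sumr; rewrite exchange_big /= big_seq big1 // => k; rewrite mem_iota /= => kC.
  under eq_bigr do rewrite phiM mulrA; rewrite -mulr_suml.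
  have rC : nth (0, 0)%N (mc_C c) k \in mc_C c by rewrite mem_nth.
  have := u0 (elt (nth (0, 0)%N (mc_C c) k)); rewrite inE map_f // uE' evE ?Cval // => /(_ isT)/eqP.
  by rewrite mulf_eq0 (negPf (kr0 _ (Cval _ rC))) => /eqP->; rewrite mul0r.
apply/mem_rmx; exists (fun t : 'I_3 => D t.+1) => j.
rewrite vE uE' evE ?Gval // mulrA divfK ?kr0 ?Gval //.
transitivity (ph (nth o4 (mc_S c) j) * \sum_(t < 3) D t.+1 * ph (dot4 m (nth [::] (mc_th c) t) (evec c (G j)))).
  congr (_ * _); rewrite -thdot; under eq_bigr do rewrite thE mulrDl; rewrite big_split /= -mulr_sumr.
  have -> : \sum_(q < m) ph (nth o4 (evec c (G j)) q) = 0; last by rewrite mulr0 add0r.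
  have [h _] := GTj j; have := phi_dot m (ones4 m) (evec c (G j)); rewrite h ph0 => e.
  rewrite [RHS]e; apply: eq_bigr => q _; rewrite nth_nseq ltn_ord mul1r //.
rewrite mulr_sumr; apply: eq_bigr => t _; rewrite phi_ent; have [_ ->] := GTj j.
by rewrite phiM mulrCA.
Qed.

End Cert.

(** * Shapes of a single vector and their enumeration *)

Variables (V I : finType) (w : I -> V -> F).
Hypothesis sum0 : forall s, \sum_v w s v = 0.
Hypothesis adm : forall m (pi : V -> 'I_m) T, T \in targets ->
  ~ has_minor (under (KW w pi)) (cmat a T.1 3 T.2).

(** For [v] outside [l] the index is [size l], so a pattern not longer than [l] gives the default 0
    there. *)
Definition vprop (s : I) (l : seq V) (t : seq g4) : Prop :=
  exists2 k : F, k != 0 & forall v, w s v = k * ph (nth o4 t (index v l)).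

Lemma mc_false c (pi : V -> 'I_(mc_m c).+1) (sf : nat -> I) (kf : nat -> F) : mc_ok c ->
  (forall i, (i < size (mc_W c))%N -> kf i != 0) ->
  (forall i, (i < size (mc_W c))%N ->
     forall q, merge w pi (sf i) q = kf i * ph (nth o4 (nth [::] (mc_W c) i) q)) -> False.
Proof.
move=> ok k0 sE; apply: (adm (pi := pi) (T := nth (F7c, 7%N) targets (mc_T c))).
  have [lt|ge] := ltnP (mc_T c) (size targets); first exact: mem_nth.
  by rewrite nth_default // mem_head.
exact: (@cert_minor c ok V I w pi sf kf k0 sE).
Qed.

(** Vertices outside [l] go to vertex 0 by the default of [nth]; this is harmless, as the pattern is
    0 there. *)
Lemma merge_labels (l : seq V) (t : seq g4) (mu : seq nat) m (q : 'I_m.+1) : uniq l ->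
  size mu = size l -> (size t <= size l)%N -> all (fun x => x <= m)%N mu ->
  \sum_(v | inord (nth 0%N mu (index v l)) == q) ph (nth o4 t (index v l))
    = ph (nth o4 (mrg m.+1 mu t) q).
Proof.
move=> ul sm st mum.
rewrite (nth_map 0%N) ?size_iota ?ltn_ord // nth_iota ?ltn_ord // add0n phi_foldr big_map big_filter.
rewrite big_mkcond (bigID (mem l)) /= [X in _ + X]big1 ?addr0 => [|v vl]; last first.
  by rewrite (memNindex vl) (nth_default _ st) ph0 if_same.
rewrite -big_uniq //= sm; case: (l) ul st sm => [|v0 l1] ul st sm; first by rewrite !big_nil.
rewrite (big_nth v0) [RHS]big_mkcond.
have -> : iota 0 (size (v0 :: l1)) = index_iota 0 (size (v0 :: l1)) by rewrite /index_iota subn0.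
rewrite !big_mkord.
apply: eq_bigr => i _; rewrite index_uniq //.
have nm : (nth 0%N mu i <= m)%N by apply: (allP mum); rewrite mem_nth // sm.
by rewrite -val_eqE /= inordK.
Qed.

Lemma okbad_false certs (l : seq V) ps wt : all mc_ok certs -> uniq l ->
  (forall t, t \in ps -> exists s, vprop s l t) -> okbad certs (size l) ps wt -> False.
Proof.
case: wt => -[eid mu] rows hc ul hp /and5P[lte /eqP smu mum r0 /andP[/eqP sr /allP hr]].
set c := nth mcert0 certs eid in mum sr hr.
have okc : mc_ok c by exact: (all_nthP mcert0 hc).
have hr' i : (i < size rows)%N -> exists s, exists2 k, k != 0 & forall q : 'I_(mc_m c).+1,
    merge w (fun v => inord (nth 0%N mu (index v l))) s q = k * ph (nth o4 (nth [::] (mc_W c) i) q).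
  move=> ir; have := hr i; rewrite mem_iota => /(_ ir); set rc := nth _ rows i.
  move=> /and4P[lt1 c0 sz /eqP <-]; have [|s [k k0 sE]] := hp (nth [::] ps rc.1); first exact: mem_nth.
  have pc0 : ph rc.2 != 0 by rewrite (phi_eq0 ha).
  exists s, (k / ph rc.2); first by rewrite mulf_neq0 ?invr_eq0.
  move=> q; rewrite (nth_map o4) ?size_map ?size_iota ?ltn_ord // phiM mulrA divfK //.
  rewrite -(merge_labels q ul smu sz mum) /merge mulr_sumr.
  by apply: eq_bigr => v _; rewrite sE.
have [s0 _] := hr' 0%N r0.
have /fin_all_exists[sk skE] : forall i : 'I_(size rows), exists sk : I * F, sk.2 != 0 /\
    forall q : 'I_(mc_m c).+1, merge w (fun v => inord (nth 0%N mu (index v l))) sk.1 q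
      = sk.2 * ph (nth o4 (nth [::] (mc_W c) i) q).
  by move=> i; have [s [k k0 h]] := hr' i (ltn_ord i); exists (s, k).
pose z i := sk (insubd (Ordinal r0) i).
have zE i : (i < size (mc_W c))%N -> val (insubd (Ordinal r0) i) = i by rewrite -sr val_insubd => ->.
apply: (@mc_false c (fun v => inord (nth 0%N mu (index v l))) (fun i => (z i).1) (fun i => (z i).2) okc) => i iW.
  by have [] := skE (insubd (Ordinal r0) i).
by move=> q; have [_ ->] := skE (insubd (Ordinal r0) i); rewrite zE.
Qed.

Definition cnt (U : {set V}) (x : V -> g4) (c : g4) : nat := #|[set v | (v \notin U) && (x v == c)]|.

Lemma cntS (U : {set V}) (x : V -> g4) (c : g4) (v0 : V) : v0 \notin U -> cnt U x c = ((x v0 == c) + cnt (v0 |: U) x c)%N.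
Proof.
move=> vU; rewrite /cnt (cardsD1 v0) inE vU /=; congr (_ + _)%N; apply: eq_card => v.
by rewrite !inE negb_or andbA.
Qed.

(** The set [U] holds the vertices already treated, and the counts refer to the others. The list
    [l'] names the remaining nonzero vertices in the order in which [gen] appends fresh entries. *)
Lemma gen_sound x l : forall U : {set V}, uniq l -> (forall v, v \in l -> v \notin U) ->
  exists l', [/\ uniq (l ++ l'), forall v, v \in l' -> v \notin U,
    map x (l ++ l') \in gen (size l) (cnt U x i4) (cnt U x a4) (cnt U x b4)
    & forall v, v \notin U -> v \notin l ++ l' -> x v = o4].
Proof.
have map_in (U : {set V}) (c : g4) : map x (enum [set v | (v \notin U) && (x v == c)]) = nseq (cnt U x c) c.
  have -> : cnt U x c = size (map x (enum [set v | (v \notin U) && (x v == c)])) by rewrite size_map -cardE.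
  apply/all_pred1P/allP=> _ /mapP[v + ->]; rewrite mem_enum inE => /andP[_ h]; exact: h.
elim: l => [|v0 l IH] U ul lU.
  pose A c := enum [set v | (v \notin U) && (x v == c)].
  have Av c v : v \in A c -> x v = c by rewrite mem_enum inE => /andP[_ /eqP].
  exists (A i4 ++ A a4 ++ A b4); split=> /=.
  - rewrite !cat_uniq !enum_uniq /= andbT; apply/andP; split; apply/hasPn=> v.
      by rewrite mem_cat => /orP[]/Av e; apply/negP=> /Av; rewrite e.
    by move=> /Av e; apply/negP=> /Av; rewrite e.
  - by move=> v; rewrite !mem_cat !mem_enum !inE => /or3P[]/andP[].
  - by rewrite !map_cat !map_in inE.
  move=> v vU; rewrite !mem_cat !mem_enum !inE vU /= !negb_or.
  by case: (x v) => -[] [].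
have vU : v0 \notin U by apply: lU; rewrite mem_head.
case/andP: ul => v0l ul.
have [|l' [u' lU' m' o']] := IH (v0 |: U) ul.
  move=> v vl; rewrite !inE negb_or lU ?inE ?vl ?orbT // andbT.
  by apply: contraNneq v0l => <-.
exists l'; split.
- rewrite cat_cons cons_uniq u' andbT mem_cat negb_or v0l /=.
  by apply/negP=> /lU'; rewrite !inE eqxx.
- by move=> v /lU'; rewrite !inE negb_or => /andP[].
- rewrite cat_cons map_cons !(cntS _ _ vU); move: m'; set n1 := cnt _ _ i4; set n2 := cnt _ _ a4; set n3 := cnt _ _ b4.
  move=> m'; rewrite [gen _ _ _ _]/= !mem_cat.
  case: (x v0) => -[] [] /=; rewrite ?add0n ?add1n;
    by rewrite (map_f (cons _) m') ?orbT.
move=> v vU'; rewrite cat_cons inE negb_or => /andP[vv0 vl]; apply: o' => //.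
by rewrite !inE negb_or vv0.
Qed.

Definition special (s : I) : Prop := exists (k : F) (x : V -> g4),
  [/\ k != 0, forall v, w s v = k * ph (x v) &
      [/\ cnt set0 x i4 = 1, cnt set0 x a4 = 1 & cnt set0 x b4 = 1]%N \/
      [/\ cnt set0 x i4 = 2, cnt set0 x a4 = 2 & cnt set0 x b4 = 0]%N].

Lemma nth_index_map (x : V -> g4) (l : seq V) v : (forall v, v \notin l -> x v = o4) ->
  nth o4 (map x l) (index v l) = x v.
Proof.
move=> h; have [vl|vl] := boolP (v \in l); last by rewrite h // nth_default ?size_map ?memNindex.
by rewrite (nth_map v) ?index_mem // nth_index.
Qed.

Lemma gen_zeros m n1 n2 n3 : nseq m o4 ++ nseq n1 i4 ++ nseq n2 a4 ++ nseq n3 b4 \in gen m n1 n2 n3.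
Proof. by elim: m => [|m IH] /=; rewrite ?inE // mem_cat (map_f (cons o4) IH). Qed.

Definition inv4 (x : g4) : g4 := if x == a4 then b4 else if x == b4 then a4 else x.

Lemma mul4K h z : h != o4 -> mul4 h (mul4 (inv4 h) z) = z.
Proof. by case: h => -[] [] //; case: z => -[] []. Qed.

(** For the shape 1, a, a^2 the first nonzero entry along [l] is scaled to 1. If the vector vanishes
    on [l], its three vertices are named in the order 1, a, a^2 instead. *)
Lemma special_type s (l : seq V) : uniq l -> special s ->
  exists2 u, u \in types (size l) & exists l', [/\ uniq (l ++ l'), size u = size (l ++ l') & vprop s (l ++ l') u].
Proof.
move=> ul [k [x [k0 wx cx]]].
have done_ (k' : F) (x' : V -> g4) l' : k' != 0 -> (forall v, w s v = k' * ph (x' v)) ->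
    uniq (l ++ l') -> (forall v, v \notin l ++ l' -> x' v = o4) -> map x' (l ++ l') \in types (size l) ->
    exists2 u, u \in types (size l) & exists l', [/\ uniq (l ++ l'), size u = size (l ++ l') & vprop s (l ++ l') u].
  move=> k'0 wx' ul' out tt; exists (map x' (l ++ l')) => //; exists l'; split=> //; first by rewrite size_map.
  by exists k' => // v; rewrite nth_index_map.
have n0 v : v \in l -> v \notin (set0 : {set V}) by rewrite inE.
case: cx => [[c1 c2 c3]|[c1 c2 c3]]; last first.
  have [l' [ul' _ tl' out]] := gen_sound x ul n0.
  apply: (done_ k x l') => // [v|]; first by apply: out; rewrite inE.
  by rewrite mem_cat; apply/orP; right; rewrite c1 c2 c3 in tl'.
have [/hasP[v1 v1l xv1]|nh] := boolP (has (fun v => x v != o4) l).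
  pose y := nth v1 [seq v <- l | x v != o4] 0; pose h := x y.
  have yl : y \in [seq v <- l | x v != o4].
    by rewrite mem_nth // size_filter -has_count; apply/hasP; exists v1.
  have h0 : h != o4 by move: yl; rewrite mem_filter => /andP[].
  pose x' v := mul4 (inv4 h) (x v).
  have x'0 v : (x' v != o4) = (x v != o4).
    by rewrite /x'; case: (h) h0 => -[] [] //; case: (x v) => -[] [].
  have cx' c : c != o4 -> cnt set0 x' c = 1%N.
    move=> cn; transitivity (cnt set0 x (mul4 h c)).
      apply: eq_card => v; rewrite !inE /= /x'.
      by case: (h) h0 => -[] [] //; case: (c) => -[] []; case: (x v) => -[] [].
    by case: (h) h0 => -[] [] // _; case: (c) cn => -[] [] // _; rewrite -/o4 -/i4 -/a4 -/b4.
  have [l' [ul' _ tl' out]] := gen_sound x' ul n0.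
  apply: (done_ (k * ph h) x' l') => //.
  - by rewrite mulf_neq0 // (phi_eq0 ha).
  - by move=> v; rewrite wx -mulrA -phiM mul4K.
  - by move=> v; apply: out; rewrite inE.
  rewrite !cx' // in tl'; rewrite mem_cat; apply/orP; left; rewrite mem_filter tl' andbT.
  rewrite /firstnz filter_map (eq_filter (a2 := fun v => x v != o4)) // filter_cat map_cat nth_cat size_map.
  have pl : (0 < size [seq v <- l | x v != o4])%N by rewrite size_filter -has_count; apply/hasP; exists v1.
  rewrite pl (nth_map v1) // -/y /x' -/h.
  by case: (h) h0 => -[] [].
have l0 v : v \in l -> x v = o4.
  by move=> vl; apply/eqP; apply: contraR nh => nv; apply/hasP; exists v.
have get c : cnt set0 x c = 1%N -> exists v, forall v', (x v' == c) = (v' == v).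
  move=> /eqP/cards1P[v /setP e]; exists v => v'; have := e v'; by rewrite !inE.
have [v1 e1] := get _ c1; have [v2 e2] := get _ c2; have [v3 e3] := get _ c3.
have x1 : x v1 = i4 by apply/eqP; rewrite e1.
have x2 : x v2 = a4 by apply/eqP; rewrite e2.
have x3 : x v3 = b4 by apply/eqP; rewrite e3.
apply: (done_ k x [:: v1; v2; v3]) => //.
- have nl v : x v != o4 -> v \notin l by apply: contra => /l0->.
  have ne v v' : x v != x v' -> v != v' by apply: contra => /eqP->.
  by rewrite cat_uniq ul /= !inE !negb_or !nl ?x1 ?x2 ?x3 //= !ne ?x1 ?x2 ?x3.
- move=> v; rewrite mem_cat !inE !negb_or => /and4P[_ n1 n2 n3].
  by move: (e1 v) (e2 v) (e3 v); rewrite (negPf n1) (negPf n2) (negPf n3); case: (x v) => -[] [].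
have mx : map x (l ++ [:: v1; v2; v3]) = nseq (size l) o4 ++ [:: i4; a4; b4].
  rewrite map_cat /= x1 x2 x3; congr (_ ++ _); rewrite -(size_map x).
  by apply/all_pred1P/allP=> _ /mapP[v /l0-> ->] /=.
rewrite mx mem_cat mem_filter (gen_zeros (size l) 1 1 1) andbT.
have -> : firstnz (nseq (size l) o4 ++ [:: i4; a4; b4]) = i4; last by [].
by rewrite /firstnz filter_cat; elim: (size l).
Qed.

(** K_4 together with the all-ones vector is the Fano plane. Three equal entries suffice: in
    characteristic 2 the sum 0 forces the fourth. *)
Lemma bad1111 s c (pi : V -> 'I_4) (ka : F) : mc_ok c -> mc_m c = 3%N ->
  mc_W c = [:: [:: i4; i4; i4; i4]] -> ka != 0 ->
  (forall q : 'I_4, (q < 3)%N -> merge w pi s q = ka) -> False.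
Proof.
move=> ok m3 W1 k0 h.
have h3 : merge w pi s ord_max = ka.
  have : \sum_q merge w pi s q = 0.
    by rewrite -[RHS](sum0 s) [RHS](partition_big pi predT).
  rewrite big_ord_recr /= (eq_bigr (fun=> ka)); last by move=> q _; apply: h; rewrite /= ltn_ord.
  rewrite sumr_const card_ord !mulrS mulr0n addr0 addrA addrr_pchar2 // add0r => /eqP.
  by rewrite addr_eq0 oppr_pchar2 // => /eqP.
have hq q : merge w pi s q = ka.
  have [q3|q3] := ltnP q 3; first exact: h.
  by rewrite -h3; congr (merge w pi s _); apply: val_inj; apply/eqP; rewrite eqn_leq q3 -ltnS ltn_ord.
case: c ok m3 W1 => m W C G S T th d g ok /= m3 W1; subst m W.
apply: (@mc_false (MCert 3 [:: [:: i4; i4; i4; i4]] C G S T th d g) pi (fun=> s) (fun=> ka) ok) => //= -[|i] // _ q.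
by rewrite hq; case: q => -[|[|[|[|]]]] //= ?; rewrite mulr1.
Qed.

Lemma cntE (x : V -> g4) (c : g4) : cnt set0 x c = (\sum_v (x v == c))%N.
Proof.
rewrite /cnt -sum1_card big_mkcond; apply: eq_bigr => v _; rewrite !inE /=.
by case: (x v == c).
Qed.

(** No nonzero value occurs three times, by keeping three such vertices apart, merging all others
    and applying [bad1111]. The sum 0 gives the numbers of entries 1, a, a^2 the same parity; this
    leaves the listed shapes and two entries of each value. *)
Lemma vector_cases s c : mc_ok c -> mc_m c = 3%N -> mc_W c = [:: [:: i4; i4; i4; i4]] ->
  [\/ forall v, w s v = 0,
      exists k p q, k != 0 /\ forall v, w s v = k * ((v == p)%:R + (v == q)%:R) | special s].
Proof.
move=> ok m3 W1.
have /fin_all_exists[x xE] : forall v, exists y, w s v = ph y by move=> v; exact: hF.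
pose n c := cnt set0 x c.
have setn z : [set v | (v \notin set0) && (x v == z)] = [set v | x v == z].
  by apply/setP=> v; rewrite !inE.
have le2 z : z != o4 -> (n z <= 2)%N.
  move=> z0; rewrite leqNgt; apply/negP; rewrite /n /cnt setn => /card_gt2P[p [q [r [[]]]]].
  rewrite !inE => /eqP xp /eqP xq /eqP xr [npq nqr nrp].
  pose pi v : 'I_4 := inord (if v == p then 0 else if v == q then 1 else if v == r then 2 else 3).
  apply: (@bad1111 s c pi (ph z) ok m3 W1); first by rewrite (phi_eq0 ha).
  move=> i i3; rewrite /merge.
  have ms y (j : nat) : (j < 3)%N -> val i = j -> x y = z -> (forall v, (pi v == i) = (v == y)) ->
      \sum_(v | pi v == i) w s v = ph z.
    by move=> _ _ xy e; rewrite (eq_bigl _ _ e) big_pred1_eq xE xy.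
  have pv v : (pi v == i) = ((if v == p then 0 else if v == q then 1 else if v == r then 2 else 3)%N == i).
    by rewrite -val_eqE /= inordK //; case: (v == p); case: (v == q); case: (v == r).
  case iE: (val i) i3 => [|[|[|]]] // _.
  - apply: (ms p 0%N) => // v; rewrite pv iE; by case: (v == p); case: (v == q); case: (v == r).
  - apply: (ms q 1%N) => // v; rewrite pv iE; case: (eqVneq v p) => [->|_]; first by rewrite (negPf npq).
    by case: (v == q); case: (v == r).
  apply: (ms r 2%N) => // v; rewrite pv iE; case: (eqVneq v p) => [->|_].
    by rewrite [p == r]eq_sym (negPf nrp).
  by case: (eqVneq v q) => [->|_]; [rewrite (negPf nqr) | case: (v == r)].
have [ev1 ev2] : ~~ odd (n i4 + n b4) /\ ~~ odd (n a4 + n b4).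
  have N1 : (n i4 + n b4 = \sum_v (x v).1)%N.
    by rewrite /n !cntE -big_split; apply: eq_bigr => v _; case: (x v) => -[] [].
  have N2 : (n a4 + n b4 = \sum_v (x v).2)%N.
    by rewrite /n !cntE -big_split; apply: eq_bigr => v _; case: (x v) => -[] [].
  have : zev a (((n i4 + n b4)%N : int), ((n a4 + n b4)%N : int)) = 0.
    rewrite -[RHS](sum0 s) /zev /= N1 N2 -!pmulrn !natr_sum mulr_suml -big_split; apply: eq_bigr => v _.
    rewrite xE; case: (x v) => -[] []; rewrite /phi /= ?mul1r ?mul0r ?addr0 ?add0r //.
    by rewrite ha addrC.
  rewrite zev_red //= => h; have : ph (odd (n i4 + n b4), odd (n a4 + n b4)) == 0.
    rewrite -[X in _ == X]h; case: (odd (n i4 + n b4)); case: (odd (n a4 + n b4)); rewrite /phi /= ?mul1r ?mul0r ?addr0 ?add0r //.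
    by rewrite ha addrC.
  by rewrite (phi_eq0 ha) => /eqP[-> ->].
have edge z : z != o4 -> n z = 2%N -> (forall z', z' != z -> z' != o4 -> n z' = 0%N) ->
    exists k p q, k != 0 /\ forall v, w s v = k * ((v == p)%:R + (v == q)%:R).
  rewrite /n /cnt => z0; rewrite setn => /eqP/cards2P[p [q [npq /setP e]]] h0.
  exists (ph z), p, q; split; first by rewrite (phi_eq0 ha).
  move=> v; rewrite xE; have := e v; rewrite !inE.
  have [->|nz] := eqVneq (x v) z.
    case: (eqVneq v p) => [->|_]; first by rewrite (negPf npq) addr0 mulr1.
    by case: (eqVneq v q) => // _; rewrite add0r mulr1.
  case: (v == p) => //; case: (v == q) => // _; rewrite addr0 mulr0.
  have [->//|xv0] := eqVneq (x v) o4.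
  have /eqP := h0 _ nz xv0; rewrite cards_eq0 => /eqP/setP/(_ v); rewrite !inE eqxx.
  by [].
have t4 h : h != o4 -> cnt set0 (fun v => mul4 (inv4 h) (x v)) i4 = 2%N ->
    cnt set0 (fun v => mul4 (inv4 h) (x v)) a4 = 2%N -> cnt set0 (fun v => mul4 (inv4 h) (x v)) b4 = 0%N -> special s.
  move=> h0 c1 c2 c3; exists (ph h), (fun v => mul4 (inv4 h) (x v)); split; last by right.
    by rewrite (phi_eq0 ha).
  by move=> v; rewrite -phiM mul4K.
have cm h z : h != o4 -> cnt set0 (fun v => mul4 (inv4 h) (x v)) z = n (mul4 h z).
  move=> h0; apply: eq_card => v; rewrite !inE /=.
  by case: (h) h0 => -[] [] //; case: (z) => -[] []; case: (x v) => -[] [].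
have := le2 i4 isT; have := le2 a4 isT; have := le2 b4 isT.
case E1: (n i4) ev1 => [|[|[|]]] // ev1; case E2: (n a4) ev2 => [|[|[|]]] // ev2;
  case E3: (n b4) ev1 ev2 => [|[|[|]]] // _ _ _ _ _.
- constructor 1 => v; rewrite xE.
  have nn z : z != o4 -> n z = 0%N by case: z => -[] [].
  have [->//|nv] := eqVneq (x v) o4.
  have /eqP := nn _ nv; rewrite /n /cnt setn cards_eq0 => /eqP/setP/(_ v).
  by rewrite !inE eqxx.
- by constructor 2; apply: (edge b4) => // -[[] []].
- by constructor 2; apply: (edge a4) => // -[[] []].
- by constructor 3; apply: (t4 a4); rewrite ?cm.
- constructor 3; exists 1, x; split=> [||]; [exact: oner_neq0 | by move=> v; rewrite mul1r | by left].
- by constructor 2; apply: (edge i4) => // -[[] []].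
- by constructor 3; apply: (t4 b4); rewrite ?cm.
- by constructor 3; apply: (t4 i4); rewrite ?cm.
(* Two entries of each value: two vertices of value 1 stay apart, and one of value a is merged with
   one of value a^2, as a + a^2 = 1. Again three entries are equal. *)
exfalso; move: E1 E2 E3; rewrite /n /cnt !setn.
move=> /eqP/cards2P[p1 [p2 [np /setP ep]]] /eqP/cards2P[q1 [q2 [nq /setP eq_]]] /eqP/cards2P[r1 [r2 [nr /setP er]]].
pose pi v : 'I_4 := inord (if v == p1 then 0 else if v == p2 then 1 else if (v == q1) || (v == r1) then 2 else 3).
have xs (S : {set V}) z : [set v | x v == z] =i S -> forall v, v \in S -> x v = z.
  by move=> e v; rewrite -e inE => /eqP.
have xp1 : x p1 = i4 by apply: (xs _ _ ep); rewrite !inE eqxx.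
have xp2 : x p2 = i4 by apply: (xs _ _ ep); rewrite !inE eqxx orbT.
have xq1 : x q1 = a4 by apply: (xs _ _ eq_); rewrite !inE eqxx.
have xr1 : x r1 = b4 by apply: (xs _ _ er); rewrite !inE eqxx.
have ne v v' : x v != x v' -> (v == v') = false by move=> h; apply/negbTE; apply: contra h => /eqP->.
apply: (@bad1111 s c pi 1 ok m3 W1 (oner_neq0 _)) => i i3; rewrite /merge.
have pv v : (pi v == i) = ((if v == p1 then 0 else if v == p2 then 1 else if (v == q1) || (v == r1) then 2 else 3)%N == i).
  by rewrite -val_eqE /= inordK //; case: (v == p1); case: (v == p2); case: (v == q1); case: (v == r1).
case iE: (val i) i3 => [|[|[|]]] // _.
- rewrite (eq_bigl (pred1 p1)) ?big_pred1_eq ?xE ?xp1 // => v; rewrite pv iE /=.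
  by case: (v == p1); case: (v == p2); case: (v == q1); case: (v == r1).
- rewrite (eq_bigl (pred1 p2)) ?big_pred1_eq ?xE ?xp2 // => v; rewrite pv iE /=.
  case: (eqVneq v p1) => [->|_]; first by rewrite (negPf np).
  by case: (v == p2); case: (v == q1); case: (v == r1).
rewrite (eq_bigl (fun v => (v == q1) || (v == r1))) => [|v]; last first.
  rewrite pv iE /=; case: (eqVneq v p1) => [->|_]; first by rewrite !ne ?xp1 ?xq1 ?xr1.
  case: (eqVneq v p2) => [->|_]; first by rewrite !ne ?xp2 ?xq1 ?xr1.
  by case: ifP.
rewrite (bigD1 q1) ?eqxx //= (eq_bigl (pred1 r1)) ?big_pred1_eq => [|v]; last first.
  rewrite /=; case: (eqVneq v q1) => [->|_]; rewrite ?andbT ?andbF //=.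
  by rewrite ne // xq1 xr1.
by rewrite !xE xq1 xr1 -phiD.
Qed.

Lemma zev_phi (b : F) p : b ^+ 2 = b + 1 -> zev b p = phi b (zred p).
Proof.
move=> hb; rewrite zev_red // /zred /phi /=.
by case: (odd _); case: (odd _); rewrite ?mul1r ?mul0r ?addr0 ?add0r // hb addrC.
Qed.

Lemma phi_conj4 x : phi (a ^+ 2) (conj4 x) = ph x.
Proof.
have a4 : (a ^+ 2) ^+ 2 = a.
  by rewrite {1}ha sqrrD ha mulr1 expr1n mulr2n (addrr_pchar2 ch) addr0 -addrA (addrr_pchar2 ch) addr0.
by case: x => -[] []; rewrite /phi /=.
Qed.

(** * Soundness of the search tree *)

Section Nodes.

Variables (R : realType) (zfams : seq (nat * seq (seq z2) * seq (seq z2))).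
Variables (certs : seq mcert) (tab : trie bentry) (nodes : seq node) (c1 : mcert) (spare : seq V).
Definition fred (f : nat * seq (seq z2) * seq (seq z2)) : family :=
  (f.1.1, map (map zred) f.1.2, map (map zred) f.2).
Hypothesis fams_ok : all (fun f => fam_ok f.1.1 f.1.2 f.2) zfams.
Hypothesis certs_ok : all mc_ok certs.
Hypotheses (c1_ok : mc_ok c1) (c1_m : mc_m c1 = 3%N) (c1_W : mc_W c1 = [:: [:: i4; i4; i4; i4]]).
Hypothesis nodes_ok : all (check_node (map fred zfams) certs tab nodes) (iota 0 (size nodes)).
Hypotheses (spare_uniq : uniq spare) (spare_size : (12 <= size spare)%N).
Hypothesis spare0 : forall v, v \in spare -> forall s, w s v = 0.

(** The named vertices [l] are extended in two ways: by [l'], the fresh vertices of the vector, and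
    by [z], spare vertices that serve as core places beyond [l] and on which the vector vanishes. *)
Lemma infam_sound (f : nat * seq (seq z2) * seq (seq z2)) (cj : bool) e0 emb (l l' z : seq V) u s v0 :
  fam_ok f.1.1 f.1.2 f.2 -> uniq (l ++ l') -> uniq (l ++ z) -> (forall v, v \in z -> w s v = 0) ->
  size emb = f.1.1 -> all (fun e => e < size (l ++ z))%N (e0 :: emb) ->
  size u = size (l ++ l') -> vprop s (l ++ l') u ->
  infam (fred f) cj (e0 :: emb) (size l) u ->
  fam_vec f.1.2 f.2 (nth v0 (l ++ z) e0) [seq nth v0 (l ++ z) e | e <- emb]
    (if cj then a ^+ 2 else a) w s.
Proof.
move=> fok ul uz z0 se /allP elt su [k k0 wE]; set b := if cj then _ else _.
have hb : b ^+ 2 = b + 1.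
  rewrite /b; case: (cj) => //; rewrite {1}ha sqrrD ha mulr1 expr1n mulr2n (addrr_pchar2 ch) addr0.
  by rewrite -ha.
rewrite /infam lhasE => /hasP[c cU].
have c0 : c != o4 by move: cU; rewrite !inE => /or3P[]/eqP->.
have pc0 : ph c != 0 by rewrite (phi_eq0 ha).
set x := [seq _ | y <- u]; set tail := [seq _ | e <- behead _]; set rest := [seq j <- _ | _].
have sx : size x = size (l ++ l') by rewrite size_map.
pose L := l ++ l'; pose K := k / ph c.
have K0 : K != 0 by rewrite mulf_neq0 ?invr_eq0.
have xE j : phi b (nth o4 x j) = ph c * ph (nth o4 u j).
  rewrite -phiM; have [ju|ju] := ltnP j (size u).
    by rewrite (nth_map o4) // /b; case: (cj) => //; rewrite phi_conj4.
  rewrite !nth_default ?size_map // /phi; by case: (c) => -[] [].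
have wx v : w s v = K * phi b (nth o4 x (index v L)).
  by rewrite xE wE mulrA divfK.
have x0 v : (nth o4 x (index v L) == o4) = (w s v == 0).
  by rewrite wx mulf_eq0 (negPf K0) (phi_eq0 hb).
pose C := [seq nth v0 (l ++ z) e | e <- emb]; pose c00 := nth v0 (l ++ z) e0.
have st : size tail = size emb by rewrite size_map.
have sC : size C = size emb by rewrite size_map.
have cval v : v \in C -> phi b (nth o4 x (index v L)) = phi b (nth o4 tail (index v C)).
  move=> vC; have ki : (index v C < size emb)%N by rewrite -sC index_mem.
  rewrite (nth_map 0%N) //=; set e := nth 0%N emb _.
  have ev : v = nth v0 (l ++ z) e by rewrite -[LHS](nth_index v0 vC) (nth_map 0%N).
  have eE : e \in emb by rewrite mem_nth.
  have elz : (e < size (l ++ z))%N by apply: elt; rewrite inE eE orbT.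
  case: ifP => em.
    have -> : index v L = e; last by [].
    rewrite ev nth_cat em /L index_cat mem_nth // index_uniq //.
    by move: ul; rewrite cat_uniq => /and3P[].
  have vz : v \in z.
    rewrite ev nth_cat em; apply: mem_nth; rewrite ltn_subLR -?size_cat //.
    by rewrite leqNgt em.
  by have /eqP := z0 v vz; rewrite -x0 => /eqP->.
have ncv v : v != c00 -> v \notin C -> nth o4 x (index v L) != o4 -> index v L \in rest.
  move=> vc vC xv; rewrite mem_filter xv mem_iota /= su.
  have ju : (index v L < size L)%N.
    by rewrite ltnNge; apply: contra xv => ge; rewrite nth_default ?sx.
  rewrite ju andbT; case: (leqP (size l) (index v L)) => //= jl.
  have vE : v = nth v0 (l ++ z) (index v L).
    rewrite nth_cat jl -[LHS](nth_index v0 (s := L)); last by rewrite -index_mem.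
    by rewrite /L nth_cat jl.
  rewrite inE negb_or; apply/andP; split.
    by apply: contra vc => /eqP je; rewrite vE je.
  by apply: contra vC => jm; rewrite vE; exact: map_f.
have tE (y : seq z2) v : tail = map zred y -> zev b (nth (0, 0) y (index v C)) =
    if v \in C then phi b (nth o4 x (index v L)) else 0.
  move=> ty; have sy : size y = size emb by rewrite -st ty size_map.
  case: ifP => vC; last by rewrite nth_default ?zev0 // sy -sC memNindex ?vC.
  rewrite cval // zev_phi // ty (nth_map (0, 0)) // sy -sC index_mem //.
case rE: rest => [|j r].
  move=> /mapP[y yY ty]; exists K => //; constructor 3; exists y => // v vc.
  rewrite (tE y) // wx; case: ifPn => // vC; congr (_ * _); apply/eqP.
  by rewrite (phi_eq0 hb); apply: contraT => /(ncv v vc vC); rewrite rE.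
case: ifP => // /nilP r0; case: ifP => // /eqP xj /mapP[y yS ty]; rewrite r0 in rE.
have jr : j \in rest by rewrite rE mem_head.
have := jr; rewrite mem_filter mem_iota /= su => /andP[/andP[_ jo] jL].
pose i := nth v0 L j.
have ji : index i L = j by rewrite index_uniq.
have wi : w s i != 0 by rewrite -x0 ji xj.
have inC : i \notin c00 :: C.
  have nn e : (e < size (l ++ z))%N -> e \in e0 :: emb -> i != nth v0 (l ++ z) e.
    move=> elz ee; apply/negP=> /eqP ie; move: ie; rewrite nth_cat; case: ifP => em ie.
      have jee : j = e by rewrite -ji ie /L index_cat mem_nth // index_uniq //; move: ul; rewrite cat_uniq => /and3P[].
      by move: jo; rewrite jee leqNgt em ee.
    have vz : i \in z by rewrite ie; apply: mem_nth; rewrite ltn_subLR -?size_cat // leqNgt em.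
    by rewrite z0 ?eqxx in wi.
  rewrite inE negb_or nn ?mem_head ?elt ?mem_head //=; apply/negP=> /mapP[e ee ie].
  by move/eqP: ie; apply/negP; apply: nn; rewrite ?elt // inE ee orbT.
exists K => //; constructor 4; exists i, y; split=> // v vc.
rewrite (tE y) // wx; congr (_ * _); have [vi|nvi] := eqVneq v i.
  by move: inC; rewrite vi inE negb_or => /andP[_ /negPf->]; rewrite ji xj addr0.
rewrite add0r; case: ifPn => // vC; apply/eqP; rewrite (phi_eq0 hb); apply: contraT => /(ncv v vc vC).
rewrite rE inE => /eqP jv; have vL : v \in L by rewrite -index_mem jv.
by case/eqP: nvi; rewrite -[LHS](nth_index v0 vL) jv.
Qed.

Lemma vprop_cat s l l' t : (size t <= size l)%N -> vprop s l t -> vprop s (l ++ l') t.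
Proof.
move=> st [k k0 h]; exists k => // v; rewrite h index_cat; case: ifP => // vl.
by rewrite !nth_default //; [rewrite (leq_trans st) ?leq_addr | rewrite memNindex ?vl].
Qed.

(** Induction on the index, children being smaller. If every vector is in the family of the node,
    [family_golden] concludes. Otherwise a vector outside it is special, and the check of its type
    yields a forbidden minor or a child whose patterns all occur. *)
Lemma node_sound i (l : seq V) : (i < size nodes)%N -> uniq l ->
  size l = nd_m (nth node0 nodes i) ->
  (forall t, t \in nd_p (nth node0 nodes i) -> exists s, vprop s l t) ->
  golden_mean R (under (rmx (fun v s => w s v))).
Proof.
have [n] := ubnP i; elim: n i l => // n IH i l; rewrite ltnS => lin isz ul sl hp.
have v0 : V by case: (spare) spare_size => [|v ?] // _; exact: v.
have cn j : (j < size nodes)%N -> check_node (map fred zfams) certs tab nodes j.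
  by move=> jn; apply: (allP nodes_ok); rewrite mem_iota.
have := cn i isz; rewrite /check_node; set nd := nth node0 nodes i in sl hp *.
set fr := nth _ _ _; case: ifP => // /and5P[/allP psz ue /eqP se /allP eb /andP[flt m7]].
rewrite lallE => /allP hu.
rewrite size_map in flt; pose f := nth (0%N, [::], [::]) zfams (nd_f nd).
have frE : fr = fred f by rewrite /fr (nth_map (0%N, [::], [::])).
have fok : fam_ok f.1.1 f.1.2 f.2 by apply: (allP fams_ok); rewrite mem_nth.
(* The at most seven named vertices may themselves be spare; five of the twelve are still
   available. *)
have [z [uz sz zsp]] : exists z : seq V, [/\ uniq (l ++ z), size z = 5 & {subset z <= spare}].
  pose z := take 5 [seq v <- spare | v \notin l]; exists z.
  have szf : (5 <= size [seq v <- spare | v \notin l])%N.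
    have : (size [seq v <- spare | v \in l] <= size l)%N.
      by apply: uniq_leq_size; [exact: filter_uniq | move=> v; rewrite mem_filter => /andP[]].
    have := count_predC (mem l) spare; rewrite !size_filter sl.
    move: spare_size m7; clear; set cA := count _ _; set cB := count _ _.
    by move: (nd_m nd) (size spare); clearbody cA cB; lia.
  split; last by move=> v /mem_take; rewrite mem_filter => /andP[].
    rewrite cat_uniq ul take_uniq ?filter_uniq // andbT; apply/hasPn=> v /mem_take.
    by rewrite mem_filter => /andP[].
  by rewrite size_take; case: ltnP => // h; apply/eqP; rewrite eqn_leq h szf.
have z0 s v : v \in z -> w s v = 0 by move=> /zsp/spare0.
case eE: (nd_e nd) se ue eb => [|e0 emb] //= [se] /andP[e0n uemb] eb.
pose c0 := nth v0 (l ++ z) e0; pose C := [seq nth v0 (l ++ z) e | e <- emb].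
have elt : all (fun e => e < size (l ++ z))%N (e0 :: emb).
  by apply/allP=> e ee; rewrite size_cat sz sl; exact: eb.
have [allf|nall] := Classical_Prop.classic (forall s, fam_vec f.1.2 f.2 c0 C
    (if nd_c nd then a ^+ 2 else a) w s).
  apply: (@family_golden R f.1.1 f.1.2 f.2 fok V c0 C _ _ F (if nd_c nd then a ^+ 2 else a) I w ch _ sum0 allf).
  - rewrite -[c0 :: C]/[seq nth v0 (l ++ z) e | e <- e0 :: emb] map_inj_in_uniq /= ?e0n //.
    move=> e e' /(allP elt) he /(allP elt) he' /eqP; rewrite nth_uniq // => /eqP //.
  - by rewrite size_map se frE.
  case: (nd_c nd) => //; rewrite {1}ha sqrrD ha mulr1 expr1n mulr2n (addrr_pchar2 ch) addr0.
  by rewrite -ha.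
have [s ns] := Classical_Pred_Type.not_all_ex_not _ _ nall.
have [ws|[k [p [q [k0 ws]]]]|sp] := vector_cases s c1_ok c1_m c1_W.
- by case: ns; exists 1; [exact: oner_neq0 | constructor 1].
- by case: ns; exists k => //; constructor 2; exists p, q.
have [u uT [l' [ul' su vu]]] := special_type ul sp.
rewrite sl in uT; have := hu u uT; rewrite frE eE.
case: ifP => [inf _|_].
  case: ns; apply: (@infam_sound f (nd_c nd) e0 emb l l' z u s v0) => //; first exact: z0.
    by move: se; rewrite frE.
  by rewrite sl.
have hps t : t \in rcons (nd_p nd) u -> exists s, vprop s (l ++ l') t /\ (size t <= size (l ++ l'))%N.
  rewrite mem_rcons inE => /orP[/eqP->|tp]; first by exists s; rewrite su.
  have tm : (size t <= size l)%N by rewrite sl; exact: psz.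
  have [s' h] := hp t tp; exists s'; split; first exact: vprop_cat.
  by rewrite size_cat (leq_trans tm) ?leq_addr.
have hps' t : t \in rcons (nd_p nd) u -> exists s, vprop s (l ++ l') t.
  by move=> /hps[s' [h _]]; exists s'.
have bad wt : okbad certs (size u) (rcons (nd_p nd) u) wt -> False.
  by rewrite su; exact: okbad_false certs_ok ul' hps'.
have badr ids : tryrows certs tab (rcons (nd_p nd) u) (size u) ids -> False.
  by rewrite /tryrows; case: tfind => // v; exact: bad.
case: ifP => [|_]; last first.
  case: ifP => [|_].
    by rewrite lhasE => /(has_nthP ([::], (0%N, [::], [::])))[j _]; case: ifP => // _ /bad.
  case: ifP => [|_]; first by rewrite /srch2 lhasE => /hasP[? _ /badr].
  by rewrite /srch3 lhasE => /hasP[? _]; rewrite lhasE => /hasP[? _ /badr].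
rewrite lhasE => /hasP[[u' [j rho]] _] /=; case: ifP => // _.
case/and5P=> /= ji /eqP srho urho /allP rhoL /allP kp _.
have jn : (j < size nodes)%N by exact: ltn_trans ji isz.
have pj t : t \in nd_p (nth node0 nodes j) -> (size t <= nd_m (nth node0 nodes j))%N.
  by have := cn j jn; rewrite /check_node; case: ifP => // /and5P[/allP h _ _ _ _] _ /h.
pose l2 := [seq nth v0 (l ++ l') e | e <- rho].
have sl2 : size l2 = size rho by rewrite size_map.
apply: (IH j l2); rewrite ?sl2 //.
- exact: leq_trans ji lin.
- rewrite map_inj_in_uniq // => e e' /rhoL he /rhoL he' /eqP.
  by rewrite nth_uniq -?su // => /eqP.
move=> t tp; have /hasP[q qps hq] := kp t tp.
have /hasP[c cU /andP[/allP h1 /allP h2]] : has (fun c =>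
    all (fun k => mul4 c (nth o4 q (nth 0%N rho k)) == nth o4 t k) (iota 0 (size rho))
    && all (fun j => (j \in rho) || (nth o4 q j == o4)) (iota 0 (size u))) units4 by exact: hq.
have [s' [[k k0 wE] sq]] := hps q qps; exists s'.
have pc0 : ph c != 0 by rewrite (phi_eq0 ha); move: cU; rewrite !inE => /or3P[]/eqP->.
exists (k / ph c); first by rewrite mulf_neq0 ?invr_eq0.
move=> v; rewrite wE; have [vl2|vl2] := boolP (v \in l2).
  have ki : (index v l2 < size rho)%N by rewrite -sl2 index_mem.
  have := h1 (index v l2); rewrite mem_iota => /(_ ki)/eqP <-; rewrite phiM mulrA divfK //; congr (_ * ph (nth _ _ _)).
  have eE' : nth 0%N rho (index v l2) \in rho by exact: mem_nth.
  have vE : v = nth v0 (l ++ l') (nth 0%N rho (index v l2)) by rewrite -[LHS](nth_index v0 vl2) (nth_map 0%N).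
  by rewrite {1}vE index_uniq // -su; exact: rhoL.
rewrite [nth o4 t _]nth_default; last by rewrite (memNindex vl2) sl2 srho; exact: pj.
rewrite ph0 mulr0; suff -> : nth o4 q (index v (l ++ l')) = o4 by rewrite ph0 mulr0.
have [vL|vL] := boolP (v \in l ++ l'); last by rewrite nth_default // (memNindex vL).
have jL : (index v (l ++ l') < size u)%N by rewrite su index_mem.
have := h2 (index v (l ++ l')); rewrite mem_iota => /(_ jL)/orP[jr|/eqP //].
case/negP: vl2; apply/mapP; exists (index v (l ++ l')) => //.
by rewrite nth_index.
Qed.

End Nodes.

End Classification.

(** * Tables *)

Module Tables.
Import String.
Local Open Scope ring_scope.

(** The two low bits of the ASCII digits 0, 1, 2, 3 are the encodings of 0, 1, a, a^2. *)
Fixpoint q4 (s : String.string) : seq g4 :=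
  match s with
  | String.EmptyString => [::]
  | String.String (Ascii.Ascii b0 b1 _ _ _ _ _ _) s' => (b0, b1) :: q4 s'
  end.
Arguments q4 s%_string.

(** Each entry gives the size of the core without [c0], the core vectors and the link vectors. *)
Definition family_table : seq (nat * seq (seq z2) * seq (seq z2)) :=
  ([:: (1%N, [:: [:: (1, 0)]], [:: [:: (-2, 1)]; [:: (-1, 1)]]); (2%N, [:: [:: (0, 1); (-1, -1)];
  [:: (-1, 1); (0, -1)]; [:: (0, 1); (0, 0)]; [:: (1, 1); (-1, -1)]; [:: (0, 0); (-1, -1)]], [::
  [:: (0, 0); (-1, -1)]; [:: (0, 1); (-1, -1)]]); (2%N, [:: [:: (-2, 1); (1, -1)]; [:: (1, -1);
  (-2, 1)]; [:: (-1, 1); (1, -1)]; [:: (-1, 1); (0, 0)]; [:: (0, 0); (1, 0)]], [:: [:: (-2, 1);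
  (1, -1)]; [:: (-1, 1); (0, 0)]]); (2%N, [:: [:: (-2, 1); (1, -1)]; [:: (1, -1); (-2, 1)]; [::
  (-1, 1); (1, -1)]; [:: (0, 0); (0, -1)]; [:: (1, 0); (0, 0)]], [:: [:: (-2, 1); (1, -1)]; [::
  (-1, 0); (0, -1)]]); (2%N, [:: [:: (0, 1); (-1, -1)]; [:: (-1, 1); (0, -1)]; [:: (-1, 1); (0,
  0)]; [:: (0, 0); (0, 1)]; [:: (0, -1); (0, 1)]], [:: [:: (-1, 0); (0, 1)]; [:: (0, -1); (0,
  1)]]); (3%N, [:: [:: (1, 0); (0, 1); (-1, -1)]; [:: (1, 0); (-1, 1); (0, -1)]; [:: (0, 0); (0,
  1); (-1, -1)]; [:: (0, 1); (0, 0); (-1, -1)]; [:: (0, 0); (0, 0); (0, -1)]; [:: (1, 0); (0, 0);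
  (0, 0)]; [:: (0, 0); (1, 0); (0, 0)]; [:: (-1, 0); (1, 0); (0, 0)]; [:: (-1, 0); (0, 0); (1,
  0)]; [:: (0, 0); (-1, 0); (1, 0)]], [:: [:: (0, 0); (0, 0); (0, -1)]]); (3%N, [:: [:: (1, 0);
  (-2, 1); (1, -1)]; [:: (0, 0); (-2, 1); (1, -1)]; [:: (0, 1); (-1, 0); (0, -1)]; [:: (-1, 1);
  (1, -1); (-1, 0)]; [:: (0, 0); (-1, 1); (1, -1)]; [:: (1, 0); (0, 0); (0, 0)]; [:: (0, 0); (1,
  0); (0, 0)]; [:: (0, 0); (0, 0); (1, 0)]; [:: (-1, 0); (1, 0); (0, 0)]; [:: (-1, 0); (0, 0); (1,
  0)]], [:: [:: (0, 0); (-2, 1); (1, -1)]]); (4%N, [:: [:: (0, 0); (1, 0); (-2, 1); (1, -1)]; [::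
  (0, 0); (1, 0); (-1, 1); (0, -1)]; [:: (1, 0); (0, 0); (-2, 1); (1, -1)]; [:: (0, 0); (0, 0);
  (-1, 1); (0, -1)]; [:: (0, -1); (0, 0); (-1, 1); (0, 0)]; [:: (1, 0); (0, 0); (0, 0); (0, 0)];
  [:: (0, 0); (1, 0); (0, 0); (0, 0)]; [:: (0, 0); (0, 0); (1, 0); (0, 0)]; [:: (0, 0); (0, 0);
  (0, 0); (1, 0)]; [:: (-1, 0); (1, 0); (0, 0); (0, 0)]; [:: (-1, 0); (0, 0); (1, 0); (0, 0)]; [::
  (-1, 0); (0, 0); (0, 0); (1, 0)]; [:: (0, 0); (-1, 0); (1, 0); (0, 0)]; [:: (0, 0); (-1, 0); (0,
  0); (1, 0)]; [:: (0, 0); (0, 0); (-1, 0); (1, 0)]], [::]); (3%N, [:: [:: (1, 0); (0, 1); (-1,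
  -1)]; [:: (0, 0); (-1, -1); (0, 1)]; [:: (-1, 0); (0, -1); (0, 1)]; [:: (0, -1); (-1, 0); (0,
  1)]; [:: (1, -1); (-1, 0); (-1, 1)]; [:: (1, 0); (0, 0); (0, 0)]; [:: (0, 0); (1, 0); (0, 0)];
  [:: (0, 0); (0, 0); (1, 0)]; [:: (-1, 0); (1, 0); (0, 0)]; [:: (-1, 0); (0, 0); (1, 0)]; [:: (0,
  0); (-1, 0); (1, 0)]], [::]); (3%N, [:: [:: (1, 0); (0, 1); (-1, -1)]; [:: (0, 0); (-1, -1); (0,
  1)]; [:: (-1, 0); (0, -1); (0, 1)]; [:: (0, 1); (0, 0); (-1, -1)]; [:: (-1, 1); (0, -1); (0,
  0)]; [:: (1, 0); (0, 0); (0, 0)]; [:: (0, 0); (1, 0); (0, 0)]; [:: (0, 0); (0, 0); (1, 0)]; [::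
  (-1, 0); (1, 0); (0, 0)]; [:: (-1, 0); (0, 0); (1, 0)]; [:: (0, 0); (-1, 0); (1, 0)]], [::]);
  (4%N, [:: [:: (1, 0); (-1, 0); (0, -1); (0, 1)]; [:: (0, 0); (0, -1); (-1, 0); (0, 1)]; [:: (-1,
  0); (1, -1); (-1, 1); (0, 0)]; [:: (0, -1); (0, 0); (0, 1); (-1, 0)]; [:: (1, -1); (-1, 0); (0,
  0); (-1, 1)]; [:: (1, 0); (0, 0); (0, 0); (0, 0)]; [:: (0, 0); (1, 0); (0, 0); (0, 0)]; [:: (0,
  0); (0, 0); (1, 0); (0, 0)]; [:: (0, 0); (0, 0); (0, 0); (1, 0)]; [:: (-1, 0); (1, 0); (0, 0);
  (0, 0)]; [:: (-1, 0); (0, 0); (1, 0); (0, 0)]; [:: (-1, 0); (0, 0); (0, 0); (1, 0)]; [:: (0, 0);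
  (-1, 0); (1, 0); (0, 0)]; [:: (0, 0); (-1, 0); (0, 0); (1, 0)]; [:: (0, 0); (0, 0); (-1, 0); (1,
  0)]], [::]); (4%N, [:: [:: (0, 0); (1, 0); (0, 1); (-1, -1)]; [:: (0, 0); (1, 0); (-1, 1); (0,
  -1)]; [:: (0, 1); (0, 0); (0, 0); (-1, -1)]; [:: (-1, 1); (0, 0); (0, 0); (0, -1)]; [:: (1, 0);
  (0, 0); (0, 0); (0, 0)]; [:: (0, 0); (1, 0); (0, 0); (0, 0)]; [:: (0, 0); (0, 0); (1, 0); (0,
  0)]; [:: (0, 0); (0, 0); (0, 0); (1, 0)]; [:: (-1, 0); (1, 0); (0, 0); (0, 0)]; [:: (-1, 0); (0,
  0); (1, 0); (0, 0)]; [:: (-1, 0); (0, 0); (0, 0); (1, 0)]; [:: (0, 0); (-1, 0); (1, 0); (0, 0)];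
  [:: (0, 0); (-1, 0); (0, 0); (1, 0)]; [:: (0, 0); (0, 0); (-1, 0); (1, 0)]], [::]); (3%N, [::
  [:: (-1, 0); (0, 1); (0, -1)]; [:: (-1, 0); (-1, 1); (1, -1)]; [:: (0, 1); (-1, 0); (0, -1)];
  [:: (-1, 1); (-1, 0); (1, -1)]; [:: (1, 0); (0, 0); (0, 0)]; [:: (0, 0); (1, 0); (0, 0)]; [::
  (0, 0); (0, 0); (1, 0)]; [:: (-1, 0); (1, 0); (0, 0)]; [:: (-1, 0); (0, 0); (1, 0)]; [:: (0, 0);
  (-1, 0); (1, 0)]], [::]); (4%N, [:: [:: (0, 0); (1, 0); (0, 1); (-1, -1)]; [:: (0, 1); (0, 0);
  (0, 0); (-1, -1)]; [:: (0, 1); (-1, 0); (0, -1); (0, 0)]; [:: (1, 0); (0, 0); (0, 0); (0, 0)];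
  [:: (0, 0); (1, 0); (0, 0); (0, 0)]; [:: (0, 0); (0, 0); (1, 0); (0, 0)]; [:: (0, 0); (0, 0);
  (0, 0); (1, 0)]; [:: (-1, 0); (1, 0); (0, 0); (0, 0)]; [:: (-1, 0); (0, 0); (1, 0); (0, 0)]; [::
  (-1, 0); (0, 0); (0, 0); (1, 0)]; [:: (0, 0); (-1, 0); (1, 0); (0, 0)]; [:: (0, 0); (-1, 0); (0,
  0); (1, 0)]; [:: (0, 0); (0, 0); (-1, 0); (1, 0)]], [::])])%Z.

(** The first entry is the certificate for the vector 1111 on which [vector_cases] relies. *)
Definition minor_table : seq mcert :=
  ([:: MCert 3 [:: q4 "1111"] [::] [:: (0, 1); (0, 2); (0, 3); (1, 2); (1, 3); (2, 3); (4, 0)] (q4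
  "1111111") 0 [:: q4 "0100"; q4 "0010"; q4 "0001"] [:: q4 "1000"; q4 "1100"; q4 "1010"; q4
  "1001"] [::]; MCert 4 [:: q4 "00123"; q4 "11022"] [:: (5, 0)] [:: (0, 1); (0, 2); (0, 4); (1,
  2); (1, 4); (2, 3); (5, 1)] (q4 "1111131") 0 [:: q4 "01000"; q4 "00130"; q4 "00021"] [:: q4
  "10000"; q4 "11000"; q4 "10100"; q4 "10230"] [:: q4 "00002"]; MCert 4 [:: q4 "00123"; q4
  "11033"] [:: (5, 0)] [:: (0, 1); (0, 2); (0, 3); (1, 2); (1, 3); (2, 3); (5, 1)] (q4 "1111111")
  0 [:: q4 "01000"; q4 "00102"; q4 "00013"] [:: q4 "10000"; q4 "11000"; q4 "10100"; q4 "10010"]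
  [:: q4 "00002"]; MCert 4 [:: q4 "00123"; q4 "12021"] [:: (5, 0)] [:: (2, 3); (0, 1); (5, 1); (0,
  2); (0, 3); (0, 4); (1, 2); (1, 3); (1, 4)] (q4 "211111111") 1 [:: q4 "01111"; q4 "01000"; q4
  "00123"] [:: q4 "10000"; q4 "10320"; q4 "01320"; q4 "00220"] [:: q4 "00002"]; MCert 4 [:: q4
  "01122"; q4 "10133"] [:: (5, 0)] [:: (0, 1); (0, 3); (0, 4); (1, 3); (1, 4); (1, 2); (5, 1)] (q4
  "1111131") 0 [:: q4 "01100"; q4 "00210"; q4 "00201"] [:: q4 "10000"; q4 "11000"; q4 "10010"; q4
  "13310"] [:: q4 "00003"]; MCert 4 [:: q4 "01122"; q4 "10313"] [:: (5, 0)] [:: (1, 4); (0, 2);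
  (0, 3); (1, 2); (1, 3); (2, 4); (0, 1); (5, 1); (0, 4)] (q4 "231313333") 1 [:: q4 "00210"; q4
  "02222"; q4 "02001"] [:: q4 "10000"; q4 "00220"; q4 "30120"; q4 "03120"] [:: q4 "00003"]; MCert
  5 [:: q4 "000123"; q4 "123000"] [:: (6, 0); (6, 1)] [:: (0, 3); (1, 5); (2, 4); (0, 4); (3, 4);
  (0, 5); (2, 3); (1, 3); (0, 1)] (q4 "113331211") 1 [:: q4 "000021"; q4 "013000"; q4 "032123"]
  [:: q4 "100000"; q4 "200130"; q4 "210300"; q4 "100100"] [:: q4 "000002"; q4 "002000"]; MCert 3
  [:: q4 "0123"; q4 "1023"; q4 "1122"] [::] [:: (0, 1); (0, 3); (2, 3); (1, 3); (4, 2); (4, 1);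
  (4, 0)] (q4 "1121111") 0 [:: q4 "0100"; q4 "0011"; q4 "0030"] [:: q4 "1000"; q4 "1100"; q4
  "1001"; q4 "0022"] [::]; MCert 3 [:: q4 "0123"; q4 "1023"; q4 "1133"] [::] [:: (0, 1); (0, 2);
  (2, 3); (1, 2); (4, 2); (4, 1); (4, 0)] (q4 "1131111") 0 [:: q4 "0100"; q4 "0011"; q4 "0002"]
  [:: q4 "1000"; q4 "1100"; q4 "1010"; q4 "0033"] [::]; MCert 3 [:: q4 "0123"; q4 "1023"; q4
  "1221"] [::] [:: (2, 3); (0, 1); (4, 2); (0, 2); (0, 3); (4, 1); (1, 2); (1, 3); (4, 0)] (q4
  "211111111") 1 [:: q4 "0111"; q4 "0100"; q4 "0012"] [:: q4 "1000"; q4 "1032"; q4 "0132"; q4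
  "0022"] [::]; MCert 3 [:: q4 "0123"; q4 "1122"; q4 "1331"] [::] [:: (1, 3); (0, 2); (4, 2); (4,
  1); (2, 3); (1, 2); (4, 0); (0, 3); (0, 1)] (q4 "212311311") 2 [:: q4 "0010"; q4 "0111"; q4
  "0201"] [:: q4 "1000"; q4 "0213"; q4 "1203"; q4 "0202"] [::]; MCert 3 [:: q4 "1122"; q4 "1212";
  q4 "1221"] [::] [:: (4, 0); (1, 2); (0, 1); (4, 1); (0, 2); (0, 3); (1, 3); (4, 2); (2, 3)] (q4
  "322321111") 3 [:: q4 "0001"; q4 "0033"; q4 "0331"] [:: q4 "1000"; q4 "3311"; q4 "0220"; q4
  "2200"] [::]; MCert 3 [:: q4 "1122"; q4 "1212"; q4 "1331"] [::] [:: (0, 3); (0, 1); (4, 2); (1,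
  3); (4, 1); (4, 0); (0, 2); (2, 3); (1, 2)] (q4 "113121323") 3 [:: q4 "0021"; q4 "0110"; q4
  "0030"] [:: q4 "1000"; q4 "1001"; q4 "1100"; q4 "3223"] [::]; MCert 4 [:: q4 "00123"; q4
  "01023"; q4 "12300"] [:: (5, 2)] [:: (1, 3); (0, 4); (5, 0); (0, 1); (0, 3); (2, 3); (1, 4); (3,
  4); (5, 1)] (q4 "321221223") 1 [:: q4 "03233"; q4 "00003"; q4 "03210"] [:: q4 "10000"; q4
  "21030"; q4 "01032"; q4 "03030"] [:: q4 "00200"]; MCert 4 [:: q4 "00123"; q4 "01032"; q4
  "12300"] [:: (5, 2)] [:: (0, 3); (0, 4); (1, 4); (3, 4); (5, 0); (2, 4); (5, 1)] (q4 "3313221")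
  0 [:: q4 "00020"; q4 "02102"; q4 "01300"] [:: q4 "10000"; q4 "30030"; q4 "30003"; q4 "01001"]
  [:: q4 "00200"]; MCert 5 [:: q4 "000123"; q4 "001032"; q4 "120003"] [:: (6, 0); (6, 1)] [:: (2,
  3); (0, 1); (6, 2); (0, 2); (0, 4); (0, 3); (1, 2); (1, 4); (1, 3)] (q4 "311111111") 1 [:: q4
  "011111"; q4 "010000"; q4 "001320"] [:: q4 "100000"; q4 "102300"; q4 "012300"; q4 "003300"] [::
  q4 "000023"; q4 "000032"]; MCert 3 [:: q4 "0123"; q4 "0132"; q4 "1122"; q4 "1133"] [::] [:: (0,
  2); (0, 3); (4, 0); (2, 3); (4, 3); (4, 2); (4, 1)] (q4 "1111111") 0 [:: q4 "0210"; q4 "0301";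
  q4 "0100"] [:: q4 "1000"; q4 "1010"; q4 "1001"; q4 "0123"] [::]; MCert 3 [:: q4 "0123"; q4
  "1023"; q4 "1203"; q4 "1230"] [::] [:: (0, 2); (4, 0); (4, 2); (0, 3); (2, 3); (4, 1); (4, 3);
  (1, 2); (0, 1)] (q4 "222112122") 1 [:: q4 "0001"; q4 "0300"; q4 "0231"] [:: q4 "1000"; q4
  "3021"; q4 "3210"; q4 "2020"] [::]; MCert 3 [:: q4 "0123"; q4 "1023"; q4 "1203"; q4 "1320"] [::]
  [:: (0, 1); (1, 2); (1, 3); (4, 3); (4, 2); (4, 0); (4, 1)] (q4 "1231111") 0 [:: q4 "0111"; q4
  "0030"; q4 "0002"] [:: q4 "1000"; q4 "1100"; q4 "0220"; q4 "0303"] [::]; MCert 3 [:: q4 "0123";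
  q4 "1032"; q4 "1122"; q4 "1133"] [::] [:: (0, 1); (0, 3); (1, 3); (4, 0); (4, 3); (0, 2); (4,
  2); (1, 2); (4, 1)] (q4 "222213231") 4 [:: q4 "0020"; q4 "0013"; q4 "0320"] [:: q4 "1000"; q4
  "0231"; q4 "2002"; q4 "2200"] [::]; MCert 3 [:: q4 "0123"; q4 "1032"; q4 "1212"; q4 "1221"] [::]
  [:: (0, 3); (0, 1); (4, 0); (4, 2); (4, 1); (0, 2); (2, 3); (4, 3); (1, 2)] (q4 "331113323") 2
  [:: q4 "0220"; q4 "0200"; q4 "0032"] [:: q4 "1000"; q4 "2031"; q4 "1331"; q4 "3003"] [::]; MCert
  4 [:: q4 "00123"; q4 "00132"; q4 "01023"; q4 "12003"] [:: (5, 3)] [:: (3, 4); (0, 2); (1, 2);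
  (0, 3); (1, 3); (5, 2); (2, 3); (5, 0); (5, 1)] (q4 "331311333") 1 [:: q4 "03222"; q4 "00200";
  q4 "00020"] [:: q4 "10000"; q4 "22000"; q4 "12300"; q4 "12030"] [:: q4 "00002"]; MCert 4 [:: q4
  "00123"; q4 "00132"; q4 "01023"; q4 "13020"] [:: (5, 3)] [:: (3, 4); (0, 2); (1, 2); (2, 4); (5,
  1); (5, 0); (0, 4); (5, 2); (1, 4)] (q4 "111111133") 1 [:: q4 "00100"; q4 "03111"; q4 "00001"]
  [:: q4 "10000"; q4 "32100"; q4 "22000"; q4 "32001"] [:: q4 "00030"]; MCert 4 [:: q4 "00123"; q4
  "01023"; q4 "01203"; q4 "10032"] [:: (5, 3)] [:: (0, 3); (1, 2); (5, 2); (0, 1); (1, 3); (5, 1);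
  (0, 2); (2, 3); (5, 0)] (q4 "211111111") 1 [:: q4 "01000"; q4 "00100"; q4 "01131"] [:: q4
  "10000"; q4 "31020"; q4 "30120"; q4 "20020"] [:: q4 "00003"]; MCert 4 [:: q4 "00123"; q4
  "01023"; q4 "01203"; q4 "12003"] [:: (5, 3)] [:: (0, 1); (2, 3); (5, 0); (0, 2); (5, 2); (1, 2);
  (0, 3); (5, 1); (1, 3)] (q4 "233323323") 1 [:: q4 "00200"; q4 "00020"; q4 "03222"] [:: q4
  "10000"; q4 "12300"; q4 "12030"; q4 "22000"] [:: q4 "00002"]; MCert 4 [:: q4 "00123"; q4
  "01023"; q4 "10203"; q4 "13002"] [:: (5, 2)] [:: (0, 2); (1, 3); (5, 1); (0, 1); (5, 3); (1, 2);
  (0, 3); (5, 0); (2, 3)] (q4 "311121131") 1 [:: q4 "01000"; q4 "00010"; q4 "01211"] [:: q4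
  "10000"; q4 "21300"; q4 "20310"; q4 "30300"] [:: q4 "00002"]; MCert 4 [:: q4 "00123"; q4
  "01032"; q4 "10203"; q4 "13002"] [:: (5, 0)] [:: (2, 3); (0, 1); (5, 3); (1, 2); (5, 1); (1, 3);
  (0, 2); (5, 2); (0, 3)] (q4 "312111111") 1 [:: q4 "01000"; q4 "01111"; q4 "00130"] [:: q4
  "10000"; q4 "01230"; q4 "10230"; q4 "00330"] [:: q4 "00002"]; MCert 3 [:: q4 "0123"; q4 "0132";
  q4 "1023"; q4 "1032"; q4 "1203"] [::] [:: (2, 3); (0, 1); (4, 4); (0, 2); (4, 2); (4, 3); (1,
  2); (4, 0); (4, 1)] (q4 "111111111") 1 [:: q4 "0111"; q4 "0100"; q4 "0010"] [:: q4 "1000"; q4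
  "1001"; q4 "0101"; q4 "0011"] [::]])%N.

Definition bad_table : btable :=
  ([:: ([:: 1; 4; 4; 10; 11], ([:: 2; 0; 1; 3; 4], 1, [:: (0, i4); (1, i4)])); ([:: 1; 6; 7; 8; 8],
  ([:: 2; 3; 4; 0; 1], 2, [:: (0, i4); (1, b4)])); ([:: 1; 4; 7; 8; 10], ([:: 2; 0; 4; 1; 3], 3,
  [:: (0, i4); (1, i4)])); ([:: 1; 6; 6; 8; 9], ([:: 1; 3; 4; 0; 2], 4, [:: (0, i4); (1, b4)]));
  ([:: 1; 5; 6; 8; 10], ([:: 1; 2; 4; 0; 3], 5, [:: (0, i4); (1, b4)])); ([:: 1; 2; 4; 4; 8; 11],
  ([:: 4; 2; 4; 0; 1; 3], 3, [:: (0, b4); (1, i4)])); ([:: 1; 2; 4; 7; 8; 8], ([:: 4; 2; 4; 3; 0;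
  1], 2, [:: (0, b4); (1, b4)])); ([:: 1; 2; 3; 4; 8; 12], ([:: 3; 4; 5; 0; 1; 2], 6, [:: (0, i4);
  (1, i4)])); ([:: 1; 1; 4; 4; 10; 10], ([:: 0; 1; 4; 2; 4; 3], 1, [:: (1, i4); (0, i4)])); ([::
  1; 1; 6; 6; 8; 8], ([:: 2; 1; 3; 4; 2; 0], 4, [:: (0, i4); (1, b4)])); ([:: 1; 2; 4; 4; 9; 10],
  ([:: 2; 0; 2; 1; 4; 3], 5, [:: (1, i4); (0, b4)])); ([:: 1; 2; 5; 6; 8; 8], ([:: 1; 3; 2; 4; 3;
  0], 5, [:: (0, i4); (1, b4)])); ([:: 2; 2; 5; 5; 8; 8], ([:: 0; 1; 3; 4; 3; 2], 2, [:: (1, b4);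
  (0, b4)])); ([:: 1; 2; 4; 5; 8; 10], ([:: 4; 0; 1; 2; 4; 3], 5, [:: (1, i4); (0, b4)])); ([:: 1;
  2; 4; 6; 8; 9], ([:: 0; 1; 2; 3; 2; 4], 3, [:: (1, a4); (0, i4)])); ([:: 1; 2; 3; 4; 4; 8; 8],
  ([:: 3; 4; 2; 3; 4; 0; 1], 2, [:: (0, a4); (1, b4)])); ([:: 1; 1; 2; 4; 4; 8; 10], ([:: 4; 0; 1;
  4; 2; 4; 3], 3, [:: (1, i4); (0, i4)])); ([:: 1; 2; 2; 4; 4; 8; 9], ([:: 4; 0; 1; 4; 2; 4; 3],
  2, [:: (1, i4); (0, b4)])); ([:: 1; 2; 2; 4; 5; 8; 8], ([:: 3; 0; 1; 3; 4; 3; 2], 2, [:: (1,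
  b4); (0, b4)])); ([:: 1; 1; 2; 2; 4; 4; 8; 8], ([:: 3; 4; 0; 1; 3; 4; 3; 2], 2, [:: (1, b4); (0,
  b4)])); ([:: 17; 20; 42; 47], ([:: 1; 0; 2; 3], 7, [:: (0, i4); (1, i4); (2, i4)])); ([:: 26;
  31; 33; 36], ([:: 2; 3; 1; 0], 8, [:: (0, i4); (1, i4); (2, b4)])); ([:: 20; 31; 33; 42], ([::
  0; 3; 1; 2], 9, [:: (0, i4); (1, i4); (2, i4)])); ([:: 21; 26; 36; 43], ([:: 1; 2; 0; 3], 10,
  [:: (0, i4); (1, i4); (2, b4)])); ([:: 21; 26; 38; 41], ([:: 0; 3; 2; 1], 11, [:: (0, i4); (1,
  i4); (2, i4)])); ([:: 22; 25; 37; 42], ([:: 2; 1; 0; 3], 12, [:: (0, i4); (1, i4); (2, b4)]));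
  ([:: 10; 16; 31; 33; 36], ([:: 2; 2; 3; 1; 0], 8, [:: (0, i4); (1, i4); (2, b4)])); ([:: 10; 15;
  16; 36; 49], ([:: 3; 4; 0; 1; 2], 13, [:: (0, i4); (1, i4); (2, i4)])); ([:: 15; 17; 20; 32;
  42], ([:: 3; 1; 0; 3; 2], 7, [:: (0, i4); (1, i4); (2, i4)])); ([:: 11; 14; 16; 36; 49], ([:: 4;
  3; 0; 1; 2], 14, [:: (0, i4); (1, i4); (2, i4)])); ([:: 5; 10; 16; 36; 59], ([:: 3; 1; 3; 0; 2],
  9, [:: (0, b4); (2, b4); (1, i4)])); ([:: 5; 16; 26; 36; 43], ([:: 1; 0; 2; 0; 3], 7, [:: (0,
  i4); (2, a4); (1, i4)])); ([:: 5; 11; 16; 36; 58], ([:: 1; 3; 3; 0; 2], 7, [:: (0, i4); (2, b4);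
  (1, i4)])); ([:: 10; 20; 27; 32; 37], ([:: 1; 0; 2; 0; 3], 9, [:: (0, b4); (2, a4); (1, i4)]));
  ([:: 7; 16; 25; 38; 40], ([:: 0; 1; 2; 3; 1], 9, [:: (2, a4); (0, a4); (1, i4)])); ([:: 6; 9;
  16; 39; 56], ([:: 2; 1; 2; 3; 0], 8, [:: (0, i4); (2, a4); (1, b4)])); ([:: 7; 9; 16; 38; 56],
  ([:: 0; 2; 2; 3; 1], 9, [:: (2, a4); (0, a4); (1, i4)])); ([:: 9; 22; 24; 32; 39], ([:: 1; 2; 0;
  0; 3], 8, [:: (0, i4); (2, a4); (1, b4)])); ([:: 5; 16; 26; 38; 41], ([:: 0; 0; 3; 2; 1], 11,
  [:: (0, i4); (1, i4); (2, i4)])); ([:: 10; 22; 25; 32; 37], ([:: 3; 2; 1; 3; 0], 12, [:: (0,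
  i4); (1, i4); (2, b4)])); ([:: 5; 17; 20; 42; 42], ([:: 1; 0; 3; 3; 2], 7, [:: (1, i4); (2, i4);
  (0, i4)])); ([:: 10; 21; 26; 33; 36], ([:: 3; 1; 2; 0; 3], 10, [:: (1, i4); (0, i4); (2, b4)]));
  ([:: 9; 20; 22; 33; 42], ([:: 0; 1; 2; 1; 3], 10, [:: (2, a4); (0, i4); (1, b4)])); ([:: 10; 21;
  21; 34; 40], ([:: 1; 2; 3; 0; 2], 8, [:: (1, b4); (2, b4); (0, b4)])); ([:: 1; 4; 14; 16; 32;
  59], ([:: 3; 2; 4; 0; 1; 5], 15, [:: (0, i4); (1, i4); (2, i4)])); ([:: 1; 4; 15; 16; 40; 50],
  ([:: 0; 3; 2; 3; 4; 1], 13, [:: (1, a4); (2, a4); (0, i4)])); ([:: 1; 4; 18; 24; 32; 47], ([::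
  3; 3; 1; 0; 3; 2], 7, [:: (0, b4); (1, b4); (2, i4)])); ([:: 2; 4; 15; 16; 33; 56], ([:: 0; 4;
  1; 4; 2; 3], 14, [:: (2, b4); (1, a4); (0, b4)])); ([:: 2; 8; 16; 31; 33; 36], ([:: 2; 2; 2; 3;
  1; 0], 8, [:: (0, i4); (1, i4); (2, b4)])); ([:: 1; 4; 16; 26; 38; 41], ([:: 0; 0; 0; 3; 2; 1],
  11, [:: (0, i4); (1, i4); (2, i4)])); ([:: 2; 8; 22; 25; 32; 37], ([:: 3; 3; 2; 0; 3; 1], 12,
  [:: (0, i4); (2, i4); (1, b4)])); ([:: 1; 2; 4; 8; 16; 32; 63], ([:: 0; 1; 4; 2; 3; 4; 5], 15,
  [:: (2, i4); (1, b4); (0, i4)]))])%N.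

(** Children precede their parents; the last node is the root, with no named vertex and no
    pattern. *)
Definition node_table : seq node :=
  ([:: Node 7 [:: q4 "0000123"; q4 "0001023"; q4 "0120030"; q4 "1300020"] 1 true [:: 1; 6; 5] [::]
  [::]; Node 6 [:: q4 "000123"; q4 "001023"; q4 "010032"; q4 "130020"] 1 true [:: 1; 5; 4] [::]
  [:: (q4 "100032", (23, [:: 2; 1; 0; 0; 4; 3], [:: (4, i4); (2, i4); (3, a4); (0, i4)])); (q4
  "120030", (22, [:: 2; 4; 0; 0; 3; 1], [:: (3, i4); (4, i4); (2, b4); (0, i4)]))]; Node 6 [:: q4
  "000123"; q4 "001023"; q4 "010230"; q4 "130020"] 1 true [:: 1; 5; 4] [::] [::]; Node 6 [:: q4
  "000123"; q4 "000132"; q4 "012003"; q4 "130002"] 5 false [:: 1; 3; 4; 5] [::] [:: (q4 "010032",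
  (22, [:: 0; 1; 0; 2; 4; 3], [:: (1, i4); (0, i4); (4, i4); (2, b4)])); (q4 "010302", (22, [:: 0;
  1; 0; 4; 2; 3], [:: (0, b4); (1, a4); (4, i4); (2, b4)]))]; Node 6 [:: q4 "000123"; q4 "001023";
  q4 "120030"] 2 false [:: 1; 4; 5] [:: (q4 "1000302", (0, [:: 1; 0; 6; 2; 3; 4; 5])); (q4
  "100032", (1, [:: 1; 0; 2; 3; 4; 5])); (q4 "100230", (2, [:: 1; 0; 2; 3; 4; 5])); (q4 "102030",
  (2, [:: 1; 0; 3; 2; 4; 5])); (q4 "130020", (3, [:: 2; 5; 3; 0; 1; 4]))] [::]; Node 6 [:: q4
  "000123"; q4 "000132"; q4 "012003"; q4 "102003"] 5 true [:: 2; 3; 4; 5] [::] [:: (q4 "001023",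
  (21, [:: 0; 0; 1; 2; 3; 4], [:: (0, i4); (1, i4); (4, i4); (2, i4)])); (q4 "001203", (21, [:: 0;
  0; 1; 3; 2; 4], [:: (1, a4); (0, b4); (4, i4); (2, i4)]))]; Node 5 [:: q4 "00123"; q4 "00132";
  q4 "01023"; q4 "10032"; q4 "12030"] 7 false [:: 0; 1; 2; 3; 4] [::] [:: (q4 "01032", (21, [:: 0;
  1; 2; 4; 3], [:: (1, i4); (0, i4); (5, i4); (4, i4)])); (q4 "01230", (21, [:: 0; 1; 3; 4; 2],
  [:: (0, a4); (1, b4); (5, i4); (4, i4)])); (q4 "01320", (24, [:: 0; 3; 2; 4; 1], [:: (5, a4);
  (2, a4); (0, a4); (3, i4)])); (q4 "10023", (22, [:: 1; 0; 2; 3; 4], [:: (0, i4); (1, i4); (5,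
  i4); (4, b4)])); (q4 "10230", (23, [:: 1; 0; 2; 4; 3], [:: (1, i4); (3, i4); (5, i4); (2,
  i4)])); (q4 "10320", (22, [:: 1; 0; 4; 3; 2], [:: (1, b4); (0, a4); (5, i4); (4, b4)])); (q4
  "13020", (22, [:: 0; 1; 2; 3; 4], [:: (0, i4); (1, i4); (2, i4); (5, i4)]))]; Node 5 [:: q4
  "00123"; q4 "00132"; q4 "01023"; q4 "12030"] 5 true [:: 1; 2; 4; 3] [:: (q4 "10032", (6, [:: 0;
  1; 2; 3; 4]))] [:: (q4 "01032", (21, [:: 0; 1; 2; 4; 3], [:: (1, i4); (0, i4); (4, i4); (3,
  i4)])); (q4 "01230", (21, [:: 0; 1; 3; 4; 2], [:: (0, a4); (1, b4); (4, i4); (3, i4)])); (q4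
  "10023", (22, [:: 1; 0; 2; 3; 4], [:: (0, i4); (1, i4); (4, i4); (3, b4)])); (q4 "10230", (25,
  [:: 1; 3; 0; 4; 2], [:: (2, a4); (3, i4); (1, i4); (4, b4)])); (q4 "10320", (22, [:: 1; 0; 4; 3;
  2], [:: (1, b4); (0, a4); (4, i4); (3, b4)])); (q4 "13020", (22, [:: 0; 1; 2; 3; 4], [:: (0,
  i4); (1, i4); (2, i4); (4, i4)]))]; Node 5 [:: q4 "00123"; q4 "00132"; q4 "12003"; q4 "13002"]
  11 false [:: 0; 1; 2; 3; 4] [::] [:: (q4 "01023", (21, [:: 0; 1; 2; 3; 4], [:: (0, i4); (1, i4);
  (4, i4); (2, i4)])); (q4 "01032", (22, [:: 0; 1; 2; 4; 3], [:: (1, i4); (0, i4); (4, i4); (3,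
  i4)])); (q4 "01203", (21, [:: 0; 1; 3; 2; 4], [:: (1, a4); (0, b4); (4, i4); (2, i4)])); (q4
  "01302", (22, [:: 0; 1; 4; 2; 3], [:: (0, b4); (1, a4); (4, i4); (3, i4)])); (q4 "10023", (21,
  [:: 1; 0; 2; 3; 4], [:: (0, i4); (1, i4); (4, i4); (3, a4)])); (q4 "10032", (22, [:: 1; 0; 2; 4;
  3], [:: (1, i4); (0, i4); (4, i4); (2, b4)])); (q4 "10203", (21, [:: 1; 0; 3; 2; 4], [:: (1,
  a4); (0, b4); (4, i4); (3, a4)])); (q4 "10302", (22, [:: 1; 0; 4; 2; 3], [:: (0, b4); (1, a4);
  (4, i4); (2, b4)]))]; Node 5 [:: q4 "00123"; q4 "00132"; q4 "12003"] 5 false [:: 0; 2; 3; 4] [::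
  (q4 "010023", (5, [:: 0; 5; 1; 2; 3; 4])); (q4 "01032", (7, [:: 0; 1; 2; 4; 3])); (q4 "01302",
  (7, [:: 0; 1; 3; 4; 2])); (q4 "13002", (8, [:: 0; 1; 2; 3; 4]))] [:: (q4 "01023", (21, [:: 0; 1;
  2; 3; 4], [:: (0, i4); (1, i4); (3, i4); (2, i4)])); (q4 "01203", (21, [:: 0; 1; 3; 2; 4], [::
  (1, a4); (0, b4); (3, i4); (2, i4)])); (q4 "10032", (22, [:: 1; 0; 2; 4; 3], [:: (1, i4); (0,
  i4); (3, i4); (2, b4)])); (q4 "10302", (22, [:: 1; 0; 4; 2; 3], [:: (0, b4); (1, a4); (3, i4);
  (2, b4)]))]; Node 5 [:: q4 "00123"; q4 "01032"; q4 "10203"] 2 false [:: 2; 4; 3] [::] [:: (q4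
  "01023", (21, [:: 0; 2; 1; 3; 4], [:: (3, i4); (1, i4); (0, i4); (2, i4)])); (q4 "01302", (24,
  [:: 0; 3; 1; 2; 4], [:: (1, a4); (3, a4); (0, i4); (2, i4)])); (q4 "10023", (23, [:: 1; 0; 2; 3;
  4], [:: (0, i4); (3, i4); (2, i4); (1, i4)])); (q4 "10302", (22, [:: 2; 0; 4; 1; 3], [:: (3,
  i4); (2, i4); (0, b4); (1, i4)])); (q4 "12003", (25, [:: 1; 3; 0; 2; 4], [:: (1, a4); (3, i4);
  (0, i4); (2, b4)])); (q4 "13002", (26, [:: 0; 1; 2; 3; 4], [:: (0, i4); (1, i4); (2, i4); (3,
  i4)]))]; Node 5 [:: q4 "00123"; q4 "00132"; q4 "01023"; q4 "10320"] 1 true [:: 2; 4; 3] [::] [::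
  (q4 "01032", (22, [:: 0; 2; 1; 3; 4], [:: (2, i4); (4, i4); (0, i4); (3, i4)])); (q4 "01230",
  (23, [:: 0; 2; 3; 4; 1], [:: (4, i4); (0, a4); (2, a4); (3, i4)])); (q4 "10032", (23, [:: 2; 0;
  1; 4; 3], [:: (4, i4); (1, i4); (3, a4); (2, i4)])); (q4 "10230", (22, [:: 2; 0; 4; 3; 1], [::
  (3, i4); (4, i4); (1, b4); (2, i4)])); (q4 "12030", (22, [:: 1; 0; 4; 3; 2], [:: (1, b4); (0,
  a4); (3, i4); (4, b4)])); (q4 "13020", (22, [:: 0; 1; 2; 3; 4], [:: (0, i4); (1, i4); (2, i4);
  (4, i4)]))]; Node 5 [:: q4 "00123"; q4 "01023"; q4 "01203"; q4 "10302"] 1 true [:: 1; 2; 4] [::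
  (q4 "10203", (6, [:: 1; 3; 0; 4; 2]))] [:: (q4 "00132", (23, [:: 0; 1; 3; 2; 4], [:: (4, a4);
  (2, i4); (1, i4); (3, i4)])); (q4 "01032", (22, [:: 0; 4; 1; 2; 3], [:: (1, b4); (4, a4); (2,
  b4); (3, i4)])); (q4 "10023", (24, [:: 2; 0; 1; 3; 4], [:: (4, i4); (0, i4); (3, a4); (2,
  i4)])); (q4 "10032", (23, [:: 0; 1; 2; 3; 4], [:: (0, i4); (1, i4); (2, i4); (4, i4)])); (q4
  "12003", (24, [:: 0; 1; 2; 3; 4], [:: (0, i4); (1, i4); (2, i4); (4, i4)]))]; Node 5 [:: q4
  "00123"; q4 "00132"; q4 "01023"; q4 "13002"] 5 false [:: 1; 2; 3; 4] [:: (q4 "10032", (6, [:: 1;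
  0; 2; 4; 3]))] [:: (q4 "01032", (22, [:: 0; 1; 2; 4; 3], [:: (1, i4); (0, i4); (4, i4); (3,
  i4)])); (q4 "01302", (22, [:: 0; 1; 4; 2; 3], [:: (0, b4); (1, a4); (4, i4); (3, i4)])); (q4
  "10023", (21, [:: 1; 0; 2; 3; 4], [:: (0, i4); (1, i4); (4, i4); (3, a4)])); (q4 "10203", (21,
  [:: 1; 0; 3; 2; 4], [:: (1, a4); (0, b4); (4, i4); (3, a4)])); (q4 "10302", (25, [:: 3; 1; 2; 0;
  4], [:: (4, a4); (3, a4); (1, a4); (2, b4)])); (q4 "12003", (21, [:: 0; 1; 2; 3; 4], [:: (0,
  i4); (1, i4); (2, i4); (4, i4)]))]; Node 5 [:: q4 "00123"; q4 "01023"; q4 "10320"] 2 false [::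
  0; 3; 4] [:: (q4 "001302", (1, [:: 1; 4; 0; 5; 3; 2])); (q4 "00132", (11, [:: 0; 1; 2; 3; 4]));
  (q4 "01320", (12, [:: 0; 4; 2; 1; 3])); (q4 "10230", (13, [:: 1; 4; 0; 2; 3]))] [:: (q4 "01032",
  (22, [:: 0; 2; 1; 3; 4], [:: (1, i4); (3, i4); (0, i4); (2, i4)])); (q4 "01230", (23, [:: 0; 2;
  3; 4; 1], [:: (3, i4); (0, a4); (1, a4); (2, i4)])); (q4 "12030", (25, [:: 2; 3; 0; 4; 1], [::
  (3, i4); (1, a4); (2, a4); (0, i4)]))]; Node 5 [:: q4 "00123"; q4 "12003"; q4 "12120"] 13 false
  [:: 0; 1; 2; 3; 4] [::] [::]; Node 5 [:: q4 "00123"; q4 "12003"] 1 false [:: 1; 3; 4] [:: (q4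
  "001032", (4, [:: 0; 1; 3; 5; 4; 2])); (q4 "00132", (9, [:: 0; 1; 2; 3; 4])); (q4 "01203", (10,
  [:: 0; 3; 1; 2; 4])); (q4 "100032", (4, [:: 2; 3; 1; 5; 4; 0])); (q4 "10032", (10, [:: 2; 1; 3;
  0; 4])); (q4 "10203", (14, [:: 3; 1; 2; 4; 0])); (q4 "10302", (14, [:: 1; 3; 0; 4; 2])); (q4
  "13002", (9, [:: 2; 3; 0; 1; 4])); (q4 "12120", (15, [:: 0; 1; 2; 3; 4]))] [::]; Node 7 [:: q4
  "0000123"; q4 "0001023"; q4 "0120003"; q4 "1300002"] 2 false [:: 5; 6; 1] [::] [::]; Node 6 [::
  q4 "000123"; q4 "001023"; q4 "010032"; q4 "130002"] 2 false [:: 4; 5; 1] [::] [:: (q4 "100032",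
  (24, [:: 3; 2; 0; 0; 1; 4], [:: (3, a4); (4, a4); (2, a4); (0, i4)])); (q4 "120003", (21, [:: 2;
  3; 0; 0; 1; 4], [:: (4, i4); (3, i4); (2, a4); (0, i4)]))]; Node 6 [:: q4 "000123"; q4 "001023";
  q4 "010203"; q4 "130002"] 2 false [:: 4; 5; 1] [::] [::]; Node 6 [:: q4 "000123"; q4 "001023";
  q4 "120003"] 1 false [:: 1; 4; 5] [:: (q4 "1000032", (17, [:: 1; 0; 6; 2; 3; 4; 5])); (q4
  "100032", (18, [:: 1; 0; 2; 3; 4; 5])); (q4 "100203", (19, [:: 1; 0; 2; 3; 4; 5])); (q4
  "102003", (19, [:: 1; 0; 3; 2; 4; 5])); (q4 "130002", (5, [:: 2; 3; 4; 0; 1; 5]))] [::]; Node 5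
  [:: q4 "00123"; q4 "01023"; q4 "10032"; q4 "10203"] 2 false [:: 3; 4; 0] [::] [:: (q4 "00132",
  (24, [:: 2; 0; 3; 1; 4], [:: (3, i4); (4, a4); (2, a4); (1, i4)])); (q4 "01032", (21, [:: 0; 2;
  1; 3; 4], [:: (1, i4); (4, i4); (0, i4); (3, i4)])); (q4 "01203", (23, [:: 0; 1; 2; 3; 4], [::
  (0, i4); (1, i4); (4, i4); (2, i4)])); (q4 "01302", (23, [:: 0; 2; 1; 3; 4], [:: (1, i4); (0,
  i4); (4, a4); (2, i4)])); (q4 "10302", (21, [:: 3; 0; 2; 1; 4], [:: (4, a4); (3, b4); (2, a4);
  (1, i4)])); (q4 "13002", (25, [:: 0; 1; 2; 3; 4], [:: (0, i4); (1, i4); (3, i4); (4, i4)]))];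
  Node 5 [:: q4 "00123"; q4 "01023"; q4 "10203"; q4 "12003"] 2 false [:: 3; 4; 0] [::] [:: (q4
  "00132", (21, [:: 0; 1; 2; 3; 4], [:: (0, i4); (4, i4); (1, i4); (3, i4)])); (q4 "01032", (21,
  [:: 0; 2; 1; 3; 4], [:: (1, i4); (4, i4); (0, i4); (2, i4)])); (q4 "01203", (24, [:: 0; 1; 2; 3;
  4], [:: (0, i4); (1, i4); (4, i4); (3, i4)])); (q4 "01302", (24, [:: 0; 2; 1; 3; 4], [:: (1,
  i4); (0, i4); (4, a4); (2, i4)])); (q4 "10302", (25, [:: 0; 2; 1; 3; 4], [:: (1, i4); (0, i4);
  (3, i4); (4, i4)])); (q4 "13002", (25, [:: 0; 1; 2; 3; 4], [:: (0, i4); (1, i4); (2, i4); (4,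
  i4)]))]; Node 5 [:: q4 "00123"; q4 "01023"; q4 "10203"] 1 false [:: 2; 3; 4] [:: (q4 "100032",
  (19, [:: 5; 0; 1; 2; 3; 4])); (q4 "10032", (21, [:: 0; 1; 2; 3; 4])); (q4 "10302", (7, [:: 1; 3;
  0; 4; 2])); (q4 "12003", (22, [:: 0; 1; 2; 3; 4]))] [:: (q4 "01032", (21, [:: 0; 2; 1; 3; 4],
  [:: (1, i4); (3, i4); (0, i4); (2, i4)])); (q4 "01302", (24, [:: 0; 2; 1; 3; 4], [:: (1, i4);
  (0, i4); (3, a4); (2, i4)])); (q4 "13002", (25, [:: 0; 1; 2; 3; 4], [:: (0, i4); (1, i4); (2,
  i4); (3, i4)]))]; Node 7 [:: q4 "0000123"; q4 "0001023"; q4 "0010023"; q4 "0100230"; q4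
  "1300020"] 1 true [:: 1; 6; 5] [::] [::]; Node 6 [:: q4 "000123"; q4 "001023"; q4 "001203"; q4
  "010302"; q4 "100302"] 1 true [:: 2; 3; 5] [::] [:: (q4 "000132", (23, [:: 0; 0; 1; 3; 2; 4],
  [:: (5, a4); (2, i4); (1, i4); (3, i4)])); (q4 "001032", (22, [:: 0; 0; 4; 1; 2; 3], [:: (1,
  b4); (5, a4); (2, b4); (3, i4)]))]; Node 6 [:: q4 "000123"; q4 "000132"; q4 "001023"; q4
  "013002"; q4 "103002"] 5 false [:: 2; 3; 4; 5] [::] [:: (q4 "001032", (22, [:: 0; 0; 1; 2; 4;
  3], [:: (1, i4); (0, i4); (5, i4); (3, i4)])); (q4 "001302", (22, [:: 0; 0; 1; 4; 2; 3], [:: (0,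
  b4); (1, a4); (5, i4); (3, i4)]))]; Node 6 [:: q4 "000123"; q4 "001023"; q4 "010023"; q4
  "100230"; q4 "102030"] 1 true [:: 0; 5; 4] [::] [::]; Node 6 [:: q4 "000123"; q4 "001023"; q4
  "010023"; q4 "100230"] 2 false [:: 3; 4; 5] [:: (q4 "1000302", (24, [:: 6; 0; 1; 2; 3; 4; 5]));
  (q4 "100032", (25, [:: 1; 2; 0; 5; 3; 4])); (q4 "100320", (26, [:: 1; 2; 5; 0; 3; 4])); (q4
  "102030", (27, [:: 0; 1; 2; 3; 4; 5])); (q4 "120030", (27, [:: 0; 2; 1; 3; 4; 5]))] [::]; Node 5
  [:: q4 "00123"; q4 "00132"; q4 "01023"; q4 "10230"] 2 false [:: 2; 3; 4] [::] [:: (q4 "01032",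
  (21, [:: 0; 2; 1; 4; 3], [:: (4, i4); (2, i4); (1, i4); (3, i4)])); (q4 "01320", (24, [:: 0; 3;
  1; 4; 2], [:: (2, a4); (4, a4); (1, i4); (3, i4)])); (q4 "10032", (23, [:: 1; 0; 2; 4; 3], [::
  (1, i4); (4, i4); (3, i4); (2, i4)])); (q4 "10320", (22, [:: 2; 0; 4; 3; 1], [:: (4, i4); (3,
  i4); (1, b4); (2, i4)])); (q4 "12030", (25, [:: 1; 3; 0; 4; 2], [:: (2, a4); (4, i4); (1, i4);
  (3, b4)])); (q4 "13020", (22, [:: 0; 1; 2; 3; 4], [:: (0, i4); (1, i4); (2, i4); (4, i4)]))];
  Node 6 [:: q4 "000123"; q4 "001023"; q4 "001203"; q4 "010302"; q4 "103002"] 1 true [:: 2; 3; 5]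
  [::] [::]; Node 5 [:: q4 "00123"; q4 "00132"; q4 "01023"; q4 "01203"; q4 "13002"] 5 false [:: 1;
  2; 3; 4] [::] [:: (q4 "01032", (22, [:: 0; 1; 2; 4; 3], [:: (1, i4); (0, i4); (5, i4); (4,
  i4)])); (q4 "01302", (22, [:: 0; 1; 4; 2; 3], [:: (0, b4); (1, a4); (5, i4); (4, i4)])); (q4
  "10023", (21, [:: 1; 0; 2; 3; 4], [:: (0, i4); (1, i4); (5, i4); (4, a4)])); (q4 "10032", (23,
  [:: 0; 1; 2; 3; 4], [:: (0, i4); (2, i4); (3, i4); (5, i4)])); (q4 "10203", (21, [:: 1; 0; 3; 2;
  4], [:: (1, a4); (0, b4); (5, i4); (4, a4)])); (q4 "10302", (23, [:: 0; 1; 3; 2; 4], [:: (1,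
  a4); (3, i4); (2, i4); (5, i4)])); (q4 "12003", (21, [:: 0; 1; 2; 3; 4], [:: (0, i4); (1, i4);
  (2, i4); (5, i4)]))]; Node 5 [:: q4 "00123"; q4 "00132"; q4 "01023"; q4 "01320"; q4 "10023"] 1
  true [:: 2; 4; 3] [::] [:: (q4 "01032", (23, [:: 0; 2; 1; 4; 3], [:: (5, i4); (1, i4); (3, a4);
  (4, i4)])); (q4 "01230", (22, [:: 0; 2; 4; 3; 1], [:: (3, i4); (5, i4); (1, b4); (4, i4)])); (q4
  "10032", (24, [:: 0; 3; 2; 4; 1], [:: (3, a4); (2, a4); (0, a4); (5, i4)])); (q4 "10230", (23,
  [:: 2; 0; 3; 4; 1], [:: (5, i4); (0, a4); (4, a4); (3, i4)])); (q4 "12030", (22, [:: 1; 0; 2; 3;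
  4], [:: (0, i4); (1, i4); (4, i4); (5, b4)])); (q4 "13020", (22, [:: 0; 1; 2; 3; 4], [:: (0,
  i4); (1, i4); (2, i4); (5, i4)]))]; Node 5 [:: q4 "00123"; q4 "01023"; q4 "01203"; q4 "10302";
  q4 "13002"] 1 true [:: 1; 2; 4] [::] [:: (q4 "00132", (23, [:: 0; 1; 3; 2; 4], [:: (5, a4); (2,
  i4); (1, i4); (3, i4)])); (q4 "01032", (25, [:: 3; 2; 1; 0; 4], [:: (4, a4); (3, a4); (5, a4);
  (0, b4)])); (q4 "10023", (24, [:: 2; 0; 1; 3; 4], [:: (5, i4); (0, i4); (3, a4); (2, i4)])); (q4
  "10032", (23, [:: 0; 1; 2; 3; 4], [:: (0, i4); (1, i4); (2, i4); (5, i4)])); (q4 "10203", (25,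
  [:: 0; 1; 2; 3; 4], [:: (0, i4); (1, i4); (5, i4); (4, i4)])); (q4 "12003", (24, [:: 0; 1; 2; 3;
  4], [:: (0, i4); (1, i4); (2, i4); (5, i4)]))]; Node 5 [:: q4 "00123"; q4 "01023"; q4 "01203";
  q4 "13002"] 2 false [:: 3; 4; 1] [:: (q4 "001032", (30, [:: 0; 5; 1; 2; 3; 4])); (q4 "00132",
  (31, [:: 0; 1; 2; 3; 4])); (q4 "01302", (32, [:: 0; 3; 2; 4; 1])); (q4 "10302", (33, [:: 0; 1;
  2; 3; 4]))] [:: (q4 "10032", (23, [:: 0; 1; 2; 3; 4], [:: (0, i4); (1, i4); (2, i4); (4, i4)]));
  (q4 "10203", (25, [:: 0; 1; 2; 3; 4], [:: (0, i4); (1, i4); (4, i4); (3, i4)])); (q4 "12003",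
  (24, [:: 0; 1; 2; 3; 4], [:: (0, i4); (1, i4); (2, i4); (4, i4)]))]; Node 5 [:: q4 "00123"; q4
  "01023"; q4 "10230"] 1 false [:: 1; 2; 3] [:: (q4 "000123", (28, [:: 0; 1; 5; 2; 3; 4])); (q4
  "00132", (29, [:: 0; 1; 2; 3; 4])); (q4 "01032", (7, [:: 0; 2; 1; 3; 4])); (q4 "10023", (34, [::
  1; 4; 0; 2; 3])); (q4 "100302", (2, [:: 1; 4; 5; 2; 3; 0])); (q4 "10032", (12, [:: 1; 0; 4; 2;
  3])); (q4 "10320", (13, [:: 1; 4; 0; 2; 3]))] [:: (q4 "13020", (25, [:: 2; 0; 3; 4; 1], [:: (2,
  i4); (0, a4); (3, a4); (1, i4)]))]; Node 4 [:: q4 "0123"; q4 "0132"; q4 "1023"; q4 "1230"] 2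
  false [:: 1; 2; 3] [::] [:: (q4 "00132", (24, [:: 2; 3; 4; 1; 0], [:: (3, i4); (0, a4); (2, a4);
  (4, b4)])); (q4 "01302", (23, [:: 2; 3; 4; 1; 0], [:: (3, i4); (0, a4); (2, a4); (4, b4)])); (q4
  "10203", (21, [:: 1; 3; 4; 2; 0], [:: (0, a4); (1, b4); (3, i4); (4, a4)])); (q4 "10302", (22,
  [:: 1; 2; 3; 4; 0], [:: (0, i4); (1, i4); (2, i4); (4, b4)])); (q4 "1032", (27, [:: 0; 1; 3; 2],
  [:: (1, i4); (0, i4); (4, i4); (2, i4); (3, i4)])); (q4 "1203", (17, [:: 0; 1; 2; 3], [:: (0,
  i4); (2, i4); (4, i4); (3, i4)])); (q4 "1302", (18, [:: 1; 0; 2; 3], [:: (2, i4); (0, i4); (4,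
  a4); (3, b4)])); (q4 "1320", (27, [:: 1; 2; 3; 0], [:: (3, i4); (4, i4); (0, a4); (1, b4); (2,
  a4)]))]; Node 5 [:: q4 "00123"; q4 "00132"; q4 "01023"; q4 "01320"; q4 "12030"] 5 true [:: 1; 2;
  4; 3] [::] [:: (q4 "01032", (21, [:: 0; 1; 2; 4; 3], [:: (1, i4); (0, i4); (5, i4); (4, i4)]));
  (q4 "01230", (21, [:: 0; 1; 3; 4; 2], [:: (0, a4); (1, b4); (5, i4); (4, i4)])); (q4 "10023",
  (22, [:: 1; 0; 2; 3; 4], [:: (0, i4); (1, i4); (5, i4); (4, b4)])); (q4 "10032", (24, [:: 0; 3;
  2; 4; 1], [:: (3, a4); (2, a4); (0, a4); (5, i4)])); (q4 "10230", (24, [:: 0; 3; 1; 4; 2], [::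
  (2, a4); (3, a4); (1, i4); (5, i4)])); (q4 "10320", (22, [:: 1; 0; 4; 3; 2], [:: (1, b4); (0,
  a4); (5, i4); (4, b4)])); (q4 "13020", (22, [:: 0; 1; 2; 3; 4], [:: (0, i4); (1, i4); (2, i4);
  (5, i4)]))]; Node 4 [:: q4 "0123"; q4 "0132"; q4 "1023"; q4 "1320"] 1 true [:: 1; 3; 2] [:: (q4
  "10203", (37, [:: 4; 0; 1; 2; 3]))] [:: (q4 "00132", (24, [:: 3; 2; 4; 1; 0], [:: (3, a4); (2,
  a4); (0, a4); (4, b4)])); (q4 "01203", (24, [:: 3; 1; 4; 2; 0], [:: (2, a4); (3, a4); (1, i4);
  (4, a4)])); (q4 "10302", (22, [:: 1; 2; 3; 4; 0], [:: (0, i4); (1, i4); (2, i4); (4, b4)])); (q4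
  "1032", (27, [:: 1; 0; 3; 2], [:: (4, i4); (2, i4); (1, i4); (0, i4); (3, a4)])); (q4 "1203",
  (18, [:: 0; 1; 2; 3], [:: (0, i4); (2, i4); (4, i4); (3, i4)])); (q4 "1230", (27, [:: 1; 2; 3;
  0], [:: (4, i4); (3, i4); (0, a4); (1, b4); (2, a4)])); (q4 "1302", (17, [:: 0; 3; 1; 2], [::
  (0, b4); (4, i4); (3, i4); (2, i4)]))]; Node 4 [:: q4 "0123"; q4 "1023"; q4 "1203"] 1 false [::
  1; 2; 3] [:: (q4 "01032", (12, [:: 4; 0; 1; 2; 3])); (q4 "10032", (34, [:: 4; 0; 1; 2; 3])); (q4
  "1032", (36, [:: 1; 2; 3; 0])); (q4 "1302", (38, [:: 2; 0; 3; 1]))] [:: (q4 "00132", (23, [:: 1;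
  2; 3; 4; 0], [:: (0, i4); (1, i4); (2, i4); (3, b4)])); (q4 "10023", (24, [:: 1; 2; 3; 4; 0],
  [:: (0, i4); (1, i4); (2, i4); (3, a4)])); (q4 "1230", (17, [:: 0; 1; 2; 3], [:: (0, i4); (1,
  i4); (2, i4); (3, i4)])); (q4 "1320", (18, [:: 0; 1; 2; 3], [:: (0, i4); (1, i4); (2, i4); (3,
  i4)]))]; Node 6 [:: q4 "000123"; q4 "001023"; q4 "010032"; q4 "210012"] 3 true [:: 1; 5; 4] [::]
  [::]; Node 7 [:: q4 "0000123"; q4 "0001023"; q4 "0120012"; q4 "2100012"] 3 true [:: 1; 6; 5]
  [::] [::]; Node 6 [:: q4 "000123"; q4 "001023"; q4 "010212"; q4 "210012"] 3 true [:: 1; 5; 4]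
  [::] [::]; Node 6 [:: q4 "000123"; q4 "001023"; q4 "120012"; q4 "210012"] 6 false [:: 0; 1; 4;
  5] [::] [::]; Node 6 [:: q4 "000123"; q4 "001023"; q4 "120012"] 3 false [:: 1; 4; 5] [:: (q4
  "100032", (40, [:: 1; 0; 2; 3; 4; 5])); (q4 "1000122", (41, [:: 1; 0; 6; 2; 3; 4; 5])); (q4
  "100212", (42, [:: 1; 0; 2; 3; 4; 5])); (q4 "102012", (42, [:: 1; 0; 3; 2; 4; 5])); (q4
  "210012", (43, [:: 0; 1; 2; 3; 4; 5]))] [::]; Node 5 [:: q4 "00123"; q4 "00132"; q4 "01023"; q4
  "20112"] 3 true [:: 2; 4; 3] [::] [::]; Node 6 [:: q4 "000123"; q4 "001023"; q4 "020112"; q4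
  "200112"] 3 true [:: 3; 5; 4] [::] [::]; Node 5 [:: q4 "00123"; q4 "01023"; q4 "01212"; q4
  "21012"] 3 true [:: 1; 4; 3] [::] [::]; Node 5 [:: q4 "00123"; q4 "01023"; q4 "10212"; q4
  "20112"] 6 false [:: 0; 2; 3; 4] [::] [::]; Node 5 [:: q4 "00123"; q4 "01023"; q4 "20112"] 3
  false [:: 0; 3; 4] [:: (q4 "00132", (45, [:: 0; 1; 2; 3; 4])); (q4 "001122", (46, [:: 0; 5; 1;
  2; 3; 4])); (q4 "02112", (47, [:: 0; 2; 1; 3; 4])); (q4 "10212", (48, [:: 0; 1; 2; 3; 4]))]
  [::]; Node 5 [:: q4 "00123"; q4 "01023"; q4 "10032"; q4 "10212"] 3 true [:: 0; 4; 3] [::] [::];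
  Node 5 [:: q4 "00123"; q4 "01023"; q4 "10212"; q4 "12012"] 3 true [:: 0; 4; 3] [::] [::]; Node 5
  [:: q4 "00123"; q4 "01023"; q4 "10212"] 3 false [:: 2; 3; 4] [:: (q4 "10032", (50, [:: 0; 1; 2;
  3; 4])); (q4 "100122", (42, [:: 5; 0; 1; 2; 3; 4])); (q4 "12012", (51, [:: 0; 1; 2; 3; 4])); (q4
  "20112", (48, [:: 0; 1; 2; 3; 4]))] [::]; Node 4 [:: q4 "0123"; q4 "0132"; q4 "1023"; q4 "2112"]
  3 true [:: 1; 3; 2] [::] [::]; Node 4 [:: q4 "0123"; q4 "1023"; q4 "1212"; q4 "2112"] 6 false
  [:: 0; 1; 2; 3] [::] [::]; Node 4 [:: q4 "0123"; q4 "1023"; q4 "1212"] 3 false [:: 1; 2; 3] [::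
  (q4 "1032", (53, [:: 1; 0; 2; 3])); (q4 "10122", (47, [:: 4; 0; 1; 2; 3])); (q4 "2112", (54, [::
  0; 1; 2; 3]))] [::]; Node 4 [:: q4 "0123"; q4 "1023"] 0 false [:: 2; 3] [:: (q4 "000123", (20,
  [:: 4; 5; 0; 1; 2; 3])); (q4 "001023", (4, [:: 4; 5; 0; 1; 2; 3])); (q4 "01023", (23, [:: 4; 0;
  1; 2; 3])); (q4 "01032", (35, [:: 0; 4; 2; 3; 1])); (q4 "01203", (35, [:: 4; 0; 1; 2; 3])); (q4
  "01302", (14, [:: 4; 0; 1; 2; 3])); (q4 "10023", (23, [:: 4; 1; 0; 2; 3])); (q4 "10032", (35,
  [:: 1; 4; 2; 3; 0])); (q4 "10203", (35, [:: 4; 1; 0; 2; 3])); (q4 "10302", (14, [:: 4; 1; 0; 2;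
  3])); (q4 "1203", (39, [:: 0; 1; 2; 3])); (q4 "1230", (39, [:: 3; 0; 1; 2])); (q4 "1302", (39,
  [:: 1; 0; 2; 3])); (q4 "1320", (39, [:: 3; 1; 0; 2])); (q4 "001212", (44, [:: 4; 5; 0; 1; 2;
  3])); (q4 "01122", (49, [:: 4; 0; 1; 2; 3])); (q4 "02121", (52, [:: 4; 0; 1; 2; 3])); (q4
  "10122", (49, [:: 4; 1; 0; 2; 3])); (q4 "1212", (55, [:: 0; 1; 2; 3])); (q4 "20121", (52, [:: 4;
  1; 0; 2; 3])); (q4 "2112", (55, [:: 1; 0; 2; 3]))] [::]; Node 5 [:: q4 "00123"; q4 "01023"; q4
  "10032"; q4 "10320"] 2 false [:: 0; 3; 4] [::] [:: (q4 "00132", (23, [:: 2; 0; 1; 4; 3], [:: (2,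
  i4); (4, i4); (3, a4); (1, i4)])); (q4 "01032", (22, [:: 0; 2; 1; 3; 4], [:: (1, i4); (4, i4);
  (0, i4); (3, i4)])); (q4 "01230", (24, [:: 0; 2; 3; 4; 1], [:: (4, i4); (0, a4); (1, a4); (2,
  i4)])); (q4 "01320", (24, [:: 0; 3; 2; 4; 1], [:: (4, a4); (1, a4); (0, a4); (2, i4)])); (q4
  "10230", (22, [:: 4; 0; 2; 3; 1], [:: (4, b4); (3, a4); (2, b4); (1, i4)])); (q4 "12030", (25,
  [:: 2; 3; 0; 4; 1], [:: (4, i4); (1, a4); (3, a4); (0, i4)]))]; Node 4 [:: q4 "0123"; q4 "1032";
  q4 "1122"; q4 "1203"; q4 "1320"] 9 false [:: 0; 1; 2; 3] [::] [:: (q4 "2211", (19, [:: 0; 1; 2;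
  3], [:: (0, i4); (1, i4); (2, i4); (5, b4)]))]; Node 4 [:: q4 "0123"; q4 "1032"; q4 "1203"; q4
  "1320"] 9 false [:: 0; 1; 2; 3] [:: (q4 "1212", (58, [:: 0; 2; 3; 1])); (q4 "1221", (58, [:: 0;
  3; 1; 2])); (q4 "2112", (58, [:: 1; 2; 0; 3])); (q4 "2121", (58, [:: 1; 3; 2; 0])); (q4 "2211",
  (58, [:: 2; 3; 0; 1]))] [:: (q4 "0132", (18, [:: 1; 0; 3; 2], [:: (1, i4); (4, i4); (3, a4); (2,
  b4)])); (q4 "1023", (18, [:: 0; 1; 2; 3], [:: (0, i4); (4, i4); (2, i4); (3, i4)])); (q4 "1230",
  (18, [:: 0; 2; 3; 1], [:: (0, a4); (4, i4); (1, i4); (2, i4)])); (q4 "1302", (18, [:: 0; 3; 1;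
  2], [:: (0, b4); (4, i4); (3, i4); (1, i4)]))]; Node 4 [:: q4 "0123"; q4 "1032"; q4 "1122"; q4
  "1203"] 9 false [:: 0; 1; 2; 3] [::] [:: (q4 "2121", (20, [:: 2; 0; 1; 3], [:: (1, a4); (3, b4);
  (2, i4); (4, i4)])); (q4 "2211", (19, [:: 0; 1; 2; 3], [:: (0, i4); (1, i4); (2, i4); (4,
  b4)]))]; Node 4 [:: q4 "0123"; q4 "1032"; q4 "2211"; q4 "1203"] 9 false [:: 2; 3; 0; 1] [::] [::
  (q4 "1122", (19, [:: 0; 1; 2; 3], [:: (0, i4); (1, i4); (4, i4); (2, b4)])); (q4 "2112", (20,
  [:: 1; 2; 0; 3], [:: (3, i4); (0, b4); (4, i4); (2, i4)]))]; Node 4 [:: q4 "0123"; q4 "1032"; q4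
  "1203"] 2 false [:: 0; 3; 1] [:: (q4 "00123", (21, [:: 0; 4; 1; 2; 3])); (q4 "00132", (57, [::
  1; 4; 0; 3; 2])); (q4 "01023", (21, [:: 2; 4; 0; 1; 3])); (q4 "0132", (36, [:: 0; 1; 3; 2]));
  (q4 "10032", (57, [:: 2; 4; 1; 3; 0])); (q4 "1023", (36, [:: 1; 2; 3; 0])); (q4 "1320", (59, [::
  0; 1; 2; 3])); (q4 "1122", (60, [:: 0; 1; 2; 3])); (q4 "1212", (60, [:: 2; 0; 1; 3])); (q4
  "1221", (61, [:: 1; 2; 0; 3])); (q4 "2112", (60, [:: 1; 2; 0; 3])); (q4 "2121", (61, [:: 2; 0;
  1; 3])); (q4 "2211", (61, [:: 0; 1; 2; 3]))] [:: (q4 "1230", (18, [:: 0; 2; 3; 1], [:: (0, a4);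
  (3, i4); (1, i4); (2, i4)]))]; Node 5 [:: q4 "00123"; q4 "01032"; q4 "20121"] 3 true [:: 2; 3;
  4] [::] [::]; Node 5 [:: q4 "00123"; q4 "01032"; q4 "10221"] 3 false [:: 2; 4; 3] [::] [::];
  Node 4 [:: q4 "0123"; q4 "1032"; q4 "1122"] 8 false [:: 0; 1; 2; 3] [:: (q4 "1203", (60, [:: 0;
  1; 2; 3])); (q4 "1320", (60, [:: 1; 0; 3; 2]))] [:: (q4 "2211", (19, [:: 0; 1; 2; 3], [:: (0,
  i4); (1, i4); (2, i4); (3, b4)]))]; Node 4 [:: q4 "0123"; q4 "1032"; q4 "1122"; q4 "1212"] 8
  false [:: 0; 1; 2; 3] [::] [:: (q4 "1320", (20, [:: 0; 2; 3; 1], [:: (0, a4); (4, i4); (2, i4);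
  (3, i4)]))]; Node 4 [:: q4 "0123"; q4 "1032"; q4 "1212"; q4 "2121"] 8 false [:: 0; 1; 2; 3] [::]
  [:: (q4 "1203", (19, [:: 0; 3; 1; 2], [:: (0, b4); (4, i4); (2, i4); (3, b4)])); (q4 "1320",
  (19, [:: 3; 0; 2; 1], [:: (1, b4); (4, a4); (3, i4); (2, b4)]))]; Node 4 [:: q4 "0123"; q4
  "1032"; q4 "1212"] 3 true [:: 0; 3; 2] [:: (q4 "1203", (60, [:: 2; 0; 1; 3])); (q4 "1320", (61,
  [:: 3; 1; 0; 2])); (q4 "1122", (66, [:: 0; 1; 2; 3])); (q4 "2121", (67, [:: 0; 1; 2; 3]))] [::
  (q4 "1221", (20, [:: 0; 1; 2; 3], [:: (0, i4); (1, i4); (2, i4); (3, i4)]))]; Node 4 [:: q4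
  "0123"; q4 "1032"; q4 "1221"; q4 "2112"] 8 true [:: 0; 1; 3; 2] [::] [:: (q4 "1203", (19, [:: 2;
  0; 1; 3], [:: (1, a4); (4, b4); (3, i4); (2, b4)])); (q4 "1320", (19, [:: 0; 2; 3; 1], [:: (0,
  a4); (4, i4); (2, i4); (3, b4)]))]; Node 4 [:: q4 "0123"; q4 "1032"; q4 "2211"; q4 "1221"] 8
  true [:: 0; 1; 3; 2] [::] [:: (q4 "1320", (20, [:: 2; 1; 3; 0], [:: (4, a4); (1, b4); (3, i4);
  (2, i4)]))]; Node 4 [:: q4 "0123"; q4 "1032"; q4 "1221"] 3 false [:: 1; 3; 2] [:: (q4 "1203",
  (61, [:: 1; 2; 0; 3])); (q4 "1320", (60, [:: 0; 3; 1; 2])); (q4 "2112", (69, [:: 0; 1; 2; 3]));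
  (q4 "2211", (70, [:: 0; 1; 2; 3]))] [:: (q4 "1212", (20, [:: 0; 1; 2; 3], [:: (0, i4); (1, i4);
  (3, i4); (2, i4)]))]; Node 4 [:: q4 "0123"; q4 "1032"; q4 "2211"] 9 false [:: 2; 3; 0; 1] [::
  (q4 "1221", (70, [:: 0; 1; 2; 3])); (q4 "2112", (70, [:: 1; 0; 3; 2]))] [:: (q4 "1122", (19, [::
  0; 1; 2; 3], [:: (0, i4); (1, i4); (3, i4); (2, b4)]))]; Node 4 [:: q4 "0123"; q4 "1032"] 0
  false [:: 2; 3] [:: (q4 "01023", (10, [:: 4; 0; 1; 2; 3])); (q4 "01032", (14, [:: 0; 4; 2; 3;
  1])); (q4 "01203", (23, [:: 0; 4; 3; 1; 2])); (q4 "01302", (10, [:: 0; 4; 3; 1; 2])); (q4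
  "10023", (23, [:: 1; 4; 2; 0; 3])); (q4 "10032", (10, [:: 1; 4; 2; 0; 3])); (q4 "10203", (10,
  [:: 4; 1; 0; 3; 2])); (q4 "10302", (14, [:: 1; 4; 3; 2; 0])); (q4 "1203", (62, [:: 0; 1; 2;
  3])); (q4 "1230", (39, [:: 0; 3; 1; 2])); (q4 "1302", (39, [:: 1; 2; 0; 3])); (q4 "1320", (62,
  [:: 0; 3; 1; 2])); (q4 "01212", (63, [:: 4; 0; 1; 2; 3])); (q4 "02211", (64, [:: 4; 0; 1; 2;
  3])); (q4 "10122", (63, [:: 4; 1; 0; 3; 2])); (q4 "1122", (65, [:: 0; 1; 2; 3])); (q4 "1212",
  (68, [:: 0; 1; 2; 3])); (q4 "1221", (71, [:: 0; 1; 2; 3])); (q4 "20121", (64, [:: 4; 1; 0; 3;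
  2])); (q4 "2112", (71, [:: 1; 0; 3; 2])); (q4 "2121", (68, [:: 1; 0; 3; 2])); (q4 "2211", (72,
  [:: 0; 1; 2; 3]))] [::]; Node 6 [:: q4 "000123"; q4 "012012"; q4 "210012"] 3 true [:: 1; 5; 4]
  [::] [::]; Node 5 [:: q4 "00123"; q4 "01122"; q4 "21120"] 3 true [:: 1; 3; 2] [::] [::]; Node 5
  [:: q4 "00123"; q4 "12012"; q4 "21012"] 6 false [:: 0; 1; 3; 4] [::] [::]; Node 5 [:: q4
  "00123"; q4 "12012"] 3 false [:: 1; 3; 4] [:: (q4 "10032", (63, [:: 1; 2; 0; 4; 3])); (q4
  "12300", (15, [:: 0; 1; 3; 4; 2])); (q4 "100122", (74, [:: 1; 0; 5; 2; 3; 4])); (q4 "10212",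
  (75, [:: 1; 0; 3; 4; 2])); (q4 "21012", (76, [:: 0; 1; 2; 3; 4]))] [::]; Node 5 [:: q4 "00123";
  q4 "00132"; q4 "02211"; q4 "20121"] 4 true [:: 2; 3; 4] [::] [::]; Node 4 [:: q4 "0123"; q4
  "0132"; q4 "2211"; q4 "2121"] 4 true [:: 1; 2; 3] [::] [::]; Node 4 [:: q4 "0123"; q4 "0132"; q4
  "2211"] 3 true [:: 2; 1; 3] [:: (q4 "01302", (45, [:: 0; 4; 3; 2; 1])); (q4 "1320", (53, [:: 0;
  3; 2; 1])); (q4 "01122", (78, [:: 0; 4; 3; 1; 2])); (q4 "01212", (78, [:: 0; 4; 2; 1; 3])); (q4
  "2112", (79, [:: 0; 1; 3; 2])); (q4 "2121", (79, [:: 0; 1; 2; 3]))] [:: (q4 "1122", (16, [:: 0;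
  1; 2; 3], [:: (0, i4); (1, i4); (3, i4); (2, b4)]))]; Node 5 [:: q4 "00123"; q4 "02211"; q4
  "20121"] 4 true [:: 2; 3; 4] [::] [::]; Node 6 [:: q4 "000123"; q4 "001032"; q4 "020121"; q4
  "200121"] 3 true [:: 3; 4; 5] [::] [::]; Node 5 [:: q4 "00123"; q4 "01032"; q4 "01212"; q4
  "21012"] 3 true [:: 1; 4; 3] [::] [::]; Node 6 [:: q4 "000123"; q4 "002211"; q4 "020211"; q4
  "200112"] 4 true [:: 3; 5; 4] [::] [::]; Node 6 [:: q4 "000123"; q4 "002211"; q4 "020211"; q4
  "200121"] 4 true [:: 3; 4; 5] [::] [::]; Node 5 [:: q4 "00123"; q4 "02211"; q4 "02121"; q4
  "20121"] 4 true [:: 2; 3; 4] [::] [::]; Node 5 [:: q4 "00123"; q4 "02211"; q4 "02121"; q4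
  "20211"] 4 true [:: 2; 3; 4] [::] [::]; Node 5 [:: q4 "00123"; q4 "02211"; q4 "20211"] 3 true
  [:: 3; 2; 4] [:: (q4 "001302", (82, [:: 0; 1; 5; 4; 2; 3])); (q4 "01320", (83, [:: 0; 4; 1; 3;
  2])); (q4 "10320", (83, [:: 1; 4; 0; 3; 2])); (q4 "001122", (84, [:: 5; 0; 1; 2; 3; 4])); (q4
  "001212", (85, [:: 5; 0; 1; 2; 3; 4])); (q4 "02112", (86, [:: 0; 1; 4; 2; 3])); (q4 "02121",
  (87, [:: 0; 1; 2; 3; 4])); (q4 "20112", (86, [:: 1; 0; 4; 2; 3])); (q4 "20121", (87, [:: 1; 0;
  2; 3; 4]))] [::]; Node 4 [:: q4 "0123"; q4 "1122"; q4 "2211"; q4 "2121"] 8 true [:: 0; 2; 1; 3]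
  [::] [::]; Node 4 [:: q4 "0123"; q4 "1122"; q4 "2211"] 8 false [:: 0; 3; 1; 2] [:: (q4 "1203",
  (69, [:: 0; 2; 3; 1])); (q4 "2121", (89, [:: 0; 1; 2; 3]))] [:: (q4 "0132", (16, [:: 0; 1; 2;
  3], [:: (0, i4); (3, i4); (1, i4); (2, b4)])); (q4 "1032", (19, [:: 0; 1; 2; 3], [:: (0, i4);
  (3, i4); (1, i4); (2, b4)]))]; Node 4 [:: q4 "0123"; q4 "1122"; q4 "2211"; q4 "1221"] 8 false
  [:: 0; 3; 1; 2] [::] [::]; Node 4 [:: q4 "0123"; q4 "1122"; q4 "2121"] 6 false [:: 0; 3; 1; 2]
  [:: (q4 "1032", (66, [:: 1; 0; 3; 2])); (q4 "1203", (70, [:: 0; 2; 3; 1])); (q4 "1212", (91, [::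
  0; 2; 3; 1])); (q4 "2211", (89, [:: 0; 1; 2; 3]))] [::]; Node 4 [:: q4 "0123"; q4 "2211"; q4
  "2121"] 4 true [:: 1; 2; 3] [:: (q4 "1203", (70, [:: 2; 0; 1; 3])); (q4 "1122", (89, [:: 0; 1;
  2; 3]))] [:: (q4 "1320", (20, [:: 1; 3; 2; 0], [:: (3, i4); (0, a4); (1, i4); (2, i4)]))]; Node
  4 [:: q4 "0123"; q4 "2211"] 3 false [:: 0; 3; 1] [:: (q4 "01302", (63, [:: 0; 4; 3; 1; 2])); (q4
  "0132", (80, [:: 0; 1; 2; 3])); (q4 "1032", (72, [:: 0; 1; 2; 3])); (q4 "1320", (68, [:: 3; 0;
  2; 1])); (q4 "01122", (81, [:: 0; 4; 3; 1; 2])); (q4 "01212", (81, [:: 4; 0; 1; 2; 3])); (q4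
  "02112", (88, [:: 0; 4; 1; 2; 3])); (q4 "1122", (90, [:: 0; 1; 2; 3])); (q4 "1221", (92, [:: 0;
  3; 1; 2])); (q4 "2112", (93, [:: 0; 3; 1; 2])); (q4 "2121", (93, [:: 0; 1; 2; 3]))] [::]; Node 5
  [:: q4 "00123"; q4 "01122"; q4 "10212"] 4 false [:: 2; 3; 4] [::] [::]; Node 4 [:: q4 "0123"; q4
  "1122"; q4 "1212"] 4 false [:: 1; 2; 3] [:: (q4 "1032", (66, [:: 0; 1; 2; 3])); (q4 "2121", (91,
  [:: 0; 2; 3; 1]))] [:: (q4 "1320", (20, [:: 0; 2; 3; 1], [:: (0, a4); (3, i4); (1, i4); (2,
  i4)]))]; Node 4 [:: q4 "0123"; q4 "1122"] 3 false [:: 2; 1; 3] [:: (q4 "01203", (52, [:: 0; 4;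
  3; 1; 2])); (q4 "1032", (65, [:: 0; 1; 2; 3])); (q4 "1230", (55, [:: 0; 3; 1; 2])); (q4 "1320",
  (68, [:: 0; 3; 1; 2])); (q4 "02121", (95, [:: 4; 0; 1; 2; 3])); (q4 "02211", (95, [:: 0; 4; 3;
  1; 2])); (q4 "11202", (75, [:: 4; 0; 1; 2; 3])); (q4 "1212", (96, [:: 0; 1; 2; 3])); (q4 "1221",
  (96, [:: 0; 3; 1; 2])); (q4 "2121", (92, [:: 0; 1; 2; 3])); (q4 "2211", (90, [:: 0; 1; 2; 3]))]
  [::]; Node 3 [:: q4 "123"] 0 false [:: 0; 1] [:: (q4 "00123", (16, [:: 0; 1; 3; 4; 2])); (q4
  "01023", (16, [:: 2; 0; 3; 4; 1])); (q4 "0123", (56, [:: 0; 3; 1; 2])); (q4 "0132", (73, [:: 0;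
  3; 2; 1])); (q4 "10023", (16, [:: 1; 2; 3; 4; 0])); (q4 "1023", (73, [:: 1; 3; 0; 2])); (q4
  "1032", (56, [:: 1; 3; 2; 0])); (q4 "01212", (77, [:: 3; 4; 0; 1; 2])); (q4 "1122", (94, [:: 3;
  2; 0; 1])); (q4 "12012", (77, [:: 3; 4; 2; 0; 1])); (q4 "1212", (94, [:: 3; 1; 2; 0])); (q4
  "1221", (97, [:: 3; 0; 1; 2])); (q4 "20112", (77, [:: 3; 4; 1; 2; 0])); (q4 "2112", (94, [:: 3;
  0; 1; 2])); (q4 "2121", (97, [:: 3; 1; 2; 0])); (q4 "2211", (97, [:: 3; 2; 0; 1]))] [::]; Node 6
  [:: q4 "000123"; q4 "012012"; q4 "102012"] 3 false [:: 2; 4; 5] [::] [::]; Node 5 [:: q4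
  "00123"; q4 "02211"; q4 "12201"] 3 false [:: 1; 4; 2] [::] [::]; Node 6 [:: q4 "001122"; q4
  "010122"; q4 "100212"] 4 false [:: 3; 4; 5] [::] [::]; Node 5 [:: q4 "01122"; q4 "01212"; q4
  "10122"] 4 false [:: 2; 3; 4] [::] [::]; Node 5 [:: q4 "01122"; q4 "10122"] 3 false [:: 3; 2; 4]
  [:: (q4 "001203", (99, [:: 0; 1; 4; 5; 2; 3])); (q4 "01230", (100, [:: 0; 4; 3; 1; 2])); (q4
  "10230", (100, [:: 1; 4; 3; 0; 2])); (q4 "002121", (101, [:: 5; 0; 1; 2; 3; 4])); (q4 "002211",
  (101, [:: 5; 0; 1; 2; 4; 3])); (q4 "01212", (102, [:: 0; 1; 2; 3; 4])); (q4 "01221", (102, [::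
  0; 1; 2; 4; 3])); (q4 "10212", (102, [:: 1; 0; 2; 3; 4])); (q4 "10221", (102, [:: 1; 0; 2; 4;
  3]))] [::]; Node 5 [:: q4 "01122"; q4 "10212"; q4 "12021"] 10 false [:: 0; 1; 2; 3; 4] [::]
  [::]; Node 5 [:: q4 "01122"; q4 "10212"; q4 "22110"] 10 false [:: 0; 1; 2; 3; 4] [::] [::]; Node
  5 [:: q4 "01122"; q4 "10212"] 4 false [:: 2; 3; 4] [:: (q4 "12021", (104, [:: 0; 1; 2; 3; 4]));
  (q4 "21201", (104, [:: 1; 0; 3; 2; 4])); (q4 "22110", (105, [:: 0; 1; 2; 3; 4]))] [::]; Node 6
  [:: q4 "001122"; q4 "022101"; q4 "202101"] 4 true [:: 2; 5; 3] [::] [::]; Node 5 [:: q4 "01122";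
  q4 "01212"; q4 "21210"] 4 true [:: 2; 3; 1] [::] [::]; Node 5 [:: q4 "01122"; q4 "21102"] 3 true
  [:: 1; 4; 2] [:: (q4 "010023", (74, [:: 0; 2; 3; 5; 1; 4])); (q4 "01032", (75, [:: 0; 2; 1; 4;
  3])); (q4 "12003", (75, [:: 3; 2; 1; 4; 0])); (q4 "012012", (107, [:: 0; 3; 4; 1; 5; 2])); (q4
  "01221", (108, [:: 0; 1; 4; 2; 3])); (q4 "021012", (107, [:: 0; 3; 4; 2; 5; 1])); (q4 "02121",
  (108, [:: 0; 2; 4; 1; 3])); (q4 "21201", (108, [:: 3; 1; 4; 2; 0])); (q4 "22101", (108, [:: 3;
  2; 4; 1; 0]))] [::]; Node 5 [:: q4 "01122"; q4 "22101"] 4 true [:: 1; 4; 2] [:: (q4 "10221",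
  (105, [:: 0; 1; 2; 4; 3])); (q4 "12012", (104, [:: 2; 0; 3; 1; 4])); (q4 "21210", (105, [:: 3;
  4; 2; 1; 0]))] [::]; Node 4 [:: q4 "1122"; q4 "2211"; q4 "1212"; q4 "2121"] 12 false [:: 0; 1;
  2; 3] [::] [::]; Node 4 [:: q4 "1122"; q4 "2211"; q4 "1212"] 8 false [:: 0; 2; 1; 3] [:: (q4
  "1032", (89, [:: 1; 0; 3; 2])); (q4 "1320", (89, [:: 3; 2; 1; 0])); (q4 "2121", (111, [:: 0; 1;
  2; 3]))] [::]; Node 4 [:: q4 "1122"; q4 "1212"] 4 false [:: 1; 2; 3] [:: (q4 "10023", (76, [::
  1; 2; 4; 0; 3])); (q4 "1032", (92, [:: 1; 0; 3; 2])); (q4 "1230", (93, [:: 3; 1; 2; 0])); (q4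
  "1302", (92, [:: 2; 0; 3; 1])); (q4 "1320", (93, [:: 3; 2; 1; 0])); (q4 "11202", (108, [:: 4; 0;
  2; 1; 3])); (q4 "12102", (108, [:: 4; 0; 1; 2; 3])); (q4 "2121", (112, [:: 0; 2; 1; 3])); (q4
  "2211", (112, [:: 0; 1; 2; 3]))] [::]; Node 4 [:: q4 "1122"; q4 "2211"] 8 false [:: 0; 2; 1; 3]
  [:: (q4 "0123", (90, [:: 0; 1; 2; 3])); (q4 "1023", (90, [:: 1; 0; 2; 3])); (q4 "1032", (90, [::
  1; 0; 3; 2])); (q4 "1203", (90, [:: 2; 3; 0; 1])); (q4 "1230", (90, [:: 3; 2; 0; 1])); (q4
  "1320", (90, [:: 3; 2; 1; 0])); (q4 "1221", (112, [:: 0; 1; 3; 2])); (q4 "2112", (112, [:: 1; 0;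
  2; 3])); (q4 "2121", (112, [:: 1; 0; 3; 2]))] [::]; Node 4 [:: q4 "1122"] 3 false [:: 2; 0; 3]
  [:: (q4 "01023", (77, [:: 0; 2; 4; 1; 3])); (q4 "01203", (77, [:: 0; 3; 4; 1; 2])); (q4 "0123",
  (97, [:: 0; 1; 2; 3])); (q4 "0132", (97, [:: 0; 1; 3; 2])); (q4 "10203", (77, [:: 1; 3; 4; 0;
  2])); (q4 "1203", (94, [:: 2; 3; 0; 1])); (q4 "1230", (94, [:: 3; 2; 0; 1])); (q4 "1320", (94,
  [:: 3; 2; 1; 0])); (q4 "01221", (103, [:: 0; 4; 1; 2; 3])); (q4 "02121", (106, [:: 0; 4; 2; 1;
  3])); (q4 "02211", (106, [:: 0; 4; 3; 1; 2])); (q4 "11022", (109, [:: 2; 0; 1; 4; 3])); (q4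
  "11202", (109, [:: 3; 0; 1; 4; 2])); (q4 "12012", (110, [:: 2; 3; 0; 4; 1])); (q4 "12102", (110,
  [:: 3; 2; 0; 4; 1])); (q4 "1212", (113, [:: 0; 1; 2; 3])); (q4 "1221", (113, [:: 0; 1; 3; 2]));
  (q4 "20121", (106, [:: 1; 4; 2; 0; 3])); (q4 "20211", (106, [:: 1; 4; 3; 0; 2])); (q4 "21012",
  (110, [:: 2; 3; 1; 4; 0])); (q4 "21102", (110, [:: 3; 2; 1; 4; 0])); (q4 "2112", (113, [:: 1; 0;
  2; 3])); (q4 "2121", (113, [:: 1; 0; 3; 2])); (q4 "2211", (114, [:: 0; 1; 2; 3]))] [::]; Node 0
  [::] 0 false [:: 0; 1] [:: (q4 "123", (98, [:: 0; 1; 2])); (q4 "1122", (115, [:: 0; 1; 2; 3]))]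
  [::]])%N.

Lemma family_table_ok : all (fun f => fam_ok f.1.1 f.1.2 f.2) family_table.
Proof. by vm_cast_no_check (erefl true). Qed.

Lemma minor_table_ok : all mc_ok minor_table.
Proof. by vm_cast_no_check (erefl true). Qed.

Lemma node_table_ok :
  all (check_node (map fred family_table) minor_table (expand bad_table) node_table) (iota 0 (size node_table)).
Proof. by vm_cast_no_check (erefl true). Qed.

End Tables.

(** * Templates without excluded minors *)

Lemma rmx_ext_minor (F : fieldType) (B E : finType) (A A' : B -> E -> F) :
  (forall b e, A b e = A' b e) -> has_minor (under (rmx A)) (under (rmx A')).
Proof.
move=> h; apply: (@rminor_has_minor F (rmx A) (rmx A') id (fun=> 1) set0); split=> //.
- by move=> e; rewrite inE.
- by move=> e; exact: oner_neq0.
move=> v; split=> [/mem_rmx[be vE]|[u [/mem_rmx[be uE] _ vE]]].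
  exists v; split=> [|x|e]; rewrite ?inE ?mul1r //.
  by apply/mem_rmx; exists be => e; rewrite vE; apply: eq_bigr => b _; rewrite h.
by apply/mem_rmx; exists be => e; rewrite vE mul1r uE; apply: eq_bigr => b _; rewrite h.
Qed.

Section TemplateGolden.

Variables (F : finFieldType) (a : F).
Hypothesis ch : 2%N \in [pchar F].
Hypothesis ha : a ^+ 2 = a + 1.
Hypothesis hF : forall x : F, exists y, x = phi a y.
Variable R : realType.

(** Twelve vertices on which all vectors vanish are adjoined to serve as the spare ones. Merging
    them with others adds only zeros, so no new minor appears; afterwards they are dropped again. *)
Lemma KW_golden (V I : finType) (w : I -> V -> F) : (forall s, \sum_v w s v = 0) ->
  (forall m (pi : V -> 'I_m) T, T \in targets -> ~ has_minor (under (KW w pi)) (cmat a T.1 3 T.2)) ->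
  golden_mean R (under (rmx (fun v s => w s v))).
Proof.
move=> sum0 adm.
pose w' s (v : V + 'I_12) : F := if v is inl v then w s v else 0.
have sum0' s : \sum_v w' s v = 0.
  by rewrite big_sumType /= sum0 big1 // addr0.
have adm' m (pi : V + 'I_12 -> 'I_m) T : T \in targets ->
    ~ has_minor (under (KW w' pi)) (cmat a T.1 3 T.2).
  move=> hT h; apply: (adm m (fun v => pi (inl v)) T hT); apply: has_minor_trans h.
  apply: rmx_ext_minor => i [[p q]|s] //; rewrite /merge [RHS]big_sumType /=.
  by rewrite [X in _ + X]big1 // addr0.
pose spare : seq (V + 'I_12) := [seq inr i | i <- enum 'I_12].
have g : golden_mean R (under (rmx (fun v s => w' s v))).
  apply: (@node_sound F a ch ha hF _ _ w' sum0' adm' R Tables.family_table Tables.minor_table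
    (expand Tables.bad_table) Tables.node_table (nth (nth mcert0 Tables.minor_table 0) Tables.minor_table 0) spare
    Tables.family_table_ok Tables.minor_table_ok _ _ _ Tables.node_table_ok _ _ _
    (size Tables.node_table).-1 [::]) => //.
  - by rewrite map_inj_uniq ?enum_uniq // => i j [].
  - by rewrite size_map size_enum_ord.
  - by move=> v /mapP[i _ ->].
apply: golden_mean_minor g _.
apply: (@rminor_has_minor F (rmx (fun v s => w' s v)) (rmx (fun v s => w s v)) id (fun=> 1) set0); split=> //.
- by move=> e; rewrite inE.
- by move=> e; exact: oner_neq0.
move=> v; split=> [/mem_rmx[be vE]|[u [/mem_rmx[be uE] _ vE]]].
  exists v; split=> [|x|e]; rewrite ?inE ?mul1r //.
  apply/mem_rmx; exists (fun x => if x is inl x then be x else 0) => e.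
  by rewrite vE big_sumType /= [X in _ + X]big1 ?addr0 // => i _; rewrite mulr0.
apply/mem_rmx; exists (fun x => be (inl x)) => e; rewrite vE mul1r uE big_sumType /=.
by rewrite [X in _ + X]big1 ?addr0 // => i _; rewrite mulr0.
Qed.

Variable Phi : frame_template F.
Hypothesis excl : forall N, conforms Phi N -> forall T, T \in targets ->
  ~ has_minor (under N) (cmat a T.1 3 T.2).

Lemma conforming_template_minor (B' E' : finType) (A : tX Phi + B' -> tCY Phi + E' -> F) :
  conforming A -> conforms Phi (template_minor A).
Proof. by move=> cA; exists B', E', A; split=> //; exact: riso_refl. Qed.

(** The hypothesis on small sets supplies [nd]: a functional of [inH] killing Y1 but not Y0, taken
    with [be] equal to 0, would give a nonzero vector supported on elements of Y0. *)
Lemma template_golden M : conforms Phi M ->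
  (forall (X : {set M}) u, (#|X| <= #|tY0 Phi|)%N -> u \in rspace M ->
     (forall e, e \notin X -> u e = 0) -> u = 0) ->
  golden_mean R (under M).
Proof.
move=> [B' [E' [A [cA MA]]]] ndM.
have [fr [la [zz [de [wf AE]]]]] := conformingP cA.
have exT T (hT : T \in targets) (B2 E2 : finType) (A2 : tX Phi + B2 -> tCY Phi + E2 -> F) :
    conforming A2 -> ~ has_minor (under (template_minor A2)) (cmat a T.1 3 T.2).
  by move=> /conforming_template_minor cA2; exact: excl cA2 T hT.
have AEE : A = tmat fr la zz de.
  by apply: FunctionalExtensionality.functional_extensionality => b;
     apply: FunctionalExtensionality.functional_extensionality => e; exact: AE.
have exF7 := exT (F7c, 7%N) isT; have exP1 := exT (P1c, 9%N) isT.
subst A; case: (MA) => f [c [[f' fK f'K] c0 hf]].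
have nd xi : @inH F Phi xi -> (forall y, hh xi (inr y) = 0) -> forall y, hh xi (inl (inr y)) = 0.
  move=> hH h1 y.
  pose TM := cdel (C_elts Phi E' : {set rmx (tmat fr la zz de)}) (Y1_elts Phi E').
  pose u : {ffun TM -> F^o} := [ffun e : TM => (pval fr zz xi (fun=> 0) (cdel_val e) : F^o)].
  have uM : u \in rspace (template_minor (tmat fr la zz de)).
    apply/(mem_tminor_pval ch exF7 wf); exists xi, (fun=> 0); split=> // e.
    by rewrite ffunE.
  have hK (z : tCY Phi + E') : keep z -> exists x : TM, cdel_val x = z.
    by rewrite keepE => /andP[z1 z2]; exact: (@cdel_emb F (rmx (tmat fr la zz de)) (C_elts Phi E') (Y1_elts Phi E') z z1 z2).
  have /hK[x xE] : keep (inl (inl (inr y)) : tCY Phi + E') by [].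
  have k0 (e : TM) : exists y0 : tY0 Phi, u e != 0 -> cdel_val e = inl (inl (inr y0)).
    exists (if cdel_val e is inl (inl (inr y0)) then y0 else y).
    have := cdel_valP e; rewrite -keepE ffunE; case: (cdel_val e) => [[[z|z]|z]|z] //=.
    by rewrite big1 ?add0r; [case: (zz z) => [j|]; rewrite ?h1 eqxx | move=> b _; rewrite mul0r].
  have [k kP] := fin_all_exists k0.
  have cX : (#|[set e : M | u (f e) != 0%R]| <= #|tY0 Phi|)%N.
    rewrite -(@card_in_imset _ _ (k \o f)); first exact: max_card.
    move=> e e'; rewrite !inE => /kP h /kP h' /= kk; apply: (can_inj fK).
    by apply: cdel_val_inj; rewrite h h' kk.
  have := ndM _ [ffun e => c e * u (f e)] cX; rewrite -hf => /(_ uM).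
  have hv e : e \notin [set e : M | u (f e) != 0%R] -> [ffun e => c e * u (f e)] e = 0 :> F^o.
    by rewrite inE negbK ffunE => /eqP ->; rewrite mulr0.
  move=> /(_ hv) /ffunP/(_ (f' x)); rewrite !ffunE f'K xE => /eqP.
  by rewrite mulf_eq0 (negPf (c0 _)) /= => /eqP.
have [V [S [w [sum0 hadm hmin]]]] := @template_frame F a ch ha hF Phi exF7 exP1 B' E' fr la zz de wf nd.
have g : golden_mean R (under (rmx (fun v s => w s v))).
  apply: KW_golden sum0 _ => m pi T hT h.
  have [B2 [E2 [A2 [cA2 h2]]]] := hadm m pi.
  exact: (exT T hT _ _ _ cA2 (has_minor_trans h2 h)).
exact: golden_mean_minor (golden_mean_minor g hmin) (riso_has_minor_sym MA).
Qed.

End TemplateGolden.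

(** * Connectivity and simplification *)

Section Field4.

Variables (F : finFieldType) (a : F).
Hypothesis cF : #|F| = 4%N.
Hypothesis ha : a ^+ 2 = a + 1.

Lemma pchar_card4 : 2%N \in [pchar F].
Proof. by apply: (@card_finPcharP F 2 2). Qed.

Lemma phi_surj (x : F) : exists y, x = phi a y.
Proof.
have ch := pchar_card4.
suff inj : injective (phi a : (bool * bool)%type -> F).
  have := inj_card_onto inj; rewrite cF card_prod card_bool => /(_ isT x)/codomP[y xy].
  by exists y.
move=> y z yz; have : phi a (add4 y z) == 0 by rewrite (phi_add ch ha) yz (addrr_pchar2 ch).
by rewrite (phi_eq0 ha); case: y z {yz} => [[] []] [[] []].
Qed.

End Field4.

Lemma iso_pull (M N : matroid) : iso M N -> exists h : {set N} -> {set M},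
  [/\ forall Y, rk (h Y) = rk Y, forall Y, #|h Y| = #|Y|, forall Y, h (~: Y) = ~: h Y
    & h [set: N] = [set: M]].
Proof.
case=> f [f' fK f'K] rf; exists (fun Y : {set N} => f @^-1: Y).
have im (Y : {set N}) : f @: (f @^-1: Y) = Y.
  apply/setP=> y; apply/imsetP/idP => [[x]|yY]; first by rewrite inE => ? ->.
  by exists (f' y); rewrite ?inE f'K.
split=> [Y|Y|Y|]; rewrite -?rf ?im //.
- by rewrite -(card_imset _ (can_inj fK)) im.
- by apply/setP=> x; rewrite !inE.
- by apply/setP=> x; rewrite !inE.
Qed.

Lemma tutte_connected_iso (M N : matroid) k : iso M N -> tutte_connected k M -> tutte_connected k N.
Proof.
move=> /iso_pull[h [hr hc hC hT]] tM j X jk [] ; rewrite -!hc -!hr hC hT => jX jC lt.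
by apply: (tM j (h X) jk).
Qed.

Lemma vertically_connected_iso (M N : matroid) k :
  iso M N -> vertically_connected k M -> vertically_connected k N.
Proof.
move=> /iso_pull[h [hr hc hC hT]] vM X; rewrite -!hr hC hT => lt.
by rewrite /spanning -!hr hC hT; exact: vM lt.
Qed.

(** The connectivity function r(X) + r(E - X) - r(E) is the same for a matroid and its dual. *)
Lemma tutte_connected_dual (M : matroid) k : tutte_connected k M -> tutte_connected k (dual M).
Proof.
move=> tM j X jk [jX jC lt]; apply: (tM j X jk); split=> //.
have e1 : (rk (X : {set dual M}) + rk [set: M] = #|X| + rk (~: X : {set M}))%N := @dual_rkE M X.
have e2 : (rk (~: X : {set dual M}) + rk [set: M] = #|~: X| + rk (X : {set M}))%N.
  by have := @dual_rkE M (~: X); rewrite setCK.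
have e3 : (rk [set: dual M] + rk [set: M] = #|M| + 0)%N.
  by have := @dual_rkE M setT; rewrite setCT cardsT => ->; have := rk_card (set0 : {set M}); rewrite cards0 leqn0 => /eqP->.
have e4 := cardsC (X : {set M}); rewrite /= in e1 e2 e3 e4 lt *.
move: lt e1 e2 e3 e4; move: (rk (X : {set dual M})) (rk (~: X : {set dual M})) (rk [set: dual M]).
move: (rk (X : {set M})) (rk (~: X : {set M})) (rk [set: M]) => a b c d e f.
by rewrite /=; move: #|X| #|~: X| #|M| => x y z; lia.
Qed.

Lemma tutte_connected_mono (M : matroid) k k' : (k <= k')%N -> tutte_connected k' M -> tutte_connected k M.
Proof. by move=> kk tM j X /andP[j0 jk]; apply: tM; rewrite j0 (leq_trans jk). Qed.

Lemma vertically_connected_mono (M : matroid) k k' : (k <= k')%N ->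
  vertically_connected k' M -> vertically_connected k M.
Proof. by move=> kk vM X lt; apply: vM; apply: leq_trans lt _; rewrite leq_add2l. Qed.

(** The size bound makes both sides large enough for a separation of order |X|. As there is none,
    r(X) + r(E - X) is at least r(E) + |X|, which forces both equalities. *)
Lemma tutte_small (M : matroid) k (X : {set M}) : tutte_connected k M -> (2 * k <= #|M|)%N ->
  (#|X| < k)%N -> rk X = #|X| /\ rk (~: X) = rk [set: M].
Proof.
move=> tM kM Xk; have rX := rk_card X; have rC : (rk (~: X) <= rk [set: M])%N by rewrite rk_mono ?subsetT.
have cC := cardsC X.
have [X0|Xp] := posnP #|X|.
  move: rX; rewrite X0 leqn0 => /eqP->; split=> //; congr (rk _).
  by move/eqP: X0; rewrite cards_eq0 => /eqP->; rewrite setC0.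
have := tM #|X| X; rewrite Xp Xk => /(_ isT) nsep.
have le : (rk [set: M] + #|X| <= rk X + rk (~: X))%N.
  rewrite leqNgt; apply/negP=> lt; apply: nsep; split=> //.
  by move: cC kM Xk; move: #|X| #|~: X| #|M| => x y z; lia.
by move: le rX rC; move: (rk X) (rk (~: X)) (rk [set: M]) #|X| => p q r x; lia.
Qed.

Lemma full_rank_vanish (F : fieldType) (M : rmatroid F) (X : {set M}) (u : {ffun M -> F^o}) :
  @rk (under M) (~: X) = @rk (under M) [set: M] -> u \in rspace M ->
  (forall e, e \notin X -> u e = 0) -> u = 0.
Proof.
move=> rX uM u0; have := dim_vanish (~: X); have := dim_vanish [set: M]; rewrite rX => <- /eqP.
rewrite eqn_add2r; have -> : vanish [set: M] = 0%VS.
  apply/eqP; rewrite -subv0; apply/subvP=> v /mem_vanish[_ v0]; rewrite memv0.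
  by apply/eqP/ffunP=> e; rewrite v0 ?inE // ffunE.
rewrite dimv0 dimv_eq0 => /eqP vX; apply/eqP; rewrite -memv0 -vX.
by apply/mem_vanish; split=> // e; rewrite inE; exact: u0.
Qed.

(** * Simplification of a matroid *)

Section Simplification.

Variable M : matroid.
Local Definition pr_of (T : finType) (sg : M -> option T) (Z : {set M}) : {set T} :=
  [set y | [exists e in Z, sg e == Some y]].

Lemma rk_parallel (P : {set M}) e f : (rk [set e; f] <= 1)%N -> (0 < rk [set f])%N -> f \in P ->
  rk (e |: P) = rk P.
Proof.
move=> r2 r1 fP; apply/eqP; rewrite eqn_leq [X in _ && X]rk_mono ?subsetUr // andbT.
have := rk_submod [set e; f] P.
have -> : [set e; f] :|: P = e |: P.
  by rewrite -setUA; congr (_ :|: _); apply/setUidPr; rewrite sub1set.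
have : (rk [set f] <= rk ([set e; f] :&: P))%N.
  by apply: rk_mono; rewrite sub1set !inE eqxx orbT fP.
by move: r1 r2; move: (rk _) (rk _) (rk _) (rk _) (rk _) => p q r s t; lia.
Qed.

Lemma rk_loop (P : {set M}) e : rk [set e] = 0%N -> rk (e |: P) = rk P.
Proof.
move=> r0; apply/eqP; rewrite eqn_leq [X in _ && X]rk_mono ?subsetUr // andbT.
by have := rk_submod [set e] P; rewrite r0; move: (rk _) (rk _) (rk _) => p q r; lia.
Qed.

(** The set [S] is maximal without loops and parallel pairs; by maximality each nonloop is parallel
    to its representative [sg e] in [S], and loops are sent to [None]. *)
Lemma simplification : exists (S : {set M}) (sg : M -> option {y : M | y \in S}),
  [/\ forall Y : {set {y : M | y \in S}}, (#|Y| <= 2)%N -> rk (val @: Y) = #|Y|,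
      forall y, sg (val y) = Some y
    & forall Z, rk Z = rk (val @: pr_of sg Z)].
Proof.
pose p (S : {set M}) := [forall X : {set M}, (X \subset S) && (#|X| <= 2)%N ==> (rk X == #|X|)].
have pP S (X : {set M}) : p S -> X \subset S -> (#|X| <= 2)%N -> rk X = #|X|.
  by move=> /forallP/(_ X) h XS X2; move: h; rewrite XS X2 => /eqP.
have [S /maxsetP[pS Smax]] : {S | maxset p S}.
  apply: ex_maxset; exists set0; apply/forallP=> X; apply/implyP; rewrite subset0.
  by case/andP=> /eqP-> _; rewrite cards0 -leqn0 -(@cards0 M) rk_card.
have r1 y : y \in S -> rk [set y] = 1%N.
  by move=> yS; rewrite (pP S) ?cards1 // sub1set.
have r2 y z : y \in S -> z \in S -> (rk [set y; z] <= 1)%N -> y = z.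
  move=> yS zS; apply: contraTeq => yz.
  by rewrite (pP S) ?cards2 ?yz // subUset !sub1set yS zS.
have ex e : exists o : option {y : M | y \in S},
    if o is Some y then (rk [set e; val y] <= 1)%N /\ (0 < rk [set e])%N else rk [set e] = 0%N.
  have [r0|rp] := posnP (rk [set e]); first by exists None.
  suff [y yS h] : exists2 y, y \in S & (rk [set e; y] <= 1)%N by exists (Some (exist _ y yS)).
  have [eS|eS] := boolP (e \in S); first by exists e; rewrite // setUid r1.
  have re : rk [set e] = 1%N.
    by apply/eqP; rewrite eqn_leq rp andbT -(cards1 e) rk_card.
  have : ~~ p (e |: S).
    apply/negP=> pe; have := Smax _ pe (subsetUr _ _) => E; move: eS; rewrite -E.
    by rewrite setU11.
  rewrite negb_forall => /existsP[X]; rewrite negb_imply => /andP[/andP[XS X2] rX].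
  have eX : e \in X.
    apply: contraNT rX => eX; rewrite (pP S) // ; apply/subsetP=> x xX.
    have := subsetP XS x xX; rewrite !inE => /orP[/eqP xe|//].
    by move: eX; rewrite -xe xX.
  have := cardsD1 e X; rewrite eX => cX.
  have [X0|/set0Pn[y]] := eqVneq (X :\ e) set0.
    by move: rX; rewrite -(setD1K eX) X0 setU0 re cards1.
  rewrite !inE => /andP[ye yX]; exists y.
    by have := subsetP XS y yX; rewrite !inE (negPf ye).
  have XE : X = [set e; y].
    apply/eqP; rewrite eq_sym eqEcard subUset !sub1set eX yX cards2 eq_sym ye /=; exact: X2.
  have c2 : #|[set e; y]| = 2 by rewrite cards2 eq_sym ye.
  move: rX (rk_card X); rewrite XE c2.
  by move: (rk _) => r; lia.
have [sg sgP] := fin_all_exists ex; exists S, sg.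
have sgv y : sg (val y) = Some y.
  have := sgP (val y); case: (sg _) => [z [h _]|]; last by rewrite r1 ?(valP y).
  by congr Some; apply: val_inj; apply/esym; apply: r2 h; exact: valP.
split=> // [Y Y2|Z].
  rewrite (pP S) ?card_imset //; first exact: val_inj; last exact: val_inj.
  by apply/subsetP=> x /imsetP[y _ ->]; exact: valP.
transitivity (rk (Z :|: val @: pr_of sg Z)); last first.
  apply: rk_closure => e eZ; have := sgP e; case E: (sg e) => [y|]; last exact: rk_loop.
  case=> h _; apply: rk_parallel h _ _; first by rewrite r1 ?(valP y).
  by apply: imset_f; rewrite inE; apply/existsP; exists e; rewrite eZ E eqxx.
rewrite setUC; apply/esym; apply: rk_closure => _ /imsetP[y + ->].
rewrite inE => /existsP[e /andP[eZ /eqP E]]; have := sgP e; rewrite E => -[h rp].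
by apply: rk_parallel rp eZ; rewrite setUC.
Qed.

Variables (M' : matroid) (v : M' -> M) (sg : M -> option M').
Hypothesis rk' : forall Y : {set M'}, rk Y = rk (v @: Y).
Hypothesis sgv : forall y, sg (v y) = Some y.
Hypothesis rk_pr : forall Z, rk Z = rk (v @: pr_of sg Z).

Let rkp Z : rk (pr_of sg Z) = rk Z. Proof. by rewrite rk' -rk_pr. Qed.

Lemma mem_pr (Z : {set M}) y : reflect (exists2 e, e \in Z & sg e = Some y) (y \in pr_of sg Z).
Proof.
rewrite inE; apply: (iffP existsP) => [[e /andP[eZ /eqP]]|[e eZ E]]; first by exists e.
by exists e; rewrite eZ E eqxx.
Qed.

Lemma simplification_minor : has_minor M M'.
Proof.
apply/has_minorP; exists v, set0; split=> [y z yz|e|X].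
- by have := sgv y; rewrite yz sgv => -[].
- by rewrite inE.
rewrite setU0 rk'; have := rk_card (set0 : {set M}); rewrite cards0 leqn0 => /eqP->.
by rewrite addn0.
Qed.

Lemma simplification_vertical k : vertically_connected k M -> vertically_connected k M'.
Proof.
(* Loops join the side of [Y], where they do not affect ranks. *)
move=> vM Y; pose X := [set e | if sg e is Some y then y \in Y else true].
have pX : pr_of sg X = Y.
  apply/setP=> y; apply/mem_pr/idP => [[e]|yY]; first by rewrite inE => + E; rewrite E.
  by exists (v y); rewrite ?inE sgv.
have pC : pr_of sg (~: X) = ~: Y.
  apply/setP=> y; rewrite [RHS]inE; apply/mem_pr/idP => [[e]|yY]; first by rewrite !inE => + E; rewrite E.
  by exists (v y); rewrite ?inE sgv.
have pT : pr_of sg [set: M] = [set: M'].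
  by apply/setP=> y; rewrite [RHS]inE; apply/mem_pr; exists (v y); rewrite ?inE ?sgv.
have rX : rk X = rk Y by rewrite -pX rkp.
by rewrite /spanning -pC -pT !rkp -rX => lt; exact: vM lt.
Qed.

(** As [N] is simple, the images of its elements are neither loops nor parallel to each other, and
    none is in the closure of [C]; so their representatives are distinct and avoid those of [C]. *)
Lemma simplification_has_minor N : simple N -> has_minor M N -> has_minor M' N.
Proof.
move=> sN /has_minorP[g [C [gi gC gr]]]; apply/has_minorP.
have r2 e e' : e != e' -> (2 <= rk [set g e; g e'])%N.
  move=> ee; have := gr [set e; e']; rewrite sN ?cards2 ?ee // imsetU1 imset_set1.
  have := rk_submod [set g e; g e'] C.
  by move: (rk _) (rk _) (rk _) (rk _) => p q r s; lia.
have r1 e : (rk C < rk (g e |: C))%N.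
  have se : rk [set e] = 1%N by rewrite sN cards1.
  by have := gr [set e]; rewrite se imset_set1 => ->; rewrite add1n.
have ex e : exists y, sg (g e) = Some y.
  case E: (sg (g e)) => [y|]; first by exists y.
  suff r0 : rk [set g e] = 0%N by have := r1 e; rewrite rk_loop // ltnn.
  rewrite -rkp; suff -> : pr_of sg [set g e] = set0.
    by apply/eqP; rewrite -leqn0 -(@cards0 M') rk_card.
  by apply/setP=> y; rewrite [RHS]inE; apply/mem_pr => -[x]; rewrite inE => /eqP->; rewrite E.
have [g' gE] := fin_all_exists ex; exists g', (pr_of sg C).
have pU (X : {set N}) : pr_of sg (g @: X :|: C) = g' @: X :|: pr_of sg C.
  apply/setP=> y; rewrite [RHS]inE; apply/mem_pr/orP => [[x]|[/imsetP[e eX ->]|/mem_pr[x xC E]]].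
  - rewrite inE => /orP[/imsetP[e eX ->]|xC E]; last by right; apply/mem_pr; exists x.
    by rewrite gE => -[<-]; left; exact: imset_f.
  - by exists (g e); rewrite ?gE // inE imset_f.
  - by exists x; rewrite // inE xC orbT.
split=> [e e' ee|e|X]; last by rewrite -pU !rkp gr.
  apply/eqP; apply: contraT => /r2; rewrite -rkp ltnNge => /negP[].
  apply: leq_trans (rk_card _) _; apply: leq_trans (_ : #|[set g' e]| <= _)%N; last by rewrite cards1.
  apply: subset_leq_card; apply/subsetP=> y /mem_pr[x]; rewrite !inE => /orP[]/eqP->.
    by rewrite gE => -[->].
  by rewrite gE ee => -[->].
apply/negP=> h; have := r1 e; have := pU [set e]; rewrite !imset_set1 => E.
rewrite -[X in (_ < X)%N]rkp E -[X in (X < _)%N]rkp (setUidPr _) ?ltnn //.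
by rewrite sub1set.
Qed.

(** Loops become zero columns and parallel elements repeated columns; neither creates a new nonzero
    subdeterminant. *)
Lemma simplification_golden (R : realType) : golden_mean R M' -> golden_mean R M.
Proof.
move=> /golden_meanP[B [A [rA gA]]]; apply/golden_meanP.
pose A' b e := if sg e is Some y then A b y else 0; exists B, A'.
have cols t (f : 'I_t -> B) (h : 'I_t -> M) : subdet A' f h = 0 \/
    exists2 k, forall j, sg (h j) = Some (k j) & subdet A' f h = subdet A f k.
  have [/forallP hs|] := boolP [forall j, isSome (sg (h j))].
    right; have /fin_all_exists[k kE] : forall j, exists y, sg (h j) = Some y.
      by move=> j; have := hs j; case: (sg _) => // y _; exists y.
    by exists k => //; apply: eq_subdet => i j; rewrite /A' kE.
  rewrite negb_forall => /existsP[j hj]; left; rewrite /subdet (expand_det_col _ j) big1 // => i _.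
  by rewrite !mxE /A'; case: (sg _) hj => //; rewrite mul0r.
split=> [X|t f h]; last first.
  by have [->|[k _ ->]] := cols t f h; [exact: pz0 | exact: gA].
rewrite -rkp -rA; apply: rk_rmx_eq => t; split=> -[f [h [hX d]]].
  have [E|[k kE E]] := cols t f h; first by rewrite E eqxx in d.
  exists f, k; rewrite -E; split=> // j.
  by apply/mem_pr; exists (h j).
have /fin_all_exists2[k kX kE] : forall j, exists2 e, e \in X & sg e = Some (h j).
  by move=> j; apply/mem_pr.
exists f, k; split=> //; congr (_ != 0): d; apply: eq_subdet => i j.
by rewrite /A' kE.
Qed.

End Simplification.

(** * Cycle matroids of complete graphs *)

Section CompleteGraphs.

Let adj_sym n (X : {set Kn_edge n}) : connect_sym (adj X).
Proof. by apply: sym_connect_sym => i j; apply: eq_existsb => e /=; rewrite setUC. Qed.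

Lemma Kn_rkE n (X : {set Kn_edge n}) :
  Kn_rk X = #|[set i | fingraph.root (adj X) i != i]|.
Proof.
rewrite /Kn_rk -[X in (X - _)%N]card_ord -(cardsC [set i | fingraph.root (adj X) i == i]).
have -> : n_comp (adj X) 'I_n = #|[set i | fingraph.root (adj X) i == i]|.
  by apply: eq_card => i; rewrite !inE andbT.
by rewrite addKn; apply: eq_card => i; rewrite !inE.
Qed.

Lemma MK_rank n : (n <= (rk [set: MK n]).+1)%N.
Proof.
case: n => // n; have c1 : n_comp (adj [set: Kn_edge n.+1]) 'I_n.+1 = 1%N.
  apply: etrans (n_comp_connect (@adj_sym _ [set: Kn_edge n.+1]) ord0); apply: eq_n_comp_r => i.
  rewrite !inE; have [->|ni] := eqVneq i ord0; first by rewrite connect0.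
  apply/esym/connect1/existsP.
  have c2 : #|[set ord0; i]| == 2 by rewrite cards2 [ord0 == i]eq_sym ni.
  by exists (exist (fun e : {set 'I_n.+1} => #|e| == 2) _ c2); rewrite !inE /= eqxx.
by rewrite -[rk _]/(Kn_rk [set: Kn_edge n.+1]) /Kn_rk c1 subn1.
Qed.

(** Every edge has an end that is not a root. If two edges have the same such end [x], their other
    ends are distinct and share the root of [x], so at least one of these is a second non-root. *)
Lemma MK_simple n : simple (MK n).
Proof.
move=> X X2; apply/eqP; rewrite eqn_leq rk_card -[rk X]/(Kn_rk X) Kn_rkE /=.
set r := fingraph.root (adj X).
have rE (e : Kn_edge n) i j : e \in X -> i \in val e -> j \in val e -> r i = r j.
  move=> eX ie je; have [->|ij] := eqVneq i j; first by [].
  apply/(fingraph.rootP (@adj_sym _ X)); apply/connect1/existsP; exists e; rewrite eX /=.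
  by rewrite eq_sym eqEcard subUset !sub1set ie je /= cards2 ij (eqP (valP e)).
have nr (e : Kn_edge n) : e \in X -> exists2 i, i \in val e & r i != i.
  move=> eX; have /cards2P[i [j [ij eE]]] := valP e.
  have ie : i \in val e by rewrite eE !inE eqxx.
  have je : j \in val e by rewrite eE !inE eqxx orbT.
  have [ri|ni] := eqVneq (r i) i; last by exists i.
  by exists j => //; rewrite -(rE e i j) // ri.
case c: #|X| X2 => [|[|[|m]]] // _.
  have /set0Pn[e /nr[i _ ri]] : X != set0 by rewrite -cards_eq0 c.
  by rewrite card_gt0; apply/set0Pn; exists i; rewrite inE.
have /card_gt1P[e [f [eX fX ef]]] : (1 < #|X|)%N by rewrite c.
apply/card_gt1P; have [x xe rx] := nr e eX; have [y yf ry] := nr f fX.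
have [xy|xy] := eqVneq x y; last by exists x, y; rewrite !inE.
have other (d : Kn_edge n) : x \in val d -> exists2 j, j != x & val d = [set x; j].
  move=> xd; have /cards2P[i [j [ij dE]]] := valP d; move: xd; rewrite dE !inE => /orP[]/eqP->.
    by exists j; rewrite // eq_sym.
  by exists i; rewrite // setUC.
have [j jx eE] := other e xe; have [k kx fE] : exists2 k, k != x & val f = [set x; k].
  by apply: other; rewrite xy.
have jk : j != k by apply: contraNneq ef => jk; apply/eqP/val_inj; rewrite eE fE jk.
have rj : r x = r j by apply: (rE e); rewrite ?eE // !inE eqxx ?orbT.
have rk : r x = r k by apply: (rE f); rewrite ?fE // !inE eqxx ?orbT.
have [Ej|nj] := eqVneq (r j) j; last by exists x, j; rewrite !inE [x == j]eq_sym rj -{1}rj.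
by exists x, k; rewrite !inE [x == k]eq_sym kx -rk {2}rj Ej.
Qed.

(** The additional [m - n] vertices are isolated, so they raise the number of vertices and that of
    components equally. *)
Lemma MK_minor n m : (n <= m)%N -> has_minor (MK m) (MK n).
Proof.
move=> nm; apply/has_minorP; pose h := widen_ord nm.
have hi : injective h by move=> i j /(congr1 val) /= /val_inj.
have gP (e : Kn_edge n) : #|h @: val e| == 2 by rewrite card_imset // (valP e).
pose g (e : Kn_edge n) : Kn_edge m := exist (fun e : {set 'I_m} => #|e| == 2) _ (gP e).
have gi : injective g.
  move=> e f /(congr1 val) /= E; apply: val_inj; apply/setP=> i.
  by rewrite -(mem_imset _ _ hi) E mem_imset.
exists g, set0; split=> // [e|X]; first by rewrite inE.
have r0 : rk (set0 : {set MK m}) = 0%N by apply/eqP; rewrite -leqn0 -(@cards0 (MK m)) rk_card.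
rewrite setU0 r0 addn0 -[LHS]/(Kn_rk (g @: X)) -[RHS]/(Kn_rk X) /Kn_rk.
set e := adj (g @: X); pose A := [pred i : 'I_m | (i < n)%N].
have eA i j : e i j -> (i < n)%N && (j < n)%N.
  case/existsP=> _ /andP[/imsetP[d _ ->] /eqP /= E].
  have : (i \in h @: val d) && (j \in h @: val d) by rewrite E !inE !eqxx orbT.
  by case/andP=> /imsetP[i' _ ->] /imsetP[j' _ ->]; rewrite /= !ltn_ord.
have clA : closed e A by move=> i j /eA/andP[hi' hj]; rewrite !inE hi' hj.
have adjn : rel_adjunction h e (adj X) A.
  apply: strict_adjunction => //.
  - by apply/subsetP=> i iA; apply/codomP; exists (Ordinal iA); apply: val_inj.
  move=> i j _; apply/existsP/existsP => [[_ /andP[/imsetP[d dX ->] /eqP /= E]]|[d /andP[dX /eqP E]]].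
    exists d; rewrite dX; apply/eqP/setP=> x; rewrite -(mem_imset _ _ hi) E !inE.
    by rewrite !(inj_eq hi).
  by exists (g d); rewrite imset_f //= E imsetU1 imset_set1.
rewrite (n_compC A) (adjunction_n_comp h (@adj_sym _ _) (@adj_sym _ _) clA adjn).
have -> : n_comp (adj X) [preim h of A] = n_comp (adj X) 'I_n.
  by apply: eq_n_comp_r => i; rewrite !inE /= ltn_ord.
have -> : n_comp e [predC A] = (m - n)%N.
  transitivity #|[set i : 'I_m | ~~ (i < n)%N]|.
    apply: eq_card => i; rewrite !inE /=; case: (ltnP i n) => hin; rewrite ?andbF //= andbT.
    have /connectP[[|j p] /= + E] := fingraph.connect_root e i; first by move=> _; rewrite /roots; apply/eqP; exact: E.
    by case/andP=> /eA/andP[]; rewrite ltnNge hin.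
  have cA : #|[set i : 'I_m | (i < n)%N]| = n.
    rewrite -[RHS]card_ord -(card_imset _ hi); apply: eq_card => i; rewrite inE.
    apply/idP/imsetP => [lt|[j _ ->]]; last by rewrite /= ltn_ord.
    by exists (Ordinal lt); rewrite // ; apply: val_inj.
  have -> : [set i : 'I_m | ~~ (i < n)%N] = ~: [set i : 'I_m | (i < n)%N].
    by apply/setP=> i; rewrite !inE.
  by rewrite cardsCs setCK cA card_ord.
have : (n_comp (adj X) 'I_n <= n)%N by rewrite -[X in (_ <= X)%N]card_ord max_card.
by have nm' := nm; move: (n_comp _ _) nm' => c; clear; lia.
Qed.

End CompleteGraphs.

(** * The theorem *)

Section Assembly.

Variables (R : realType) (F : finFieldType) (a : F).
Hypothesis cF : #|F| = 4%N.
Hypothesis ha : a ^+ 2 = a + 1.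

Let ch : 2%N \in [pchar F] := pchar_card4 cF.
Let hF := @phi_surj F a cF ha.

(** The matroids behind [targets]. Both lists of the theorem contain them, and the first one also
    their duals, as the templates [Psi] require. *)
Definition excluded_core : seq matroid := [:: Fano; P1 a; P3 a; V1 a; Pappus].

Lemma dual_not_golden N : ~ golden_mean R N -> ~ golden_mean R (dual N).
Proof. by move=> nN /golden_mean_dual g; apply: nN; exact: golden_mean_iso (iso_dualK N) g. Qed.

Lemma golden_excludes M s : (forall N, List.In N s -> ~ golden_mean R N) ->
  golden_mean R M -> excludes M s.
Proof. by move=> h g; apply/excludesP=> N Ns /(golden_mean_minor g); exact: h. Qed.

Lemma targets_excluded M : (forall N, List.In N excluded_core -> ~ has_minor M N) ->
  forall T, T \in targets -> ~ has_minor M (cmat a T.1 3 T.2).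
Proof.
move=> h T; rewrite !inE => /or4P[|||/orP[]] /eqP-> /= hm.
- by apply: (h Fano); [left | exact: has_minor_isor (Fano_iso a ch) hm].
- by apply: (h (P1 a)); [right; left | exact: hm].
- by apply: (h (P3 a)); [do 2!right; left | exact: hm].
- by apply: (h (V1 a)); [do 3!right; left | exact: hm].
- by apply: (h Pappus); [do 4!right; left | exact: has_minor_isor (Pappus_iso ch ha) hm].
Qed.

Lemma represents_iso (M : matroid) (B : finType) (A : B -> M -> F) :
  represents A -> iso (under (rmx A)) M.
Proof. by move=> rA; exists id; [exists id | move=> X; rewrite imset_id rA]. Qed.

Definition excluded_tutte : seq matroid :=
  [:: Fano; dual Fano; V1 a; dual (V1 a); V2 a;
      V3 a; dual (V3 a); P1 a; dual (P1 a); P2 a;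
      P3 a; dual (P3 a); Pappus; dual Pappus].

Definition excluded_vertical : seq matroid :=
  [:: Fano; dual Fano; V1 a; V2 a; V3 a;
      P1 a; P2 a; P3 a; Pappus].

Let ngFano : ~ golden_mean R Fano := @Fano_not_golden F a ch ha R.
Let ngV1 : ~ golden_mean R (V1 a) := @V1_not_golden F a ch ha R.
Let ngV2 : ~ golden_mean R (V2 a) := @V2_not_golden F a ch ha R.
Let ngV3 : ~ golden_mean R (V3 a) := @V3_not_golden F a ch ha R.
Let ngP1 : ~ golden_mean R (P1 a) := @P1_not_golden F a ch ha R.
Let ngP2 : ~ golden_mean R (P2 a) := @P2_not_golden F a ch ha R.
Let ngP3 : ~ golden_mean R (P3 a) := @P3_not_golden F a ch ha R.
Let ngPappus := @Pappus_not_golden R.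

Lemma excluded_tutte_not_golden N : List.In N excluded_tutte -> ~ golden_mean R N.
Proof.
case=> [<-|]; first exact: ngFano.
case=> [<-|]; first exact: (dual_not_golden ngFano).
case=> [<-|]; first exact: ngV1.
case=> [<-|]; first exact: (dual_not_golden ngV1).
case=> [<-|]; first exact: ngV2.
case=> [<-|]; first exact: ngV3.
case=> [<-|]; first exact: (dual_not_golden ngV3).
case=> [<-|]; first exact: ngP1.
case=> [<-|]; first exact: (dual_not_golden ngP1).
case=> [<-|]; first exact: ngP2.
case=> [<-|]; first exact: ngP3.
case=> [<-|]; first exact: (dual_not_golden ngP3).
case=> [<-|]; first exact: ngPappus.
by case=> // <-; exact: (dual_not_golden ngPappus).
Qed.

Lemma excluded_vertical_not_golden N : List.In N excluded_vertical -> ~ golden_mean R N.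
Proof.
case=> [<-|]; first exact: ngFano.
case=> [<-|]; first exact: (dual_not_golden ngFano).
case=> [<-|]; first exact: ngV1.
case=> [<-|]; first exact: ngV2.
case=> [<-|]; first exact: ngV3.
case=> [<-|]; first exact: ngP1.
case=> [<-|]; first exact: ngP2.
case=> [<-|]; first exact: ngP3.
by case=> // <-; exact: ngPappus.
Qed.

Lemma excluded_core_tutte N : List.In N excluded_core -> List.In N excluded_tutte.
Proof.
case=> [<-|[<-|[<-|[<-|[<-|[]]]]]]; [by left | by do 7!right; left | by do 10!right; left |
  by do 2!right; left | by do 12!right; left].
Qed.

Lemma excluded_core_dual N : List.In N excluded_core -> List.In (dual N) excluded_tutte.
Proof.
case=> [<-|[<-|[<-|[<-|[<-|[]]]]]]; [by right; left | by do 8!right; left | by do 11!right; left |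
  by do 3!right; left | by do 13!right; left].
Qed.

Lemma excluded_core_vertical N : List.In N excluded_core -> List.In N excluded_vertical.
Proof.
case=> [<-|[<-|[<-|[<-|[<-|[]]]]]]; [by left | by do 5!right; left | by do 7!right; left |
  by do 2!right; left | by do 8!right; left].
Qed.

Lemma golden_template (Phi : frame_template F) (M : rmatroid F) :
  (forall N, conforms Phi N -> forall T, List.In T excluded_core -> ~ has_minor (under N) T) ->
  conforms Phi M ->
  (forall X : {set M}, (#|X| <= #|tY0 Phi|)%N -> @rk (under M) (~: X) = @rk (under M) [set: M]) ->
  golden_mean R (under M).
Proof.
move=> ex cM rX; apply: (@template_golden F a ch ha hF R Phi) cM _.
  by move=> N /ex; exact: targets_excluded.
by move=> X u cX uM u0; apply: full_rank_vanish u0 => //; exact: rX.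
Qed.

Lemma tutte_connected_golden : HypothesisA ->
  exists k : nat, (0 < k)%N /\
    forall M : matroid,
      tutte_connected k M -> representable F M -> (2 * k <= #|M|)%N ->
      (golden_mean R M <-> excludes M excluded_tutte).
Proof.
move=> hA; have [k0 [s [t [Phi [Psi [k0p hPhi hPsi hM]]]]]] :=
  hA F 2%N ch 3%N isT _ (@excludes_minor_closed F excluded_tutte).
pose y1 := (\max_i #|tY0 (Phi i)|)%N; pose y2 := (\max_j #|tY0 (Psi j)|)%N.
(* The bound 3 yields simplicity through [tutte_small]; exceeding every |Y0| makes complements of
   sets of that size spanning, in the matroid for [Phi] and in its dual for [Psi]. *)
exists (maxn (maxn k0 3) (maxn y1 y2).+1); set k := maxn _ _.
have kk0 : (k0 <= k)%N by rewrite !leq_max leqnn.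
have k3 : (3 <= k)%N by rewrite !leq_max leqnn orbT.
have ky1 i : (#|tY0 (Phi i)| < k)%N.
  by rewrite !leq_max !ltnS leq_max (leq_bigmax i) !orbT.
have ky2 j : (#|tY0 (Psi j)| < k)%N.
  by rewrite !leq_max !ltnS leq_max (leq_bigmax j) !orbT.
split=> [|M tM [r [A rA]] kM]; first by rewrite (leq_trans _ k3).
split=> [|exM]; first exact: golden_excludes excluded_tutte_not_golden.
have NM := represents_iso rA; set N := rmx A in NM.
have MN := iso_sym NM.
have exN : excludes (under N) excluded_tutte.
  move/excludesP: exM => exM; apply/excludesP=> P PL h; apply: exM PL _.
  exact: has_minor_isol MN h.
have tN : tutte_connected k (under N) by exact: tutte_connected_iso MN tM.
have cN : (2 * k <= #|N|)%N by exact: kM.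
have small := fun X => @tutte_small (under N) k X tN cN.
have sN : simple (under N).
  by move=> X X2; apply: (proj1 (small X _)); exact: leq_ltn_trans X2 k3.
have nF : ~ has_minor (under N) (PG 2 3) by case: exN.
have cN0 : (2 * k0 <= #|N|)%N by apply: leq_trans cN; rewrite leq_mul2l kk0 orbT.
have [[i cP]|[j cP]] := hM N exN sN (tutte_connected_mono kk0 tN) cN0 nF.
  apply: golden_mean_iso NM _; apply: golden_template cP _ => [P /hPhi/excludesP exP T hT|X cX].
    by apply: exP; exact: excluded_core_tutte.
  by apply: (proj2 (small X _)); exact: leq_ltn_trans cX (ky1 i).
have dN := under_rdual N.
have tD : tutte_connected k (under (rdual N)).
  exact: tutte_connected_iso (iso_sym dN) (tutte_connected_dual tN).
have g : golden_mean R (under (rdual N)).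
  apply: golden_template cP _ => [P /hPsi/excludesP exP T hT h|X cX].
    apply: (exP (dual T)); first exact: excluded_core_dual.
    exact: has_minor_isol (under_rdual P) (has_minor_dual h).
  by apply: (proj2 (@tutte_small (under (rdual N)) k X tD cN _)); exact: leq_ltn_trans cX (ky2 j).
have := golden_mean_dual (golden_mean_iso dN g) => /(golden_mean_iso (iso_dualK _)).
exact: golden_mean_iso.
Qed.

Lemma vertically_connected_golden : HypothesisB ->
  exists k n : nat, [/\ (0 < k)%N, (0 < n)%N &
    forall M : matroid,
      vertically_connected k M -> representable F M -> has_minor M (MK n) ->
      (golden_mean R M <-> excludes M excluded_vertical)].
Proof.
move=> hB; have [k0 [n0 [s [t [Phi [Psi [[k0p n0p] hPhi _ hM _]]]]]]] :=
  hB F 2%N ch 3%N isT _ (@excludes_minor_closed F excluded_vertical).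
pose y := (\max_i #|tY0 (Phi i)|)%N.
(* A minor M(K_n) with [n] at least [y + 3] makes the rank larger than [y], so a set of at most [y]
   elements does not span; connectivity above [y] then makes its complement spanning. *)
exists (maxn k0 y.+1), (maxn n0 y.+3); set k := maxn _ _; set n := maxn _ _.
have kk0 : (k0 <= k)%N by rewrite leq_max leqnn.
have yk : (y < k)%N by rewrite leq_max leqnn orbT.
have nn0 : (n0 <= n)%N by rewrite leq_max leqnn.
have yn : (y.+3 <= n)%N by rewrite leq_max leqnn orbT.
split=> [||M vM [r [A rA]] hKn]; [exact: leq_trans k0p kk0 | exact: leq_trans n0p nn0 |].
split=> [|exM]; first exact: golden_excludes excluded_vertical_not_golden.
have NM := represents_iso rA; set N := rmx A in NM.
have MN := iso_sym NM.
(* The structural hypothesis concerns simple matroids, so it is applied to the simplification, which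
   keeps vertical connectivity and the minor M(K_n). *)
have [S [sg [S2 sgv rkS]]] := simplification (under N).
pose N' := rmx (fun b (e : {e : M | e \in S}) => A b (val e)).
have rk' (Y : {set under N'}) : rk Y = @rk (under N) (val @: Y) by exact: rk_rmx_comp.
have mN : has_minor (under N) (under N') by exact: (simplification_minor rk' sgv).
have exN : excludes (under N') excluded_vertical.
  move/excludesP: exM => exM; apply/excludesP=> P PL h; apply: exM PL _.
  exact: has_minor_isol MN (has_minor_trans mN h).
have vN : vertically_connected k (under N').
  exact: (simplification_vertical rk' sgv rkS) (vertically_connected_iso MN vM).
have mK : has_minor (under N') (MK n).
  exact: (simplification_has_minor rk' rkS) (@MK_simple n) (has_minor_isol NM hKn).
have sN : simple (under N') by move=> X X2; rewrite rk' S2.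
have nF : ~ has_minor (under N') (PG 2 3) by case: exN.
have [i cP] := hM N' exN sN (vertically_connected_mono kk0 vN)
  (has_minor_trans mK (MK_minor nn0)) nF.
apply: golden_mean_iso NM _; apply: (simplification_golden rk' rkS).
apply: golden_template cP _ => [P /hPhi/excludesP exP T hT|X cX].
  by apply: exP; exact: excluded_core_vertical.
have cy : (#|X| <= y)%N by apply: leq_trans cX (leq_bigmax i).
have rT : (y < @rk (under N') [set: N'])%N.
  have := has_minor_rk mK; have := MK_rank n; move: yn.
  by move: (rk _) (rk _) => p q; lia.
have rX := @rk_card (under N') X.
have rC : (@rk (under N') (~: X) <= @rk (under N') [set: N'])%N by rewrite rk_mono ?subsetT.
have lt : (@rk (under N') X + @rk (under N') (~: X) < @rk (under N') [set: N'] + k)%N.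
  by rewrite addnC -addnS leq_add // (leq_ltn_trans rX) // (leq_ltn_trans cy).
have [sX|//] := vN X lt.
by move: rT; rewrite ltnNge -sX (leq_trans rX cy).
Qed.

End Assembly.

Theorem theorem1p4 (R : realType) (GF4 : finFieldType) (hGF4 : #|GF4| = 4%N)
    (alpha : GF4) (halpha : alpha ^+ 2 = alpha + 1) :
  (HypothesisA ->
   exists k : nat, (0 < k)%N /\
     forall M : matroid,
       tutte_connected k M -> representable GF4 M -> (2 * k <= #|M|)%N ->
       (golden_mean R M <->
        excludes M
          [:: Fano; dual Fano; V1 alpha; dual (V1 alpha); V2 alpha;
              V3 alpha; dual (V3 alpha); P1 alpha; dual (P1 alpha); P2 alpha;
              P3 alpha; dual (P3 alpha); Pappus; dual Pappus]))
  /\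
  (HypothesisB ->
   exists k n : nat, [/\ (0 < k)%N, (0 < n)%N &
     forall M : matroid,
       vertically_connected k M -> representable GF4 M -> has_minor M (MK n) ->
       (golden_mean R M <->
        excludes M
          [:: Fano; dual Fano; V1 alpha; V2 alpha; V3 alpha;
              P1 alpha; P2 alpha; P3 alpha; Pappus])]).
Proof. by split; [exact: tutte_connected_golden | exact: vertically_connected_golden]. Qed.
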